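(* Let $n\ge2$ and let $d\ge1$ be an integer. There is a constant $c>0$ depending only on $n$ and $d$ such that the following holds. Let $\Omega\subset\mathbb R^n$ be a domain of diameter $R$ that is star-shaped with respect to a ball $B_\rho$ of radius $\rho$, and let $f\in H^{d-1}_0(\Omega)\cap L^2_0(\Omega)$. Then there exists $\mathbf u\in[H^d_0(\Omega)]^n$ such that $\nabla\cdot\mathbf u=f$ and $$ |\mathbf u|_{d,\Omega}\le c\left\{\sum_{\ell=1}^{d-1}\frac{R}{\rho^{d-\ell}}\,|f|_{\ell,\Omega}+\frac{R}{\rho^d}\left[1+\left(\frac{|\Omega|}{|B_\rho|}\right)^{\frac{n-2}{2(n-1)}}\left(\log\frac{|\Omega|}{|B_\rho|}\right)^{\frac{n}{2(n-1)}}\right]\|f\|_{0,\Omega}\right\}. $$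
   Context: Star-shaped with respect to a ball $B$: for every $x\in\Omega$, $y\in B$ the segment joining $x$ and $y$ lies in $\Omega$. $|\Omega|$, $|B_\rho|$ are Lebesgue measures. $\|\cdot\|_{0,\Omega}$ is the $L^2(\Omega)$ norm; $|\cdot|_{s,\Omega}$ is the $H^s(\Omega)$ seminorm (the $L^2$ norm of all derivatives of order $s$), also for vector fields. $H^s_0(\Omega)$ is the closure of $\mathcal C_0^\infty(\Omega)$ in $H^s(\Omega)$, with $H^0_0(\Omega)=L^2(\Omega)$; $L^2_0(\Omega)$ is the space of zero-average $L^2(\Omega)$ functions. *)

(* Defs.v *)
From HB Require Import structures.
From mathcomp Require Import all_boot all_order all_algebra.
From mathcomp Require Import all_classical all_reals all_analysis.
Set Implicit Arguments.
Unset Strict Implicit.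
Unset Printing Implicit Defensive.
Import Order.TTheory GRing.Theory Num.Theory.
Import numFieldNormedType.Exports.

Local Open Scope classical_set_scope.
Local Open Scope ring_scope.

(* ['rV[R]_n] carries the sigma-algebra generated by the coordinates, as the
   library does for [n.-tuple R]; it is the Borel sigma-algebra. *)
Section measurable_rV.
Variables (R : realType) (n : nat).

Let coord (i : 'I_n) (x : 'rV[R]_n) : measurableTypeR R := x ord0 i.

Let rV_set0 : g_sigma_preimage coord set0.
Proof. exact: sigma_algebra0. Qed.

Let rV_setC A : g_sigma_preimage coord A -> g_sigma_preimage coord (~` A).
Proof. exact: sigma_algebraC. Qed.

Let rV_bigcup (F : _^nat) : (forall i, g_sigma_preimage coord (F i)) ->
  g_sigma_preimage coord (\bigcup_i (F i)).
Proof. exact: sigma_algebra_bigcup. Qed.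

HB.instance Definition _ := @isMeasurable.Build default_measure_display
  'rV[R]_n (g_sigma_preimage coord) rV_set0 rV_setC rV_bigcup.

Lemma measurable_coord (i : 'I_n) :
  measurable_fun [set: 'rV[R]_n] (fun x => x ord0 i : measurableTypeR R).
Proof.
move=> _ Y mY; rewrite setTI; apply: sub_sigma_algebra => /=.
rewrite -bigcup_seq/=; exists i => /=; first by rewrite mem_index_enum.
by exists Y => //; rewrite setTI.
Qed.

Lemma measurable_fun_rVP d (T : measurableType d) (f : T -> 'rV[R]_n) :
  measurable_fun [set: T] f <->
  forall i, measurable_fun [set: T] (fun x => f x ord0 i : measurableTypeR R).
Proof.
split=> [mf i|mf].
  exact: (measurableT_comp (measurable_coord i) mf).
have sub : g_sigma_preimage coord `<=` [set A | measurable (f @^-1` A)].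
  apply: smallest_sub.
    split=> /=; first by rewrite preimage_set0.
      by move=> A mA; rewrite setTD preimage_setC; exact: measurableC.
    by move=> F mF; rewrite preimage_bigcup; exact: bigcupT_measurable.
  rewrite -bigcup_seq => A [i _ [B mB <-]] /=.
  rewrite setTI -[X in measurable X]setTI.
  exact: mf.
by move=> _ A mA; rewrite setTI; exact: sub.
Qed.

End measurable_rV.

Section lebesgue_rV.
Variable R : realType.

Section cons.
Variable n : nat.

Definition rV_cons (p : measurableTypeR R * 'rV[R]_n) : 'rV[R]_n.+1 :=
  row_mx (p.1 : R)%:M p.2.

Lemma measurable_rV_cons : measurable_fun setT rV_cons.
Proof.
apply/measurable_fun_rVP => i.
case: (@split_ordP 1 n i) => j ->.
  rewrite (_ : (fun _ => _) = fst)//.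
  apply/funext => -[x y].
  by rewrite /rV_cons [LHS]row_mxEl mxE (ord1 j) eqxx mulr1n.
rewrite (_ : (fun _ => _) = (fun x : 'rV[R]_n => x ord0 j) \o snd).
  by apply: measurableT_comp => //; exact: measurable_coord.
by apply/funext => -[x y]; rewrite /rV_cons [LHS]row_mxEr.
Qed.

Definition rV_uncons (x : 'rV[R]_n.+1) : measurableTypeR R * 'rV[R]_n :=
  (x ord0 ord0, \row_i x ord0 (lift ord0 i)).

Lemma measurable_rV_uncons : measurable_fun setT rV_uncons.
Proof.
apply/measurable_fun_pair; first exact: measurable_coord.
apply/measurable_fun_rVP => i.
under eq_fun do rewrite mxE.
exact: measurable_coord.
Qed.

Lemma rV_consK : cancel rV_cons rV_uncons.
Proof.
move=> [x y]; rewrite /rV_uncons /rV_cons/=; congr pair.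
  rewrite (_ : ord0 = lshift n (ord0 : 'I_1)); last exact/val_inj.
  by rewrite [LHS]row_mxEl mxE eqxx mulr1n.
apply/rowP => i; rewrite mxE.
rewrite (_ : lift ord0 i = rshift 1 i); last exact/val_inj.
by rewrite [LHS]row_mxEr.
Qed.

Lemma rV_unconsK : cancel rV_uncons rV_cons.
Proof.
move=> x; apply/rowP => i; case: (@split_ordP 1 n i) => j ->.
  rewrite [LHS]row_mxEl mxE (ord1 j) eqxx mulr1n; congr (x _ _); exact/val_inj.
by rewrite [LHS]row_mxEr mxE; congr (x _ _); exact/val_inj.
Qed.

Variable mu : {sigma_finite_measure set 'rV[R]_n -> \bar R}.

Definition lebesgue_rVS : set 'rV[R]_n.+1 -> \bar R :=
  pushforward (@lebesgue_measure R \x mu)%E rV_cons.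

HB.instance Definition _ := Measure.copy lebesgue_rVS
  (@measure_function_pushforward__canonical__measure_function_Measure _ _ _ _ _
    (@lebesgue_measure R \x mu)%E _ measurable_rV_cons).

Let lebesgue_rVS_sigma_finite : sigma_finite setT lebesgue_rVS.
Proof.
have /sigma_finiteP[F [TF ndF Foo]] := sigma_finiteT (@lebesgue_measure R).
have /sigma_finiteP[G [TG ndG Goo]] := sigma_finiteT mu.
exists (fun k => rV_uncons @^-1` (F k `*` G k)).
  rewrite -preimage_bigcup (_ : \bigcup_k (F k `*` G k) = setT) ?preimage_setT//.
  apply/seteqP; split=> // -[x y] _.
  have [k _ Fkx] : (\bigcup_k F k) x by rewrite -TF.
  have [l _ Gly] : (\bigcup_k G k) y by rewrite -TG.
  exists (maxn k l) => //; split.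
    by move: x Fkx; exact/subsetPset/ndF/leq_maxl.
  by move: y Gly; exact/subsetPset/ndG/leq_maxr.
move=> k; have [mF Fk] := Foo k; have [mG Gk] := Goo k; split.
  rewrite -[X in measurable X]setTI; apply: measurable_rV_uncons => //.
  exact: measurableX.
rewrite /lebesgue_rVS /pushforward (_ : _ @^-1` _ = F k `*` G k).
  by rewrite product_measure1E// lte_mul_pinfty// ge0_fin_numE.
by rewrite -comp_preimage (_ : rV_uncons \o rV_cons = id)//; apply/funext/rV_consK.
Qed.

HB.instance Definition _ := Measure_isSigmaFinite.Build _ _ _ lebesgue_rVS
  lebesgue_rVS_sigma_finite.

End cons.

(* n-dimensional Lebesgue measure, as the n-fold product of [lebesgue_measure] *)
Fixpoint lebesgue_rV (n : nat) :
    {sigma_finite_measure set 'rV[R]_n -> \bar R} :=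
  match n with
  | 0 => dirac (0 : 'rV[R]_0)
  | n'.+1 => lebesgue_rVS (lebesgue_rV n')
  end.

Lemma lebesgue_rV_box (n : nat) (A : 'I_n -> set (measurableTypeR R)) :
  (forall i, measurable (A i)) ->
  lebesgue_rV n [set x | forall i, A i (x ord0 i)] =
  (\prod_(i < n) @lebesgue_measure R (A i))%E.
Proof.
elim: n A => [A _|n IH A mA].
  rewrite big_ord0 (_ : [set _ | _] = setT); last first.
    by apply/seteqP; split=> // x _ [].
  by rewrite /= diracT.
rewrite big_ord_recl -IH// -product_measure1E//=; last first.
  rewrite (_ : (fun _ => _) = \big[setI/setT]_(i < n)
      ((fun x : 'rV[R]_n => x ord0 i) @^-1` A (lift ord0 i))).
    apply: bigsetI_measurable => i _.
    by rewrite -[X in measurable X]setTI; exact: measurable_coord.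
  apply/seteqP; split=> [x Ax|x].
    by elim/big_ind : _ => //= i _; exact: Ax.
  by rewrite -bigcap_seq => Ax i; apply: (Ax i); rewrite /= mem_index_enum.
rewrite /lebesgue_rVS /pushforward; congr (_ \x _)%E.
apply/seteqP; split=> -[y x] /=.
  move=> Ayx; split=> [|i].
    by have := Ayx ord0; have [-> _] := rV_consK (y, x).
  by have := Ayx (lift ord0 i); have [_ <-] := rV_consK (y, x); rewrite mxE.
move=> [Ay Ax] i; case: (unliftP ord0 i) => [j|] ->.
  by have := Ax j; have [_ {1}<-] := rV_consK (y, x); rewrite mxE.
by have [-> _] := rV_consK (y, x).
Qed.

End lebesgue_rV.

Section euclidean.
Variables (R : realType) (n : nat).
Implicit Types (x y : 'rV[R]_n) (Om B : set 'rV[R]_n).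

(* the library norm [`|x|] on ['rV[R]_n] is the max norm *)
Definition enorm x : R := Num.sqrt (\sum_i x ord0 i ^+ 2).

Definition eball x (r : R) : set 'rV[R]_n := [set y | enorm (y - x) < r].

Definition ediameter Om : \bar R :=
  ereal_sup [set (enorm (p.1 - p.2))%:E | p in Om `*` Om].

Definition domain Om := [/\ Om !=set0, open Om & connected Om].

Definition star_shaped Om B :=
  forall x y, Om x -> B y ->
  forall t : R, 0 <= t <= 1 -> Om ((1 - t) *: x + t *: y).

Definition vol Om : R := fine (lebesgue_rV R n Om).

End euclidean.

Section test_functions.
Variables (R : realType) (n : nat).
Implicit Types (phi : 'rV[R]_n -> R) (Om : set 'rV[R]_n).

Definition partial (i : 'I_n) phi : 'rV[R]_n -> R :=
  fun x => 'D_(delta_mx ord0 i) phi x.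

Definition partials (w : seq 'I_n) phi : 'rV[R]_n -> R := foldr partial phi w.

Definition smooth phi := forall w : seq 'I_n,
  continuous (partials w phi) /\
  forall i x, derivable (partials w phi) x (delta_mx ord0 i).

Definition test_function Om phi :=
  [/\ smooth phi, compact (closure [set x | phi x != 0])
    & closure [set x | phi x != 0] `<=` Om].

Definition mpartial (a : 'I_n -> nat) phi : 'rV[R]_n -> R :=
  partials (flatten [seq nseq (a i) i | i <- enum 'I_n]) phi.

End test_functions.

Section sobolev.
Variables (R : realType) (n : nat) (Om : set 'rV[R]_n).
Local Notation mu := (lebesgue_rV R n).
Implicit Types (u f g : 'rV[R]_n -> R) (a : 'I_n -> nat) (s : nat).

(* Elements of L^2(Om) and of the Sobolev spaces are represented by functions on
   the whole space of which only the restriction to Om matters. *)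
Definition L2 : set ('rV[R]_n -> R) := [set u | u \_ Om \in Lfun mu 2%:E].

Definition L2norm u : R := fine ('N[mu]_2%:E[EFin \o (u \_ Om)])%E.

Definition L20 : set ('rV[R]_n -> R) :=
  [set u | L2 u /\ \int[mu]_(x in Om) u x = 0].

Definition weak_derivative a u g := forall phi, test_function Om phi ->
  \int[mu]_(x in Om) (u x * mpartial a phi x) =
  (-1) ^+ (\sum_i a i)%N * \int[mu]_(x in Om) (g x * phi x).

(* some square-integrable weak derivative of u, unique up to a null set; the
   default value 0 is irrelevant when u is regular enough *)
Definition wderiv a u : 'rV[R]_n -> R :=
  xget (cst 0) [set g | L2 g /\ weak_derivative a u g].

Definition Hs s : set ('rV[R]_n -> R) :=
  [set u | L2 u /\ forall a, (\sum_i a i <= s)%N ->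
    exists2 g, L2 g & weak_derivative a u g].

Definition Hs_seminorm s u : R :=
  Num.sqrt (\sum_(a : {ffun 'I_n -> 'I_s.+1} | (\sum_i a i == s)%N)
    L2norm (wderiv (fun i => a i) u) ^+ 2).

Definition Hs_norm s u : R :=
  Num.sqrt (\sum_(l < s.+1) Hs_seminorm l u ^+ 2).

(* the closure of the test functions in H^s, with H^0_0 = L^2 *)
Definition Hs0 s : set ('rV[R]_n -> R) :=
  if s is 0 then L2 else
  [set u | Hs s u /\ forall e : R, 0 < e ->
    exists2 phi, test_function Om phi & Hs_norm s (u \- phi) < e].

Definition Hs_seminorm_vec s (u : 'I_n -> 'rV[R]_n -> R) : R :=
  Num.sqrt (\sum_i Hs_seminorm s (u i) ^+ 2).

Definition wdiv (u : 'I_n -> 'rV[R]_n -> R) : 'rV[R]_n -> R :=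
  fun x => \sum_i wderiv (fun j => j == i : nat) (u i) x.

End sobolev.

(* Main.v *)
Require Import Defs.
From HB Require Import structures.
From mathcomp Require Import all_boot all_order all_algebra.
From mathcomp Require Import all_classical all_reals all_analysis measurable_realfun.
From mathcomp Require Import ring lra zify.
Import Order.TTheory GRing.Theory Num.Theory.
Import numFieldNormedType.Exports.
Set Implicit Arguments.
Unset Strict Implicit.
Unset Printing Implicit Defensive.

Local Open Scope classical_set_scope.
Local Open Scope ring_scope.

(** The field is Bogovskii's, [u(x) = ∫∫ ((x - y)/t) om((x - (1-t)y - t x0)/(rho t)) (rho t)^-n f(y) dy dt]
    for [f] a test function, [0 < t < 1] truncated at a dyadic [eps], and [om] a fixed bump of integral one.
    The fundamental theorem of calculus in [t] shows that its divergence is the average of [f] under the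
    contraction of ratio [1 - eps] towards the ball, minus [∫ f] times a bump.

    The top derivatives are bounded without Fourier analysis.  For [t <= 1/2] all but one derivative are
    moved onto [f]; splitting the remaining integral dyadically, the pieces are almost orthogonal because
    each kernel is a derivative, and the Cotlar-Stein lemma sums them.  For [t >= 1/2] all derivatives fall
    on [om], and the operator at time [t] has norm at most a constant times
    [min((1-t)^(-n/2), (|Om|/|B|)^(1/2))]: weighting the time integral by Minkowski's inequality gives
    the factor in the volume ratio.  Leibniz' rule for the factor [y - x0] costs the diameter.

    For a general [f], test functions [f_k] converge to [f] in [H^(d-1)]; with [eps_k -> 0] fast enough,
    all derivatives of the fields of [f_k] up to order [d] are Cauchy in [L^2], and weak derivatives, which
    are unique because test functions are dense, pass to the limit. *)

(** * Lebesgue measure on row vectors *)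

(** Truncating in [t] keeps every dilation factor [(rho t)^-1] bounded, so the truncated fields of
    test functions are test functions of [Om], and Fubini, differentiation and integration by parts
    apply to them directly. The price is that the top order bound must not depend on the truncation,
    while the weight [1 / t] is not integrable at zero: absolute estimates lose a logarithm of
    [eps], and only cancellation between dyadic scales removes it. The operators at fixed time have
    kernels [th (al x + be y + ga)] with two different scales, so they are contractions rather than
    convolutions. The integral over time of the minimum of both norm bounds has order
    [q^((n-2)/(2n))] for [n >= 3] and [log q] for [n = 2], where [q] is the volume ratio. The
    exponent in the statement is larger for [n >= 3]; this slack allows a simple explicit weight.
    The bump lives in the max-norm ball of radius [1/(2n)]: the Euclidean norm is at most [n] times
    the max norm, so its rescaled support fills at most half of the radius of the ball, and the rest
    absorbs the closure of the supports. *)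

Section change_of_variables.
Context {d : measure_display} {T : measurableType d} {R : realType}.
Variables (m : {measure set T -> \bar R}) (h : T -> T) (k : R).
Hypothesis mh : measurable_fun setT h.
Hypothesis k0 : 0 <= k.
Hypothesis hk : forall A, measurable A -> m (h @^-1` A) = (k%:E * m A)%E.

(** The image of [m] under [h] and the multiple [k m] agree on measurable sets, hence integrate
    alike. *)
Lemma ge0_integral_change (f : T -> \bar R) :
  measurable_fun setT f -> (forall x, 0 <= f x)%E ->
  (\int[m]_x f (h x) = k%:E * \int[m]_x f x)%E.
Proof.
move=> mf f0.
have <- := @ge0_integral_mscale _ _ R m setT measurableT (NngNum k0) f mf (fun x _ => f0 x).
pose m1 : {measure set T -> \bar R} :=
  (@measure_function_pushforward__canonical__measure_function_Measure _ _ _ _ _ m _ mh).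
transitivity (\int[m1]_x f x)%E.
  by rewrite (ge0_integral_pushforward mh)//; apply: eq_integral.
by apply: eq_measure_integral => A mA _; exact: hk.
Qed.

Lemma integrable_change (f : T -> R) :
  m.-integrable setT (EFin \o f) -> m.-integrable setT (EFin \o (f \o h)).
Proof.
move=> /integrableP[mf fi]; apply/integrableP; split.
  exact: (measurableT_comp mf mh).
rewrite (@ge0_integral_change (fun x => `|(EFin \o f) x|)%E)//.
  by rewrite lte_mul_pinfty.
exact: measurableT_comp.
Qed.

Lemma Rintegral_change (f : T -> R) : m.-integrable setT (EFin \o f) ->
  \int[m]_x f (h x) = k * \int[m]_x f x.
Proof.
move=> fi.
have mf : measurable_fun setT (EFin \o f) := measurable_int m fi.
rewrite /Rintegral integralE [in RHS]integralE.
have p := integrable_pos_fin_num measurableT fi.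
have q := integrable_neg_fin_num measurableT fi.
have -> : (\int[m]_x ((fun x => (f (h x))%:E)^\+ x) = \int[m]_x ((EFin \o f)^\+ (h x)))%E.
  by apply: eq_integral => x _; rewrite !funeposE.
have -> : (\int[m]_x ((fun x => (f (h x))%:E)^\- x) = \int[m]_x ((EFin \o f)^\- (h x)))%E.
  by apply: eq_integral => x _; rewrite !funenegE.
rewrite (ge0_integral_change (f := (EFin \o f)^\+%E))//; last exact: measurable_funepos.
rewrite (ge0_integral_change (f := (EFin \o f)^\-%E))//; last exact: measurable_funeneg.
by rewrite -muleBr ?fin_num_adde_defr// fineM// fin_numB p q.
Qed.

End change_of_variables.

Section affine_measure.
Variable R : realType.

(** By uniqueness of Lebesgue measure: [|a|] times the image measure gives each interval []x, y]]
    its length. For [a < 0] the preimage is closed on the other side, which does not change its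
    length. *)
Lemma lebesgue_measure_affine (a b : R) (A : set (measurableTypeR R)) :
  a != 0 -> measurable A ->
  lebesgue_measure ((fun x : measurableTypeR R => a * x + b : measurableTypeR R) @^-1` A) =
  (`|a|^-1%:E * lebesgue_measure A)%E.
Proof.
move=> a0 mA.
set h := (fun x : measurableTypeR R => a * x + b : measurableTypeR R).
have mh : measurable_fun setT h by apply: measurable_funD => //; exact: measurable_funM.
have a0' : 0 < `|a| by rewrite normr_gt0.
pose m := mscale (NngNum (ltW a0')) (pushforward (@lebesgue_measure R) h).
pose m' : {measure set (measurableTypeR R) -> \bar R} :=
  mscale (NngNum (ltW a0')) (@measure_function_pushforward__canonical__measure_function_Measure _ _ _ _ _ (@lebesgue_measure R) _ mh).
have E : lebesgue_measure A = m' A.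
  apply: lebesgue_measure_unique => // _ [[x y] _ <-] /=.
  rewrite /m' /= /mscale /= /pushforward.
  have [a_lt0|a_gt0|/eqP] := ltgtP a 0; last by rewrite (negbTE a0).
  - have -> : h @^-1` `]x, y] = `[(y - b) / a, (x - b) / a[%classic.
      apply/seteqP; split=> z /=; rewrite !in_itv/= /h.
        by rewrite ler_ndivrMr// ltr_ndivlMr// (mulrC z); lra.
      by rewrite ler_ndivrMr// ltr_ndivlMr// (mulrC z); lra.
    rewrite !lebesgue_measure_itv/= !lte_fin ltr_nM2r ?invr_lt0// ltrD2r.
    case: ifPn; last by rewrite mule0.
    move=> _; rewrite -!EFinB -EFinM; congr EFin.
    by rewrite ltr0_norm//; field.
  - have -> : h @^-1` `]x, y] = `](x - b) / a, (y - b) / a]%classic.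
      apply/seteqP; split=> z /=; rewrite !in_itv/= /h.
        by rewrite ler_pdivlMr// ltr_pdivrMr// (mulrC z); lra.
      by rewrite ler_pdivlMr// ltr_pdivrMr// (mulrC z); lra.
    rewrite !lebesgue_measure_itv/= !lte_fin ltr_pM2r ?invr_gt0// ltrD2r.
    case: ifPn; last by rewrite mule0.
    move=> _; rewrite -!EFinB -EFinM; congr EFin.
    by rewrite gtr0_norm//; field.
rewrite E /m' /= /mscale /= muleA -EFinM mulVf ?mul1e//.
by rewrite gt_eqF.
Qed.

Lemma Rintegral_affine (a b : R) (f : R -> R) :
  a != 0 -> (@lebesgue_measure R).-integrable setT (EFin \o f) ->
  \int[lebesgue_measure]_x f (a * x + b) = `|a|^-1 * \int[lebesgue_measure]_x f x.
Proof.
move=> a0 fi.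
apply: (@Rintegral_change _ (measurableTypeR R) R lebesgue_measure
  (fun x : measurableTypeR R => a * x + b : measurableTypeR R) `|a|^-1) => //.
- by apply: measurable_funD => //; exact: measurable_funM.
- by move=> A mA; exact: lebesgue_measure_affine.
Qed.

Variable n : nat.
Local Notation V := 'rV[R]_n.
Local Notation mu := (lebesgue_rV R n).

Definition rV_boxes : set (set V) :=
  [set A | exists2 B : 'I_n -> set (measurableTypeR R),
    (forall i, measurable (B i)) & A = [set x : V | forall i, B i (x ord0 i)]].

Lemma measurable_rV_box (B : 'I_n -> set (measurableTypeR R)) :
  (forall i, measurable (B i)) -> measurable [set x : V | forall i, B i (x ord0 i)].
Proof.
move=> mB.
rewrite (_ : [set _ | _] = \big[setI/setT]_(i < n)
      ((fun x : 'rV[R]_n => x ord0 i) @^-1` B i)).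
  apply: bigsetI_measurable => i _.
  by rewrite -[X in measurable X]setTI; exact: measurable_coord.
apply/seteqP; split=> [x Ax|x].
  by elim/big_ind : _ => //= i _; exact: Ax.
by rewrite -bigcap_seq => Ax i; apply: (Ax i); rewrite /= mem_index_enum.
Qed.

Lemma measurable_rVE : @measurable _ V = <<s rV_boxes >>.
Proof.
apply/seteqP; split; last first.
  apply: smallest_sub; first exact: sigma_algebra_measurable.
  by move=> A [B mB ->]; exact: measurable_rV_box.
apply: smallest_sub; first exact: smallest_sigma_algebra.
rewrite -bigcup_seq => A [i _ [B mB <-]]; apply: sub_sigma_algebra.
exists (fun j => if j == i then B else setT).
  by move=> j; case: ifP.
rewrite setTI; apply/seteqP; split=> x /=.
  by move=> Bx j; case: ifP => [/eqP ->|].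
by move=> /(_ i); rewrite eqxx.
Qed.

Lemma rV_boxes_setI : setI_closed rV_boxes.
Proof.
move=> _ _ [A mA ->] [B mB ->]; exists (fun i => A i `&` B i).
  by move=> i; exact: measurableI.
apply/seteqP; split=> x /=; first by move=> [Ax Bx] i; split.
by move=> H; split=> i; have [] := H i.
Qed.

Definition cube (r : R) : set V := [set x | forall i, `[- r, r]%classic (x ord0 i)].

Lemma measurable_cube r : measurable (cube r).
Proof. by apply: (@measurable_rV_box (fun=> `[- r, r]%classic)) => i. Qed.

Lemma cube_boxes r : rV_boxes (cube r).
Proof. by exists (fun=> `[- r, r]%classic). Qed.

Lemma cube_measure r : 0 <= r -> mu (cube r) = ((2 * r) ^+ n)%:E.
Proof.
move=> r0; rewrite (@lebesgue_rV_box _ _ (fun=> `[- r, r]%classic))//.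
rewrite (eq_bigr (fun=> (2 * r)%:E)); last first.
  move=> i _; rewrite lebesgue_measure_itv/= lte_fin.
  case: ifPn; first by move=> _; rewrite -EFinB; congr EFin; ring.
  by rewrite -leNgt => h; congr EFin; lra.
elim: n => [|m IH]; first by rewrite big_ord0 expr0.
by rewrite big_ord_recl IH -EFinM exprS.
Qed.

Lemma cube_finite r : (mu (cube r) < +oo)%E.
Proof.
have [r0|r0] := leP 0 r; first by rewrite cube_measure// ltry.
case: (posnP n) => [n0|n0].
  apply: le_lt_trans (_ : mu (cube 0) < +oo)%E; last by rewrite cube_measure// ltry.
  apply: le_measure; rewrite ?inE; try exact: measurable_cube.
  by move=> x _ i; have := ltn_ord i; rewrite [X in (_ < X)%N]n0.
rewrite (_ : cube r = set0) ?measure0//; apply/seteqP; split=> // x /(_ (Ordinal n0)) /=.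
by rewrite in_itv/=; lra.
Qed.

Lemma coord_le_norm (x : V) i : `|x ord0 i| <= `|x|.
Proof.
rewrite [leRHS]mx_normrE.
exact: (@le_bigmax _ _ _ 0 (fun ij : 'I_1 * 'I_n => `|x ij.1 ij.2|) (ord0, i)).
Qed.

Lemma rV_norm_le (x : V) r : 0 <= r -> (forall i, `|x ord0 i| <= r) -> `|x| <= r.
Proof.
move=> r0 xr; rewrite [leLHS]mx_normrE.
by apply/bigmax_leP; split=> // -[i j] _ /=; rewrite (ord1 i).
Qed.

Lemma cube_cover : \bigcup_k cube k%:R = setT.
Proof.
apply/seteqP; split=> // x _.
exists (Num.truncn `|x|).+1 => // i; rewrite /= in_itv/= -ler_norml.
by apply: (le_trans (coord_le_norm x i)); rewrite ltW// truncnS_gt.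
Qed.
Lemma measurable_fun_rV_affine (a : R) (b : V) :
  measurable_fun setT (fun x : V => a *: x + b).
Proof.
apply/measurable_fun_rVP => i.
under eq_fun do rewrite !mxE.
apply: measurable_funD => //.
by apply: measurable_funM => //; exact: measurable_coord.
Qed.

(** Both sides are measures in [A]. They agree on boxes by the one-dimensional case, the boxes are a
    generating pi-system, and cubes of finite measure exhaust the space. *)
Lemma lebesgue_rV_affine (a : R) (b : V) (A : set V) : a != 0 -> measurable A ->
  mu ((fun x : V => a *: x + b) @^-1` A) = ((`|a|^-1 ^+ n)%:E * mu A)%E.
Proof.
move=> a0 mA.
set h := (fun x : V => a *: x + b).
have mh : measurable_fun setT h := measurable_fun_rV_affine a b.
have a0' : 0 <= `|a|^-1 ^+ n by rewrite exprn_ge0// invr_ge0.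
pose m2 : {measure set V -> \bar R} := mscale (NngNum a0') mu.
pose m1 : {measure set V -> \bar R} :=
  (@measure_function_pushforward__canonical__measure_function_Measure _ _ _ _ _ mu _ mh).
change (m1 A = m2 A).
apply: (measure_unique rV_boxes (fun k => cube k%:R)) => //.
- exact: measurable_rVE.
- exact: rV_boxes_setI.
- by move=> k; exact: cube_boxes.
- exact: cube_cover.
- move=> _ [B mB ->].
  rewrite /m1 /m2 /= /mscale /= /pushforward.
  rewrite (_ : h @^-1` _ = [set x : V | forall i, ((fun y : measurableTypeR R =>
     a * y + b ord0 i : measurableTypeR R) @^-1` B i) (x ord0 i)]); last first.
    by apply/seteqP; split=> x /= H i; have := H i; rewrite /h !mxE.
  have mB' i : measurable ((fun y : measurableTypeR R =>
     a * y + b ord0 i : measurableTypeR R) @^-1` B i).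
    rewrite -[X in measurable X]setTI.
    suff : measurable_fun setT (fun y : measurableTypeR R =>
       a * y + b ord0 i : measurableTypeR R) by exact.
    by apply: measurable_funD => //; exact: measurable_funM.
  rewrite (lebesgue_rV_box mB') (lebesgue_rV_box mB).
  rewrite (eq_bigr (fun i => (`|a|^-1%:E * lebesgue_measure (B i))%E)); last first.
    by move=> i _; rewrite lebesgue_measure_affine.
  rewrite big_split/=; congr (_ * _)%E.
  elim: (n) => [|k IH]; first by rewrite big_ord0 expr0.
  by rewrite big_ord_recl IH -EFinM exprS.
- move=> k; rewrite /m1/= /pushforward.
  apply: le_lt_trans (cube_finite ((k%:R + `|b|) / `|a|)).
  apply: le_measure; rewrite ?inE.
  - rewrite -[X in measurable X]setTI; apply: (measurable_fun_rV_affine a b) => //.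
    exact: measurable_cube.
  - exact: measurable_cube.
  move=> x hx i; have := hx i; rewrite /h/= !in_itv/= !mxE -!ler_norml => H.
  rewrite ler_pdivlMr ?normr_gt0// mulrC -normrM.
  have := coord_le_norm b i.
  have := ler_normB (a * x ord0 i + b ord0 i) (b ord0 i).
  rewrite addrK; lra.
Qed.

Lemma integrable_rV_affine (a : R) (b : V) (f : V -> R) :
  a != 0 -> mu.-integrable setT (EFin \o f) ->
  mu.-integrable setT (EFin \o (fun x => f (a *: x + b))).
Proof.
move=> a0; apply: (integrable_change (measurable_fun_rV_affine a b) (k := `|a|^-1 ^+ n)).
  by rewrite exprn_ge0// invr_ge0.
by move=> A mA; exact: lebesgue_rV_affine.
Qed.

Lemma Rintegral_rV_affine (a : R) (b : V) (f : V -> R) :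
  a != 0 -> mu.-integrable setT (EFin \o f) ->
  \int[mu]_x f (a *: x + b) = `|a|^-1 ^+ n * \int[mu]_x f x.
Proof.
move=> a0 fi; apply: (Rintegral_change (measurable_fun_rV_affine a b) (k := `|a|^-1 ^+ n)) => //.
by move=> A mA; exact: lebesgue_rV_affine.
Qed.

(** The sigma-algebra comes from the coordinates and the topology from the max norm. They are
    matched by writing an open set as a countable union of boxes with rational centre and half-width
    [1/(k+1)]. *)
Lemma rV_open_measurable (A : set V) : open A -> measurable A.
Proof.
move=> oA.
pose box (c : 'rV[rat]_n) (k : nat) : set V :=
  [set x : V | forall i, (`](ratr (c ord0 i) - k.+1%:R^-1), (ratr (c ord0 i) + k.+1%:R^-1)[%classic : set (measurableTypeR R)) (x ord0 i)].
have mbox c k : measurable (box c k).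
  by apply: (@measurable_rV_box (fun i => `](ratr (c ord0 i) - k.+1%:R^-1), (ratr (c ord0 i) + k.+1%:R^-1)[%classic)).
have -> : A = \bigcup_(p : 'rV[rat]_n * nat) (if `[<box p.1 p.2 `<=` A>] then box p.1 p.2 else set0).
  apply/seteqP; split=> x; last first.
    by move=> [[c k] _ /=]; case: ifPn => //; move/asboolP => H /H.
  move=> Ax; have := oA; rewrite openE => /(_ _ Ax).
  move=> /nbhs_ballP[e/= e0 xA].
  (* A box around [x] has width [2/(k+1)], so this [k] keeps it inside the ball of radius [e]. *)
  pose k := Num.truncn (2 / e).
  have ke : 2 / k.+1%:R < e.
    by rewrite ltr_pdivrMr// mulrC -ltr_pdivrMr// truncnS_gt.
  have k0 : (0 : R) < k.+1%:R^-1 by rewrite invr_gt0.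
  have : forall i, exists c : rat, (x ord0 i - k.+1%:R^-1 < ratr c < x ord0 i + k.+1%:R^-1).
    move=> i; have [|c cP] := @rat_in_itvoo R (x ord0 i - k.+1%:R^-1) (x ord0 i + k.+1%:R^-1).
      by rewrite ltrD2l gtrN.
    by exists c; move: cP; rewrite in_itv.
  move=> /choice[c cP].
  exists (\row_i c i, k) => //=.
  case: ifPn.
    move=> _ i; rewrite /= in_itv/= mxE; have := cP i.
    by move: (k.+1%:R^-1) => j; lra.
  move=> /asboolP; apply: contra_notP => _ y yb.
  apply: xA; rewrite -ball_normE/=.
  apply: le_lt_trans ke; apply: rV_norm_le; first by rewrite divr_ge0.
  move=> i; rewrite !mxE.
  have := yb i; rewrite /= in_itv/= mxE; have := cP i; move: k0.
  by rewrite ler_norml; move: (k.+1%:R^-1) => j; lra.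
by apply: countable_bigcupT_measurable => // -[c k] /=; case: ifP.
Qed.

Lemma rV_continuous_measurable (f : V -> R) : continuous f -> measurable_fun setT f.
Proof.
move=> /continuousP cf; apply: (measurability _ (RGenOpens.measurableE R)).
move=> _ [B [a [b ->]] <-]; rewrite setTI; apply: rV_open_measurable.
exact/cf/interval_open.
Qed.

End affine_measure.

(** * Smooth functions *)

Section line.
Variables (R : realType) (n : nat).
Local Notation V := 'rV[R]_n.
Implicit Types (f : V -> R) (x y v : V).

Lemma is_derive_line f x v s : derivable f (x + s *: v) v ->
  is_derive s 1 (fun s : R => f (x + s *: v)) ('D_v f (x + s *: v)).
Proof.
move=> df.
have E : (fun h : R => h^-1 *: (((fun s : R => f (x + s *: v)) \o shift s) (h *: (1 : R))
     - f (x + s *: v))) =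
   (fun h : R => h^-1 *: ((f \o shift (x + s *: v)) (h *: v) - f (x + s *: v))).
  apply/funext => h /=; congr (_ *: (f _ - _)).
  by rewrite [h *: 1]mulr1 scalerDl addrCA.
apply: DeriveDef; first by rewrite /derivable E.
by rewrite /derive E.
Qed.

Lemma line_continuous f x v : (forall y, derivable f y v) ->
  continuous (fun s : R => f (x + s *: v)).
Proof.
move=> df s; apply: differentiable_continuous; apply/derivable1_diffP.
by have [] := is_derive_line (df (x + s *: v)).
Qed.

Lemma MVT_line f x v t : (forall y, derivable f y v) ->
  exists2 c, `|c| <= `|t| & f (x + t *: v) - f x = t * 'D_v f (x + c *: v).
Proof.
move=> df.
have wc a b : {within `[a, b], continuous (fun s : R => f (x + s *: v))}.
  by apply: continuous_subspaceT; exact: line_continuous.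
have isd (s : R) : is_derive s 1 (fun s : R => f (x + s *: v)) ('D_v f (x + s *: v)).
  exact: is_derive_line.
have [t0|t0] := leP 0 t.
  have [c] := MVT_segment t0 (fun s _ => isd s) (wc _ _).
  rewrite in_itv/= scale0r addr0 subr0 => /andP[c0 ct] ->; exists c.
    by rewrite !ger0_norm.
  by rewrite mulrC.
have [c] := MVT_segment (ltW t0) (fun s _ => isd s) (wc _ _).
rewrite in_itv/= scale0r addr0 sub0r => /andP[c0 ct] E; exists c.
  by rewrite !ler0_norm// ?lerN2// ltW.
by rewrite -opprB E mulrN opprK mulrC.
Qed.

End line.

(** * Paths along the coordinate axes *)

Section telescoping.
Variables (R : realType) (n : nat).
Local Notation V := 'rV[R]_n.
Implicit Types (f : V -> R) (x y v : V).

(** The vertices of a path from [x] to [y] that changes one coordinate at a time: a smooth function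
    comes with derivatives along the basis vectors only, and each leg of the path is parallel to one
    of them. *)
Definition mixed x y (k : nat) : V := \row_i (if (i < k)%N then y ord0 i else x ord0 i).

Lemma mixed0 x y : mixed x y 0 = x.
Proof. by apply/rowP => i; rewrite mxE. Qed.

Lemma mixedn x y : mixed x y n = y.
Proof. by apply/rowP => i; rewrite mxE ltn_ord. Qed.

Lemma mixedS x y (k : 'I_n) :
  mixed x y k.+1 = mixed x y k + (y ord0 k - x ord0 k) *: delta_mx ord0 k.
Proof.
apply/rowP => i; rewrite !mxE eqxx/= ltnS leq_eqVlt -val_eqE/=.
have [ik|ik] := eqVneq (val i) (val k).
  have -> : i = k by exact: val_inj.
  by rewrite ltnn mulr1 addrCA subrr addr0.
by rewrite /= mulr0 addr0.
Qed.

Lemma telescope_mixed f x y :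
  f y - f x = \sum_(k < n) (f (mixed x y k.+1) - f (mixed x y k)).
Proof.
rewrite -[in LHS](mixedn x y) -[in X in _ - f X](mixed0 x y).
by rewrite -(telescope_sumr (fun k => f (mixed x y k)))// big_mkord.
Qed.

Lemma mixed_dist x y k : `|mixed x y k - x| <= `|y - x|.
Proof.
apply: rV_norm_le => // i; rewrite !mxE; case: ifP => _.
  by have := coord_le_norm (y - x) i; rewrite !mxE.
by rewrite subrr normr0.
Qed.

Lemma partial_lipschitz f (M : R) :
  (forall i x, derivable f x (delta_mx ord0 i)) ->
  (forall i x, `|partial i f x| <= M) ->
  forall x y, `|f y - f x| <= n%:R * M * `|y - x|.
Proof.
move=> df fM x y; rewrite telescope_mixed.
apply: (le_trans (ler_norm_sum _ _ _)).
apply: le_trans (_ : \sum_(i < n) M * `|y - x| <= _); last first.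
  by rewrite sumr_const card_ord -mulrA mulr_natl.
apply: ler_sum => k _; rewrite mixedS.
have [c _ ->] := MVT_line (mixed x y k) (y ord0 k - x ord0 k) (df k).
rewrite normrM mulrC ler_pM//; first exact: fM.
by have := coord_le_norm (y - x) k; rewrite !mxE.
Qed.

Lemma delta_norm_le (i : 'I_n) : `|delta_mx ord0 i : V| <= 1.
Proof.
apply: rV_norm_le => // j; rewrite mxE.
by case: (_ && _); rewrite ?normr1 ?normr0.
Qed.

Lemma is_derive_directional f x v :
  (forall i x, derivable f x (delta_mx ord0 i)) ->
  (forall i, continuous (partial i f)) ->
  is_derive x v f (\sum_i v ord0 i * partial i f x).
Proof.
move=> df cf.
suff C : h^-1 *: ((f \o shift x) (h *: v) - f x) @[h --> 0^'] -->
    \sum_i v ord0 i * partial i f x.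
  by apply: DeriveDef; [apply: cvgP C|apply/cvg_lim].
apply/cvgrPdist_le => e e0.
pose e' := e / (\sum_(i < n) `|v ord0 i| + 1).
have s0 : 0 < \sum_(i < n) `|v ord0 i| + 1.
  by rewrite ltr_wpDl// sumr_ge0.
have e'0 : 0 < e' by rewrite divr_gt0.
have : nbhs x [set y | forall i, `|partial i f x - partial i f y| <= e'].
  apply: (@filter_forall _ _ (fun i => [set y | `|partial i f x - partial i f y| <= e']) (nbhs x) (nbhs_filter x)) => i.
  by have /cvgrPdist_le /(_ _ e'0) := cf i x.
move=> /nbhs_ballP[d /= d0 xd].
near=> h.
have h0 : h != 0 by near: h; exact: nbhs_dnbhs_neq.
(* The mean value points lie within [2 |h| |v|] of [x]: one [|h| |v|] for the vertex of the path,
   one for the point on the leg. *)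
have hd : `|h| * (2 * `|v| + 1) < d.
  rewrite -ltr_pdivlMr; last by rewrite ltr_wpDl// mulr_ge0.
  by near: h; apply: dnbhs0_lt; rewrite divr_gt0// ltr_wpDl// mulr_ge0.
rewrite /= telescope_mixed scaler_sumr -sumrB.
apply: (le_trans (ler_norm_sum _ _ _)).
apply: le_trans (_ : \sum_(i < n) `|v ord0 i| * e' <= _); last first.
  rewrite -mulr_suml /e' mulrCA -[leRHS]mulr1 ler_wpM2l//; first exact: ltW.
  by rewrite ltW// ltr_pdivrMr// mul1r ltrDl.
apply: ler_sum => k _; rewrite mixedS.
have [c cP ->] := MVT_line (mixed x (h *: v + x) k) ((h *: v + x) ord0 k - x ord0 k) (df k).
rewrite !mxE addrK.
set pp := partial k f _; set qq := 'D_ _ _ _.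
have -> : h^-1 *: (h * v ord0 k * qq) = v ord0 k * qq.
  by rewrite -[LHS]/(h^-1 * (h * v ord0 k * qq)) !mulrA mulVf// mul1r.
rewrite -mulrBr normrM ler_wpM2l//.
apply: (xd _ _ k).
rewrite -ball_normE /=.
apply: le_lt_trans hd.
rewrite -opprB normrN addrAC.
apply: (le_trans (ler_normD _ _)).
rewrite mulrDr mulr1 mulrA [_ * 2]mulrC -mulrA mulr2n mulrDl mul1r -addrA lerD//.
  by apply: (le_trans (mixed_dist _ _ _)); rewrite addrK normrZ.
rewrite normrZ; apply: le_trans (_ : `|c| <= _).
  by rewrite ler_piMr// delta_norm_le.
apply: (le_trans cP); rewrite !mxE addrK normrM.
apply: (@le_trans _ _ (`|h| * `|v|)); first by rewrite ler_wpM2l// coord_le_norm.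
by rewrite lerDl.
Unshelve. all: by end_near. Qed.

End telescoping.

(** * Symmetry of second derivatives *)

Section schwarz.
Variables (R : realType) (n : nat).
Local Notation V := 'rV[R]_n.
Implicit Types (f : V -> R) (x y v : V).

Lemma dist_le_halves (A B C D e : R) : `|A - C| <= e / 2 -> `|B - D| <= e / 2 ->
  C = D -> `|A - B| <= e.
Proof. by move=> H1 H2 CD; move: H1 H2; rewrite CD !ler_norml; lra. Qed.

(** The mean value theorem in direction [u] for [y |-> f (y + t v) - f y], then in direction [v] for
    ['D_u f]. *)
Lemma second_difference f (u v : V) x (s t : R) :
  (forall y, derivable f y u) -> (forall y, derivable ('D_u f) y v) ->
  exists c d, [/\ `|c| <= `|s|, `|d| <= `|t| &
   f (x + s *: u + t *: v) - f (x + s *: u) - f (x + t *: v) + f x =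
   s * t * 'D_v ('D_u f) (x + c *: u + d *: v)].
Proof.
move=> df ddf.
pose g y := f (y + t *: v) - f y.
have dg y : is_derive y u g ('D_u f (y + t *: v) - 'D_u f y).
  apply: is_deriveB; last exact: derivableP (df y).
  have := derivableP (df (y + t *: v)).
  have E : (fun h : R => h^-1 *: (((fun z => f (z + t *: v)) \o shift y) (h *: u)
     - f (y + t *: v))) =
   (fun h : R => h^-1 *: ((f \o shift (y + t *: v)) (h *: u) - f (y + t *: v))).
    by apply/funext => h /=; rewrite addrA.
  by move=> [a b]; apply: DeriveDef; rewrite ?/derivable ?/derive E.
have [|c cs] := @MVT_line _ _ g x u s; first by move=> y; have [] := dg y.
have [_ ->] := dg (x + c *: u).
have [d dt ->] := MVT_line (x + c *: u) t ddf.
move=> E; exists c, d; split=> //.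
rewrite -mulrA -E /g opprB addrA.
by rewrite [RHS]addrAC.
Qed.

(** The second difference with equal steps is symmetric in both directions, so the two mixed
    derivatives, each at some point near [x], equal the same quotient; continuity brings both points
    back to [x]. *)
Lemma Schwarz f (u v : V) x :
  (forall y, derivable f y u) -> (forall y, derivable f y v) ->
  (forall y, derivable ('D_u f) y v) -> (forall y, derivable ('D_v f) y u) ->
  continuous ('D_v ('D_u f)) -> continuous ('D_u ('D_v f)) ->
  'D_v ('D_u f) x = 'D_u ('D_v f) x.
Proof.
move=> fu fv fuv fvu cuv cvu.
apply/eqP; rewrite -subr_eq0 -normr_le0; apply/ler_addgt0Pr => e e0.
rewrite add0r.
have e20 : 0 < e / 2 by rewrite divr_gt0.
have /cvgrPdist_le /(_ _ e20) := cuv x.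
move=> /nbhs_ballP[a /= a0 xa].
have /cvgrPdist_le /(_ _ e20) := cvu x.
move=> /nbhs_ballP[b /= b0 xb].
pose h := Num.min a b / (`|u| + `|v| + 1).
have s0 : 0 < `|u| + `|v| + 1 by rewrite ltr_wpDl// addr_ge0.
have ab0 : 0 < Num.min a b by rewrite lt_min a0.
have h0 : 0 < h by rewrite divr_gt0.
have hs c d : `|c| <= `|h| -> `|d| <= `|h| -> `|c *: u + d *: v| < Num.min a b.
  rewrite (gtr0_norm h0) => ch dh; apply: (le_lt_trans (ler_normD _ _)).
  rewrite !normrZ; apply: (@le_lt_trans _ _ (h * `|u| + h * `|v|)).
    by rewrite lerD// ler_wpM2r.
  rewrite -mulrDr /h -mulrA gtr_pMr// mulrC ltr_pdivrMr// mul1r.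
  by rewrite ltrDl.
have [c [d [ch dh E1]]] := second_difference x h h fu fuv.
have [c' [d' [ch' dh' E2]]] := second_difference x h h fv fvu.
have E3 : 'D_v ('D_u f) (x + c *: u + d *: v) = 'D_u ('D_v f) (x + c' *: v + d' *: u).
  have hh : h * h != 0 by rewrite mulf_neq0// gt_eqF.
  have hh' : x + h *: v + h *: u = x + h *: u + h *: v by rewrite addrAC.
  move: E1 E2; rewrite hh'.
  move: ('D_v ('D_u f) _) ('D_u ('D_v f) _) => P Q E1 E2; apply: (mulfI hh).
  by rewrite -E1 -E2; congr (_ + _); rewrite addrAC.
have inball r (w : V) : `|w| < r -> ball x r (x + w).
  by rewrite -ball_normE /= opprD addNKr normrN.
have H1 : `|'D_u ('D_v f) x - 'D_u ('D_v f) (x + c' *: v + d' *: u)| <= e / 2.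
  rewrite -addrA; apply: (xb (x + _)); apply: inball; rewrite addrC.
  by apply: (lt_le_trans (hs _ _ dh' ch')); rewrite ge_min lexx orbT.
have H2 : `|'D_v ('D_u f) x - 'D_v ('D_u f) (x + c *: u + d *: v)| <= e / 2.
  rewrite -addrA; apply: (xa (x + _)); apply: inball.
  by apply: (lt_le_trans (hs _ _ ch dh)); rewrite ge_min lexx.
exact: (dist_le_halves H2 H1 E3).
Qed.

End schwarz.

(** * Algebra of smooth functions *)

Section smooth_functions.
Variables (R : realType) (n : nat).
Local Notation V := 'rV[R]_n.
Local Notation mu := (lebesgue_rV R n).
Local Notation e_ i := (delta_mx ord0 i : V).
Implicit Types (f g h : V -> R) (x y v : V) (w : seq 'I_n).

Lemma partials_rcons w i f : partials (rcons w i) f = partials w (partial i f).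
Proof. by rewrite /partials foldr_rcons. Qed.

Lemma partials_cat w w' f : partials (w ++ w') f = partials w (partials w' f).
Proof. by rewrite /partials foldr_cat. Qed.

Lemma smooth_continuous f : smooth f -> continuous f.
Proof. by move=> /(_ [::])[]. Qed.

Lemma smooth_derivable f i x : smooth f -> derivable f x (e_ i).
Proof. by move=> /(_ [::])[_]; apply. Qed.

Lemma smooth_partials f w : smooth f -> smooth (partials w f).
Proof. by move=> sf w'; rewrite -partials_cat; exact: sf. Qed.

Lemma smooth_partial f i : smooth f -> smooth (partial i f).
Proof. exact: (smooth_partials [:: i]). Qed.

(** A coinduction principle: a class closed under partial derivatives, with continuous and derivable
    members, consists of smooth functions. The word is consumed from its right end, where the
    derivative that is applied first stands. *)
Lemma smooth_coind (P : (V -> R) -> Prop) :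
  (forall f, P f -> [/\ continuous f, forall i x, derivable f x (e_ i) &
     forall i, P (partial i f)]) ->
  forall f, P f -> smooth f.
Proof.
move=> HP f Pf w; elim/last_ind: w f Pf => [|w i IH] f Pf.
  by have [? ? _] := HP _ Pf.
by rewrite partials_rcons; apply: IH; have [_ _] := HP _ Pf; apply.
Qed.

Lemma partialD f g i : (forall x, derivable f x (e_ i)) ->
  (forall x, derivable g x (e_ i)) -> partial i (f \+ g) = partial i f \+ partial i g.
Proof. by move=> df dg; apply/funext => x; rewrite /partial deriveD. Qed.

Lemma partialB f g i : (forall x, derivable f x (e_ i)) ->
  (forall x, derivable g x (e_ i)) -> partial i (f \- g) = partial i f \- partial i g.
Proof. by move=> df dg; apply/funext => x; rewrite /partial deriveB. Qed.

Lemma partialZ (k : R) f i : (forall x, derivable f x (e_ i)) ->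
  partial i (fun x => k * f x) = (fun x => k * partial i f x).
Proof. by move=> df; apply/funext => x; rewrite /partial (deriveZ k). Qed.

Lemma partialM f g i : (forall x, derivable f x (e_ i)) ->
  (forall x, derivable g x (e_ i)) ->
  partial i (f \* g) = (f \* partial i g) \+ (g \* partial i f).
Proof. by move=> df dg; apply/funext => x; rewrite /partial deriveM. Qed.

Lemma smoothD f g : smooth f -> smooth g -> smooth (f \+ g).
Proof.
move=> sf sg.
apply: (@smooth_coind (fun h => exists f g, [/\ smooth f, smooth g & h = f \+ g])); last by exists f, g.
move=> _ [f1 [g1 [sf1 sg1 ->]]]; split.
- by move=> x; apply: continuousD; exact: smooth_continuous.
- by move=> i x; apply: derivableD; exact: smooth_derivable.
- move=> i; exists (partial i f1), (partial i g1); split; try exact: smooth_partial.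
  by apply: partialD => x; exact: smooth_derivable.
Qed.

Lemma smoothZ (k : R) f : smooth f -> smooth (fun x => k * f x).
Proof.
move=> sf.
apply: (@smooth_coind (fun h => exists2 f, smooth f & h = (fun x => k * f x))); last by exists f.
move=> _ [f1 sf1 ->]; split.
- by move=> x; apply: continuousM; [exact: cst_continuous|exact: smooth_continuous].
- by move=> i x; apply: derivableZ; exact: smooth_derivable.
- move=> i; exists (partial i f1); first exact: smooth_partial.
  by apply: partialZ => x; exact: smooth_derivable.
Qed.

Lemma smoothB f g : smooth f -> smooth g -> smooth (f \- g).
Proof.
move=> sf sg; rewrite (_ : f \- g = f \+ (fun x => -1 * g x)).
  exact: (smoothD sf (smoothZ (-1) sg)).
by apply/funext => x /=; rewrite mulN1r.
Qed.

Lemma smooth_cst (k : R) : smooth (fun _ : V => k).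
Proof.
apply: (@smooth_coind (fun h => exists k : R, h = (fun=> k))); last by exists k.
move=> _ [c ->]; split.
- by move=> x; exact: cst_continuous.
- by move=> i x; exact: derivable_cst.
- by move=> i; exists 0; apply/funext => x; rewrite /partial derive_cst.
Qed.

(** Leibniz' rule turns a product into a sum of products, so the products alone do not form a class
    closed under derivation. *)
Inductive product_span : (V -> R) -> Prop :=
| product_span_mul f g : smooth f -> smooth g -> product_span (f \* g)
| product_span_add f g : product_span f -> product_span g -> product_span (f \+ g).

Lemma smoothM f g : smooth f -> smooth g -> smooth (f \* g).
Proof.
move=> sf sg; apply: (@smooth_coind product_span); last exact: product_span_mul.
move=> h; elim=> {h f g sf sg} [f g sf sg|f g _ [cf df pf] _ [cg dg pg]]; split.
- by move=> x; apply: continuousM; [exact: smooth_continuous sf x|exact: smooth_continuous sg x].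
- by move=> i x; apply: derivableM; [exact: (smooth_derivable sf)|exact: (smooth_derivable sg)].
- move=> i; rewrite (partialM (fun x => smooth_derivable sf) (fun x => smooth_derivable sg)).
  apply: product_span_add; apply: product_span_mul.
  + exact: sf.
  + exact: (@smooth_partial g i sg).
  + exact: sg.
  + exact: (@smooth_partial f i sf).
- by move=> x; apply: continuousD; [exact: cf|exact: cg].
- by move=> i x; apply: derivableD; [exact: df|exact: dg].
- move=> i; rewrite (partialD (df i) (dg i)).
  exact: (product_span_add (pf i) (pg i)).
Qed.

Lemma is_derive_affine (a : R) (b : V) f v x : derivable f (a *: x + b) v ->
  is_derive x v (fun x => f (a *: x + b)) (a * 'D_v f (a *: x + b)).
Proof.
move=> df.
have H : is_derive (0 : R) (1 : R) ((fun s : R => f ((a *: x + b) + s *: v)) \o (fun h : R => a * h))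
   (a * 'D_v f (a *: x + b)).
  rewrite mulrC.
  apply: is_derive1_comp.
  - have := @is_derive_line _ _ f (a *: x + b) v (a * 0).
    by rewrite mulr0 scale0r addr0; apply.
  - have /= := @is_deriveZ R R^o R^o id a 0 1 1 (is_derive_id _ _).
    by rewrite [a *: 1]mulr1.
have : is_derive (0 : R) (1 : R) (fun h : R => f (a *: (h *: v + x) + b)) (a * 'D_v f (a *: x + b)).
  have E : (fun h : R => f (a *: (h *: v + x) + b)) =
      (fun s : R => f ((a *: x + b) + s *: v)) \o (fun h : R => a * h).
    by apply/funext => h /=; rewrite scalerDr scalerA -addrA addrC.
  by rewrite E.
move=> [H1 H2].
have E : (fun h : R => h^-1 *: (((fun x => f (a *: x + b)) \o shift x) (h *: v) - f (a *: x + b))) =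
  (fun h : R => h^-1 *: (((fun h : R => f (a *: (h *: v + x) + b)) \o shift 0) (h *: (1 : R)) - f (a *: (0 *: v + x) + b))).
  by apply/funext => h /=; rewrite scale0r !add0r addr0 [h *: 1]mulr1.
apply: DeriveDef; first by rewrite /derivable E.
by rewrite -H2 /derive E.
Qed.

Lemma partial_affine (a : R) (b : V) f i : (forall x, derivable f x (e_ i)) ->
  partial i (fun x => f (a *: x + b)) = (fun x => a * partial i f (a *: x + b)).
Proof.
move=> df; apply/funext => x.
by have [_] := is_derive_affine (df (a *: x + b)).
Qed.

Lemma affine_continuous (a : R) (b : V) : continuous (fun x : V => a *: x + b).
Proof.
by move=> x; apply: continuousD; [apply: scaler_continuous|exact: cst_continuous].
Qed.

Lemma smooth_affine (a : R) (b : V) f : smooth f -> smooth (fun x => f (a *: x + b)).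
Proof.
move=> sf.
apply: (@smooth_coind (fun h => exists (k : R) f, smooth f /\ h = (fun x => k * f (a *: x + b)))); last first.
  by exists 1, f; split=> //; apply/funext => x; rewrite mul1r.
move=> _ [k [f1 [sf1 ->]]].
have d1 i x : derivable (fun x => f1 (a *: x + b)) x (e_ i).
  by have [] := is_derive_affine (@smooth_derivable _ i (a *: x + b) sf1).
split.
- move=> x; apply: continuousM; first exact: cst_continuous.
  apply: (@continuous_comp _ _ _ (fun x : V => a *: x + b) f1); first exact: affine_continuous.
  exact: smooth_continuous.
- by move=> i x; apply: derivableZ; exact: d1.
- move=> i; exists (k * a), (partial i f1); split; first exact: smooth_partial.
  rewrite partialZ; last exact: d1.
  rewrite partial_affine; last by move=> x; exact: smooth_derivable.
  by apply/funext => x; rewrite mulrA.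
Qed.

Lemma is_derive_coord (i : 'I_n) x v :
  is_derive x v (fun x : V => x ord0 i) (v ord0 i).
Proof.
have C : h^-1 *: (((fun x : V => x ord0 i) \o shift x) (h *: v) - x ord0 i)
   @[h --> (0 : R)^'] --> v ord0 i.
  apply: (cvg_near_cst _); near=> h => /=.
  rewrite !mxE addrK -[LHS]/(h^-1 * (h * _)) mulKf//.
  by near: h; exact: nbhs_dnbhs_neq.
by apply: DeriveDef; [apply: cvgP C|apply/cvg_lim].
Unshelve. all: by end_near. Qed.

Lemma partial_coord (i j : 'I_n) :
  partial j (fun x : V => x ord0 i) = (fun=> (i == j)%:R).
Proof.
apply/funext => x; rewrite /partial.
by have [_] := is_derive_coord i x (e_ j); rewrite mxE eqxx /= => ->.
Qed.

Lemma smooth_coord (i : 'I_n) : smooth (fun x : V => x ord0 i).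
Proof.
apply: (@smooth_coind (fun h => h = (fun x : V => x ord0 i) \/ exists k : R, h = (fun=> k))); last by left.
move=> _ [->|[c ->]]; split.
- by move=> x; exact: coord_continuous.
- by move=> j x; have [] := is_derive_coord i x (e_ j).
- by move=> j; right; rewrite partial_coord; eexists.
- by move=> x; exact: cst_continuous.
- by move=> j x; exact: derivable_cst.
- by move=> j; right; exists 0; apply/funext => x; rewrite /partial derive_cst.
Qed.

Lemma smooth_sum (I : Type) (r : seq I) (F : I -> V -> R) :
  (forall i, smooth (F i)) -> smooth (fun x => \sum_(i <- r) F i x).
Proof.
move=> sF; elim: r => [|i r IH].
  rewrite (_ : (fun _ => _) = fun=> 0); first exact: smooth_cst.
  by apply/funext => x; rewrite big_nil.
rewrite (_ : (fun _ => _) = F i \+ (fun x => \sum_(i <- r) F i x)).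
  exact: smoothD.
by apply/funext => x; rewrite big_cons.
Qed.

Lemma partialC f i j : smooth f -> partial i (partial j f) = partial j (partial i f).
Proof.
move=> sf; apply/funext => x; apply: Schwarz.
- by move=> y; exact: smooth_derivable.
- by move=> y; exact: smooth_derivable.
- by move=> y; apply: smooth_derivable; exact: smooth_partial.
- by move=> y; apply: smooth_derivable; exact: smooth_partial.
- by apply: smooth_continuous; do 2 apply: smooth_partial.
- by apply: smooth_continuous; do 2 apply: smooth_partial.
Qed.

Lemma partials_partialC f i w : smooth f ->
  partials w (partial i f) = partial i (partials w f).
Proof.
move=> sf; elim: w => //= j w ->.
by apply: partialC; exact: smooth_partials.
Qed.

Lemma partials_perm f w w' : smooth f -> perm_eq w w' -> partials w f = partials w' f.
Proof.
move=> sf; elim: w w' => [|i w IH] w'.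
  by rewrite perm_sym => /perm_nilP ->.
move=> ww'.
have iw' : i \in w' by rewrite -(perm_mem ww') mem_head.
move: ww'; case/splitPr: iw' => w1 w2.
rewrite perm_sym -cat1s perm_catCA perm_cons perm_sym => /IH /= ->.
by rewrite !partials_cat /= (partials_partialC _ _ (smooth_partials w2 sf)).
Qed.

(** Partial derivatives commute, so a word acts through its letter counts. This is the bridge
    between words, which suit inductions, and the multi-indices of the Sobolev norms. *)
Lemma mpartial_count f w : smooth f ->
  partials w f = mpartial (fun i => count_mem i w) f.
Proof.
move=> sf; apply: partials_perm => //.
apply/allP => /= i _; apply/eqP.
rewrite count_flatten -map_comp.
rewrite (eq_map (g := fun j => (j == i) * count_mem j w)%N); last first.
  by move=> j /=; rewrite count_nseq /= eq_sym; case: eqP.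
rewrite sumnE big_map big_enum/= (bigD1 i)//= eqxx mul1n big1 ?addn0// => j.
by move/negbTE ->.
Qed.

End smooth_functions.

(** * Smooth functions of bounded support *)

Section compact_support.
Variables (R : realType) (n : nat).
Local Notation V := 'rV[R]_n.
Local Notation mu := (lebesgue_rV R n).
Local Notation e_ i := (delta_mx ord0 i : V).
Implicit Types (f g h : V -> R) (x y v : V) (w : seq 'I_n).

Definition bdd_support f := exists r : R, forall x, r < `|x| -> f x = 0.

Definition Cc f := smooth f /\ bdd_support f.

Definition bounded_fun_on_V f := exists M : R, forall x, `|f x| <= M.

Lemma open_norm_gt (r : R) : open [set y : V | r < `|y|].
Proof.
have -> : [set y : V | r < `|y|] = (fun y : V => `|y|) @^-1` [set z : R | r < z] by [].
apply: open_comp; last exact: open_gt.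
by move=> y _; exact: norm_continuous.
Qed.

Lemma bdd_support_partial f i : bdd_support f -> bdd_support (partial i f).
Proof.
move=> [r fr]; exists r => x xr; rewrite /partial.
rewrite (@near_eq_derive _ _ _ f (cst 0) x (e_ i)); first exact: derive_cst.
have : open [set y : V | r < `|y|] by exact: open_norm_gt.
rewrite openE => /(_ x xr); apply: filterS => y /=; exact: fr.
Qed.

Lemma Cc_partial f i : Cc f -> Cc (partial i f).
Proof.
by move=> [sf bf]; split; [exact: smooth_partial|exact: bdd_support_partial].
Qed.

Lemma Cc_partials f w : Cc f -> Cc (partials w f).
Proof. by move=> cf; elim: w => //= i w; exact: Cc_partial. Qed.

Lemma CcD f g : Cc f -> Cc g -> Cc (f \+ g).
Proof.
move=> [sf [r fr]] [sg [s gs]]; split; first exact: smoothD.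
exists (Num.max r s) => x; rewrite gt_max => /andP[rx sx] /=.
by rewrite fr// gs// addr0.
Qed.

Lemma CcZ k f : Cc f -> Cc (fun x => k * f x).
Proof.
move=> [sf [r fr]]; split; first exact: smoothZ.
by exists r => x rx; rewrite fr// mulr0.
Qed.

Lemma CcM_smooth f g : smooth f -> Cc g -> Cc (f \* g).
Proof.
move=> sf [sg [r gr]]; split; first exact: smoothM.
by exists r => x rx /=; rewrite gr// mulr0.
Qed.

Lemma Cc_affine (a : R) (b : V) f : a != 0 -> Cc f -> Cc (fun x => f (a *: x + b)).
Proof.
move=> a0 [sf [r fr]]; split; first exact: smooth_affine.
exists ((r + `|b|) / `|a|) => x; rewrite ltr_pdivrMr ?normr_gt0// mulrC -normrZ => H.
apply: fr; rewrite -ltrBrDr in H; apply: (lt_le_trans H).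
by rewrite lerBlDr -{1}(addrK b (a *: x)); apply: (le_trans (ler_normB _ _)).
Qed.

Lemma continuous_bdd_support_bounded f : continuous f -> bdd_support f ->
  bounded_fun_on_V f.
Proof.
move=> cf [r fr].
have cK : compact [set x : V | `|x| <= Num.max r 0].
  apply: bounded_closed_compact.
    by exists (Num.max r 0); split; [exact: num_real|move=> M rM x /= /le_trans; apply; exact: ltW].
  rewrite -openC (_ : ~` _ = [set x : V | Num.max r 0 < `|x|]).
    exact: open_norm_gt.
  apply/seteqP; split=> x /=; first by move=> /negP; rewrite -ltNge.
  by move=> xr; apply/negP; rewrite -ltNge.
have [||c _ cmax] := @EVT_max_rV R n (fun x => `|f x|) _ _ cK.
- by exists 0; rewrite /= normr0 le_max lexx orbT.
- apply: continuous_subspaceT => x; apply: continuous_comp; first exact: cf.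
  exact: norm_continuous.
exists `|f c| => x; have [xr|rx] := leP `|x| (Num.max r 0).
  by apply: cmax; rewrite inE.
rewrite fr ?normr0//; apply: le_lt_trans rx.
by rewrite le_max lexx.
Qed.

Lemma Cc_bounded f : Cc f -> bounded_fun_on_V f.
Proof.
move=> [sf bf]; apply: continuous_bdd_support_bounded => //.
exact: smooth_continuous.
Qed.

Lemma Cc_lipschitz f : Cc f -> exists2 L : R, 0 <= L & forall x y, `|f y - f x| <= L * `|y - x|.
Proof.
move=> cf.
have : forall i, exists M : R, forall x, `|partial i f x| <= M.
  by move=> i; apply: Cc_bounded; exact: Cc_partial.
move=> /choice[M HM].
have M0 i : 0 <= M i by apply: le_trans (HM i 0).
exists (n%:R * \sum_i M i); first by rewrite mulr_ge0// sumr_ge0.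
move=> x y; apply: partial_lipschitz => [i z|i z].
  by apply: smooth_derivable; have [] := cf.
apply: (le_trans (HM i z)); rewrite (bigD1 i)//= lerDl.
by rewrite sumr_ge0.
Qed.

Lemma smooth_measurable f : smooth f -> measurable_fun setT f.
Proof. by move=> /smooth_continuous; exact: rV_continuous_measurable. Qed.

Lemma test_function_Cc (Om : set V) f : test_function Om f -> Cc f.
Proof.
move=> [sf cK _]; split=> //.
have /compact_bounded [M [_ HM]] := cK.
exists (M + 1) => x xM; apply/eqP; apply: contraTT xM => fx.
rewrite -leNgt; apply: HM; first by rewrite ltrDl.
exact: subset_closure.
Qed.

Lemma test_functionP (Om : set V) f :
  Cc f -> closure [set x | f x != 0] `<=` Om -> test_function Om f.
Proof.
move=> [sf [r fr]] cO; split=> //.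
apply: bounded_closed_compact; last exact: closed_closure.
exists r; split; first exact: num_real.
move=> M rM x /= xc; rewrite leNgt; apply/negP => Mx.
have oA : open [set y : V | M < `|y|] by exact: open_norm_gt.
have [y [/= fy My]] := xc _ (open_nbhs_nbhs (conj oA Mx)).
by move: fy; rewrite fr ?eqxx// (lt_trans rM).
Qed.

Lemma test_function_supp (Om : set V) f x : test_function Om f -> ~ Om x -> f x = 0.
Proof.
move=> [_ _ sO] nx; apply/eqP; apply: contra_notT nx => fx.
by apply: sO; exact: subset_closure.
Qed.

End compact_support.

Lemma lipschitz_continuous_rV (R : realType) (n : nat) (f : 'rV[R]_n -> R) (K : R) :
  0 < K -> (forall x y, `|f y - f x| <= K * `|y - x|) -> continuous f.
Proof.
move=> K0 lip x; apply/(@cvgrPdist_le _ _ _ (nbhs x) (nbhs_filter x)) => e e0.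
apply/nbhs_ballP; exists (e / K); first by rewrite /= divr_gt0.
move=> y; rewrite -ball_normE/= distrC => xy.
rewrite distrC (le_trans (lip x y))// mulrC -ler_pdivlMr//.
exact: ltW.
Qed.

(** * Differentiation under the integral sign *)

Section parametric_integral.
Variables (R : realType) (n : nat) (d : measure_display) (T : measurableType d).
Variable nu : {measure set T -> \bar R}.
Local Notation V := 'rV[R]_n.
Local Notation e_ i := (delta_mx ord0 i : V).
Variables (a : T -> R) (b : T -> V) (A : R).
Hypothesis ma : measurable_fun setT a.
Hypothesis mb : measurable_fun setT b.
Hypothesis aA : forall p, `|a p| <= A.
Implicit Types (th : V -> R) (m : T -> R) (x : V) (w : seq 'I_n).

(** One form for the parametric integrals below: a dilated convolution has [p = y] and constant [a],
    a time average has [p = (t, y)] and for [a] the dilation factor. Each derivative in [x] brings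
    down one factor [a], whence the bound on [a]. *)
Definition param_int th m : V -> R :=
  fun x => \int[nu]_p (th (a p *: x + b p) * m p).

Lemma measurable_param x : measurable_fun setT (fun p => a p *: x + b p).
Proof.
apply/measurable_fun_rVP => i.
under eq_fun do rewrite !mxE.
apply: measurable_funD; last exact: (measurableT_comp (measurable_coord i) mb).
exact: measurable_funM.
Qed.

Lemma integrable_param th m x : Cc th -> nu.-integrable setT (EFin \o m) ->
  nu.-integrable setT (EFin \o (fun p => th (a p *: x + b p) * m p)).
Proof.
move=> cth im.
have [M HM] := Cc_bounded cth.
have mm : measurable_fun setT m by apply/measurable_EFinP; exact: measurable_int im.
apply: (@le_integrable _ _ _ nu _ _ _ (EFin \o (fun p => M * m p))) => //.
- apply/measurable_EFinP; apply: measurable_funM => //.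
  apply: (measurableT_comp (f := th)); last exact: measurable_param.
  by apply: smooth_measurable; have [] := cth.
- move=> p _ /=; rewrite lee_fin !normrM ler_wpM2r//.
  by rewrite (le_trans (HM _))// ler_norm.
- rewrite (_ : _ \o _ = (fun p => M%:E * (m p)%:E)%E) //.
  exact: integrableZl.
Qed.

Lemma integrable_mul_a m : nu.-integrable setT (EFin \o m) ->
  nu.-integrable setT (EFin \o (fun p => a p * m p)).
Proof.
move=> im.
have mm : measurable_fun setT m by apply/measurable_EFinP; exact: measurable_int im.
apply: (@le_integrable _ _ _ nu _ _ _ (EFin \o (fun p => A * m p))) => //.
- by apply/measurable_EFinP; exact: measurable_funM.
- move=> p _ /=; rewrite lee_fin !normrM ler_wpM2r//.
  by rewrite (le_trans (aA _))// ler_norm.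
- rewrite (_ : _ \o _ = (fun p => A%:E * (m p)%:E)%E) //.
  exact: integrableZl.
Qed.

Lemma param_int_continuous th m : Cc th -> nu.-integrable setT (EFin \o m) ->
  continuous (param_int th m).
Proof.
move=> cth im.
have [L L0 HL] := Cc_lipschitz cth.
have imn : nu.-integrable setT (EFin \o (fun p => `|m p|)).
  by have := integrable_abse im.
pose K := L * (A * \int[nu]_p `|m p|) + 1.
have K0 : 0 <= L * (A * \int[nu]_p `|m p|).
  rewrite !mulr_ge0//; last by apply: Rintegral_ge0.
  by rewrite (le_trans _ (aA point)).
have lip x y : `|param_int th m y - param_int th m x| <= K * `|y - x|.
  rewrite /param_int -RintegralB//; try exact: integrable_param.
  have ii : nu.-integrable setT (EFin \o (fun p => th (a p *: y + b p) * m p - th (a p *: x + b p) * m p)).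
    rewrite (_ : _ \o _ = (fun p => (th (a p *: y + b p) * m p)%:E - (th (a p *: x + b p) * m p)%:E)%E)//.
    by apply: integrableB => //; exact: integrable_param.
  apply: (le_trans (le_normr_Rintegral measurableT ii)).
  apply: (@le_trans _ _ (\int[nu]_p ((L * A * `|y - x|) * `|m p|))).
    apply: le_Rintegral => //.
    - exact: integrable_abse ii.
    - rewrite (_ : _ \o _ = (fun p => (L * A * `|y - x|)%:E * (`|m p|)%:E)%E) //.
      exact: integrableZl.
    move=> p _; rewrite -mulrBl normrM ler_wpM2r//.
    apply: (le_trans (HL _ _)).
    rewrite -mulrA ler_wpM2l// opprD addrACA subrr addr0 -scalerBr normrZ.
    by rewrite ler_wpM2r.
  rewrite RintegralZl// /K mulrDl mul1r; set J := Rintegral _ _ _.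
  have -> : L * A * `|y - x| * J = L * (A * J) * `|y - x| by ring.
  by rewrite lerDl.
by apply: (lipschitz_continuous_rV _ lip); rewrite ltr_wpDl.
Qed.

Lemma param_int_derive th m i x : Cc th -> nu.-integrable setT (EFin \o m) ->
  is_derive x (e_ i) (param_int th m) (param_int (partial i th) (fun p => a p * m p) x).
Proof.
move=> cth im.
have [M HM] := Cc_bounded (Cc_partial i cth).
pose f (s : R) (p : T) := th (a p *: (x + s *: e_ i) + b p) * m p.
have dth y : derivable th y (e_ i) by apply: smooth_derivable; have [] := cth.
have df p (s : R) : is_derive s 1 (f ^~ p)
    (partial i th (a p *: (x + s *: e_ i) + b p) * (a p * m p)).
  have dg : forall y, derivable (fun x => th (a p *: x + b p)) y (e_ i).
    by move=> y; have [] := is_derive_affine (dth (a p *: y + b p)).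
  have := is_derive_line (dg (x + s *: e_ i)).
  have -> : 'D_(e_ i) (fun x => th (a p *: x + b p)) (x + s *: e_ i) =
     a p * partial i th (a p *: (x + s *: e_ i) + b p).
    by have [_] := is_derive_affine (dth (a p *: (x + s *: e_ i) + b p)).
  move=> H.
  have -> : f ^~ p = m p \*: (fun s : R => th (a p *: (x + s *: e_ i) + b p)).
    by apply/funext => t; rewrite /f mulrC.
  apply: is_derive_eq.
  by rewrite -[LHS]/(m p * (a p * _)); ring.
have intf s : nu.-integrable setT (EFin \o f s) by exact: integrable_param.
have d1f s p : partial1of2 f s p = partial i th (a p *: (x + s *: e_ i) + b p) * (a p * m p).
  by rewrite partial1of2E; have [_] := df p s.
have imn : nu.-integrable setT (EFin \o (fun p => M * `|a p * m p|)).
  rewrite (_ : _ \o _ = (fun p => M%:E * (`|a p * m p|)%:E)%E) //.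
  by apply: integrableZl => //; exact: (integrable_abse (integrable_mul_a im)).
have I0 : `](-1 : R), 1[%classic 0 by rewrite /= in_itv/=; lra.
have := @cvg_differentiation_under_integral R _ _ nu f setT measurableT 0 (-1) 1 I0
  (fun s _ => intf s) _ (fun p => M * `|a p * m p|) _ imn.
rewrite (_ : \int[nu]_y partial1of2 f 0 y = param_int (partial i th) (fun p => a p * m p) x); last first.
  apply: eq_Rintegral => p _; rewrite d1f.
  by rewrite scale0r addr0.
have E : (fun h : R => h^-1 *: (\int[nu]_y f (h + 0) y - \int[nu]_y f 0 y)) =
   (fun h : R => h^-1 *: ((param_int th m \o shift x) (h *: e_ i) - param_int th m x)).
  apply/funext => h; congr (_ *: (_ - _)).
    rewrite /param_int /=; apply: eq_Rintegral => p _.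
    by rewrite /f addr0 [x + _]addrC.
  by rewrite /param_int; apply: eq_Rintegral => p _; rewrite /f scale0r addr0.
rewrite E => H.
have {}H : h^-1 *: ((param_int th m \o shift x) (h *: e_ i) - param_int th m x) @[h --> 0^'] -->
   param_int (partial i th) (fun p => a p * m p) x.
  apply: H.
  - by move=> s p _ _; have [] := df p s.
  - by move=> p; apply: mulr_ge0 => //; exact: (le_trans _ (HM 0)).
  - by move=> s p _ _; rewrite d1f normrM; apply: ler_wpM2r => //; exact: HM.
by apply: DeriveDef; [apply: cvgP H|apply/cvg_lim].
Qed.

Lemma param_int_partial th m i : Cc th -> nu.-integrable setT (EFin \o m) ->
  partial i (param_int th m) = param_int (partial i th) (fun p => a p * m p).
Proof.
move=> cth im; apply/funext => x; rewrite /partial.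
by have [_] := param_int_derive i x cth im.
Qed.

Lemma param_int_smooth th m : Cc th -> nu.-integrable setT (EFin \o m) ->
  smooth (param_int th m).
Proof.
move=> cth im.
apply: (@smooth_coind _ _ (fun F => exists th m, [/\ Cc th, nu.-integrable setT (EFin \o m) & F = param_int th m])); last by exists th, m.
move=> _ [th1 [m1 [c1 i1 ->]]]; split.
- exact: param_int_continuous.
- by move=> i x; have [] := param_int_derive i x c1 i1.
- move=> i; rewrite param_int_partial//; do 2 eexists; split; last by [].
    exact: Cc_partial.
  exact: integrable_mul_a.
Qed.

End parametric_integral.

(** * Bounded functions of bounded support *)

Section bounded_finite.
Context {d : measure_display} {T : measurableType d} {R : realType}.
Variable nu : {measure set T -> \bar R}.
Implicit Types (f g k : T -> R).

(** Boundedness with a carrier of finite measure is stable under products and gives integrability at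
    once; this keeps the side conditions of Fubini and Cauchy-Schwarz short. *)
Definition bfin f := measurable_fun setT f /\
  exists M D, [/\ measurable D, (nu D < +oo)%E, 0 <= M & forall x, `|f x| <= M * \1_D x].

Lemma integrable_indic_fin (D : set T) : measurable D -> (nu D < +oo)%E ->
  nu.-integrable setT (EFin \o (\1_D : T -> R)).
Proof.
move=> mD D8; apply/integrableP; split.
  by apply/measurable_EFinP; exact: measurable_indic.
rewrite (eq_integral (fun x => (\1_D x)%:E)); last first.
  by move=> x _; rewrite /= ger0_norm.
by rewrite integral_indic// setIT.
Qed.

Lemma integrableZ_real f (r : R) : nu.-integrable setT (EFin \o f) ->
  nu.-integrable setT (EFin \o (fun x => r * f x)).
Proof.
move=> fi; rewrite (_ : _ \o _ = (fun p => r%:E * (f p)%:E)%E) //.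
exact: integrableZl.
Qed.

Lemma integrableD_real f g : nu.-integrable setT (EFin \o f) ->
  nu.-integrable setT (EFin \o g) -> nu.-integrable setT (EFin \o (fun x => f x + g x)).
Proof.
move=> fi gi; rewrite (_ : _ \o _ = (fun p => (f p)%:E + (g p)%:E)%E) //.
exact: integrableD.
Qed.

Lemma integrableB_real f g : nu.-integrable setT (EFin \o f) ->
  nu.-integrable setT (EFin \o g) -> nu.-integrable setT (EFin \o (fun x => f x - g x)).
Proof.
move=> fi gi; rewrite (_ : _ \o _ = (fun p => (f p)%:E - (g p)%:E)%E) //.
exact: integrableB.
Qed.

Lemma integrable_norm_real f : nu.-integrable setT (EFin \o f) ->
  nu.-integrable setT (EFin \o (fun x => `|f x|)).
Proof. by move=> fi; have := integrable_abse fi. Qed.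

Lemma integrable_dom f g : measurable_fun setT f -> nu.-integrable setT (EFin \o g) ->
  (forall x, `|f x| <= g x) -> nu.-integrable setT (EFin \o f).
Proof.
move=> mf gi fg.
apply: (@le_integrable _ _ _ nu _ _ _ (EFin \o g)) => //.
- exact/measurable_EFinP.
- by move=> x _ /=; rewrite lee_fin (le_trans (fg x))// ler_norm.
Qed.

Lemma bfin_integrable f : bfin f -> nu.-integrable setT (EFin \o f).
Proof.
move=> [mf [M [D [mD D8 M0 fM]]]].
apply: (integrable_dom mf _ fM).
exact: integrableZ_real (integrable_indic_fin mD D8).
Qed.

Lemma bfinM_bounded f k (K : R) : measurable_fun setT k -> (forall x, `|k x| <= K) ->
  bfin f -> bfin (fun x => k x * f x).
Proof.
move=> mk kK [mf [M [D [mD D8 M0 fM]]]]; split; first exact: measurable_funM.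
exists (`|K| * M), D; split => //; first by rewrite mulr_ge0.
move=> x; rewrite normrM -mulrA ler_pM//.
by rewrite (le_trans (kK x))// ler_norm.
Qed.

Lemma bfin_bounded f : bfin f -> exists M, forall x, `|f x| <= M.
Proof.
move=> [_ [M [D [_ _ M0 fM]]]]; exists M => x; apply: (le_trans (fM x)).
by rewrite indicE; case: (_ \in _); rewrite ?mulr1 ?mulr0.
Qed.

Lemma bfinM f g : bfin f -> bfin g -> bfin (fun x => f x * g x).
Proof.
move=> bf bg; have [M fM] := bfin_bounded bf.
by apply: (bfinM_bounded _ fM) => //; have [] := bf.
Qed.

(** For [K > 0] the minimum is at [s = A / K]. For [K = 0] an affine function of [s] that is bounded
    below is constant, which forces [A = 0]. *)
Lemma discriminant_le (A B K : R) : 0 <= K -> (forall s, 0 <= B - 2 * s * A + s ^+ 2 * K) ->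
  A ^+ 2 <= K * B.
Proof.
move=> K0 H; have [K1|K1] := ltrP 0 K.
  have := H (A / K); rewrite -(pmulr_rge0 _ K1).
  have -> : K * (B - 2 * (A / K) * A + (A / K) ^+ 2 * K) = K * B - A ^+ 2.
    by field; rewrite gt_eqF.
  by rewrite subr_ge0.
have KE : K = 0 by apply/eqP; rewrite eq_le K1 K0.
move: H; rewrite KE mul0r => H.
have [->|A0] := eqVneq A 0; first by rewrite expr0n.
have := H ((B + 1) / (2 * A)).
have -> : B - 2 * ((B + 1) / (2 * A)) * A + ((B + 1) / (2 * A)) ^+ 2 * 0 = -1 by field.
by rewrite lerNr oppr0 ler10.
Qed.

(** The quadratic polynomial behind this is [s |-> ∫ k (g - s)^2]. *)
Lemma Cauchy_Schwarz_weight k g : (forall x, 0 <= k x) ->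
  nu.-integrable setT (EFin \o k) ->
  nu.-integrable setT (EFin \o (fun x => k x * g x)) ->
  nu.-integrable setT (EFin \o (fun x => k x * g x ^+ 2)) ->
  (\int[nu]_x (k x * g x)) ^+ 2 <= (\int[nu]_x k x) * \int[nu]_x (k x * g x ^+ 2).
Proof.
move=> k0 ik ikg ikg2; apply: discriminant_le; first exact: Rintegral_ge0.
move=> s.
rewrite -RintegralZl// -RintegralZl// -RintegralB//; last exact: integrableZ_real.
rewrite -RintegralD//; last 2 first.
- exact: integrableB_real (integrableZ_real _ _).
- exact: integrableZ_real.
apply: Rintegral_ge0 => x _.
have -> : k x * g x ^+ 2 - 2 * s * (k x * g x) + s ^+ 2 * k x = k x * (g x - s) ^+ 2 by ring.
by rewrite mulr_ge0// sqr_ge0.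
Qed.

Lemma Cauchy_Schwarz f g : nu.-integrable setT (EFin \o (fun x => f x ^+ 2)) ->
  nu.-integrable setT (EFin \o (fun x => f x * g x)) ->
  nu.-integrable setT (EFin \o (fun x => g x ^+ 2)) ->
  (\int[nu]_x (f x * g x)) ^+ 2 <= (\int[nu]_x (f x ^+ 2)) * \int[nu]_x (g x ^+ 2).
Proof.
move=> if2 ifg ig2; apply: discriminant_le.
  by apply: Rintegral_ge0 => x _; exact: sqr_ge0.
move=> s.
rewrite -RintegralZl// -RintegralZl// -RintegralB//; last exact: integrableZ_real.
rewrite -RintegralD//; last 2 first.
- exact: integrableB_real (integrableZ_real _ _).
- exact: integrableZ_real.
apply: Rintegral_ge0 => x _.
have -> : g x ^+ 2 - 2 * s * (f x * g x) + s ^+ 2 * f x ^+ 2 = (g x - s * f x) ^+ 2 by ring.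
exact: sqr_ge0.
Qed.

End bounded_finite.

Section bounded_finite_product.
Context {d1 d2 : measure_display} {T1 : measurableType d1} {T2 : measurableType d2} {R : realType}.
Variables (m1 : {sigma_finite_measure set T1 -> \bar R}) (m2 : {sigma_finite_measure set T2 -> \bar R}).
Implicit Types (f : T1 * T2 -> R).

(** The carrier is a product of sets of finite measure, not just a set of finite product measure:
    then every section is of class [bfin], with bounds uniform in the section, and so are the
    partial integrals. *)
Definition bfin2 f := measurable_fun setT f /\
  exists M D E, [/\ measurable D /\ measurable E, (m1 D < +oo)%E, (m2 E < +oo)%E, 0 <= M &
    forall x y, `|f (x, y)| <= M * (\1_D x * \1_E y)].

Lemma bfin2_bfin f : bfin2 f -> bfin (m1 \x m2)%E f.
Proof.
move=> [mf [M [D [E [[mD mE] D8 E8 M0 fM]]]]]; split=> //.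
exists M, (D `*` E); split=> //.
- exact: measurableX.
- apply: (@le_lt_trans _ _ (m1 D * m2 E)%E).
    by rewrite le_eqVlt; apply/orP; left; apply/eqP; exact: product_measure1E.
  by rewrite lte_mul_pinfty// ge0_fin_numE.
- move=> [x y]; apply: (le_trans (fM x y)); rewrite !indicE ler_wpM2l//.
  by rewrite in_setX -natrM mulnb.
Qed.

Lemma bfin2_section1 f x : bfin2 f -> bfin m2 (fun y => f (x, y)).
Proof.
move=> [mf [M [D [E [[mD mE] D8 E8 M0 fM]]]]]; split.
  by apply: measurableT_comp => //; exact: measurable_pair1.
exists M, E; split=> // y; apply: (le_trans (fM x y)).
rewrite !indicE ler_wpM2l//; case: (_ \in _); rewrite ?mul1r ?mul0r//.
Qed.

Lemma bfin2_section2 f y : bfin2 f -> bfin m1 (fun x => f (x, y)).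
Proof.
move=> [mf [M [D [E [[mD mE] D8 E8 M0 fM]]]]]; split.
  by apply: measurableT_comp => //; exact: measurable_pair2.
exists M, D; split=> // x; apply: (le_trans (fM x y)).
rewrite !indicE ler_wpM2l//; case: (_ \in E); rewrite ?mulr1 ?mulr0//.
Qed.

Lemma bfin2_integral1 f : bfin2 f -> bfin m1 (fun x => \int[m2]_y f (x, y)).
Proof.
move=> bf; have iF := bfin_integrable (bfin2_bfin bf).
have secE x : (\int[m2]_y f (x, y))%:E = fubini_F m2 (EFin \o f) x.
  rewrite /Rintegral fineK//; apply: integrable_fin_num => //.
  exact: (bfin_integrable (bfin2_section1 x bf)).
split.
  apply/measurable_EFinP; rewrite (_ : _ \o _ = fubini_F m2 (EFin \o f)).
    exact: measurable_fubini_F iF.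
  by apply/funext => x; rewrite /= secE.
have [mf [M [D [E [[mD mE] D8 E8 M0 fM]]]]] := bf.
exists (M * fine (m2 E)), D; split=> //.
  by rewrite mulr_ge0// fine_ge0.
move=> x.
have isec := bfin_integrable (bfin2_section1 x bf).
apply: (le_trans (le_normr_Rintegral measurableT isec)).
have iE : m2.-integrable setT (EFin \o (fun y => M * \1_D x * \1_E y)).
  exact: integrableZ_real (integrable_indic_fin mE E8).
apply: (@le_trans _ _ (\int[m2]_y (M * \1_D x * \1_E y))).
  apply: le_Rintegral => //; first exact: integrable_norm_real.
  by move=> y _; rewrite -mulrA.
rewrite RintegralZl//; last exact: integrable_indic_fin.
by rewrite /Rintegral integral_indic// setIT mulrAC.
Qed.

Lemma bfin2_product_integral f : bfin2 f ->
  Rintegral (m1 \x m2)%E setT f = \int[m1]_x \int[m2]_y f (x, y).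
Proof.
move=> bf; have iF := bfin_integrable (bfin2_bfin bf).
rewrite /Rintegral -(integral12_prod_meas1 iF); congr fine.
apply: eq_integral => x _; rewrite /fubini_F fineK//.
apply: integrable_fin_num => //.
exact: (bfin_integrable (bfin2_section1 x bf)).
Qed.

Lemma bfin2_product_integral_sym f : bfin2 f ->
  Rintegral (m1 \x m2)%E setT f = \int[m2]_y \int[m1]_x f (x, y).
Proof.
move=> bf; have iF := bfin_integrable (bfin2_bfin bf).
rewrite /Rintegral -(integral21_prod_meas1 iF); congr fine.
apply: eq_integral => x _; rewrite /fubini_G fineK//.
apply: integrable_fin_num => //.
exact: (bfin_integrable (bfin2_section2 x bf)).
Qed.

Lemma bfin2_Fubini f : bfin2 f ->
  \int[m1]_x \int[m2]_y f (x, y) = \int[m2]_y \int[m1]_x f (x, y).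
Proof.
by move=> bf; rewrite -bfin2_product_integral// bfin2_product_integral_sym.
Qed.

End bounded_finite_product.

(** * Integration by parts on the whole space *)

Section bounded_supported.
Variables (R : realType) (n : nat).
Local Notation V := 'rV[R]_n.
Local Notation mu := (lebesgue_rV R n).
Local Notation e_ i := (delta_mx ord0 i : V).
Implicit Types (f g h : V -> R) (x y v : V) (w : seq 'I_n).

Definition Bb f := [/\ measurable_fun setT f, bounded_fun_on_V f & bdd_support f].

Lemma cubeP (r : R) x : 0 <= r -> (cube r x <-> `|x| <= r).
Proof.
move=> r0; split=> [H|xr i].
  by apply: rV_norm_le => // i; have := H i; rewrite /= in_itv/= ler_norml.
by rewrite /= in_itv/= -ler_norml (le_trans (coord_le_norm x i)).
Qed.

Lemma bdd_support_cube f : bdd_support f -> exists2 r, 0 <= r & forall x, ~ cube r x -> f x = 0.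
Proof.
move=> [r fr]; exists (Num.max r 0); first by rewrite le_max lexx orbT.
move=> x xr; apply: fr; rewrite ltNge; apply/negP => H; apply: xr.
by apply/cubeP; rewrite le_max ?lexx ?orbT// H.
Qed.

Lemma Bb_bfin f : Bb f -> bfin mu f.
Proof.
move=> [mf [M fM] /bdd_support_cube[r r0 fr]]; split=> //.
exists `|M|, (cube r); split=> //; [exact: measurable_cube|exact: cube_finite|].
move=> x; rewrite indicE; have [xr|xr] := pselect (cube r x).
  by rewrite mem_set// mulr1 (le_trans (fM x))// ler_norm.
by rewrite fr// normr0 mulr_ge0.
Qed.

Lemma Bb_integrable f : Bb f -> mu.-integrable setT (EFin \o f).
Proof. by move=> /Bb_bfin/bfin_integrable. Qed.

Lemma Cc_Bb f : Cc f -> Bb f.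
Proof.
move=> cf; have [sf bf] := cf; split=> //; first exact: smooth_measurable.
exact: Cc_bounded.
Qed.

Lemma BbD f g : Bb f -> Bb g -> Bb (f \+ g).
Proof.
move=> [mf [M fM] [r fr]] [mg [N gN] [s gs]]; split.
- exact: measurable_funD.
- by exists (M + N) => x; rewrite (le_trans (ler_normD _ _))// lerD.
- exists (Num.max r s) => x; rewrite gt_max => /andP[rx sx] /=.
  by rewrite fr// gs// addr0.
Qed.

Lemma BbM_bounded f g : measurable_fun setT f -> bounded_fun_on_V f -> Bb g ->
  Bb (f \* g).
Proof.
move=> mf [M fM] [mg [N gN] [s gs]]; split.
- exact: measurable_funM.
- by exists (M * N) => x; rewrite normrM ler_pM.
- by exists s => x sx /=; rewrite gs// mulr0.
Qed.

Lemma BbM f g : Bb f -> Bb g -> Bb (f \* g).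
Proof. by move=> [mf bf _]; exact: BbM_bounded. Qed.

Lemma BbZ (k : R) f : Bb f -> Bb (fun x => k * f x).
Proof.
move=> bf; apply: (@BbM_bounded (fun=> k)) => //.
by exists `|k|.
Qed.

(** By translation invariance [x |-> ∫ f (x + y) dy] is constant, and its derivative at [0] is the
    integral in question. The indicator of [K] changes nothing for [|x| <= 1] and provides the
    integrable factor that [param_int] asks for. *)
Lemma integral_partial0 f i : Cc f -> \int[mu]_x partial i f x = 0.
Proof.
move=> cf; have [sf [r fr]] := cf.
pose K : set V := cube (`|r| + 1).
have mK : measurable K by exact: measurable_cube.
have iK : mu.-integrable setT (EFin \o (\1_K : V -> R)).
  by apply: integrable_indic_fin => //; exact: cube_finite.
pose F := param_int mu (fun=> 1) (fun y : V => y) f \1_K.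
have outK (h : V -> R) x y : (forall z, r < `|z| -> h z = 0) -> `|x| <= 1 ->
    h (1 *: x + y) * \1_K y = h (1 *: x + y).
  move=> hr x1; rewrite indicE; have [Ky|Ky] := pselect (K y).
    by rewrite mem_set// mulr1.
  rewrite hr ?mul0r// scale1r.
  have : `|r| + 1 < `|y|.
    by rewrite ltNge; apply/negP => H; apply: Ky; apply/cubeP.
  have := ler_normB (x + y) x; rewrite addrAC subrr add0r => H1 H2.
  have := ler_norm r; lra.
have FE x : `|x| <= 1 -> F x = \int[mu]_y f y.
  move=> x1; rewrite /F /param_int.
  transitivity (\int[mu]_y f (1 *: y + x)).
    by apply: eq_Rintegral => y _; rewrite outK// !scale1r addrC.
  rewrite Rintegral_rV_affine ?normr1 ?invr1 ?expr1n ?mul1r ?oner_neq0//.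
  exact: Bb_integrable (Cc_Bb cf).
have dF : is_derive (0 : V) (e_ i) F (param_int mu (fun=> 1) (fun y : V => y) (partial i f) (fun p => 1 * \1_K p) 0).
  apply: (@param_int_derive _ _ _ _ _ _ _ 1) => //; first by move=> _; rewrite normr1.

have dF0 : 'D_(e_ i) F 0 = 0.
  rewrite (@near_eq_derive _ _ _ F (cst (\int[mu]_y f y)) 0 (e_ i)); first exact: derive_cst.
  apply/nbhs_ballP; exists 1 => //= y; rewrite -ball_normE/= sub0r normrN => y1.
  by rewrite FE// ltW.
have [r' fr'] : bdd_support (partial i f) by apply: bdd_support_partial; exists r.
have [_] := dF; rewrite dF0 => ->; rewrite /param_int.
apply: eq_Rintegral => y _; rewrite scaler0 add0r mul1r indicE.
have [Ky|Ky] := pselect (K y); first by rewrite mem_set// mulr1.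
rewrite memNset// mulr0 /partial.
rewrite (@near_eq_derive _ _ _ f (cst 0) y (e_ i)); first exact: derive_cst.
have : r < `|y|.
  rewrite ltNge; apply/negP => H; apply: Ky; apply/cubeP.
    by rewrite addr_ge0.
  by have := ler_norm r; lra.
have := @open_norm_gt R n r; rewrite openE => /[apply].
by apply: filterS => z; exact: fr.
Qed.

Lemma integration_by_parts_rV f g i : Cc f -> smooth g ->
  \int[mu]_x (partial i f x * g x) = - \int[mu]_x (f x * partial i g x).
Proof.
move=> cf sg; have [sf _] := cf.
have cgf : Cc (g \* f) by exact: CcM_smooth.
have := integral_partial0 i cgf.
rewrite (partialM (fun x => smooth_derivable sg) (fun x => smooth_derivable sf)) => H.
have i1 : mu.-integrable setT (EFin \o (fun x => partial i f x * g x)).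
  have := Bb_integrable (Cc_Bb (CcM_smooth sg (Cc_partial i cf))).
  by congr (_.-integrable _ _); apply/funext => x /=; rewrite mulrC.
have i2 : mu.-integrable setT (EFin \o (fun x => f x * partial i g x)).
  have := Bb_integrable (Cc_Bb (CcM_smooth (@smooth_partial _ _ g i sg) cf)).
  by congr (_.-integrable _ _); apply/funext => x /=; rewrite mulrC.
apply/eqP; rewrite -addr_eq0 -RintegralD//; apply/eqP; rewrite -[RHS]H.
by apply: eq_Rintegral => x _ /=; rewrite [g x * _]mulrC.
Qed.

End bounded_supported.

(** * Dilated convolutions *)

Section conv.
Variables (R : realType) (n : nat).
Local Notation V := 'rV[R]_n.
Local Notation mu := (lebesgue_rV R n).
Local Notation e_ i := (delta_mx ord0 i : V).
Implicit Types (f g h th : V -> R) (x y v : V) (w : seq 'I_n) (al be : R) (ga : V).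

Definition ip f g := \int[mu]_x (f x * g x).

(** A derivative in [x] costs [al], an integration by parts in [y] costs [1 / be], and passing to
    the adjoint exchanges [al] and [be]. All later estimates play these three rules against each
    other. *)
Definition conv th al be ga h : V -> R :=
  fun x => \int[mu]_y (th (al *: x + (be *: y + ga)) * h y).

Lemma convE th al be ga h :
  conv th al be ga h = param_int mu (fun=> al) (fun y => be *: y + ga) th h.
Proof. by []. Qed.

Lemma conv_smooth th al be ga h : Cc th -> Bb h -> smooth (conv th al be ga h).
Proof.
move=> cth bh; apply: (@param_int_smooth _ _ _ _ _ _ _ `|al|) => //.
  exact: measurable_fun_rV_affine.
exact: Bb_integrable.
Qed.

Lemma conv_partial th al be ga h i : Cc th -> Bb h ->
  partial i (conv th al be ga h) = (fun x => al * conv (partial i th) al be ga h x).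
Proof.
move=> cth bh; rewrite convE (@param_int_partial _ _ _ _ _ _ _ `|al|) => //.
- apply/funext => x; rewrite /param_int /conv -RintegralZl//.
    by apply: eq_Rintegral => y _; rewrite mulrCA.
  apply: (@integrable_param _ _ _ _ _ (fun=> al)) => //.
  + exact: measurable_fun_rV_affine.
  + exact: Cc_partial.
  + exact: Bb_integrable.
- exact: measurable_fun_rV_affine.
- exact: Bb_integrable.
Qed.

Lemma conv_bdd_support th al be ga h : al != 0 -> bdd_support th -> bdd_support h ->
  bdd_support (conv th al be ga h).
Proof.
move=> al0 [r tr] [s hs].
exists ((`|r| + `|be| * `|s| + `|ga|) / `|al|) => x.
rewrite ltr_pdivrMr ?normr_gt0// => H.
rewrite /conv (_ : (fun _ => _) = cst 0).
  by rewrite Rintegral_cst ?mul0r.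
apply/funext => y /=; have [ys|ys] := ltP s `|y|; first by rewrite hs// mulr0.
rewrite tr ?mul0r//.
have h1 : `|be *: y| <= `|be| * `|s|.
  by rewrite normrZ ler_wpM2l// (le_trans ys)// ler_norm.
have h2 := ler_normB (al *: x + (be *: y + ga)) (be *: y + ga).
rewrite addrK normrZ in h2.
have h3 := ler_normD (be *: y) ga.
have h4 := ler_norm r.
rewrite mulrC in H; lra.
Qed.

Lemma conv_Cc th al be ga h : al != 0 -> Cc th -> Bb h -> Cc (conv th al be ga h).
Proof.
move=> al0 cth bh; split; first exact: conv_smooth.
by apply: conv_bdd_support => //; [case: cth|case: bh].
Qed.

Lemma conv_Bb th al be ga h : al != 0 -> Cc th -> Bb h -> Bb (conv th al be ga h).
Proof. by move=> *; apply: Cc_Bb; exact: conv_Cc. Qed.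

Lemma conv_partial_ibp th al be ga g i : be != 0 -> Cc th -> smooth g ->
  conv (partial i th) al be ga g = (fun x => - be^-1 * conv th al be ga (partial i g) x).
Proof.
move=> be0 cth sg; apply/funext => x.
have E (t : V -> R) y : t (al *: x + (be *: y + ga)) = t (be *: y + (al *: x + ga)).
  by rewrite addrCA.
have cc : Cc (fun y => th (be *: y + (al *: x + ga))) by exact: Cc_affine.
have := integration_by_parts_rV i cc sg.
rewrite partial_affine; last by move=> y; apply: smooth_derivable; case: cth.
have cp := Cc_partial i cth.
move: (partial i th) cp => p cp H; rewrite mulNr /conv.
have -> : \int[mu]_y (th (al *: x + (be *: y + ga)) * partial i g y) =
    \int[mu]_y (th (be *: y + (al *: x + ga)) * partial i g y).
  by apply: eq_Rintegral => y _; rewrite E.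
rewrite -mulrN -H.
under [X in _ = _ * X]eq_Rintegral do rewrite -mulrA.
rewrite RintegralZl//; last first.
  apply: Bb_integrable; apply: Cc_Bb.
  have := CcM_smooth sg (Cc_affine (al *: x + ga) be0 cp).
  by congr Cc; apply/funext => y; rewrite /= mulrC.
by rewrite (mulKf be0); apply: eq_Rintegral => y _; rewrite E.
Qed.

Lemma measurable_conv_kernel th al be ga : measurable_fun setT th ->
  measurable_fun setT (fun z : V * V => th (al *: z.1 + (be *: z.2 + ga))).
Proof.
move=> mth; apply: measurableT_comp => //.
apply/measurable_fun_rVP => i.
under eq_fun do rewrite !mxE.
apply: measurable_funD.
  by apply: measurable_funM => //; exact: (measurableT_comp (measurable_coord i) measurable_fst).
apply: measurable_funD => //.
by apply: measurable_funM => //; exact: (measurableT_comp (measurable_coord i) measurable_snd).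
Qed.

Lemma bfin2_kernel th al be ga h : al != 0 -> Bb th -> Bb h ->
  bfin2 mu mu (fun z : V * V => th (al *: z.1 + (be *: z.2 + ga)) * h z.2).
Proof.
move=> al0 [mth [M tM] [r tr]] [mh [N hN] [s hs]]; split.
  apply: measurable_funM; first exact: measurable_conv_kernel.
  exact: measurableT_comp.
pose ra := (`|r| + `|be| * `|s| + `|ga|) / `|al|.
have ra0 : 0 <= ra by rewrite divr_ge0// !addr_ge0// mulr_ge0.
exists (`|M| * `|N|), (cube ra), (cube `|s|); split.
- by split; exact: measurable_cube.
- exact: cube_finite.
- exact: cube_finite.
- by rewrite mulr_ge0.
move=> x y /=; have [sy|sy] := pselect (cube `|s| y); last first.
  rewrite hs ?mulr0 ?normr0 ?mulr_ge0//.
  rewrite ltNge; apply/negP => H; apply: sy; apply/cubeP => //.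
  by rewrite (le_trans H)// ler_norm.
have [sx|sx] := pselect (cube ra x).
  rewrite !indicE !mem_set// !mulr1 normrM ler_pM//.
    by rewrite (le_trans (tM _))// ler_norm.
  by rewrite (le_trans (hN _))// ler_norm.
rewrite tr ?mul0r ?normr0 ?mulr_ge0//.
have {}sx : ra < `|x| by rewrite ltNge; apply/negP => H; apply: sx; apply/cubeP.
have {}sy : `|y| <= `|s| by apply/cubeP.
have h1 : `|be *: y| <= `|be| * `|s| by rewrite normrZ ler_wpM2l.
have h2 := ler_normB (al *: x + (be *: y + ga)) (be *: y + ga).
rewrite addrK normrZ in h2.
have h3 := ler_normD (be *: y) ga.
have h4 := ler_norm r.
move: sx; rewrite ltr_pdivrMr ?normr_gt0// mulrC; lra.
Qed.

Lemma bfin2M_bounded1 (K : V * V -> R) f : bfin2 mu mu K -> measurable_fun setT f ->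
  bounded_fun_on_V f -> bfin2 mu mu (fun z => f z.1 * K z).
Proof.
move=> [mK [M [D [E [[mD mE] D8 E8 M0 fM]]]]] mf [N fN]; split.
  by apply: measurable_funM => //; exact: measurableT_comp.
exists (`|N| * M), D, E; split => //; first by rewrite mulr_ge0.
move=> x y /=; rewrite normrM -mulrA ler_pM//.
by rewrite (le_trans (fN x))// ler_norm.
Qed.

Lemma conv_adjoint th al be ga f g : al != 0 -> Cc th -> Bb f -> Bb g ->
  ip (conv th al be ga f) g = ip f (conv th be al ga g).
Proof.
move=> al0 cth bf bg.
have [mg gM _] := bg; have [mf fM _] := bf.
have bk := bfin2M_bounded1 (bfin2_kernel be ga al0 (Cc_Bb cth) bf) mg gM.
rewrite /ip.
transitivity (\int[mu]_x \int[mu]_y (g x * (th (al *: x + (be *: y + ga)) * f y))).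
  apply: eq_Rintegral => x _; rewrite mulrC RintegralZl//.
  apply: (@integrable_param _ _ _ _ _ (fun=> al)) => //.
    exact: measurable_fun_rV_affine.
  exact: Bb_integrable.
rewrite (bfin2_Fubini bk) /=; apply: eq_Rintegral => y _.
rewrite -RintegralZl//; last first.
  apply: (@integrable_param _ _ _ _ _ (fun=> be)) => //.
    exact: measurable_fun_rV_affine.
  exact: Bb_integrable.
apply: eq_Rintegral => x _; rewrite [be *: y + (_ + _)]addrCA.
by ring.
Qed.

Lemma Rintegral_conv_kernel th be ga x al : be != 0 -> Bb th ->
  \int[mu]_y th (al *: x + (be *: y + ga)) = `|be|^-1 ^+ n * \int[mu]_y th y.
Proof.
move=> be0 bth.
rewrite -[RHS](@Rintegral_rV_affine R n be (al *: x + ga) th be0 (Bb_integrable bth)).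
by apply: eq_Rintegral => y _; rewrite addrCA.
Qed.

Lemma integrable_conv_kernel th be ga x al : be != 0 -> Bb th ->
  mu.-integrable setT (EFin \o (fun y => th (al *: x + (be *: y + ga)))).
Proof.
move=> be0 bth.
have := @integrable_rV_affine R n be (al *: x + ga) th be0 (Bb_integrable bth).
by congr (_.-integrable _ _); apply/funext => y /=; rewrite addrCA.
Qed.

Lemma Bb_norm f : Bb f -> Bb (fun x => `|f x|).
Proof.
move=> [mf [M fM] [r fr]]; split; first exact: measurableT_comp.
  by exists M => x; rewrite normr_id.
by exists r => x xr; rewrite fr ?normr0.
Qed.

(** The Schur test: Cauchy-Schwarz in [y] with weight [|th|], where the kernel has integral
    [|be|^-n] times the L1 norm of [th], and then Fubini, where the integral in [x] brings
    [|al|^-n]. *)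
Lemma conv_L2_Schur th al be ga g : al != 0 -> be != 0 -> Bb th -> Bb g ->
  ip (conv th al be ga g) (conv th al be ga g) <=
  (`|be|^-1 ^+ n * \int[mu]_z `|th z|) * (`|al|^-1 ^+ n * \int[mu]_z `|th z|) * ip g g.
Proof.
move=> al0 be0 bth bg.
have bth' := Bb_norm bth.
have bg2 : Bb (fun y => g y ^+ 2) by exact: (BbM bg bg).
set C := `|be|^-1 ^+ n * _; set D := `|al|^-1 ^+ n * _.
have bk := bfin2_kernel be ga al0 bth bg.
have bk2 := bfin2_kernel be ga al0 bth' bg2.
have C0 : 0 <= C.
  by rewrite mulr_ge0// ?exprn_ge0 ?invr_ge0//; exact: Rintegral_ge0.
have bc : bfin mu (conv th al be ga g) by exact: (bfin2_integral1 bk).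
have bk3 := bfin2_integral1 bk2.
have ptw x : conv th al be ga g x * conv th al be ga g x <=
    C * \int[mu]_y (`|th (al *: x + (be *: y + ga))| * g y ^+ 2).
  rewrite -expr2 -real_normK ?num_real//.
  have i1 := bfin_integrable (bfin2_section1 x bk).
  apply: (@le_trans _ _ ((\int[mu]_y (`|th (al *: x + (be *: y + ga))| * `|g y|)) ^+ 2)).
    rewrite lerXn2r ?nnegrE//; first exact: Rintegral_ge0.
    apply: (le_trans (le_normr_Rintegral measurableT i1)).
    by under eq_Rintegral do rewrite normrM.
  apply: (le_trans (Cauchy_Schwarz_weight _ _ _ _)) => //=.
  - exact: (@integrable_conv_kernel (fun z => `|th z|)).
  - have := integrable_norm_real i1.
    by congr (_.-integrable _ _); apply/funext => y /=; rewrite normrM.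
  - have := bfin_integrable (bfin2_section1 x bk2).
    by congr (_.-integrable _ _); apply/funext => y /=; rewrite real_normK ?num_real.
  rewrite (@Rintegral_conv_kernel (fun z => `|th z|))// -/C ler_wpM2l//.
  by under eq_Rintegral do rewrite real_normK ?num_real//.
apply: (@le_trans _ _ (\int[mu]_x (C * \int[mu]_y (`|th (al *: x + (be *: y + ga))| * g y ^+ 2)))).
  apply: le_Rintegral => //.
    exact: (bfin_integrable (bfinM bc bc)).
  exact: integrableZ_real (bfin_integrable bk3).
rewrite RintegralZl//; last exact: bfin_integrable bk3.
rewrite -mulrA ler_wpM2l// (bfin2_Fubini bk2)/= /ip -RintegralZl//; last first.
  exact: Bb_integrable (BbM bg bg).
rewrite le_eqVlt; apply/orP; left; apply/eqP; apply: eq_Rintegral => y _.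
have i1 := @integrable_conv_kernel (fun z => `|th z|) al ga y be al0 bth'.
rewrite RintegralZr//; last first.
  by move: i1; congr (_.-integrable _ _); apply/funext => x /=; rewrite addrCA.
rewrite -expr2; congr (_ * _).
rewrite -[RHS](@Rintegral_conv_kernel (fun z => `|th z|) al ga y be al0 bth').
by apply: eq_Rintegral => x _; rewrite addrCA.
Qed.

Lemma bounded_indic_Bb (D : set V) r : 0 <= r -> measurable D -> D `<=` cube r ->
  Bb (\1_D : V -> R).
Proof.
move=> r0 mD Dr; split.
- exact: measurable_indic.
- by exists 1 => x; rewrite indicE; case: (_ \in _); rewrite ?normr1 ?normr0.
- exists r => x rx; rewrite indicE memNset// => /Dr /(cubeP _ r0).
  by rewrite leNgt rx.
Qed.

(** The Hilbert-Schmidt bound: Cauchy-Schwarz against the square of the kernel cut to [D]. In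
    contrast with the Schur test it carries no power of [|be|^-1], so it survives as [t] tends to
    one, where [be] tends to zero; the price is the volume of [D]. *)
Lemma conv_L2_HS th al be ga g (D : set V) : al != 0 -> be != 0 -> Bb th -> Bb g ->
  measurable D -> Bb (\1_D : V -> R) -> (forall x, ~ D x -> g x = 0) ->
  ip (conv th al be ga g) (conv th al be ga g) <=
  `|al|^-1 ^+ n * (\int[mu]_z th z ^+ 2) * vol D * ip g g.
Proof.
move=> al0 be0 bth bg mD bD gD.
have bth2 : Bb (fun y => th y ^+ 2) by exact: (BbM bth bth).
have bg2 : Bb (fun y => g y ^+ 2) by exact: (BbM bg bg).
have bk := bfin2_kernel be ga al0 bth bg.
have bk2 := bfin2_kernel be ga al0 bth2 bD.
have bc : bfin mu (conv th al be ga g) by exact: (bfin2_integral1 bk).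
have bk3 := bfin2_integral1 bk2.
have gg0 : 0 <= ip g g by apply: Rintegral_ge0 => y _; rewrite -expr2 sqr_ge0.
have ptw x : conv th al be ga g x * conv th al be ga g x <=
    ip g g * \int[mu]_y (th (al *: x + (be *: y + ga)) ^+ 2 * \1_D y).
  rewrite -expr2.
  have D2 y : \1_D y ^+ 2 = \1_D y :> R by rewrite indicE; case: (_ \in _); rewrite ?expr1n ?expr0n.
  have -> : conv th al be ga g x = \int[mu]_y ((th (al *: x + (be *: y + ga)) * \1_D y) * g y).
    apply: eq_Rintegral => y _; rewrite indicE; have [Dy|Dy] := pselect (D y).
      by rewrite mem_set// mulr1.
    by rewrite memNset// mulr0 mul0r gD// mulr0.
  rewrite mulrC; apply: (le_trans (Cauchy_Schwarz _ _ _)).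
  - have := bfin_integrable (bfin2_section1 x bk2).
    by congr (_.-integrable _ _); apply/funext => y /=; rewrite exprMn D2.
  - have := bfin_integrable (bfin2_section1 x bk).
    congr (_.-integrable _ _); apply/funext => y /=; rewrite indicE; have [Dy|Dy] := pselect (D y).
      by rewrite mem_set// mulr1.
    by rewrite memNset// mulr0 mul0r gD// mulr0.
  - exact: Bb_integrable bg2.
  by under eq_Rintegral do rewrite exprMn D2.
apply: (@le_trans _ _ (\int[mu]_x (ip g g * \int[mu]_y (th (al *: x + (be *: y + ga)) ^+ 2 * \1_D y)))).
  apply: le_Rintegral => //.
    exact: (bfin_integrable (bfinM bc bc)).
  exact: integrableZ_real (bfin_integrable bk3).
rewrite RintegralZl//; last exact: bfin_integrable bk3.
rewrite [leRHS]mulrC ler_wpM2l// (bfin2_Fubini bk2)/=.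
rewrite le_eqVlt; apply/orP; left; apply/eqP.
have i1 y := @integrable_conv_kernel (fun z => th z ^+ 2) al ga y be al0 bth2.
transitivity (\int[mu]_y (`|al|^-1 ^+ n * (\int[mu]_z th z ^+ 2) * \1_D y)).
  apply: eq_Rintegral => y _; rewrite RintegralZr//; last first.
    by move: (i1 y); congr (_.-integrable _ _); apply/funext => x /=; rewrite addrCA.
  congr (_ * _); rewrite -[RHS](@Rintegral_conv_kernel (fun z => th z ^+ 2) al ga y be al0 bth2).
  by apply: eq_Rintegral => x _; rewrite addrCA.
rewrite RintegralZl//; last exact: Bb_integrable bD.
by congr (_ * _); rewrite /Rintegral integral_indic// setIT.
Qed.

End conv.

(** * Almost orthogonality *)

Section cotlar_stein.
Variables (R : realType) (E : lmodType R) (P : E -> Prop) (ip : E -> E -> R).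
Hypothesis P0 : P 0.
Hypothesis PD : forall f g, P f -> P g -> P (f + g).
Hypothesis ipDl : forall f g h, P f -> P g -> P h -> ip (f + g) h = ip f h + ip g h.
Hypothesis ipC : forall f g, ip f g = ip g f.
Hypothesis ip_ge0 : forall f, P f -> 0 <= ip f f.
Hypothesis ip_CS : forall f g, P f -> P g -> ip f g ^+ 2 <= ip f f * ip g g.

Let nrm f := Num.sqrt (ip f f).

Let nrm_ge0 f : 0 <= nrm f. Proof. exact: sqrtr_ge0. Qed.

Let nrm2 f : P f -> nrm f ^+ 2 = ip f f.
Proof. by move=> Pf; rewrite sqr_sqrtr// ip_ge0. Qed.

Let ip_le_nrm f g : P f -> P g -> ip f g <= nrm f * nrm g.
Proof.
move=> Pf Pg; apply: (le_trans (ler_norm _)).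
rewrite -(@ler_pXn2r _ 2)// ?nnegrE ?mulr_ge0//.
by rewrite exprMn !nrm2// real_normK ?num_real// ip_CS.
Qed.

Let nrmD f g : P f -> P g -> nrm (f + g) <= nrm f + nrm g.
Proof.
move=> Pf Pg; rewrite -(@ler_pXn2r _ 2)// ?nnegrE ?addr_ge0//.
rewrite nrm2; last exact: PD.
rewrite ipDl//; last exact: PD.
rewrite ![ip _ (f + g)]ipC !ipDl// sqrrD !nrm2// [ip g f]ipC.
have := ip_le_nrm Pf Pg; lra.
Qed.

Let ip0 f : P f -> ip 0 f = 0.
Proof. by move=> Pf; have := ipDl P0 P0 Pf; rewrite addr0 => H; lra. Qed.

Let P_sum (I : Type) (r : seq I) (F : I -> E) : (forall i, P (F i)) -> P (\sum_(i <- r) F i).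
Proof. by move=> PF; elim/big_ind : _. Qed.

Let nrm_sum (I : Type) (r : seq I) (F : I -> E) : (forall i, P (F i)) ->
  nrm (\sum_(i <- r) F i) <= \sum_(i <- r) nrm (F i).
Proof.
move=> PF; elim: r => [|i r IH].
  by rewrite !big_nil /nrm ip0// sqrtr0.
rewrite !big_cons; apply: (le_trans (nrmD (PF i) (P_sum r PF))).
by rewrite lerD2l.
Qed.

Variables (N : nat) (T Ts : 'I_N -> E -> E).
Hypothesis PT : forall j f, P f -> P (T j f).
Hypothesis PTs : forall j f, P f -> P (Ts j f).
Hypothesis TD : forall j f g, P f -> P g -> T j (f + g) = T j f + T j g.
Hypothesis TsD : forall j f g, P f -> P g -> Ts j (f + g) = Ts j f + Ts j g.
Hypothesis adj : forall j f g, P f -> P g -> ip (T j f) g = ip f (Ts j g).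

Let S f := \sum_(j < N) T j f.
Let Ss f := \sum_(j < N) Ts j f.

Let PS f : P f -> P (S f). Proof. by move=> Pf; apply: P_sum => j; exact: PT. Qed.
Let PSs f : P f -> P (Ss f). Proof. by move=> Pf; apply: P_sum => j; exact: PTs. Qed.

Let additive0 (U : E -> E) : (forall f g, P f -> P g -> U (f + g) = U f + U g) -> U 0 = 0.
Proof. by move=> UD; have := UD _ _ P0 P0; rewrite addr0 => /eqP; rewrite -subr_eq subrr => /eqP. Qed.

Let additive_sum (U : E -> E) (I : Type) (r : seq I) (F : I -> E) :
  (forall f g, P f -> P g -> U (f + g) = U f + U g) -> (forall i, P (F i)) ->
  U (\sum_(i <- r) F i) = \sum_(i <- r) U (F i).
Proof.
move=> UD PF; elim: r => [|i r IH]; first by rewrite !big_nil additive0.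
rewrite !big_cons UD//; first by rewrite IH.
exact: P_sum.
Qed.

Let ip_suml (I : Type) (r : seq I) (F : I -> E) g : (forall i, P (F i)) -> P g ->
  ip (\sum_(i <- r) F i) g = \sum_(i <- r) ip (F i) g.
Proof.
move=> PF Pg; elim: r => [|i r IH]; first by rewrite !big_nil ip0.
rewrite !big_cons ipDl//; first by rewrite IH.
exact: P_sum.
Qed.

Let adjS f g : P f -> P g -> ip (S f) g = ip f (Ss g).
Proof.
move=> Pf Pg; rewrite /S /Ss ip_suml//; last by move=> j; exact: PT.
rewrite [RHS]ipC ip_suml//; last by move=> j; exact: PTs.
by apply: eq_bigr => j _; rewrite adj// ipC.
Qed.

(** The terms in the expansion of a power of [Ss S]: the letters select operators [Ts j] and [T j]
    in turn, and [b] tells whether an adjoint stands outermost. *)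
Fixpoint alternating (b : bool) (w : seq 'I_N) (f : E) : E :=
  if w is j :: w' then (if b then Ts j else T j) (alternating (~~ b) w' f) else f.

Fixpoint alternatingS (b : bool) (k : nat) (f : E) : E :=
  if k is k'.+1 then (if b then Ss else S) (alternatingS (~~ b) k' f) else f.

Fixpoint words (k : nat) : seq (seq 'I_N) :=
  if k is k'.+1 then [seq j :: w | j <- index_enum 'I_N, w <- words k'] else [:: [::]].

Let P_alt b w f : P f -> P (alternating b w f).
Proof.
move=> Pf; elim: w b => //= j w IH b.
by case: b; [apply: PTs|apply: PT]; exact: IH.
Qed.

Let P_altS b k f : P f -> P (alternatingS b k f).
Proof.
move=> Pf; elim: k b => //= k IH b.
by case: b; [apply: PSs|apply: PS]; exact: IH.
Qed.

Let altS_words b k f : P f -> alternatingS b k f = \sum_(w <- words k) alternating b w f.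
Proof.
move=> Pf; elim: k b => [|k IH] b /=; first by rewrite big_seq1.
rewrite big_allpairs_dep/= IH.
case: b; rewrite /Ss /S; apply: eq_bigr => j _.
  by rewrite additive_sum// => [|w]; [exact: TsD|exact: P_alt].
by rewrite additive_sum// => [|w]; [exact: TD|exact: P_alt].
Qed.

Variables (c K : R) (ka : 'I_N -> 'I_N -> R).
Hypothesis c0 : 0 < c.
Hypothesis K0 : 0 < K.
Hypothesis ka0 : forall i j, 0 <= ka i j.
Hypothesis kaK : forall i, \sum_j ka i j <= K.
Hypothesis Tc : forall j f, P f -> ip (T j f) (T j f) <= c ^+ 2 * ip f f.
Hypothesis Tsc : forall j f, P f -> ip (Ts j f) (Ts j f) <= c ^+ 2 * ip f f.
Hypothesis TsT : forall i j f, P f ->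
  ip (Ts i (T j f)) (Ts i (T j f)) <= (ka i j ^+ 2) ^+ 2 * ip f f.
Hypothesis TTs : forall i j f, P f ->
  ip (T i (Ts j f)) (T i (Ts j f)) <= (ka i j ^+ 2) ^+ 2 * ip f f.

Let nrm_bound f g (r : R) : P f -> P g -> 0 <= r -> ip f f <= r ^+ 2 * ip g g -> nrm f <= r * nrm g.
Proof.
move=> Pf Pg r0 H; rewrite -(@ler_pXn2r _ 2)// ?nnegrE ?mulr_ge0//.
by rewrite exprMn !nrm2.
Qed.

(** The bound from grouping the operators two by two from the left, a last single one costing [c].
    Grouping from the second letter on gives another bound; the geometric mean of both sees every
    pair of neighbours once, which is [path_bound] up to [c]. *)
Fixpoint pair_bound (w : seq 'I_N) : R :=
  match w with
  | [::] => 1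
  | [:: j] => c
  | j :: (k :: w' as _) => ka j k ^+ 2 * pair_bound w'
  end.

Fixpoint path_bound (j : 'I_N) (w : seq 'I_N) : R :=
  if w is k :: w' then ka j k * path_bound k w' else 1.

Let path_bound_ge0 j w : 0 <= path_bound j w.
Proof. by elim: w j => //= k w IH j; rewrite mulr_ge0. Qed.

Let pair_bound_ge0 w : 0 <= pair_bound w.
Proof.
have [m wm] := ubnP (size w); elim: m w wm => // m IH [|j [|k w]] //= wm.
  exact: ltW.
by rewrite mulr_ge0 ?sqr_ge0// IH// -ltnS ltnW.
Qed.

Let alt_pair b w f : P f -> nrm (alternating b w f) <= pair_bound w * nrm f.
Proof.
move=> Pf; have [m wm] := ubnP (size w); elim: m w wm => // m IH [|j [|k w]] wm.
- by rewrite mul1r.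
- by clear IH; case: b => /=; apply: nrm_bound => //; [exact: PTs|exact: ltW|exact: Tsc|exact: PT|exact: ltW|exact: Tc].
- have Pw := P_alt b w Pf.
  have IHw : nrm (alternating b w f) <= pair_bound w * nrm f.
    by apply: IH; rewrite /= in wm; rewrite -ltnS ltnW.
  apply: (@le_trans _ _ (ka j k ^+ 2 * nrm (alternating b w f))).
    rewrite /= negbK; case: (b) Pw => Pw; apply: nrm_bound => //.
    + by apply: PTs; exact: PT.
    + exact: sqr_ge0.
    + exact: TsT.
    + by apply: PT; exact: PTs.
    + exact: sqr_ge0.
    + exact: TTs.
  by rewrite /= -mulrA ler_wpM2l// sqr_ge0.
Qed.

(** The pairs of [j :: w] together with those of [w] exhaust the pairs of neighbours, and exactly
    one of the two words has odd length and contributes [c]. *)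
Let pair_bound_path j w : pair_bound (j :: w) * pair_bound w = c * path_bound j w ^+ 2.
Proof.
elim: w j => [|k w IH] j; first by rewrite /= expr1n.
rewrite [path_bound _ _]/= exprMn mulrCA -IH.
have -> : pair_bound [:: j, k & w] = ka j k ^+ 2 * pair_bound w by [].
ring.
Qed.

Let alt_path b j w f : P f -> nrm (alternating b (j :: w) f) <= c * path_bound j w * nrm f.
Proof.
move=> Pf.
have H1 := alt_pair b (j :: w) Pf.
have H2 : nrm (alternating b (j :: w) f) <= c * pair_bound w * nrm f.
  apply: (@le_trans _ _ (c * nrm (alternating (~~ b) w f))).
    have Pw := P_alt (~~ b) w Pf.
    case: (b) Pw => Pw /=; apply: nrm_bound => //.
    + exact: PTs.
    + exact: ltW.
    + exact: Tsc.
    + exact: PT.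
    + exact: ltW.
    + exact: Tc.
  by rewrite -mulrA; exact: (ler_wpM2l (ltW c0) (alt_pair _ _ Pf)).
have pc : 0 <= c * path_bound j w * nrm f by rewrite !mulr_ge0// ltW.
rewrite -(@ler_pXn2r _ 2) ?nnegrE//.
rewrite [leLHS]expr2.
apply: (le_trans (ler_pM _ _ H1 H2)) => //.
rewrite le_eqVlt; apply/orP; left; apply/eqP.
transitivity (c * (pair_bound (j :: w) * pair_bound w) * nrm f ^+ 2); first ring.
by rewrite pair_bound_path; ring.
Qed.

Let sum_path k j : \sum_(w <- words k) path_bound j w <= K ^+ k.
Proof.
elim: k j => [|k IH] j /=; first by rewrite big_seq1.
rewrite big_allpairs_dep/=.
apply: (@le_trans _ _ (\sum_i ka j i * K ^+ k)).
  by apply: ler_sum => i _; rewrite -mulr_sumr ler_wpM2l.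
by rewrite -mulr_suml exprS ler_wpM2r// exprn_ge0// ltW.
Qed.

(** There are [N] choices for the first letter; each later letter, summed along a row of [ka],
    contributes a factor [K]. *)
Let altS_bound b k f : P f -> nrm (alternatingS b k.+1 f) <= c * N%:R * K ^+ k * nrm f.
Proof.
move=> Pf; rewrite altS_words//.
apply: (le_trans (nrm_sum _ _)); first by move=> w; exact: P_alt.
rewrite big_allpairs_dep/=.
apply: (@le_trans _ _ (\sum_(j < N) c * K ^+ k * nrm f)); last first.
  by rewrite sumr_const card_ord -[leLHS]mulr_natl; lra.
apply: ler_sum => j _.
apply: (@le_trans _ _ (\sum_(w <- words k) c * path_bound j w * nrm f)).
  by apply: ler_sum => w _; exact: alt_path.
by rewrite -mulr_suml -mulr_sumr ler_wpM2r// ler_wpM2l// ltW.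
Qed.

Let A m f := alternatingS true (m.*2) f.

Let PA m f : P f -> P (A m f). Proof. exact: P_altS. Qed.

Let altS_add m1 m2 f : A (m1 + m2) f = A m1 (A m2 f).
Proof. by elim: m1 => //= m1 IH; rewrite /A addSn doubleS /= -/(A _ _) IH. Qed.

Let A_sym m f g : P f -> P g -> ip (A m f) g = ip f (A m g).
Proof.
move=> Pf Pg; elim: m f g Pf Pg => // m IH f g Pf Pg.
have -> : A m.+1 f = Ss (S (A m f)) by [].
rewrite ipC -adjS//; [|by apply: PS; exact: PA].
rewrite ipC adjS//; [|exact: PA|exact: PS].
rewrite IH//; last by apply: PSs; exact: PS.
have -> : Ss (S g) = A 1 g by [].
by rewrite -altS_add addn1.
Qed.

(** The constant [B] is what [2^k]-th roots would remove in the limit. Instead, if [q = x / y]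
    exceeded one, Bernoulli's inequality would make the powers of [q] unbounded. *)
Lemma le_of_pow_le (x y B : R) : 0 <= x -> 0 < y ->
  (forall k, x ^+ (2 ^ k) <= B * y ^+ (2 ^ k)) -> x <= y.
Proof.
move=> x0 y0 H; rewrite leNgt; apply/negP => yx.
pose q := x / y; have q1 : 1 < q by rewrite ltr_pdivlMr ?mul1r.
have Hq k : q ^+ (2 ^ k) <= B.
  by rewrite expr_div_n ler_pdivrMr ?exprn_gt0.
have bern m : 1 + m%:R * (q - 1) <= q ^+ m.
  elim: m => [|m IH]; first by rewrite mul0r addr0.
  rewrite exprS; apply: (@le_trans _ _ (q * (1 + m%:R * (q - 1)))); last by rewrite ler_wpM2l// ltW// (lt_trans ltr01).
  have : 0 <= m%:R * (q - 1) * (q - 1) by rewrite mulr_ge0// ?mulr_ge0// subr_ge0 ltW.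
  by rewrite -natr1; nra.
pose m := Num.truncn (B / (q - 1)).
have Bm : B < m.+1%:R * (q - 1).
  by rewrite -ltr_pdivrMr ?subr_gt0// truncnS_gt.
have mk : m.+1%:R <= (2 ^ m.+1)%:R :> R by rewrite ler_nat ltnW// ltn_expl.
have H1 := bern (2 ^ m.+1)%N; have H2 := Hq m.+1.
have : m.+1%:R * (q - 1) <= (2 ^ m.+1)%:R * (q - 1) by rewrite ler_wpM2r// subr_ge0 ltW.
lra.
Qed.

(** [A m] is the [m]-th power of the symmetric operator [Ss S], so the square of the norm of [A m f]
    is at most the norm of [A m.*2 f] times that of [f]. Iterating compares [A 1 f] with high
    powers, for which the sum over words loses only a factor independent of the exponent. *)
Theorem Cotlar_Stein f : P f -> ip (S f) (S f) <= K ^+ 2 * ip f f.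
Proof.
move=> Pf.
have step m : nrm (A m f) ^+ 2 <= nrm (A m.*2 f) * nrm f.
  rewrite nrm2; last exact: PA.
  rewrite A_sym//; last exact: PA.
  rewrite -altS_add addnn ipC; apply: ip_le_nrm => //; exact: PA.
have dyadic k : nrm (A 1 f) ^+ (2 ^ k) * nrm f <= nrm (A (2 ^ k) f) * nrm f ^+ (2 ^ k).
  elim: k => [|k IH]; first by rewrite !expr1.
  have [->|f0] := eqVneq (nrm f) 0.
    by rewrite mulr0 mulr_ge0.
  have f0' : 0 < nrm f by rewrite lt_def f0 nrm_ge0.
  rewrite expnS mul2n -addnn !exprD.
  rewrite -(@ler_pM2r _ (nrm f))//.
  apply: (@le_trans _ _ ((nrm (A 1 f) ^+ (2 ^ k) * nrm f) ^+ 2)).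
    by rewrite le_eqVlt; apply/orP; left; apply/eqP; ring.
  apply: (@le_trans _ _ ((nrm (A (2 ^ k) f) * nrm f ^+ (2 ^ k)) ^+ 2)).
    by rewrite ler_pXn2r// ?nnegrE ?mulr_ge0 ?exprn_ge0.
  rewrite exprMn addnn; apply: (@le_trans _ _ (nrm (A (2 ^ k).*2 f) * nrm f * (nrm f ^+ (2 ^ k)) ^+ 2)).
    by rewrite ler_wpM2r// ?sqr_ge0.
  by rewrite le_eqVlt; apply/orP; left; apply/eqP; ring.
have main : nrm (A 1 f) <= K ^+ 2 * nrm f.
  have [f0|f0] := eqVneq (nrm f) 0.
    rewrite f0 mulr0; have := @altS_bound true 1 _ Pf.
    by rewrite f0 mulr0.
  have f0' : 0 < nrm f by rewrite lt_def f0 nrm_ge0.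
  (* [A (2 ^ k)] is a product of [2^(k+1)] sums, and the bound by words has [K] to one power less:
     hence the division by [K]. *)
  apply: (@le_of_pow_le _ _ (c * N%:R / K)) => //.
    by rewrite mulr_gt0// exprn_gt0.
  move=> k; rewrite -(@ler_pM2r _ (nrm f))//.
  apply: (le_trans (dyadic k)).
  have e2 : (0 < (2 ^ k).*2)%N by rewrite double_gt0 expn_gt0.
  have := @altS_bound true ((2 ^ k).*2.-1) _ Pf.
  rewrite prednK// => H.
  apply: (@le_trans _ _ (c * N%:R * K ^+ (2 ^ k).*2.-1 * nrm f * nrm f ^+ (2 ^ k))).
    by rewrite ler_wpM2r// exprn_ge0.
  rewrite exprMn -exprM mul2n.
  have -> : K ^+ (2 ^ k).*2 = K * K ^+ (2 ^ k).*2.-1 by rewrite -exprS prednK.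
  rewrite le_eqVlt; apply/orP; left; apply/eqP.
  by field; rewrite gt_eqF.
rewrite adjS//; last exact: PS.
have -> : Ss (S f) = A 1 f by [].
apply: (le_trans (ip_le_nrm Pf (PA 1 Pf))).
apply: (@le_trans _ _ (nrm f * (K ^+ 2 * nrm f))); first by rewrite ler_wpM2l.
by rewrite -(nrm2 Pf) mulrCA -expr2.
Qed.

End cotlar_stein.

(** * Minkowski's integral inequality *)

Section minkowski_weight.
Variables (d1 d2 : measure_display) (T1 : measurableType d1) (T2 : measurableType d2) (R : realType).
Variables (nu : {sigma_finite_measure set T1 -> \bar R}) (mu : {sigma_finite_measure set T2 -> \bar R}).

(** Cauchy-Schwarz in [t] with weight [m]: the squared integral of [F] is at most [∫ m] times
    [∫ F^2 / m], over [D]. After integration in [x] the slice bounds turn the second factor into [B]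
    times [∫ m] again. The positive bounds on [m] make [1 / m] bounded, so that Fubini applies. *)
Lemma Minkowski_weight (F : T1 * T2 -> R) (D : set T1) (m : T1 -> R) (m0 m1 B : R) :
  bfin2 nu mu F -> measurable D -> (nu D < +oo)%E ->
  (forall t x, ~ D t -> F (t, x) = 0) ->
  measurable_fun setT m -> 0 < m0 -> (forall t, m0 <= m t <= m1) -> 0 <= B ->
  (forall t, D t -> \int[mu]_x (F (t, x) ^+ 2) <= m t ^+ 2 * B) ->
  \int[mu]_x ((\int[nu]_t F (t, x)) ^+ 2) <= (\int[nu]_t (m t * \1_D t)) ^+ 2 * B.
Proof.
move=> bF mD D8 FD mm m00 mP B0 HB.
have mpos t : 0 < m t by have /andP[h _] := mP t; exact: lt_le_trans h.
have im : bfin nu (fun t => m t * \1_D t).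
  split; first by apply: measurable_funM => //; exact: measurable_indic.
  exists m1, D; split => //; first by rewrite (le_trans (ltW (mpos point)))//; have /andP[] := mP point.
  move=> t; rewrite normrM [`|\1_D t|]ger0_norm// ler_wpM2r//.
  by rewrite gtr0_norm//; have /andP[] := mP t.
have [mF [M [D1 [E [[mD1 mE] D18 E8 M0 FM]]]]] := bF.
have bG : bfin2 nu mu (fun z => (m z.1)^-1 * (F z * F z)).
  split.
    apply: measurable_funM; last exact: measurable_funM.
    apply: (measurableT_comp (f := fun t => (m t)^-1)) => //.
    have -> : (fun t => (m t)^-1) = (fun t => m t `^ (-1)).
      by apply/funext => t; rewrite powR_inv1// ltW.
    exact: (measurableT_comp (f := fun z : R => z `^ (-1))).
  exists (m0^-1 * (M * M)), D1, E; split => //.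
    by rewrite !mulr_ge0// invr_ge0 ltW.
  move=> t x; rewrite !normrM.
  have -> : m0^-1 * (M * M) * (\1_D1 t * \1_E x) = m0^-1 * ((M * (\1_D1 t * \1_E x)) * (M * (\1_D1 t * \1_E x))).
    by rewrite !indicE; case: (_ \in D1); case: (_ \in E); rewrite ?mulr0 ?mulr1 ?mul0r ?mulr0.
  rewrite ler_pM ?mulr_ge0//; last by rewrite ler_pM.
  rewrite gtr0_norm ?invr_gt0// lef_pV2 ?posrE//.
  by have /andP[] := mP t.
set I := \int[nu]_t (m t * \1_D t).
have I0 : 0 <= I by apply: Rintegral_ge0 => t _; rewrite mulr_ge0// ltW.
have FE t x : F (t, x) = (m t * \1_D t) * ((m t)^-1 * F (t, x)).
  rewrite indicE; have [Dt|Dt] := pselect (D t).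
    by rewrite mem_set// mulr1 mulVKf// gt_eqF.
  by rewrite FD// !mulr0.
have GE t x : (m t)^-1 * (F (t, x) * F (t, x)) = (m t * \1_D t) * ((m t)^-1 * F (t, x)) ^+ 2.
  by rewrite {1}FE; ring.
have ptw x : (\int[nu]_t F (t, x)) ^+ 2 <= I * \int[nu]_t ((m t)^-1 * (F (t, x) * F (t, x))).
  have -> : \int[nu]_t F (t, x) = \int[nu]_t ((m t * \1_D t) * ((m t)^-1 * F (t, x))).
    by apply: eq_Rintegral => t _; exact: FE.
  apply: (le_trans (Cauchy_Schwarz_weight _ _ _ _)).
  - by move=> t; rewrite mulr_ge0// ltW.
  - exact: bfin_integrable.
  - have := bfin_integrable (bfin2_section2 x bF).
    by congr (_.-integrable _ _); apply/funext => t /=; rewrite -FE.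
  - have := bfin_integrable (bfin2_section2 x bG).
    by congr (_.-integrable _ _); apply/funext => t /=; rewrite -GE.
  rewrite -/I le_eqVlt; apply/orP; left; apply/eqP; congr (_ * _).
  by apply: eq_Rintegral => t _; rewrite GE.
have bG' : bfin2 mu nu (fun z => (m z.2)^-1 * (F (z.2, z.1) * F (z.2, z.1))).
  have [mG [M' [D' [E' [[mD' mE'] D8' E8' M0' GM']]]]] := bG.
  split; first exact: (measurableT_comp mG (measurable_swap (T1 := T2) (T2 := T1))).
  by exists M', E', D'; split => // x t; rewrite [_ * \1_D' t]mulrC GM'.
have bF' : bfin2 mu nu (fun z => F (z.2, z.1)).
  split; first exact: (measurableT_comp mF (measurable_swap (T1 := T2) (T2 := T1))).
  by exists M, E, D1; split => // x t; rewrite [_ * \1_D1 t]mulrC FM.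
have iF := bfin2_integral1 bF'; have iG := bfin2_integral1 bG'.
apply: (@le_trans _ _ (\int[mu]_x (I * \int[nu]_t ((m t)^-1 * (F (t, x) * F (t, x)))))).
  apply: le_Rintegral => //.
  - exact: (bfin_integrable (bfinM iF iF)).
  - exact: (integrableZ_real _ (bfin_integrable iG)).
rewrite RintegralZl//; last exact: bfin_integrable iG.
rewrite -(bfin2_Fubini bG) expr2 -mulrA ler_wpM2l//=.
rewrite mulrC -RintegralZl//; last exact: bfin_integrable.
apply: le_Rintegral => //.
- exact: (bfin_integrable (bfin2_integral1 bG)).
- exact: (integrableZ_real _ (bfin_integrable im)).
move=> t _; have [Dt|Dt] := pselect (D t); last first.
  rewrite indicE memNset// !mulr0.
  have -> : \int[mu]_x ((m t)^-1 * (F (t, x) * F (t, x))) = \int[mu]_x 0.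
    by apply: eq_Rintegral => x _; rewrite FD// mul0r mulr0.
  by rewrite Rintegral_cst// mul0r.
rewrite indicE mem_set// mulr1 RintegralZl//; last first.
  have bs := bfin2_section1 t bF; exact: (bfin_integrable (bfinM bs bs)).
rewrite mulrC ler_pdivrMr//.
apply: (le_trans (HB t Dt)); rewrite expr2; lra.
Qed.

End minkowski_weight.

(** * Inner product and compositions of dilated convolutions *)

Section rV_lmod.
Variables (R : realType) (n : nat).
Local Notation V := 'rV[R]_n.
Local Notation mu := (lebesgue_rV R n).
Implicit Types (f g h th : V -> R) (al be : R) (ga : V).

Lemma ipDl f g h : Bb f -> Bb g -> Bb h -> ip (f + g) h = ip f h + ip g h.
Proof.
move=> bf bg bh; rewrite /ip -RintegralD//; last 2 first.
- exact: Bb_integrable (BbM bf bh).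
- exact: Bb_integrable (BbM bg bh).
by apply: eq_Rintegral => x _; rewrite -mulrDl.
Qed.

Lemma ipC f g : ip f g = ip g f.
Proof. by apply: eq_Rintegral => x _; rewrite mulrC. Qed.

Lemma ip_ge0 f : 0 <= ip f f.
Proof. by apply: Rintegral_ge0 => x _; rewrite -expr2 sqr_ge0. Qed.

Lemma ip_CS f g : Bb f -> Bb g -> ip f g ^+ 2 <= ip f f * ip g g.
Proof.
move=> bf bg; apply: (le_trans (Cauchy_Schwarz _ _ _)).
- exact: Bb_integrable (BbM bf bf).
- exact: Bb_integrable (BbM bf bg).
- exact: Bb_integrable (BbM bg bg).
by [].
Qed.

Lemma ipZ (r : R) f : Bb f -> ip (fun x => r * f x) (fun x => r * f x) = r ^+ 2 * ip f f.
Proof.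
move=> bf; rewrite /ip -RintegralZl//; last exact: Bb_integrable (BbM bf bf).
by apply: eq_Rintegral => x _; ring.
Qed.

Lemma Bb0 : Bb (0 : V -> R).
Proof.
split; [exact: measurable_cst|by exists 0 => x; rewrite normr0|by exists 0].
Qed.

Lemma convD th al be ga f g : Cc th -> Bb f -> Bb g ->
  conv th al be ga (f + g) = conv th al be ga f + conv th al be ga g.
Proof.
move=> cth bf bg; apply/funext => x; rewrite /conv fctE.
have H h : Bb h -> mu.-integrable setT (EFin \o (fun y => th (al *: x + (be *: y + ga)) * h y)).
  move=> bh; apply: (@integrable_param _ _ _ _ _ (fun=> al)) => //.
    exact: measurable_fun_rV_affine.
  exact: Bb_integrable.
rewrite -[RHS]/(\int[mu]_y _ + \int[mu]_y _).
rewrite -RintegralD//; try exact: H.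
by apply: eq_Rintegral => y _; rewrite -mulrDr.
Qed.

Lemma convZ th al be ga (r : R) f : Cc th -> Bb f ->
  conv th al be ga (fun x => r * f x) = (fun x => r * conv th al be ga f x).
Proof.
move=> cth bf; apply/funext => x; rewrite /conv -RintegralZl//.
  by apply: eq_Rintegral => y _; rewrite mulrCA.
apply: (@integrable_param _ _ _ _ _ (fun=> al)) => //.
  exact: measurable_fun_rV_affine.
exact: Bb_integrable.
Qed.

(** Integration by parts moves the derivative of the outer kernel onto the inner convolution, where
    it costs [al2]. The factor [al2 / be1] is a gain when the inner scale is the coarser one. *)
Lemma conv_conv_coarse th1 th2 i al1 be1 ga1 al2 be2 ga2 h :
  Cc th1 -> Cc th2 -> Bb h -> be1 != 0 -> al2 != 0 ->
  conv (partial i th1) al1 be1 ga1 (conv (partial i th2) al2 be2 ga2 h) =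
  (fun x => - (al2 / be1) * conv th1 al1 be1 ga1 (conv (partial i (partial i th2)) al2 be2 ga2 h) x).
Proof.
move=> c1 c2 bh b0 a0.
have c2' := Cc_partial i c2.
rewrite conv_partial_ibp//; last exact: conv_smooth.
rewrite conv_partial// convZ//; last first.
  by apply: conv_Bb => //; exact: Cc_partial.
by apply/funext => x; ring.
Qed.

(** The opposite move: the derivative of the inner kernel comes out as a derivative in [x] divided
    by [al2], and passes to the outer kernel at the cost [be1]. For scales far apart, this factor or
    the reciprocal one of the coarse case is small. *)
Lemma conv_conv_fine th1 th2 i al1 be1 ga1 al2 be2 ga2 h :
  Cc th1 -> Cc th2 -> Bb h -> be1 != 0 -> al2 != 0 ->
  conv (partial i th1) al1 be1 ga1 (conv (partial i th2) al2 be2 ga2 h) =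
  (fun x => - (be1 / al2) * conv (partial i (partial i th1)) al1 be1 ga1 (conv th2 al2 be2 ga2 h) x).
Proof.
move=> c1 c2 bh b0 a0.
have c1' := Cc_partial i c1.
rewrite (@conv_partial_ibp _ _ (partial i th1))//; last exact: conv_smooth.
rewrite conv_partial//  convZ//; last first.
  by apply: conv_Bb => //; exact: Cc_partial.
by apply/funext => x; field; rewrite a0 b0.
Qed.

End rV_lmod.

(** * Almost orthogonality of the dyadic pieces *)

Section dyadic_orthogonality.
Variables (R : realType) (n : nat).
Local Notation V := 'rV[R]_n.
Local Notation mu := (lebesgue_rV R n).
Implicit Types (f g h th : V -> R) (al be : R) (ga : V).

Definition L1 th := \int[mu]_z `|th z|.

Lemma L1_ge0 th : 0 <= L1 th. Proof. exact: Rintegral_ge0. Qed.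

(** With this normalisation the Schur bound depends on [|al| |be| tau^2] only. At time [t], with
    [tau = rho t], this number is [1 - t]: it is free of [rho], and at least [1/2] for small
    times. *)
Definition nconv th (tau al be : R) ga g : V -> R :=
  fun x => tau^-1 ^+ n * conv th al be ga g x.

Lemma nconv_bound th (tau lam al be : R) ga g : 0 < tau -> 0 < lam ->
  `|al| * `|be| = lam / tau ^+ 2 -> Cc th -> Bb g ->
  ip (nconv th tau al be ga g) (nconv th tau al be ga g) <=
  lam^-1 ^+ n * L1 th ^+ 2 * ip g g.
Proof.
move=> t0 l0 E cth bg.
have alb : `|al| * `|be| != 0 by rewrite E gt_eqF// divr_gt0// exprn_gt0.
have al0 : al != 0 by apply: contra_neq alb => ->; rewrite normr0 mul0r.
have be0 : be != 0 by apply: contra_neq alb => ->; rewrite normr0 mulr0.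
rewrite /nconv ipZ; last exact: conv_Bb.
apply: (@le_trans _ _ ((tau^-1 ^+ n) ^+ 2 * ((`|be|^-1 ^+ n * L1 th) * (`|al|^-1 ^+ n * L1 th) * ip g g))).
  by rewrite ler_wpM2l ?sqr_ge0// conv_L2_Schur//; exact: Cc_Bb.
rewrite le_eqVlt; apply/orP; left; apply/eqP.
have -> : lam^-1 = tau^-1 ^+ 2 * (`|be|^-1 * `|al|^-1).
  rewrite -invfM [`|be| * _]mulrC E; field.
  by rewrite !gt_eqF.
have -> : (tau^-1 ^+ 2 * (`|be|^-1 * `|al|^-1)) ^+ n =
    (tau^-1 ^+ n) ^+ 2 * (`|be|^-1 ^+ n * `|al|^-1 ^+ n).
  move: (tau^-1) (`|be|^-1) (`|al|^-1) => a b c.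
  by rewrite !exprMn; congr (_ * _); rewrite -!exprM mulnC.
by ring.
Qed.

Lemma nconv_Bb th tau al be ga g : al != 0 -> Cc th -> Bb g -> Bb (nconv th tau al be ga g).
Proof. by move=> al0 cth bg; apply: BbZ; exact: conv_Bb. Qed.

Lemma nconvZ th tau al be ga (r : R) g : Cc th -> Bb g ->
  nconv th tau al be ga (fun x => r * g x) = (fun x => r * nconv th tau al be ga g x).
Proof. by move=> cth bg; apply/funext => x; rewrite /nconv convZ// mulrCA. Qed.

(** The disjunction leaves the choice between the two integrations by parts. The factor [2 ^+ n]
    comes from [lam1] and [lam2] being at least [1/2]. *)
Lemma nconv_pair_bound th i (tau1 lam1 al1 be1 tau2 lam2 al2 be2 : R) ga1 ga2 h (q : R) :
  0 < tau1 -> 2^-1 <= lam1 -> `|al1| * `|be1| = lam1 / tau1 ^+ 2 ->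
  0 < tau2 -> 2^-1 <= lam2 -> `|al2| * `|be2| = lam2 / tau2 ^+ 2 ->
  Cc th -> Bb h -> `|al2 / be1| <= q \/ `|be1 / al2| <= q ->
  forall F, F = nconv (partial i th) tau1 al1 be1 ga1 (nconv (partial i th) tau2 al2 be2 ga2 h) ->
  ip F F <= (q * (2 ^+ n * L1 th * L1 (partial i (partial i th)))) ^+ 2 * ip h h.
Proof.
move=> t1 l1 E1 t2 l2 E2 cth bh qP.
have l1' : 0 < lam1 by apply: lt_le_trans l1; rewrite invr_gt0.
have l2' : 0 < lam2 by apply: lt_le_trans l2; rewrite invr_gt0.
have nz (al be lam tau : R) : 0 < lam -> 0 < tau -> `|al| * `|be| = lam / tau ^+ 2 ->
    al != 0 /\ be != 0.
  move=> lam0 tau0 E; have alb : `|al| * `|be| != 0 by rewrite E gt_eqF// divr_gt0// exprn_gt0.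
  by split; apply: contra_neq alb => ->; rewrite normr0 ?mul0r ?mulr0.
have [a10 b10] := nz _ _ _ _ l1' t1 E1.
have [a20 b20] := nz _ _ _ _ l2' t2 E2.
have c1 := Cc_partial i cth; have c2 := Cc_partial i c1.
have li (lam : R) : 2^-1 <= lam -> lam^-1 ^+ n <= 2 ^+ n.
  move=> lam2'; have lam0 : 0 < lam by apply: lt_le_trans lam2'; rewrite invr_gt0.
  rewrite lerXn2r// ?nnegrE ?invr_ge0 ?(ltW lam0)//.
  by rewrite invf_ple ?posrE.
have two thA thB (r : R) : Cc thA -> Cc thB -> `|r| <= q ->
   ip (fun x => r * nconv thA tau1 al1 be1 ga1 (nconv thB tau2 al2 be2 ga2 h) x)
      (fun x => r * nconv thA tau1 al1 be1 ga1 (nconv thB tau2 al2 be2 ga2 h) x) <=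
   (q * (2 ^+ n * L1 thA * L1 thB)) ^+ 2 * ip h h.
  move=> cA cB rq.
  have bB : Bb (nconv thB tau2 al2 be2 ga2 h) by exact: nconv_Bb.
  rewrite ipZ; last exact: nconv_Bb.
  apply: (@le_trans _ _ (r ^+ 2 * (lam1^-1 ^+ n * L1 thA ^+ 2 * (lam2^-1 ^+ n * L1 thB ^+ 2 * ip h h)))).
    rewrite ler_wpM2l ?sqr_ge0//.
    apply: (le_trans (nconv_bound ga1 t1 l1' E1 cA bB)).
    rewrite ler_wpM2l//.
      by rewrite mulr_ge0 ?sqr_ge0// exprn_ge0// invr_ge0 ltW.
    exact: nconv_bound.
  have -> : r ^+ 2 * (lam1^-1 ^+ n * L1 thA ^+ 2 * (lam2^-1 ^+ n * L1 thB ^+ 2 * ip h h)) =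
     r ^+ 2 * (lam1^-1 ^+ n * lam2^-1 ^+ n) * (L1 thA ^+ 2 * L1 thB ^+ 2 * ip h h) by ring.
  have -> : (q * (2 ^+ n * L1 thA * L1 thB)) ^+ 2 * ip h h =
     q ^+ 2 * (2 ^+ n * 2 ^+ n) * (L1 thA ^+ 2 * L1 thB ^+ 2 * ip h h) by ring.
  have X0 : 0 <= L1 thA ^+ 2 * L1 thB ^+ 2 * ip h h by rewrite !mulr_ge0 ?L1_ge0 ?ip_ge0.
  have n1 : 0 <= lam1^-1 ^+ n by rewrite exprn_ge0// invr_ge0 ltW.
  have n2 : 0 <= lam2^-1 ^+ n by rewrite exprn_ge0// invr_ge0 ltW.
  apply: (ler_wpM2r X0); apply: ler_pM; rewrite ?sqr_ge0 ?mulr_ge0//.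
    by rewrite -real_normK ?num_real// lerXn2r// ?nnegrE// (le_trans _ rq).
  by apply: ler_pM => //; exact: li.
move=> F FE0.
have FE : F = (fun x => tau1^-1 ^+ n * (tau2^-1 ^+ n *
    conv (partial i th) al1 be1 ga1 (conv (partial i th) al2 be2 ga2 h) x)).
  apply/funext => x; rewrite FE0 /nconv convZ//.
  exact: conv_Bb.
case: qP => qP.
  have -> : F = (fun x => - (al2 / be1) * nconv th tau1 al1 be1 ga1 (nconv (partial i (partial i th)) tau2 al2 be2 ga2 h) x).
    rewrite FE conv_conv_coarse//; apply/funext => x; rewrite /nconv convZ//.
      by ring.
    exact: conv_Bb.
  by apply: two => //; rewrite normrN.
have -> : F = (fun x => - (be1 / al2) * nconv (partial i (partial i th)) tau1 al1 be1 ga1 (nconv th tau2 al2 be2 ga2 h) x).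
  rewrite FE conv_conv_fine//; apply/funext => x; rewrite /nconv convZ//.
    by ring.
  exact: conv_Bb.
rewrite [2 ^+ n * _ * _]mulrAC.
by apply: two => //; rewrite normrN.
Qed.

(** With truncated subtraction the exponent is the distance of [i] and [k]; on either side of [i] a
    geometric series is at most [4]. *)
Lemma geometric_dist_sum (N : nat) (i : 'I_N) :
  \sum_(k < N) (3 / 4 : R) ^+ ((i - k) + (k - i))%N <= 8.
Proof.
have r0 : (0 : R) <= 3 / 4 by lra.
have geo m : \sum_(0 <= k < m) (3 / 4 : R) ^+ k <= 4.
  have -> : \sum_(0 <= k < m) (3 / 4 : R) ^+ k = 4 * (1 - (3 / 4) ^+ m).
    elim: m => [|m IH]; first by rewrite big_nil expr0 subrr mulr0.
    by rewrite big_nat_recr//= IH exprS; field.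
  have := exprn_ge0 m r0; lra.
rewrite -(big_mkord xpredT (fun k => (3 / 4 : R) ^+ ((i - k) + (k - i))%N)).
rewrite (@big_cat_nat _ _ _ i) //=; last exact: ltnW.
have -> : (8 : R) = 4 + 4 by lra.
apply: lerD.
  rewrite big_nat_rev /= add0n.
  apply: le_trans (_ : \sum_(0 <= k < i) (3 / 4) ^+ k.+1 <= _).
    rewrite big_nat [leRHS]big_nat; apply: ler_sum => k /andP[_ ki].
    rewrite le_eqVlt; apply/orP; left; apply/eqP; congr (_ ^+ _).
    by lia.
  apply: le_trans (geo i); apply: ler_sum => k _.
  rewrite exprS ler_piMl ?exprn_ge0//; lra.
rewrite -{1}(add0n i) big_addn.
apply: le_trans (geo (N - i)%N).
rewrite big_nat [leRHS]big_nat; apply: ler_sum => k /andP[_ ki].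
by rewrite addnK (_ : (i - (k + i) = 0)%N) //; lia.
Qed.

Variables (th : V -> R) (i : 'I_n).
Hypothesis cth : Cc th.
Variables (rho : R) (x0 : V).
Hypothesis rho0 : 0 < rho.

(* [x |-> (rho t)^-n ∫ p((x - (1-t) y - t x0) / (rho t)) g(y) dy], and below its adjoint *)
Definition fwd (t : R) (p : V -> R) g : V -> R :=
  nconv p (rho * t) (rho * t)^-1 (- ((1 - t) / (rho * t))) (- (t / (rho * t)) *: x0) g.

Definition bwd (t : R) (p : V -> R) g : V -> R :=
  nconv p (rho * t) (- ((1 - t) / (rho * t))) (rho * t)^-1 (- (t / (rho * t)) *: x0) g.

Definition cotlar_const : R := 2 * (2 ^+ n * L1 th * L1 (partial i (partial i th))) + 1.

(** The pieces at times [tau / 2^j] and [tau / 2^k] have scales in the ratio of these times, up to a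
    factor 2 from [1 - t], so their products decay like [2^-|j - k|]. The free coefficients [c j]
    are there to carry a weight in time. *)
Lemma dyadic_sum_bound (N : nat) (tau : R) (c : 'I_N -> R) g :
  0 < tau <= 2^-1 -> (forall j, `|c j| <= 1) -> Bb g ->
  forall F, F = (fun x => \sum_(j < N) c j * fwd (tau / 2 ^+ j) (partial i th) g x) ->
  ip F F <= 64 * cotlar_const * ip g g.
Proof.
move=> /andP[tau0 tau2] c1 bg.
pose t (j : 'I_N) : R := tau / 2 ^+ j.
have t0 j : 0 < t j by rewrite divr_gt0// exprn_gt0.
have t2 j : t j <= 2^-1.
  apply: le_trans tau2; rewrite ler_pdivrMr ?exprn_gt0// ler_peMr// ?(ltW tau0)//.
  by rewrite exprn_ege1// ler1n.
have lam2 j : 2^-1 <= 1 - t j by have := t2 j; lra.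
have lam0 j : 0 < 1 - t j by apply: lt_le_trans (lam2 j); rewrite invr_gt0.
have rt j : 0 < rho * t j by rewrite mulr_gt0.
have Ef j : `|(rho * t j)^-1| * `|- ((1 - t j) / (rho * t j))| = (1 - t j) / (rho * t j) ^+ 2.
  rewrite normrN !ger0_norm ?invr_ge0 ?divr_ge0 ?(ltW (rt j)) ?(ltW (lam0 j))//.
  by field; rewrite !gt_eqF.
have Eb j : `|- ((1 - t j) / (rho * t j))| * `|(rho * t j)^-1| = (1 - t j) / (rho * t j) ^+ 2.
  by rewrite mulrC Ef.
have cp := Cc_partial i cth.
have nzf j : (rho * t j)^-1 != 0 by rewrite invr_eq0 gt_eqF.
have nzb j : - ((1 - t j) / (rho * t j)) != 0 by rewrite oppr_eq0 mulf_neq0// gt_eqF.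
pose T j g : V -> R := fun x => c j * fwd (t j) (partial i th) g x.
pose Ts j g : V -> R := fun x => c j * bwd (t j) (partial i th) g x.
have A0 : 0 < cotlar_const.
  by rewrite ltr_wpDl// !mulr_ge0 ?exprn_ge0 ?L1_ge0.
(* The Cotlar-Stein hypotheses bound products by [ka ^+ 2], and [1/2 <= (3/4)^2]. A row of powers of
   [3/4] has sum at most 8, whose square is the constant [64]. *)
pose ka (j k : 'I_N) : R := Num.sqrt cotlar_const * (3 / 4) ^+ ((j - k) + (k - j))%N.
have fB j h : Bb h -> Bb (fwd (t j) (partial i th) h) by move=> bh; exact: nconv_Bb.
have bB j h : Bb h -> Bb (bwd (t j) (partial i th) h) by move=> bh; exact: nconv_Bb.
have csq j : c j ^+ 2 <= 1.
  by rewrite -real_normK ?num_real// expr_le1.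
have ratio j k : `|(t j) / (t k)| * 2 <= 2 * 2^-1 ^+ ((j - k) + (k - j))%N \/
                 `|(t k) / (t j)| * 2 <= 2 * 2^-1 ^+ ((j - k) + (k - j))%N.
  have H (a b : 'I_N) : (a <= b)%N -> `|(t b) / (t a)| * 2 <= 2 * 2^-1 ^+ (b - a)%N.
    move=> ab; rewrite ger0_norm; last by rewrite divr_ge0// ltW.
    have -> : t b / t a = 2^-1 ^+ (b - a)%N; last by rewrite mulrC.
    have bE : nat_of_ord b = ((b - a) + a)%N by rewrite subnK.
    rewrite /t {1}bE; move: (b - a)%N => m.
    by rewrite exprD exprVn; field; rewrite !expf_neq0 ?gt_eqF.
  case/orP: (leq_total j k) => jk; [right|left]; apply: (le_trans (H _ _ jk)).
    by rewrite (_ : (j - k = 0)%N) //; apply/eqP.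
  by rewrite (_ : (k - j = 0)%N) ?addn0 //; apply/eqP.
have kaE (j k : 'I_N) : (2 * 2^-1 ^+ ((j - k) + (k - j))%N * (2 ^+ n * L1 th * L1 (partial i (partial i th)))) ^+ 2 <= (ka j k ^+ 2) ^+ 2.
  rewrite lerXn2r ?nnegrE ?sqr_ge0 ?mulr_ge0 ?exprn_ge0 ?L1_ge0//.
  rewrite /ka exprMn sqr_sqrtr ?(ltW A0)// -exprM mulnC exprM.
  rewrite mulrAC ler_pM ?mulr_ge0 ?exprn_ge0 ?L1_ge0//.
    by rewrite /cotlar_const lerDl.
  by rewrite lerXn2r ?nnegrE//; lra.
have csc (a b : R) (U : V -> R) X : 0 <= X -> Bb U -> a ^+ 2 <= 1 -> b ^+ 2 <= 1 -> ip U U <= X ->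
   ip (fun x => a * (b * U x)) (fun x => a * (b * U x)) <= X.
  move=> X0 bU a1 b1 UX.
  rewrite (_ : (fun x => _) = (fun x => (a * b) * U x)); last by apply/funext => x; rewrite mulrA.
  rewrite ipZ//; apply: le_trans UX; rewrite ler_piMl ?ip_ge0// exprMn.
  by rewrite mulr_ile1 ?sqr_ge0.
have main := @Cotlar_Stein R (V -> R) (@Bb R n) (@ip R n) (@Bb0 R n) (@BbD R n) (@ipDl R n)
  (@ipC R n) (fun f _ => ip_ge0 f) (@ip_CS R n) N T Ts _ _ _ _ _
  (2 ^+ n * L1 (partial i th) + 1) (8 * Num.sqrt cotlar_const) ka _ _ _ _ _ _ _ _ g bg.
move=> F FE; have {F FE}-> : F = \sum_(j < N) T j g by rewrite FE; apply/funext => x; rewrite fct_sumE.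
have -> : 64 * cotlar_const = (8 * Num.sqrt cotlar_const) ^+ 2.
  by rewrite exprMn sqr_sqrtr ?(ltW A0)//; ring.
have single j (al be : R) ga h : `|al| * `|be| = (1 - t j) / (rho * t j) ^+ 2 -> al != 0 -> Bb h ->
    forall U, U = (fun x => c j * nconv (partial i th) (rho * t j) al be ga h x) ->
    ip U U <= (2 ^+ n * L1 (partial i th) + 1) ^+ 2 * ip h h.
  move=> E al0 bh U ->; have bU : Bb (nconv (partial i th) (rho * t j) al be ga h) by exact: nconv_Bb.
  rewrite ipZ//; apply: (@le_trans _ _ (ip (nconv (partial i th) (rho * t j) al be ga h) (nconv (partial i th) (rho * t j) al be ga h))).
    by rewrite ler_piMl// ip_ge0.
  apply: (le_trans (nconv_bound ga (rt j) (lam0 j) E cp bh)).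
  rewrite ler_wpM2r ?ip_ge0//.
  apply: (@le_trans _ _ ((2 ^+ n * L1 (partial i th)) ^+ 2)); last first.
    rewrite lerXn2r ?nnegrE ?addr_ge0 ?mulr_ge0 ?exprn_ge0 ?L1_ge0//.
    by rewrite lerDl.
  rewrite exprMn ler_wpM2r ?sqr_ge0//.
  apply: (@le_trans _ _ (2 ^+ n)).
    rewrite lerXn2r// ?nnegrE ?invr_ge0 ?(ltW (lam0 j))//.
    by rewrite invf_ple ?posrE.
  by rewrite expr2 ler_peMr ?exprn_ge0// exprn_ege1// ler1n.
apply: main.
- by move=> j h bh; apply: BbZ; exact: fB.
- by move=> j h bh; apply: BbZ; exact: bB.
- move=> j f h bf bh; apply/funext => x.
  by rewrite /T /fwd /nconv convD// !fctE !mulrDr.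
- move=> j f h bf bh; apply/funext => x.
  by rewrite /Ts /bwd /nconv convD// !fctE !mulrDr.
- move=> j f h bf bh.
  have E (r s : R) (U W : V -> R) : Bb U -> Bb W ->
      ip (fun x => r * (s * U x)) W = r * s * ip U W.
    move=> bU bW; rewrite /ip -RintegralZl//; last exact: Bb_integrable (BbM bU bW).
    by apply: eq_Rintegral => x _; ring.
  rewrite /T /Ts /fwd /bwd /nconv E//; last exact: conv_Bb.
  rewrite [RHS]ipC E//; last exact: conv_Bb.
  by rewrite [in RHS]ipC conv_adjoint.
- by rewrite ltr_wpDl// mulr_ge0 ?exprn_ge0 ?L1_ge0.
- by rewrite mulr_gt0// sqrtr_gt0.
- by move=> j k; rewrite mulr_ge0 ?sqrtr_ge0 ?exprn_ge0//; lra.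
- move=> j; rewrite -mulr_sumr mulrC ler_wpM2r ?sqrtr_ge0//.
  exact: geometric_dist_sum.
- by move=> j h bh; exact: (single j _ _ (- (t j / (rho * t j)) *: x0) h (Ef j) (nzf j) bh (T j h) erefl).
- by move=> j h bh; exact: (single j _ _ (- (t j / (rho * t j)) *: x0) h (Eb j) (nzb j) bh (Ts j h) erefl).
- move=> j k h bh; rewrite /Ts /T /bwd nconvZ//; last exact: fB.
  apply: csc => //; first by rewrite mulr_ge0 ?sqr_ge0 ?ip_ge0.
    by apply: nconv_Bb => //; exact: fB.
  apply: le_trans (ler_wpM2r (ip_ge0 h) (kaE j k)).
  have Hr a b : `|(rho * t b)^-1 / (rho * t a)^-1| <= `|t a / t b| * 2.
    rewrite (_ : (rho * t b)^-1 / (rho * t a)^-1 = t a / t b).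
      by rewrite ler_peMr// ler1n.
    by field; rewrite !gt_eqF.
  have Hq : `|(rho * t k)^-1 / (rho * t j)^-1| <= 2 * 2^-1 ^+ ((j - k) + (k - j))%N \/
      `|(rho * t j)^-1 / (rho * t k)^-1| <= 2 * 2^-1 ^+ ((j - k) + (k - j))%N.
    by have [H|H] := ratio j k; [left|right]; apply: le_trans H; exact: Hr.
  exact: (@nconv_pair_bound th i _ _ _ _ _ _ _ _ (- (t j / (rho * t j)) *: x0) (- (t k / (rho * t k)) *: x0) h _
    (rt j) (lam2 j) (Eb j) (rt k) (lam2 k) (Ef k) cth bh Hq _ erefl).
- move=> j k h bh; rewrite /Ts /T /fwd nconvZ//; last exact: bB.
  apply: csc => //; first by rewrite mulr_ge0 ?sqr_ge0 ?ip_ge0.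
    by apply: nconv_Bb => //; exact: bB.
  apply: le_trans (ler_wpM2r (ip_ge0 h) (kaE j k)).
  have Hr a b : `|- ((1 - t b) / (rho * t b)) / - ((1 - t a) / (rho * t a))| <= `|t a / t b| * 2.
    have -> : - ((1 - t b) / (rho * t b)) / - ((1 - t a) / (rho * t a)) = (t a / t b) * ((1 - t b) / (1 - t a)).
      by field; rewrite !gt_eqF.
    rewrite normrM ler_wpM2l// ger0_norm ?divr_ge0 ?(ltW (lam0 _))//.
    rewrite ler_pdivrMr//; have := t0 b; have := t2 a; lra.
  have Hq : `|- ((1 - t k) / (rho * t k)) / - ((1 - t j) / (rho * t j))| <= 2 * 2^-1 ^+ ((j - k) + (k - j))%N \/
      `|- ((1 - t j) / (rho * t j)) / - ((1 - t k) / (rho * t k))| <= 2 * 2^-1 ^+ ((j - k) + (k - j))%N.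
    by have [H|H] := ratio j k; [left|right]; apply: le_trans H; exact: Hr.
  exact: (@nconv_pair_bound th i _ _ _ _ _ _ _ _ (- (t j / (rho * t j)) *: x0) (- (t k / (rho * t k)) *: x0) h _
    (rt j) (lam2 j) (Ef j) (rt k) (lam2 k) (Eb k) cth bh Hq _ erefl).
Qed.

End dyadic_orthogonality.

Section measurable_inverse.
Variable R : realType.

(** Real powers are measurable, and the power [-1] is the inverse on nonnegative arguments;
    [t^-1 = t (t^2)^-1] reduces to these, also at [0] because [0^-1 = 0]. *)
Lemma measurable_invr : measurable_fun [set: R] (fun t : R => t^-1).
Proof.
have -> : (fun t : R => t^-1) = (fun t : R => t * (t ^+ 2) `^ (-1)).
  apply/funext => t; rewrite powR_inv1 ?sqr_ge0//.
  have [->|t0] := eqVneq t 0; first by rewrite mul0r invr0.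
  by field.
apply: measurable_funM => //.
apply: (measurableT_comp (f := fun z : R => z `^ (-1))) => //.
Qed.

End measurable_inverse.

Section bfin2_closure.
Context {d1 d2 : measure_display} {T1 : measurableType d1} {T2 : measurableType d2} {R : realType}.
Variables (m1 : {sigma_finite_measure set T1 -> \bar R}) (m2 : {sigma_finite_measure set T2 -> \bar R}).
Implicit Types (f g : T1 * T2 -> R).

Lemma bfin2D f g : bfin2 m1 m2 f -> bfin2 m1 m2 g -> bfin2 m1 m2 (fun z => f z + g z).
Proof.
move=> [mf [M [D [E [[mD mE] D8 E8 M0 fM]]]]] [mg [M' [D' [E' [[mD' mE'] D8' E8' M0' gM]]]]].
split; first exact: measurable_funD.
exists (M + M'), (D `|` D'), (E `|` E'); split.
- by split; exact: measurableU.
- by rewrite (le_lt_trans (measureU2 _ _ _))// lte_add_pinfty.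
- by rewrite (le_lt_trans (measureU2 _ _ _))// lte_add_pinfty.
- exact: addr_ge0.
move=> x y; apply: (le_trans (ler_normD _ _)); rewrite mulrDl lerD//.
  apply: (le_trans (fM x y)); rewrite ler_wpM2l// !indicE -!natrM ler_nat !in_setU.
  by case: (x \in D); case: (y \in E); rewrite ?orbT.
apply: (le_trans (gM x y)); rewrite ler_wpM2l// !indicE -!natrM ler_nat !in_setU.
by case: (x \in D'); case: (y \in E'); rewrite ?orbT.
Qed.

Lemma bfin2_0 : bfin2 m1 m2 (fun _ => 0).
Proof.
split; first exact: measurable_cst.
by exists 0, set0, set0; split; rewrite ?measure0// => x y; rewrite normr0 mul0r.
Qed.

Lemma bfin2_sum (I : Type) (r : seq I) (F : I -> T1 * T2 -> R) :
  (forall i, bfin2 m1 m2 (F i)) -> bfin2 m1 m2 (fun z => \sum_(i <- r) F i z).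
Proof.
move=> bF; elim: r => [|i r IH].
  rewrite (_ : (fun _ => _) = fun=> 0); first exact: bfin2_0.
  by apply/funext => z; rewrite big_nil.
rewrite (_ : (fun _ => _) = (fun z => F i z + \sum_(i <- r) F i z)).
  exact: bfin2D.
by apply/funext => z; rewrite big_cons.
Qed.

Lemma bfin2_swap f : bfin2 m1 m2 f -> bfin2 m2 m1 (fun z => f (z.2, z.1)).
Proof.
move=> [mf [M [D [E [[mD mE] D8 E8 M0 fM]]]]]; split.
  exact: (measurableT_comp mf (measurable_swap (T1 := T2) (T2 := T1))).
by exists M, E, D; split => // x t; rewrite [_ * \1_D t]mulrC fM.
Qed.

End bfin2_closure.

(** * Integrals of contractions over time *)

Section time_kernel.
Variables (R : realType) (n : nat).
Local Notation V := 'rV[R]_n.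
Local Notation mu := (lebesgue_rV R n).
Local Notation leb := (@lebesgue_measure R).
Implicit Types (f g h p : V -> R) (w : R -> R).
Variables (rho : R) (x0 : V).
Hypothesis rho0 : 0 < rho.

Local Notation fwd := (fwd rho x0).

(** Away from [s t = 0] the dilation factor is bounded, which puts all integrands into [bfin2]. The
    scale [s] is [1] for the operator itself and [2^-j] for its dyadic pieces after substitution. *)
Definition time_weight (s : R) w := [/\ measurable_fun [set: R] w,
  exists W, forall t, `|w t| <= W &
  exists2 a, 0 < a & forall t, w t != 0 -> a <= s * t <= 1].

Lemma fwd_kernel_vec (t : R) (x y : V) : 0 < t ->
  (rho * t)^-1 *: x + (- ((1 - t) / (rho * t)) *: y + - (t / (rho * t)) *: x0) =
  (rho * t)^-1 *: (x - x0 - (1 - t) *: (y - x0)).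
Proof.
move=> t0; apply/rowP => i; rewrite !mxE.
by field; rewrite !gt_eqF.
Qed.

Lemma measurable_time_vec (s : R) (d : measure_display) (T : measurableType d)
  (ft : T -> R) (fx fy : T -> V) : measurable_fun setT ft -> measurable_fun setT fx ->
  measurable_fun setT fy ->
  measurable_fun setT (fun z : T =>
    (rho * (s * ft z))^-1 *: fx z + (- ((1 - s * ft z) / (rho * (s * ft z))) *: fy z + - ((s * ft z) / (rho * (s * ft z))) *: x0)).
Proof.
move=> mt mx my.
have mi : measurable_fun setT (fun z => (rho * (s * ft z))^-1).
  apply: (measurableT_comp (@measurable_invr R)).
  by do 2 apply: measurable_funM => //.
have mst : measurable_fun setT (fun z => s * ft z) by exact: measurable_funM.
apply/measurable_fun_rVP => i; under eq_fun do rewrite !mxE.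
apply: measurable_funD.
  by apply: measurable_funM => //; exact: (measurableT_comp (measurable_coord i) mx).
apply: measurable_funD.
  apply: measurable_funM; last exact: (measurableT_comp (measurable_coord i) my).
  by apply: measurable_funN; apply: measurable_funM => //; exact: measurable_funB.
by apply: measurable_funM => //; apply: measurable_funN; exact: measurable_funM.
Qed.

Lemma itv_finite (a b : R) : (leb `[a, b]%classic < +oo)%E.
Proof. by rewrite lebesgue_measure_itv/=; case: ifP => _; rewrite ?ltry// -EFinB ltry. Qed.

Lemma time_weight_indic s w : 0 < s -> time_weight s w ->
  exists2 a, 0 < a & exists2 W, 0 <= W & forall t, `|w t| <= W * \1_(`[a / s, s^-1]%classic) t.
Proof.
move=> s0 [mw [W wW] [a a0 wa]]; exists a => //; exists W; first exact: le_trans (wW 0).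
move=> t; rewrite indicE; have [wt|wt] := eqVneq (w t) 0.
  by rewrite wt normr0 mulr_ge0// (le_trans _ (wW 0)).
rewrite mem_set ?mulr1//= in_itv/=.
have /andP[h1 h2] := wa _ wt.
by rewrite ler_pdivrMr// [t * s]mulrC h1/= -[s^-1]mul1r ler_pdivlMr// mulrC.
Qed.

Lemma kernel_support_bound (t a r1 r2 : R) (p : V -> R) (x y : V) :
  0 < a -> a <= t -> t <= 1 -> 0 <= r1 -> 0 <= r2 ->
  (forall z, r1 < `|z| -> p z = 0) -> `|y| <= r2 ->
  r1 * rho + r2 + `|x0| *+ 3 < `|x| ->
  p ((rho * t)^-1 *: x + (- ((1 - t) / (rho * t)) *: y + - (t / (rho * t)) *: x0)) = 0.
Proof.
move=> a0 at1 t1 r10 r20 pr yr xr.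
have t0 : 0 < t by exact: lt_le_trans at1.
rewrite fwd_kernel_vec//; apply: pr.
rewrite normrZ gtr0_norm ?invr_gt0 ?mulr_gt0// mulrC ltr_pdivlMr ?mulr_gt0//.
have h1 : r1 * (rho * t) <= r1 * rho.
  by rewrite ler_wpM2l// ler_piMr// ltW.
have h2 : `|(1 - t) *: (y - x0)| <= r2 + `|x0|.
  rewrite normrZ ger0_norm ?subr_ge0//.
  apply: (@le_trans _ _ (1 * `|y - x0|)); first by rewrite ler_wpM2r//; lra.
  by rewrite mul1r (le_trans (ler_normB _ _))// lerD2r.
have h3 := ler_normB (x - x0 - (1 - t) *: (y - x0)) (- ((1 - t) *: (y - x0))).
rewrite opprK subrK normrN in h3.
have h4 := ler_normD (x - x0) x0; rewrite subrK in h4.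
have h5 := normr_ge0 x0.
rewrite -mulr_natl in xr; lra.
Qed.

(** The Dirac mass on the pairs [(t, x)] is a device: through [bfin2_integral1] this yields the
    joint measurability in [(t, x)] of the integral over [y], and a finite measure makes the
    finiteness of the carrier immediate. *)
Lemma bfin2_time_kernel3 (s : R) w p g : 0 < s -> time_weight s w -> Cc p -> Bb g ->
  bfin2 (@dirac _ (measurableTypeR R * V)%type (0, 0) R) mu (fun z : (R * V) * V =>
    w z.1.1 * ((rho * (s * z.1.1))^-1 ^+ n * (p ((rho * (s * z.1.1))^-1 *: z.1.2 +
      (- ((1 - s * z.1.1) / (rho * (s * z.1.1))) *: z.2 + - ((s * z.1.1) / (rho * (s * z.1.1))) *: x0)) * g z.2))).
Proof.
move=> s0 tw cp bg; have [mw [W0 _] _] := tw.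
have [a a0 [W W_ge0 HW]] := time_weight_indic s0 tw.
have [mg [G HG] /bdd_support_cube[r2 r20 gr2]] := bg.
have [M HM] := Cc_bounded cp.
have [sp /bdd_support_cube[r1 r10 pr1']] := cp.
have pr1 z : r1 < `|z| -> p z = 0.
  by move=> zr; apply: pr1' => /(cubeP _ r10); rewrite leNgt zr.
have m11 : measurable_fun setT (fun z : (measurableTypeR R * V) * V => z.1.1 : R).
  exact: (measurableT_comp measurable_fst measurable_fst).
have m12 : measurable_fun setT (fun z : (measurableTypeR R * V) * V => z.1.2).
  exact: (measurableT_comp measurable_snd measurable_fst).
split.
  apply: measurable_funM; first exact: (measurableT_comp mw m11).
  apply: measurable_funM.
    apply: measurable_funX; apply: (measurableT_comp (@measurable_invr R)).
    by do 2 apply: measurable_funM => //.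
  apply: measurable_funM; last exact: (measurableT_comp mg measurable_snd).
  apply: (measurableT_comp (smooth_measurable sp)).
  exact: measurable_time_vec.
pose ra := r1 * rho + r2 + `|x0| *+ 3.
have ra0 : 0 <= ra by rewrite !addr_ge0 ?mulr_ge0 ?mulrn_wge0// ltW.
exists (W * ((rho * a)^-1 ^+ n * (`|M| * `|G|))), (`[a / s, s^-1]%classic `*` cube ra), (cube r2).
have ira : 0 <= (rho * a)^-1 by rewrite invr_ge0 mulr_ge0// ltW.
split.
- by split; [apply: measurableX => //; exact: measurable_cube|exact: measurable_cube].
- by rewrite /= /dirac indicE; case: (_ \in _); rewrite ltry.
- exact: cube_finite.
- by rewrite !mulr_ge0// exprn_ge0.
move=> [t x] y /=.
rewrite [X in _ <= _ * X](_ : _ = \1_(`[a / s, s^-1]%classic) t * (\1_(cube ra) x * \1_(cube r2) y)); last first.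
  rewrite !indicE in_setX /=.
  by case: (t \in _); case: (x \in _); case: (y \in _); rewrite ?mulr1 ?mulr0 ?mul0r.
have [wt|wt] := eqVneq (w t) 0.
  rewrite wt mul0r normr0 !mulr_ge0 ?exprn_ge0//.
have := HW t; rewrite indicE; case: (boolP (t \in _)); last first.
  by move=> _; rewrite mulr0 normr_le0 (negbTE wt).
move=> /set_mem /=; rewrite in_itv/= => /andP[at1 t1]; rewrite mulr1 => wW.
have ast : a <= s * t by rewrite mulrC -ler_pdivrMr.
have st1 : s * t <= 1 by rewrite mulrC -ler_pdivlMr// mul1r.
have st0 : 0 < s * t by exact: lt_le_trans ast.
have ist : 0 <= (rho * (s * t))^-1 by rewrite invr_ge0 mulr_ge0// ltW.
rewrite mul1r.
have [yr|yr] := pselect (cube r2 y); last first.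
  by rewrite gr2// !mulr0 normr0 mulr_ge0// ?mulr_ge0// ?exprn_ge0.
have [xr|xr] := pselect (cube ra x); last first.
  rewrite (@kernel_support_bound (s * t) a r1 r2 p x y)//.
  - by rewrite mul0r !mulr0 normr0 mulr_ge0// ?mulr_ge0// ?exprn_ge0.
  - exact/cubeP.
  - by rewrite ltNge; apply/negP => H; apply: xr; apply/cubeP.
rewrite !indicE !mem_set// !mulr1 normrM ler_pM// normrM ler_pM//.
  rewrite ger0_norm ?exprn_ge0// lerXn2r ?nnegrE//.
  by rewrite lef_pV2 ?posrE ?(mulr_gt0 rho0) ?(ler_pM2l rho0).
rewrite normrM ler_pM//.
  by rewrite (le_trans (HM _))// ler_norm.
by rewrite (le_trans (HG _))// ler_norm.
Qed.

Lemma bfin2_time_fwd (s : R) w p g : 0 < s -> time_weight s w -> Cc p -> Bb g ->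
  bfin2 leb mu (fun z : R * V => w z.1 * fwd (s * z.1) p g z.2).
Proof.
move=> s0 tw cp bg.
have bK := bfin2_time_kernel3 s0 tw cp bg.
have [mI _] := bfin2_integral1 bK.
have E : (fun z : R * V => w z.1 * fwd (s * z.1) p g z.2) =
  (fun x : measurableTypeR R * V => \int[mu]_y (w x.1 * ((rho * (s * x.1))^-1 ^+ n * (p ((rho * (s * x.1))^-1 *: x.2 +
      (- ((1 - s * x.1) / (rho * (s * x.1))) *: y + - ((s * x.1) / (rho * (s * x.1))) *: x0)) * g y)))).
  apply/funext => -[t x]; rewrite /fwd /nconv /conv.
  have ii : mu.-integrable setT (EFin \o (fun y => p ((rho * (s * t))^-1 *: x +
      (- ((1 - s * t) / (rho * (s * t))) *: y + - ((s * t) / (rho * (s * t))) *: x0)) * g y)).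
    apply: (@integrable_param _ _ _ _ _ (fun=> _)) => //.
      exact: measurable_fun_rV_affine.
    exact: Bb_integrable.
  rewrite RintegralZl//; last exact: integrableZ_real.
  by rewrite RintegralZl.
split; first by rewrite E; exact: mI.
have [a a0 [W W_ge0 HW]] := time_weight_indic s0 tw.
have [mg [G HG] /bdd_support_cube[r2 r20 gr2]] := bg.
have [M HM] := Cc_bounded cp.
have [sp /bdd_support_cube[r1 r10 pr1']] := cp.
have pr1 z : r1 < `|z| -> p z = 0.
  by move=> zr; apply: pr1' => /(cubeP _ r10); rewrite leNgt zr.
pose ra := r1 * rho + r2 + `|x0| *+ 3.
have ra0 : 0 <= ra by rewrite !addr_ge0 ?mulr_ge0 ?mulrn_wge0// ltW.
have ig : mu.-integrable setT (EFin \o (fun y => `|g y|)).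
  exact: Bb_integrable (Bb_norm bg).
have ig0 : 0 <= \int[mu]_y `|g y| by apply: Rintegral_ge0.
have ira : 0 <= (rho * a)^-1 by rewrite invr_ge0 mulr_ge0// ltW.
exists (W * ((rho * a)^-1 ^+ n * (`|M| * \int[mu]_y `|g y|))), `[a / s, s^-1]%classic, (cube ra).
split.
- by split => //; exact: measurable_cube.
- exact: itv_finite.
- exact: cube_finite.
- by rewrite !mulr_ge0// exprn_ge0.
move=> t x /=.
have [wt|wt] := eqVneq (w t) 0.
  by rewrite wt mul0r normr0 !mulr_ge0 ?exprn_ge0.
have := HW t; rewrite indicE; case: (boolP (t \in _)); last first.
  by move=> _; rewrite mulr0 normr_le0 (negbTE wt).
move=> /set_mem /=; rewrite in_itv/= => /andP[at1 t1]; rewrite mulr1 mul1r => wW.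
have ast : a <= s * t by rewrite mulrC -ler_pdivrMr.
have st1 : s * t <= 1 by rewrite mulrC -ler_pdivlMr// mul1r.
have st0 : 0 < s * t by exact: lt_le_trans ast.
have ist : 0 <= (rho * (s * t))^-1 by rewrite invr_ge0 mulr_ge0// ltW.
have ii : mu.-integrable setT (EFin \o (fun y => p ((rho * (s * t))^-1 *: x +
      (- ((1 - s * t) / (rho * (s * t))) *: y + - ((s * t) / (rho * (s * t))) *: x0)) * g y)).
  apply: (@integrable_param _ _ _ _ _ (fun=> _)) => //.
    exact: measurable_fun_rV_affine.
  exact: Bb_integrable.
have [xr|xr] := pselect (cube ra x).
  rewrite indicE mem_set// mulr1 normrM ler_pM// /fwd /nconv normrM ler_pM//.
    rewrite ger0_norm ?exprn_ge0// lerXn2r ?nnegrE//.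
    by rewrite lef_pV2 ?posrE ?(mulr_gt0 rho0) ?(ler_pM2l rho0).
  apply: (le_trans (le_normr_Rintegral measurableT ii)).
  rewrite -RintegralZl//; apply: le_Rintegral => //.
  - exact: integrable_norm_real ii.
  - exact: integrableZ_real.
  move=> y _; rewrite normrM ler_wpM2r//.
  by rewrite (le_trans (HM _))// ler_norm.
rewrite [X in `|_ * X|](_ : _ = 0); last first.
  rewrite /fwd /nconv /conv.
  have -> : \int[mu]_y (p ((rho * (s * t))^-1 *: x +
      (- ((1 - s * t) / (rho * (s * t))) *: y + - ((s * t) / (rho * (s * t))) *: x0)) * g y) = \int[mu]_y 0.
    apply: eq_Rintegral => y _; have [yr|yr] := pselect (cube r2 y); last by rewrite gr2// mulr0.
    rewrite (@kernel_support_bound (s * t) a r1 r2 p x y)// ?mul0r//.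
      exact/cubeP.
    by rewrite ltNge; apply/negP => H; apply: xr; apply/cubeP.
  by rewrite Rintegral_cst// mul0r mulr0.
by rewrite mulr0 normr0 !mulr_ge0 ?exprn_ge0.
Qed.

End time_kernel.

(** * Operators averaged over time *)

Section time_integral.
Variables (R : realType) (n : nat).
Local Notation V := 'rV[R]_n.
Local Notation mu := (lebesgue_rV R n).
Local Notation leb := (@lebesgue_measure R).
Local Notation e_ i := (delta_mx ord0 i : V).
Implicit Types (f g h p : V -> R) (w v : R -> R).
Variables (rho : R) (x0 : V).
Hypothesis rho0 : 0 < rho.

Local Notation fwd := (fwd rho x0).

Definition timeop w p g : V -> R := fun x => \int[leb]_t (w t * fwd t p g x).

Lemma time_weightM w (k : R -> R) (K : R) : time_weight 1 w -> measurable_fun setT k ->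
  (forall t, w t != 0 -> `|k t| <= K) -> time_weight 1 (fun t => k t * w t).
Proof.
move=> [mw [W wW] [a a0 wa]] mk kK; split; first exact: measurable_funM.
  exists (`|K| * W) => t; rewrite normrM.
  have [->|wt] := eqVneq (w t) 0; first by rewrite normr0 mulr0 mulr_ge0// (le_trans _ (wW t)).
  by rewrite ler_pM// (le_trans (kK _ wt))// ler_norm.
by exists a => // t wt; apply: wa; apply: contra_neq wt => ->; rewrite mulr0.
Qed.

Lemma measurable_rho_inv : measurable_fun setT (fun t : R => (rho * t)^-1).
Proof. by apply: (measurableT_comp (@measurable_invr R)); exact: measurable_funM. Qed.

Lemma time_weight_inv w : time_weight 1 w -> time_weight 1 (fun t => (rho * t)^-1 * w t).
Proof.
move=> tw; have [_ _ [a a0 wa]] := tw.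
apply: (@time_weightM _ _ (rho * a)^-1) => //; first exact: measurable_rho_inv.
move=> t wt; have := wa t wt; rewrite mul1r => /andP[at1 _].
have t0 := lt_le_trans a0 at1.
by rewrite ger0_norm ?invr_ge0 ?mulr_ge0 ?(ltW rho0) ?(ltW t0)// lef_pV2 ?posrE ?mulr_gt0// ler_pM2l.
Qed.

Lemma time_weight_invX w s : time_weight 1 w -> time_weight 1 (fun t => (rho * t)^-1 ^+ s * w t).
Proof.
elim: s => [|s IH] tw; first by under eq_fun do rewrite expr0 mul1r.
by under eq_fun do rewrite exprS -mulrA; apply: time_weight_inv; exact: IH.
Qed.

(* the integrand of [timeop] with the time and space variables integrated together, in the form
   required by [param_int]; the cut-off [1_{[a, 1]}] keeps the dilation factor bounded *)
Let dil (a : R) (z : R * V) : R := \1_(`[a, 1]%classic) z.1 * (rho * z.1)^-1.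
Let shift (z : R * V) : V :=
  - ((1 - z.1) / (rho * z.1)) *: z.2 + - (z.1 / (rho * z.1)) *: x0.
Let mass w g (z : R * V) : R := w z.1 * ((rho * z.1)^-1 ^+ n * g z.2).

Lemma measurable_dil a : measurable_fun [set: measurableTypeR R * V] (dil a).
Proof.
apply: measurable_funM.
  exact: (measurableT_comp (measurable_indic (measurable_itv _)) measurable_fst).
exact: (measurableT_comp measurable_rho_inv measurable_fst).
Qed.

Lemma measurable_shift : measurable_fun [set: measurableTypeR R * V] shift.
Proof.
have mi : measurable_fun setT (fun z : measurableTypeR R * V => (rho * z.1)^-1).
  exact: (measurableT_comp measurable_rho_inv measurable_fst).
apply/measurable_fun_rVP => i; under eq_fun do rewrite !mxE.
apply: measurable_funD.
  apply: measurable_funM; last exact: (measurableT_comp (measurable_coord i) measurable_snd).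
  by apply: measurable_funN; apply: measurable_funM => //; exact: measurable_funB.
by apply: measurable_funM => //; apply: measurable_funN; exact: measurable_funM.
Qed.

Lemma dil_bound a z : 0 < a -> `|dil a z| <= (rho * a)^-1.
Proof.
move=> a0; rewrite /dil indicE; case: (boolP (z.1 \in _)) => [/set_mem/=|_]; last first.
  by rewrite mul0r normr0 invr_ge0 mulr_ge0// ltW.
rewrite in_itv/= mul1r => /andP[at1 _]; have t0 := lt_le_trans a0 at1.
by rewrite ger0_norm ?invr_ge0 ?mulr_ge0 ?(ltW rho0) ?(ltW t0)// lef_pV2 ?posrE ?mulr_gt0// ler_pM2l.
Qed.

Lemma bfin2_mass w g : time_weight 1 w -> Bb g -> bfin2 leb mu (mass w g).
Proof.
move=> tw bg; have [mv [W vW] [a a0 va]] := time_weight_invX n tw.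
have [mg [G HG] /bdd_support_cube[r r0 gr]] := bg.
have E z : mass w g z = ((rho * z.1)^-1 ^+ n * w z.1) * g z.2 by rewrite /mass; ring.
split.
  rewrite (_ : mass w g = (fun z => ((rho * z.1)^-1 ^+ n * w z.1) * g z.2)); last exact/funext.
  apply: measurable_funM; first exact: (measurableT_comp mv measurable_fst).
  exact: (measurableT_comp mg measurable_snd).
exists (`|W| * `|G|), `[a, 1]%classic, (cube r); split.
- by split => //; exact: measurable_cube.
- exact: itv_finite.
- exact: cube_finite.
- by rewrite mulr_ge0.
move=> t x; rewrite E /= !indicE.
have [->|vt] := eqVneq ((rho * t)^-1 ^+ n * w t) 0.
  by rewrite mul0r normr0 !mulr_ge0.
rewrite (mem_set (_ : `[a, 1]%classic t)) ?mul1r; last first.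
  by have := va t vt; rewrite /= in_itv/= mul1r.
have [xr|xr] := pselect (cube r x).
  rewrite (mem_set xr) mulr1 normrM ler_pM//.
    by rewrite (le_trans (vW _))// ler_norm.
  by rewrite (le_trans (HG _))// ler_norm.
by rewrite gr// mulr0 normr0 !mulr_ge0.
Qed.

(** As one integral over [(t, y)] the operator becomes a [param_int], so that its smoothness and its
    derivatives come from differentiation under the integral sign. *)
Lemma timeop_param w p g a : time_weight 1 w -> Cc p -> Bb g ->
  0 < a -> (forall t, w t != 0 -> a <= 1 * t <= 1) ->
  timeop w p g = param_int (leb \x mu)%E (dil a) shift p (mass w g).
Proof.
move=> tw cp bg a0 wa; apply/funext => x; rewrite /param_int.
have bm := bfin2_mass tw bg.
have [Mp HMp] := Cc_bounded cp.
have mk : measurable_fun [set: measurableTypeR R * V] (fun z => p (dil a z *: x + shift z)).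
  apply: (measurableT_comp (smooth_measurable cp.1)).
  exact: (measurable_param (measurable_dil a) measurable_shift).
have bF : bfin2 leb mu (fun z => p (dil a z *: x + shift z) * mass w g z).
  have [mm [M [D [E [mDE D8 E8 M0 HM]]]]] := bm; split; first exact: measurable_funM.
  exists (`|Mp| * M), D, E; split => //; first by rewrite mulr_ge0.
  move=> t y; rewrite normrM -mulrA ler_pM//.
  by rewrite (le_trans (HMp _))// ler_norm.
apply: etrans; last by symmetry; exact: (bfin2_product_integral bF).
apply: eq_Rintegral => t _.
have [wt|wt] := eqVneq (w t) 0.
  rewrite wt mul0r (_ : (fun y => _) = cst 0) ?Rintegral_cst ?mul0r//.
  by apply/funext => y; rewrite /mass /= wt mul0r mulr0.
rewrite /fwd /nconv /conv mulrA -RintegralZl//; last first.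
  apply: (@integrable_param _ _ _ _ _ (fun=> _)) => //.
    exact: measurable_fun_rV_affine.
  exact: Bb_integrable.
apply: eq_Rintegral => y _; rewrite /mass /dil /shift /= indicE mem_set; last first.
  by have := wa t wt; rewrite /= in_itv/= mul1r.
by rewrite mul1r; ring.
Qed.

Lemma integrable_mass w g : time_weight 1 w -> Bb g ->
  (leb \x mu)%E.-integrable setT (EFin \o mass w g).
Proof. by move=> tw bg; apply: bfin_integrable; apply: bfin2_bfin; exact: bfin2_mass. Qed.

Lemma timeop_smooth w p g : time_weight 1 w -> Cc p -> Bb g -> smooth (timeop w p g).
Proof.
move=> tw cp bg; have [_ _ [a a0 wa]] := tw.
rewrite (timeop_param tw cp bg a0 wa).
apply: (param_int_smooth (measurable_dil a) measurable_shift (fun z => dil_bound z a0)) => //.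
exact: integrable_mass.
Qed.

Lemma timeop_partial w p g i : time_weight 1 w -> Cc p -> Bb g ->
  partial i (timeop w p g) = timeop (fun t => (rho * t)^-1 * w t) (partial i p) g.
Proof.
move=> tw cp bg; have [_ _ [a a0 wa]] := tw.
rewrite (timeop_param tw cp bg a0 wa).
rewrite (param_int_partial (measurable_dil a) measurable_shift (fun z => dil_bound z a0))//; last first.
  exact: integrable_mass.
rewrite (@timeop_param _ _ _ a (time_weight_inv tw) (Cc_partial i cp) bg a0); last first.
  by move=> t wt; apply: wa; apply: contra_neq wt => ->; rewrite mulr0.
congr param_int; apply/funext => -[t y]; rewrite /mass /dil /= indicE.
have [->|wt] := eqVneq (w t) 0; first by rewrite mulr0 !mul0r mulr0.
rewrite mem_set; last by have := wa t wt; rewrite /= in_itv/= mul1r.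
by rewrite mul1r; ring.
Qed.

Lemma timeop_partials w p g s : time_weight 1 w -> Cc p -> Bb g ->
  partials s (timeop w p g) = timeop (fun t => (rho * t)^-1 ^+ size s * w t) (partials s p) g.
Proof.
move=> tw cp bg; elim: s => [|i s IH] /=.
  by under [in RHS]eq_fun do rewrite expr0 mul1r.
rewrite IH (timeop_partial i (time_weight_invX _ tw) (Cc_partials s cp) bg).
by congr timeop; apply/funext => t; rewrite exprS mulrA.
Qed.

Lemma fwd_partial_ibp t p g i : 0 < t < 1 -> Cc p -> smooth g ->
  fwd t (partial i p) g = (fun x => (rho * t) / (1 - t) * fwd t p (partial i g) x).
Proof.
move=> /andP[t0 t1] cp sg; apply/funext => x.
have t1' : 1 - t != 0 by rewrite subr_eq0 gt_eqF.
rewrite /fwd /nconv conv_partial_ibp//; last first.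
  by rewrite oppr_eq0 mulf_neq0// invr_eq0 mulf_neq0 ?gt_eqF.
rewrite invrN opprK invf_div; ring.
Qed.

(** A derivative falling on the kernel costs [(rho t)^-1], and moving it to [g] gains
    [rho t / (1 - t)]. The net factor [(1 - t)^-1] is regular at [t = 0] and at most [2] on the
    support of the weight. *)
Lemma timeop_partial_near w p g i : time_weight 1 w -> (forall t, w t != 0 -> t <= 2^-1) ->
  Cc p -> Cc g ->
  partial i (timeop w p g) = timeop (fun t => (1 - t)^-1 * w t) p (partial i g).
Proof.
move=> tw w2 cp cg; have [_ _ [a a0 wa]] := tw.
rewrite (timeop_partial i tw cp (Cc_Bb cg)).
apply/funext => x; apply: eq_Rintegral => t _.
have [->|wt] := eqVneq (w t) 0; first by rewrite !mulr0 !mul0r.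
have := wa t wt; rewrite mul1r => /andP[at1 _]; have t0 := lt_le_trans a0 at1.
have t1 : t < 1 by have := w2 t wt; lra.
rewrite fwd_partial_ibp ?t0//; last by case: cg.
by field; rewrite subr_eq0 !gt_eqF// mulr_gt0.
Qed.

Lemma near_weight w s : time_weight 1 w -> (forall t, w t != 0 -> t <= 2^-1) ->
  time_weight 1 (fun t => (1 - t)^-1 ^+ s * w t).
Proof.
move=> tw w2; have [_ _ [a a0 wa]] := tw.
apply: (@time_weightM _ _ (2 ^+ s)) => //.
  apply: measurable_funX; apply: (measurableT_comp (@measurable_invr R)).
  exact: measurable_funB.
move=> t wt; have t2 := w2 t wt.
have t1 : 2^-1 <= 1 - t by lra.
have t1' : 0 < 1 - t by apply: lt_le_trans t1.
rewrite ger0_norm ?exprn_ge0 ?invr_ge0 ?(ltW t1')// lerXn2r ?nnegrE ?invr_ge0 ?(ltW t1')//.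
by rewrite -[leRHS]invrK lef_pV2 ?posrE.
Qed.

Lemma timeop_partials_near w p g s : time_weight 1 w -> (forall t, w t != 0 -> t <= 2^-1) ->
  Cc p -> Cc g ->
  partials s (timeop w p g) = timeop (fun t => (1 - t)^-1 ^+ size s * w t) p (partials s g).
Proof.
move=> tw w2 cp cg; elim: s => [|i s IH] /=.
  by under [in RHS]eq_fun do rewrite expr0 mul1r.
rewrite IH (timeop_partial_near i (near_weight _ tw w2) _ cp (Cc_partials s cg)).
  by congr timeop; apply/funext => t; rewrite exprS mulrA.
by move=> t wt; apply: w2; apply: contra_neq wt => ->; rewrite mulr0.
Qed.

Lemma timeop_bfin2 w p g : time_weight 1 w -> Cc p -> Bb g ->
  bfin2 leb mu (fun z : R * V => w z.1 * fwd z.1 p g z.2).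
Proof.
move=> tw cp bg; have := bfin2_time_fwd x0 rho0 ltr01 tw cp bg.
by congr bfin2; apply/funext => z; rewrite mul1r.
Qed.

Lemma timeop_integrable w p g x : time_weight 1 w -> Cc p -> Bb g ->
  leb.-integrable setT (EFin \o (fun t => w t * fwd t p g x)).
Proof. by move=> tw cp bg; apply: bfin_integrable; exact: bfin2_section2 (timeop_bfin2 tw cp bg). Qed.

Lemma timeop_Bb w p g : time_weight 1 w -> Cc p -> Bb g -> Bb (timeop w p g).
Proof.
move=> tw cp bg; have bF := bfin2_swap (timeop_bfin2 tw cp bg).
have [mI [M [D [mD D8 M0 HM]]]] := bfin2_integral1 bF.
split => //; first by exists M => x; apply: (le_trans (HM x)); rewrite ler_piMr// indicE lern1 leq_b1.
have [_ _ [a a0 wa]] := tw.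
have [_ _ /bdd_support_cube[r2 r20 gr2]] := bg.
have [sp /bdd_support_cube[r1 r10 pr1]] := cp.
exists (r1 * rho + r2 + `|x0| *+ 3) => x xr.
rewrite /timeop (_ : (fun t => _) = cst 0) ?Rintegral_cst ?mul0r//.
apply/funext => t; have [->|wt] := eqVneq (w t) 0; first by rewrite mul0r.
have := wa t wt; rewrite mul1r => /andP[at1 t1].
rewrite /fwd /nconv /conv (_ : (fun y => _) = cst 0) ?Rintegral_cst ?mul0r ?mulr0//.
apply/funext => y; have [yr|yr] := pselect (cube r2 y); last by rewrite gr2// mulr0.
rewrite (@kernel_support_bound _ _ _ _ rho0 t a r1 r2 p x y)// ?mul0r//.
  by move=> z zr; apply: pr1 => /(cubeP _ r10); rewrite leNgt zr.
exact/cubeP.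
Qed.

Lemma timeop_Cc w p g : time_weight 1 w -> Cc p -> Bb g -> Cc (timeop w p g).
Proof. by move=> tw cp bg; split; [exact: timeop_smooth|have [] := timeop_Bb tw cp bg]. Qed.

(** The kernel freed from the cut-off in [dil], with the integrability that lets the integrals over
    [t] and [y] be exchanged in the computation of the divergence. *)
Lemma timeop_kernel w p g x : time_weight 1 w -> Cc p -> Bb g ->
  bfin2 leb mu (fun z : R * V => w z.1 * ((rho * z.1)^-1 ^+ n *
    (p ((rho * z.1)^-1 *: x + (- ((1 - z.1) / (rho * z.1)) *: z.2 + - (z.1 / (rho * z.1)) *: x0)) *
     g z.2))) /\
  timeop w p g x = \int[leb]_t \int[mu]_y (w t * ((rho * t)^-1 ^+ n *
    (p ((rho * t)^-1 *: x + (- ((1 - t) / (rho * t)) *: y + - (t / (rho * t)) *: x0)) * g y))).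
Proof.
move=> tw cp bg; have [_ _ [a a0 wa]] := tw.
have bm := bfin2_mass tw bg.
have [Mp HMp] := Cc_bounded cp.
have mk : measurable_fun [set: measurableTypeR R * V] (fun z => p (dil a z *: x + shift z)).
  apply: (measurableT_comp (smooth_measurable cp.1)).
  exact: (measurable_param (measurable_dil a) measurable_shift).
have E z : p (dil a z *: x + shift z) * mass w g z = w z.1 * ((rho * z.1)^-1 ^+ n *
    (p ((rho * z.1)^-1 *: x + (- ((1 - z.1) / (rho * z.1)) *: z.2 + - (z.1 / (rho * z.1)) *: x0)) *
     g z.2)).
  rewrite /mass; have [->|wt] := eqVneq (w z.1) 0; first by rewrite !mul0r mulr0.
  rewrite /dil /shift indicE mem_set; last by have := wa z.1 wt; rewrite /= in_itv/= mul1r.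
  by rewrite mul1r; ring.
have bF : bfin2 leb mu (fun z => p (dil a z *: x + shift z) * mass w g z).
  have [mm [M [D [E' [mDE D8 E8 M0 HM]]]]] := bm; split; first exact: measurable_funM.
  exists (`|Mp| * M), D, E'; split => //; first by rewrite mulr_ge0.
  move=> t y; rewrite normrM -mulrA ler_pM//.
  by rewrite (le_trans (HMp _))// ler_norm.
split; first by move: bF; congr bfin2; apply/funext => z; rewrite E.
rewrite (timeop_param tw cp bg a0 wa) /param_int.
apply: (etrans (bfin2_product_integral bF)).
by apply: eq_Rintegral => t _; apply: eq_Rintegral => y _; rewrite E.
Qed.

End time_integral.

(** * Times near zero *)

Section near_bound.
Variables (R : realType) (n : nat).
Local Notation V := 'rV[R]_n.
Local Notation mu := (lebesgue_rV R n).
Local Notation leb := (@lebesgue_measure R).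
Implicit Types (f g h p : V -> R) (w v : R -> R).
Variables (rho : R) (x0 : V).
Hypothesis rho0 : 0 < rho.

Local Notation fwd := (fwd rho x0).
Local Notation timeop := (timeop rho x0).

Definition dyadic_indic (j : nat) (t : R) : R :=
  \1_(`]2^-1 / 2 ^+ j.+1, 2^-1 / 2 ^+ j]%classic) t.

Lemma dyadic_indicE j t :
  dyadic_indic j t = (2^-1 / 2 ^+ j.+1 < t)%R%:R - (2^-1 / 2 ^+ j < t)%R%:R.
Proof.
rewrite /dyadic_indic indicE.
have [h|h] := ltP (2^-1 / 2 ^+ j) t.
  rewrite memNset; last by rewrite /= in_itv/= [t <= _]leNgt h andbF.
  rewrite (_ : _ < t = true) ?subrr//; apply: le_lt_trans h.
  rewrite exprS invfM mulrCA ler_piMl ?mulr_ge0 ?invr_ge0 ?exprn_ge0//.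
  by rewrite invf_le1// ler1n.
rewrite subr0; congr ((nat_of_bool _)%:R); apply/idP/idP.
  by move/set_mem; rewrite /= in_itv/= => /andP[].
by move=> h'; apply/mem_set; rewrite /= in_itv/= h' h.
Qed.

Lemma dyadic_partition (N : nat) t : 2^-1 / 2 ^+ N < t <= 2^-1 ->
  \sum_(j < N) dyadic_indic j t = 1.
Proof.
move=> /andP[tN t2]; under eq_bigr do rewrite dyadic_indicE.
rewrite -(big_mkord xpredT (fun j => ((2^-1 / 2 ^+ j.+1 < t)%R%:R - (2^-1 / 2 ^+ j < t)%R%:R : R))).
rewrite (telescope_sumr (fun j => (2^-1 / 2 ^+ j < t)%R%:R : R))//.
by rewrite tN expr0 divr1 ltNge t2 subr0.
Qed.

Lemma dyadic_indic_scale j (s : R) :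
  dyadic_indic j (s / 2 ^+ j) = \1_(`]4^-1, 2^-1]%classic) s.
Proof.
have p0 : (0 : R) < 2 ^+ j by rewrite exprn_gt0.
rewrite /dyadic_indic !indicE; congr ((nat_of_bool _)%:R); apply/idP/idP => /set_mem H; apply/mem_set; move: H => /=;
  rewrite !in_itv/= exprS invfM mulrA ltr_pM2r ?invr_gt0// ler_pM2r ?invr_gt0//;
  by rewrite (_ : 2^-1 * 2^-1 = 4^-1 :> R)//; field.
Qed.

Lemma time_weight_dyadic (v : R -> R) j : measurable_fun setT v ->
  (exists W, forall t, `|v t| <= W) ->
  time_weight (2 ^+ j)^-1
    (fun s => (2 ^+ j)^-1 * (v (s / 2 ^+ j) * \1_(`]4^-1, 2^-1]%classic) s)).
Proof.
move=> mv [W vW]; split.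
- apply: measurable_funM => //; apply: measurable_funM; last exact: measurable_indic.
  by apply: (measurableT_comp mv); exact: measurable_funM.
- exists ((2 ^+ j)^-1 * W) => t; rewrite normrM ger0_norm ?invr_ge0 ?exprn_ge0//.
  rewrite ler_wpM2l ?invr_ge0 ?exprn_ge0// normrM (le_trans _ (vW (t / 2 ^+ j)))//.
  by rewrite ler_piMr// indicE ger0_norm// lern1 leq_b1.
exists ((2 ^+ j)^-1 * 4^-1); first by rewrite mulr_gt0// invr_gt0// exprn_gt0.
move=> t; rewrite indicE; case: (boolP (t \in _)) => [/set_mem/=|_]; last by rewrite !mulr0 eqxx.
rewrite in_itv/= => /andP[t4 t2] _.
have p0 : (0 : R) < 2 ^+ j by rewrite exprn_gt0.
rewrite ler_pM2l ?invr_gt0// (ltW t4)/= mulrC ler_pdivrMr// mul1r (le_trans t2)//.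
by rewrite (@le_trans _ _ 1)// ?invf_le1// ?ler1n// exprn_ege1// ler1n.
Qed.

(* substitution [t = s / 2^j] with [s] in []1/4, 1/2]] *)
Lemma timeop_dyadic (N : nat) v p g x : time_weight 1 v -> Cc p -> Bb g ->
  (forall t, v t != 0 -> 2^-1 / 2 ^+ N < t <= 2^-1) ->
  timeop v p g x = \int[leb]_s (\sum_(j < N)
    ((2 ^+ j)^-1 * (v (s / 2 ^+ j) * \1_(`]4^-1, 2^-1]%classic) s)) * fwd ((2 ^+ j)^-1 * s) p g x).
Proof.
move=> tv cp bg vN.
have [mv [W vW] _] := tv.
have iF := timeop_integrable x0 rho0 x tv cp bg.
have [mF _] := bfin2_section2 x (timeop_bfin2 x0 rho0 tv cp bg).
set F := (fun t => v t * fwd t p g x) in iF mF.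
have iFj j : leb.-integrable setT (EFin \o (fun t => dyadic_indic j t * F t)).
  apply: integrable_dom (integrable_norm_real iF) _.
    by apply: measurable_funM; [exact: measurable_indic|exact: mF].
  move=> t; rewrite normrM ler_piMl// /dyadic_indic indicE ger0_norm//.
  by rewrite lern1 leq_b1.
have -> : timeop v p g x = \int[leb]_t (\sum_(j < N) dyadic_indic j t * F t).
  apply: eq_Rintegral => t _; rewrite -mulr_suml.
  have [vt|vt] := eqVneq (v t) 0; first by rewrite /F vt mul0r mulr0.
  by rewrite dyadic_partition ?mul1r//; exact: vN.
have sumR (G : nat -> R -> R) : (forall j, leb.-integrable setT (EFin \o G j)) ->
    \int[leb]_t (\sum_(j < N) G j t) = \sum_(j < N) \int[leb]_t G j t.
  move=> iG; elim: N {vN} => [|k IH].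
    under eq_Rintegral do rewrite big_ord0.
    by rewrite big_ord0 Rintegral_cst// mul0r.
  under eq_Rintegral do rewrite big_ord_recr/=.
  rewrite big_ord_recr/= -IH RintegralD//.
  elim: k {IH} => [|k IH].
    rewrite (_ : _ \o _ = cst 0%E); first exact: integrable0.
    by apply/funext => t /=; rewrite big_ord0.
  under [X in _ \o X]eq_fun do rewrite big_ord_recr/=.
  exact: integrableD_real.
have E (j : nat) s : ((2 ^+ j)^-1 * (v (s / 2 ^+ j) * \1_(`]4^-1, 2^-1]%classic) s)) * fwd ((2 ^+ j)^-1 * s) p g x =
    (2 ^+ j)^-1 * (dyadic_indic j ((2 ^+ j)^-1 * s + 0) * F ((2 ^+ j)^-1 * s + 0)).
  rewrite addr0 -(dyadic_indic_scale j) /F [_^-1 * s]mulrC; ring.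
rewrite (sumR (fun j t => dyadic_indic j t * F t) iFj).
have iE (j : nat) : leb.-integrable setT (EFin \o (fun s => ((2 ^+ j)^-1 * (v (s / 2 ^+ j) * \1_(`]4^-1, 2^-1]%classic) s)) * fwd ((2 ^+ j)^-1 * s) p g x)).
  apply: bfin_integrable; have j0 : 0 < (2 ^+ j)^-1 :> R by rewrite invr_gt0 exprn_gt0.
  exact: bfin2_section2 (bfin2_time_fwd x0 rho0 j0 (time_weight_dyadic j mv (ex_intro _ W vW)) cp bg).
rewrite (sumR _ iE); apply: eq_bigr => j _.
have p0 : (0 : R) < 2 ^+ j by rewrite exprn_gt0.
under [RHS]eq_Rintegral => s _ do rewrite E.
have iG : leb.-integrable setT (EFin \o (fun s => dyadic_indic j ((2 ^+ j)^-1 * s + 0) * F ((2 ^+ j)^-1 * s + 0))).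
  rewrite (_ : (fun s => _ * _) = (fun s => 2 ^+ j * (((2 ^+ j)^-1 * (v (s / 2 ^+ j) * \1_(`]4^-1, 2^-1]%classic) s)) * fwd ((2 ^+ j)^-1 * s) p g x))).
    exact: integrableZ_real (iE j).
  by apply/funext => s; rewrite E (mulVKf (lt0r_neq0 p0)).
rewrite (RintegralZl _ measurableT iG).
have q0 : (2 ^+ j)^-1 != 0 :> R by rewrite invr_neq0// lt0r_neq0.
transitivity ((2 ^+ j)^-1 * (`|(2 ^+ j)^-1|^-1 * \int[leb]_t (dyadic_indic j t * F t))).
  by rewrite (gtr0_norm (_ : 0 < (2 ^+ j)^-1)) ?invr_gt0// invrK (mulKf (lt0r_neq0 p0)).
by congr (_ * _); symmetry; exact: (Rintegral_affine 0 q0 (iFj j)).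
Qed.

Lemma Bb_sum (I : Type) (r : seq I) (G : I -> V -> R) :
  (forall i, Bb (G i)) -> Bb (fun x => \sum_(i <- r) G i x).
Proof.
move=> bG; elim: r => [|i r IH].
  rewrite (_ : (fun _ => _) = 0); first exact: Bb0.
  by apply/funext => z; rewrite big_nil.
rewrite (_ : (fun _ => _) = G i \+ (fun z => \sum_(i <- r) G i z)); first exact: BbD.
by apply/funext => z; rewrite big_cons.
Qed.

(** For fixed [s] the pieces at times [t = s / 2^j] are almost orthogonal with coefficients [t v t],
    which are at most one in absolute value. Hence a bound uniform in [N], although the integral of
    [1 / t] over the support grows with [N]. *)
Lemma near_bound (N : nat) v th i g : measurable_fun setT v -> Cc th -> Bb g ->
  (forall t, `|v t| <= t^-1 * \1_(`]2^-1 / 2 ^+ N, 2^-1]%classic) t) ->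
  ip (timeop v (partial i th) g) (timeop v (partial i th) g) <= 64 * cotlar_const th i * ip g g.
Proof.
move=> mv cth bg vv.
have N0 : (0 : R) < 2^-1 / 2 ^+ N by rewrite divr_gt0// exprn_gt0.
have vN t : v t != 0 -> 2^-1 / 2 ^+ N < t <= 2^-1.
  move=> vt; have := vv t; rewrite indicE; case: (boolP (t \in _)) => [/set_mem/=|_].
    by rewrite in_itv.
  by rewrite mulr0 normr_le0 (negbTE vt).
have vW t : `|v t| <= (2^-1 / 2 ^+ N)^-1.
  apply: (le_trans (vv t)); rewrite indicE; case: (boolP (t \in _)) => [/set_mem/=|_].
    rewrite in_itv/= => /andP[h _]; rewrite mulr1 lef_pV2 ?posrE ?(ltW h)//; exact: lt_trans h.
  by rewrite mulr0 invr_ge0 ltW.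
have tv : time_weight 1 v.
  split => //; first by exists (2^-1 / 2 ^+ N)^-1.
  exists (2^-1 / 2 ^+ N) => // t /vN/andP[h1 h2]; rewrite mul1r (ltW h1)/= (le_trans h2)//.
  by rewrite invf_le1// ler1n.
have cp := Cc_partial i cth.
pose D : set (measurableTypeR R) := `]4^-1, 2^-1]%classic.
have C0 : 0 <= cotlar_const th i.
  by rewrite /cotlar_const !addr_ge0// !mulr_ge0// ?exprn_ge0// L1_ge0.
have B0 : 0 <= 64 * cotlar_const th i * ip g g by rewrite !mulr_ge0// ip_ge0.
have mD : leb D = (4^-1)%:E.
  rewrite /D lebesgue_measure_itv/= lte_fin ltf_pV2 ?posrE// ltr_nat/= -EFinD; congr EFin.
  by field.
have D8 : (leb D < +oo)%E by rewrite mD ltry.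
pose F (z : R * V) := \sum_(j < N)
    ((2 ^+ j)^-1 * (v (z.1 / 2 ^+ j) * \1_D z.1)) * fwd ((2 ^+ j)^-1 * z.1) (partial i th) g z.2.
have bF : bfin2 leb mu F.
  apply: bfin2_sum => j; have j0 : 0 < (2 ^+ j)^-1 :> R by rewrite invr_gt0 exprn_gt0.
  have H := bfin2_time_fwd x0 rho0 j0 (time_weight_dyadic j mv (ex_intro _ _ vW)) cp bg.
  exact: H.
(* Pulling [1 / s] out of the coefficients costs at most [4] on each slice, and the interval of [s]
   has length [1/4], so the weight has integral one. *)
have := @Minkowski_weight _ _ _ _ _ leb mu F D (fun=> 4) 4 4 (64 * cotlar_const th i * ip g g) bF.
have -> : \int[mu]_x ((\int[leb]_t F (t, x)) ^+ 2) = ip (timeop v (partial i th) g) (timeop v (partial i th) g).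
  by apply: eq_Rintegral => x _; rewrite -(timeop_dyadic x tv cp bg vN) expr2.
have -> : \int[leb]_t ((4 : R) * \1_D t) = 1.
  rewrite RintegralZl//; last by apply: integrable_indic_fin => //; exact: measurable_itv.
  by rewrite /Rintegral integral_indic//= ?setIT ?mD/= ?mulfV//; exact: measurable_itv.
rewrite expr1n mul1r; apply=> //.
- exact: measurable_itv.
- by move=> t x Dt; rewrite /F big1// => j _; rewrite indicE memNset// !mulr0 mul0r.
- by move=> t; rewrite !lexx.
move=> t Dt; have := Dt; rewrite /D /= in_itv/= => /andP[t4 t2].
have t0 : 0 < t by apply: lt_trans t4; rewrite invr_gt0.
have := @dyadic_sum_bound _ _ th i cth rho x0 rho0 N t (fun j => t / 2 ^+ j * v (t / 2 ^+ j)) g.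
rewrite t0 t2 => /(_ erefl) H.
have {}H := H _ bg _ erefl.
set G := fun x => _ in H.
have FG x : F (t, x) ^+ 2 = t^-1 ^+ 2 * (G x * G x).
  rewrite -expr2 -exprMn; congr (_ ^+ 2); rewrite /F /G mulr_sumr; apply: eq_bigr => j _ /=.
  rewrite indicE mem_set// mulr1 [_^-1 * t]mulrC; field.
  by rewrite !gt_eqF// exprn_gt0.
have bG : Bb G.
  apply: Bb_sum => j; apply: BbZ; apply: nconv_Bb => //.
  by rewrite invr_eq0 mulf_neq0 ?gt_eqF// divr_gt0// exprn_gt0.
under eq_Rintegral do rewrite FG.
rewrite RintegralZl//; last exact: Bb_integrable (BbM bG bG).
apply: (@le_trans _ _ (t^-1 ^+ 2 * (64 * cotlar_const th i * ip g g))).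
  rewrite ler_wpM2l ?sqr_ge0//; apply: H => j.
  have s0 : 0 < t / 2 ^+ j by rewrite divr_gt0// exprn_gt0.
  rewrite normrM gtr0_norm// mulrC -ler_pdivlMr// mul1r (le_trans (vv _))//.
  by rewrite ler_piMr ?invr_ge0 ?(ltW s0)// indicE lern1 leq_b1.
rewrite ler_wpM2r// lerXn2r ?nnegrE ?invr_ge0 ?(ltW t0)//.
by rewrite -[leRHS]invrK lef_pV2 ?posrE ?(ltW t4).
Qed.

End near_bound.

(** * Times away from zero *)

Section clamped_weight.
Variable R : realType.
Local Notation leb := (@lebesgue_measure R).
Implicit Types (k G m : R -> R).

(** The weight is [k] at [1 - t + dl], with this argument clamped to [[dl, 1 + dl]]: the shift
    avoids the singularity of [k] at zero, and the clamping gives positive bounds on the whole line,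
    as [Minkowski_weight] requires. *)
Lemma clamped_weight k G (dl : R) : 0 < dl -> measurable_fun [set: R] k ->
  (forall s : R, 0 < s -> is_derive s 1 G (k s)) ->
  (forall s : R, 0 < s -> {for s, continuous k}) ->
  (forall s s' : R, 0 < s -> s <= s' -> k s' <= k s) -> (forall s : R, 0 < s -> 0 < k s) ->
  exists m : R -> R, [/\ measurable_fun setT m,
    exists m0 m1 : R, 0 < m0 /\ forall t, m0 <= m t <= m1,
    forall t : R, 0 <= t <= 1 -> m t = k (1 - t + dl) &
    forall D : set (measurableTypeR R), measurable D -> D `<=` `[0, 1]%classic ->
      \int[leb]_t (m t * \1_D t) <= G (1 + dl) - G dl].
Proof.
move=> dl0 mk dG ck decr k0.
pose cl s := Num.max dl (Num.min (1 + dl) s).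
have cl1 s : dl <= cl s by rewrite /cl le_max lexx.
have cl0 s : 0 < cl s by exact: lt_le_trans (cl1 s).
have cl2 s : cl s <= 1 + dl by rewrite /cl ge_max ge_min lexx andbT lerDr.
have clE s : dl <= s <= 1 + dl -> cl s = s.
  by move=> /andP[h1 h2]; rewrite /cl min_r// max_r.
have mcl : measurable_fun setT cl.
  by apply: (@measurable_maxr _ _ _ _ (cst dl)) => //; exact: (@measurable_minr _ _ _ _ (cst (1 + dl))).
pose m t := k (cl (-1 * t + (1 + dl))).
have mm : measurable_fun setT m.
  apply: (measurableT_comp mk); apply: (measurableT_comp mcl).
  by apply: measurable_funD => //; exact: measurable_funM.
have mbd t : k (1 + dl) <= m t <= k dl by rewrite /m !decr//.
exists m; split => //.
- by exists (k (1 + dl)), (k dl); split => //; apply: k0; rewrite addr_gt0.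
- by move=> t /andP[t0 t1]; rewrite /m clE; [congr k; ring|apply/andP; split; lra].
move=> D mD D01.
pose I : set (measurableTypeR R) := `[dl, 1 + dl]%classic.
have mI : measurable I by exact: measurable_itv.
have I8 : (leb I < +oo)%E by exact: itv_finite.
have kcl0 s : 0 <= k (cl s) by exact/ltW/k0.
have iK : leb.-integrable setT (EFin \o (fun s => k (cl s) * \1_I s)).
  apply: bfin_integrable; split.
    by apply: measurable_funM; [exact: (measurableT_comp mk mcl)|exact: measurable_indic].
  exists (k dl), I; split => //; first exact/ltW/k0.
  by move=> s; rewrite normrM !ger0_norm// ler_wpM2r// decr.
have D1 t : \1_D t <= \1_I (-1 * t + (1 + dl)) :> R.
  rewrite !indicE; case: (boolP (t \in D)) => [/set_mem/D01/=|_]; last by rewrite ler0n.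
  rewrite in_itv/= => /andP[t0 t1]; rewrite mem_set// /I/= in_itv/=.
  by apply/andP; split; lra.
have D8 : (leb D < +oo)%E.
  apply: (@le_lt_trans _ _ (leb `[0, 1]%classic)); last exact: itv_finite.
  by apply: le_measure => //; rewrite ?inE//; exact: measurable_itv.
have iA : leb.-integrable setT (EFin \o (fun t => k (cl (-1 * t + (1 + dl))) * \1_I (-1 * t + (1 + dl)))).
  apply: bfin_integrable; split.
    apply: measurable_funM => //.
    apply: (measurableT_comp (measurable_indic mI)).
    by apply: measurable_funD => //; exact: measurable_funM.
  exists (k dl), (`[0, 1]%classic); split => //; [exact: itv_finite|exact/ltW/k0|].
  move=> t; rewrite normrM ger0_norm//; rewrite ler_pM//; first exact: decr.
  rewrite !indicE ger0_norm//; case: (boolP (_ \in I)) => [/set_mem|_]; last by rewrite ler0n.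
  rewrite /I/= in_itv/= => /andP[t0 t1]; rewrite mem_set//= in_itv/=.
  by apply/andP; split; lra.
apply: (@le_trans _ _ (\int[leb]_t (k (cl (-1 * t + (1 + dl))) * \1_I (-1 * t + (1 + dl))))).
  apply: le_Rintegral => //.
    apply: bfin_integrable; split.
      by apply: measurable_funM => //; exact: measurable_indic.
    exists (k dl), D; split => //; first exact/ltW/k0.
    move=> t; rewrite normrM [`|\1_D t|]ger0_norm// ler_wpM2r//.
    by rewrite ger0_norm ?(andP (mbd t)).2//; exact: kcl0.
  by move=> t _; rewrite ler_wpM2l//; exact: kcl0.
have n10 : (-1 : R) != 0 by rewrite oppr_eq0.
rewrite (Rintegral_affine (1 + dl) n10 iK) normrN1 invr1 mul1r.
have -> : \int[leb]_s (k (cl s) * \1_I s) = \int[leb]_(s in I) k s.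
  rewrite [RHS]Rintegral_mkcond; apply: eq_Rintegral => s _; rewrite patchE indicE.
  case: ifPn => [/set_mem Is|_]; last by rewrite mulr0.
  by rewrite mulr1 clE//; move: Is; rewrite /I/= in_itv.
rewrite /Rintegral (@continuous_FTC2 _ k G dl (1 + dl))//.
- by rewrite ltrDr.
- apply: continuous_in_subspaceT => s; rewrite inE/= in_itv/= => /andP[s1 _]; apply: ck.
  exact: lt_le_trans s1.
- have cG s : 0 < s -> {for s, continuous G}.
    move=> s0; apply: differentiable_continuous; apply/derivable1_diffP.
    by have := dG s s0; case.
  split.
  + by move=> s; rewrite in_itv/= => /andP[s1 _]; have [] := dG s (lt_trans dl0 s1).
  + by apply: cvg_at_right_filter; exact: cG.
  + by apply: cvg_at_left_filter; apply: cG; rewrite addr_gt0.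
move=> s; rewrite in_itv/= => /andP[s1 _]; rewrite derive1E.
exact: (@derive_val _ _ _ _ _ _ _ (dG s (lt_trans dl0 s1))).
Qed.

End clamped_weight.

Section far_weight.
Variable R : realType.
Local Notation leb := (@lebesgue_measure R).

Definition log_factor (n : nat) (q : R) : R :=
  1 + q `^ ((n%:R - 2) / (2 * (n%:R - 1))) * ln q `^ (n%:R / (2 * (n%:R - 1))).

Lemma log_factor_ge1 n q : 1 <= log_factor n q.
Proof. by rewrite /log_factor lerDl mulr_ge0// powR_ge0. Qed.

Lemma expR1_le4 : expR 1 <= 4 :> R.
Proof.
have h : expR (- (2^-1)) >= 2^-1 :> R.
  by apply: le_trans (expR_ge1Dx _); lra.
have -> : expR 1 = (expR (- (2^-1)))^-1 ^+ 2 :> R.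
  by rewrite -expRN opprK -expRM_natl; congr expR; field.
have h2 : (expR (- (2^-1)))^-1 <= 2 :> R by rewrite -[leRHS]invrK lef_pV2 ?posrE ?expR_gt0.
by rewrite (_ : 4 = 2 ^+ 2)//; [rewrite lerXn2r ?nnegrE ?invr_ge0 ?expR_ge0|rewrite -natrX].
Qed.

(** The logarithm in [log_factor] vanishes at [q = 1], so two ranges are needed: up to [q = exp 1]
    the power is at most [4] and the summand [1] dominates, beyond it the logarithm is at least
    one. *)
Lemma powR_le_log_factor n q : (2 <= n)%N -> 1 <= q ->
  q `^ ((n%:R - 2) / (2 * (n%:R - 1))) <= 4 * log_factor n q.
Proof.
move=> n2 q1.
have n2' : 2 <= n%:R :> R by rewrite ler_nat.
set e := (_ / _).
have e0 : 0 <= e by rewrite /e divr_ge0 ?mulr_ge0//; lra.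
have e1 : e <= 1 by rewrite /e ler_pdivrMr; lra.
have Q1 := log_factor_ge1 n q.
have [h|h] := leP q (expR 1).
  apply: (@le_trans _ _ (q `^ 1)); first by rewrite ler_powR.
  by rewrite powRr1; [have := expR1_le4; lra|lra].
have l1 : 1 <= ln q.
  by rewrite -[leLHS]expRK ler_ln ?posrE ?expR_gt0 ?(ltW h)//; lra.
have : 1 <= ln q `^ (n%:R / (2 * (n%:R - 1))).
  rewrite -[leLHS](powRr0 (ln q)) ler_powR// divr_ge0// mulr_ge0//; lra.
rewrite /log_factor -/e; set B := _ `^ _ => B1.
have A0 : 0 <= q `^ e by exact: powR_ge0.
by nra.
Qed.

(** Here [L] stands for [ln q] and [b] for [- ln (1 - t)]. Replacing [L] by [N b] on the right
    leaves [N / (N - 1) <= 3/2], which holds from [N = 3] on; this is what makes [3/4] the exponent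
    of the weight. *)
Lemma far_exponent_le1 (N e L b : R) : 2 * e * (N - 1) = N - 2 -> 3 <= N -> 0 <= e ->
  0 <= b -> N * b <= L -> N * b <= 2 * (e * L + 3 / 4 * b).
Proof.
move=> E N3 e0 b0 h.
have : 2 * e * (N * b) <= 2 * e * L by rewrite ler_wpM2l// mulr_ge0.
have : N * b * (N - 1) <= (2 * e * (N * b) + 3 / 2 * b) * (N - 1).
  rewrite [leRHS](_ : _ = b * (N * (2 * e * (N - 1)) + 3 / 2 * (N - 1))); last by ring.
  rewrite E [leLHS](_ : _ = b * (N * (N - 1))); last by ring.
  by rewrite ler_wpM2l//; lra.
rewrite ler_pM2r; last by lra.
lra.
Qed.

(** The complementary case: replacing [b] by [L / N] leaves [1 / (N - 1) <= 3 / (2 N)], the same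
    condition on [N]. *)
Lemma far_exponent_le2 (N e L b : R) : 2 * e * (N - 1) = N - 2 -> 3 <= N -> 0 <= L ->
  L <= N * b -> L <= 2 * (e * L + 3 / 4 * b).
Proof.
move=> E N3 L0 h.
have : N * (N - 1) * L <= N * (N - 1) * (2 * (e * L + 3 / 4 * b)).
  rewrite [leRHS](_ : _ = N * L * (2 * e * (N - 1)) + 3 / 2 * (N - 1) * (N * b)); last by field.
  rewrite E; have : 3 / 2 * (N - 1) * L <= 3 / 2 * (N - 1) * (N * b) by rewrite ler_wpM2l//; lra.
  have : 0 <= L * (N - 3) by rewrite mulr_ge0//; lra.
  nra.
by rewrite ler_pM2l// mulr_gt0//; lra.
Qed.

(* The weight is a multiple of [(1 - t + delta)^(-3/4)] with [delta = 1/q] if [n >= 3], and of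
   [(1 - t + delta)^-1] with [delta = q^(-1/2)] if [n = 2]. *)
Lemma far_weight (n : nat) : (2 <= n)%N -> exists2 C : R, 0 <= C & forall q : R, 1 <= q ->
  exists m : R -> R, [/\ measurable_fun setT m,
    exists m0 m1 : R, 0 < m0 /\ forall t, m0 <= m t <= m1,
    forall t : R, 0 < t < 1 -> (1 - t)^-1 ^+ n <= m t ^+ 2 \/ q <= m t ^+ 2 &
    forall D : set (measurableTypeR R), measurable D -> D `<=` `[0, 1]%classic ->
      \int[leb]_t (m t * \1_D t) <= C * log_factor n q].
Proof.
rewrite leq_eqVlt => /orP[/eqP <-|n3].
  (* For [n = 2] the weight [2 / (1 - t + delta)] has integral at most [2 ln (1 + delta) + ln q],
     hence at most [2 + ln q]. *)
  exists 4 => // q q1; have q0 : 0 < q by apply: lt_le_trans q1.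
  have sq0 : 0 < Num.sqrt q by rewrite sqrtr_gt0.
  have dl0 : 0 < (Num.sqrt q)^-1 by rewrite invr_gt0.
  have [] := @clamped_weight R (fun s => 2 * s^-1) (fun s => 2 * ln s) (Num.sqrt q)^-1 dl0.
  - by apply: measurable_funM => //; exact: measurable_invr.
  - move=> s s0; have := is_derive1_ln s0 => H.
    exact: (is_deriveZ 2 H).
  - move=> s s0; apply: cvgM; first exact: cvg_cst.
    by apply: cvgV; [rewrite gt_eqF|exact: cvg_id].
  - move=> s s' s0 ss'; rewrite ler_pM2l// lef_pV2 ?posrE//; exact: lt_le_trans ss'.
  - by move=> s s0; rewrite mulr_gt0// invr_gt0.
  move=> m [mm mb mE mI]; exists m; split => //.
    move=> t /andP[t0 t1]; rewrite mE ?(ltW t0) ?(ltW t1)//.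
    have [h|h] := leP (Num.sqrt q)^-1 (1 - t).
      have t1' : 0 < 1 - t by rewrite subr_gt0.
      have u0 : 0 < 1 - t + (Num.sqrt q)^-1 by rewrite addr_gt0.
      left; rewrite lerXn2r ?nnegrE//; [by rewrite invr_ge0 ltW|by rewrite divr_ge0// ltW|].
      by rewrite ler_pdivlMr// mulrC ler_pdivrMr//; move: h; set a := _^-1; lra.
    have t1' : 0 < 1 - t by rewrite subr_gt0.
    have u0 : 0 < 1 - t + (Num.sqrt q)^-1 by rewrite addr_gt0.
    right; rewrite -[leLHS](sqr_sqrtr (ltW q0)) lerXn2r ?nnegrE//; first by rewrite divr_ge0// ltW.
    rewrite ler_pdivlMr// -ler_pdivlMl//; move: h; set a := _^-1; lra.
  move=> D mD D01; apply: (le_trans (mI D mD D01)).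
  rewrite /log_factor subrr mul0r powRr0 mul1r.
  rewrite (_ : 2 / (2 * (2 - 1)) = 1 :> R); last by field.
  rewrite powRr1 ?ln_ge0// lnV ?posrE//.
  have lq : ln (Num.sqrt q) = 2^-1 * ln q by rewrite -powR12_sqrt ?(ltW q0)// ln_powR.
  have hq : (Num.sqrt q)^-1 <= 1.
    by rewrite invf_le1// -[leLHS](sqrtr1 R) ler_sqrt ?(ltW q0).
  have h1 : -1 < (Num.sqrt q)^-1 by apply: lt_trans dl0; lra.
  have := le_ln1Dx h1; have := ln_ge0 q1; rewrite lq; lra.
have n0 : (0 < n)%N by exact: leq_trans n3.
(* The antiderivative [8 q^e s^(1/4)] grows by at most [16 q^e], and [powR_le_log_factor]
   contributes another factor [4]. *)
exists 64 => // q q1; have q0 : 0 < q by apply: lt_le_trans q1.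
have n3' : 3 <= n%:R :> R by rewrite ler_nat.
set e := (n%:R - 2) / (2 * (n%:R - 1)) : R.
have qe0 : 0 < q `^ e by exact: powR_gt0.
have dl0 : 0 < q^-1 by rewrite invr_gt0.
have [] := @clamped_weight R (fun s => 2 * q `^ e * s `^ (4^-1 - 1)) (fun s => 8 * q `^ e * s `^ 4^-1) q^-1 dl0.
- by apply: measurable_funM => //; exact: measurable_powR.
- move=> s s0; have H := is_derive1_powR 4^-1 s0.
  rewrite (_ : 2 * _ * _ = (8 * q `^ e) *: (4^-1 * s `^ (4^-1 - 1))); first exact: is_deriveZ.
  by rewrite /GRing.scale/=; field.
- move=> s s0; apply: cvgM; first exact: cvg_cst.
  suff : {for s, continuous (fun x : R => x `^ (4^-1 - 1))} by [].
  apply: differentiable_continuous; apply/derivable1_diffP.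
  by have := is_derive1_powR (4^-1 - 1) s0; case.
- move=> s s' s0 ss'; rewrite ler_pM2l ?mulr_gt0//.
  rewrite (_ : 4^-1 - 1 = - (3 / 4) :> R); last by field.
  rewrite !powRN lef_pV2 ?posrE ?powR_gt0//; last exact: lt_le_trans ss'.
  by rewrite ge0_ler_powR// ?nnegrE ?(ltW s0)// (le_trans (ltW s0)).
- by move=> s s0; rewrite !mulr_gt0// powR_gt0.
move=> m [mm mb mE mI]; exists m; split => //.
  move=> t /andP[t0 t1]; rewrite mE ?(ltW t0) ?(ltW t1)//.
  have t1' : 0 < 1 - t by rewrite subr_gt0.
  (* The sum [1 - t + 1/q] is at most twice this maximum, and the factor [2] in the weight absorbs
     the resulting [2^(3/4)]. *)
  set s := Num.max (1 - t) q^-1.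
  have s0 : 0 < s by rewrite lt_max t1'.
  have hs : 1 - t + q^-1 <= 2 * s.
    by rewrite mulr_natl mulr2n lerD// le_max lexx ?orbT.
  have H : expR (e * ln q + 3 / 4 * - ln s) <= 2 * q `^ e * (1 - t + q^-1) `^ (4^-1 - 1).
    have powE (x y : R) : 0 < x -> x `^ y = expR (y * ln x) by move=> x0; rewrite /powR gt_eqF.
    rewrite expRD -powE//; set X := (1 - t + q^-1) `^ _.
    rewrite [leRHS](_ : _ = q `^ e * (2 * X)); last by ring.
    rewrite ler_pM2l// /X (_ : 4^-1 - 1 = - (3 / 4) :> R); last by field.
    rewrite (_ : 3 / 4 * - ln s = - (3 / 4) * ln s); last by ring.
    rewrite -powE//; apply: (@le_trans _ _ (2 * (2 * s) `^ (- (3 / 4)))); last first.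
      have s2 : 0 < 2 * s by rewrite mulr_gt0.
      have u0 : 0 < 1 - t + q^-1 by rewrite addr_gt0.
      rewrite ler_pM2l// !powRN lef_pV2 ?posrE ?powR_gt0//.
      by rewrite ge0_ler_powR// nnegrE ltW.
    rewrite powRM ?(ltW s0)// mulrA ler_peMl ?powR_ge0//.
    have h34 : 2 `^ (3 / 4) <= 2 :> R by rewrite -[leRHS](@powRr1 R 2)// ler_powR//; lra.
    by rewrite powRN ler_pdivlMr ?powR_gt0// mul1r.
  have {}H : expR (2 * (e * ln q + 3 / 4 * - ln s)) <= (2 * q `^ e * (1 - t + q^-1) `^ (4^-1 - 1)) ^+ 2.
    by rewrite expRM_natl lerXn2r ?nnegrE ?expR_ge0// !mulr_ge0// powR_ge0.
  have L0 : 0 <= ln q by exact: ln_ge0.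
  have E2 : 2 * e * (n%:R - 1) = n%:R - 2 by rewrite /e; field; rewrite gt_eqF//; lra.
  have e0 : 0 <= e by rewrite /e divr_ge0 ?mulr_ge0//; lra.
  have [h|h] := leP q^-1 (1 - t); last first.
    right; apply: le_trans H; rewrite -[leLHS](lnK (_ : q \is Num.pos)) ?posrE// ler_expR.
    rewrite /s max_r ?(ltW h)// lnV ?posrE// opprK; nra.
  have sE : s = 1 - t by rewrite /s max_l.
  have b0 : 0 <= - ln s by rewrite oppr_ge0 ln_le0// sE; lra.
  have [hb|hb] := leP (n%:R * - ln s) (ln q).
    left; apply: le_trans H.
    rewrite (_ : (1 - t)^-1 = expR (- ln s)); last by rewrite sE expRN lnK ?posrE.
    rewrite -expRM_natl ler_expR; move: (ln q) (- ln s) L0 b0 hb => L b L0 b0 hb.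
    by apply: (far_exponent_le1 E2).
  right; apply: le_trans H; rewrite -[leLHS](lnK (_ : q \is Num.pos)) ?posrE// ler_expR.
  move: (ln q) (- ln s) L0 b0 hb => L b L0 b0 hb.
  by apply: (far_exponent_le2 E2); rewrite // ltW.
move=> D mD D01; apply: (le_trans (mI D mD D01)).
have h1 : (1 + q^-1) `^ 4^-1 <= 2.
  apply: (@le_trans _ _ (2 `^ 4^-1)).
    rewrite ge0_ler_powR ?nnegrE ?addr_ge0 ?(ltW dl0)//.
    by have : q^-1 <= 1; [rewrite invf_le1|lra].
  by rewrite -[leRHS](@powRr1 R 2)// ler_powR//; lra.
have h2 := powR_ge0 q^-1 4^-1.
have h3 := powR_le_log_factor (ltnW n3) q1; rewrite -/e in h3.
nra.
Qed.

End far_weight.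

(** * Norms at a fixed time *)

Section far_bound.
Variables (R : realType) (n : nat).
Local Notation V := 'rV[R]_n.
Local Notation mu := (lebesgue_rV R n).
Local Notation leb := (@lebesgue_measure R).
Implicit Types (f g h p : V -> R) (w v m : R -> R).
Variables (rho : R) (x0 : V).
Hypothesis rho0 : 0 < rho.

Local Notation fwd := (fwd rho x0).
Local Notation timeop := (timeop rho x0).

Lemma fwd_Bb t p g : 0 < t -> Cc p -> Bb g -> Bb (fwd t p g).
Proof. by move=> t0 cp bg; apply: nconv_Bb => //; rewrite invr_eq0 mulf_neq0 ?gt_eqF. Qed.

Lemma fwd_Schur t p g : 0 < t < 1 -> Cc p -> Bb g ->
  ip (fwd t p g) (fwd t p g) <= (1 - t)^-1 ^+ n * L1 p ^+ 2 * ip g g.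
Proof.
move=> /andP[t0 t1] cp bg; have rt0 : 0 < rho * t by rewrite mulr_gt0.
apply: nconv_bound => //; first by rewrite subr_gt0.
rewrite normrN [X in X * _]gtr0_norm ?invr_gt0// gtr0_norm ?divr_gt0 ?subr_gt0//.
by field; rewrite !gt_eqF.
Qed.

Lemma timeop_Minkowski w p g (D : set (measurableTypeR R)) m (m0 m1 B : R) :
  time_weight 1 w -> Cc p -> Bb g -> measurable D -> D `<=` `[0, 1]%classic ->
  (forall t, `|w t| <= \1_D t) ->
  measurable_fun setT m -> 0 < m0 -> (forall t, m0 <= m t <= m1) -> 0 <= B ->
  (forall t, D t -> w t != 0 -> ip (fwd t p g) (fwd t p g) <= m t ^+ 2 * B) ->
  ip (timeop w p g) (timeop w p g) <= (\int[leb]_t (m t * \1_D t)) ^+ 2 * B.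
Proof.
move=> tw cp bg mD D01 wD mm m00 mb B0 H.
have bF := timeop_bfin2 x0 rho0 tw cp bg.
have D8 : (leb D < +oo)%E.
  apply: (@le_lt_trans _ _ (leb `[0, 1]%classic)); last exact: itv_finite.
  by apply: le_measure => //; rewrite ?inE//; exact: measurable_itv.
have -> : ip (timeop w p g) (timeop w p g) =
    \int[mu]_x ((\int[leb]_t (w (t, x).1 * fwd (t, x).1 p g (t, x).2)) ^+ 2).
  by apply: eq_Rintegral => x _; rewrite expr2.
apply: (Minkowski_weight bF mD D8 _ mm m00 mb B0).
  move=> t x Dt; have := wD t; rewrite indicE memNset// normr_le0 => /eqP wt.
  by rewrite /= wt mul0r.
move=> t Dt /=.
have [wt|wt] := eqVneq (w t) 0.
  under eq_Rintegral do rewrite wt mul0r expr0n/=.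
  by rewrite Rintegral_cst// mul0r mulr_ge0// sqr_ge0.
have [_ _ [a a0 wa]] := tw; have := wa t wt; rewrite mul1r => /andP[at1 _].
have t0 := lt_le_trans a0 at1.
have bf := fwd_Bb t0 cp bg.
have -> : \int[mu]_x ((w t * fwd t p g x) ^+ 2) = w t ^+ 2 * ip (fwd t p g) (fwd t p g).
  rewrite /ip -RintegralZl//; last exact: Bb_integrable (BbM bf bf).
  by apply: eq_Rintegral => x _; rewrite exprMn [_ ^+ 2 in RHS]expr2.
apply: le_trans (H t Dt wt).
rewrite ler_piMl ?ip_ge0// -real_normK ?num_real// expr_le1// (le_trans (wD t))//.
Qed.

(** Minkowski's inequality with constant weight and no use of orthogonality. It measures the effect
    of lowering the truncation, once all derivatives act on a fixed smooth function. *)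
Lemma timeop_short w p g (b : R) : time_weight 1 w -> Cc p -> Bb g -> 0 <= b <= 2^-1 ->
  (forall t, `|w t| <= \1_(`[0, b]%classic) t) ->
  ip (timeop w p g) (timeop w p g) <= b ^+ 2 * (2 ^+ n * L1 p ^+ 2 * ip g g).
Proof.
move=> tw cp bg /andP[b0 b2] wb.
have mI : measurable (`[0, b]%classic : set (measurableTypeR R)) by exact: measurable_itv.
have mb : leb `[0, b]%classic = b%:E.
  rewrite lebesgue_measure_itv/= lte_fin; case: ltP => h /=; first by rewrite oppr0 adde0.
  by congr EFin; apply/eqP; rewrite eq_le h b0.
have := @timeop_Minkowski w p g `[0, b]%classic (fun=> 1) 1 1 (2 ^+ n * L1 p ^+ 2 * ip g g) tw cp bg mI.
have -> : \int[leb]_t ((1 : R) * \1_(`[0, b]%classic) t) = b.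
  rewrite RintegralZl//; last by apply: integrable_indic_fin => //; exact: itv_finite.
  by rewrite mul1r /Rintegral integral_indic// setIT [X in fine X](_ : _ = b%:E).
apply => //.
- move=> t /=; rewrite !in_itv/= => /andP[-> tb]; rewrite (le_trans tb)// (le_trans b2)//.
  by rewrite invf_le1// ler1n.
- by move=> t; rewrite !lexx.
- by rewrite mulr_ge0 ?ip_ge0// mulr_ge0 ?sqr_ge0// exprn_ge0.
move=> t /=; rewrite in_itv/= => /andP[t0 tb] wt.
have [_ _ [a a0 wa]] := tw; have := wa t wt; rewrite mul1r => /andP[at1 _].
have {}t0 := lt_le_trans a0 at1.
have t1 : 2^-1 <= 1 - t by have := le_trans tb b2; lra.
have t1' : 0 < 1 - t by exact: lt_le_trans t1.
apply: le_trans (@fwd_Schur t p g _ cp bg) _; first by rewrite t0/=; lra.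
rewrite expr1n mul1r ler_wpM2r ?ip_ge0// ler_wpM2r ?sqr_ge0//.
rewrite lerXn2r ?nnegrE ?invr_ge0 ?(ltW t1')//.
by rewrite -[leRHS]invrK lef_pV2 ?posrE.
Qed.

Definition far_const p : R := 2 ^+ n * (L1 p ^+ 2 + 4 ^+ n * ip p p).

Lemma far_const_ge0 p : 0 <= far_const p.
Proof. by rewrite /far_const mulr_ge0 ?exprn_ge0// addr_ge0 ?sqr_ge0// mulr_ge0 ?ip_ge0// exprn_ge0. Qed.

(** The Schur test gives [(1 - t)^-n]. For [t > 1/2] the Hilbert-Schmidt bound gives a multiple of
    [|Om| / (rho t)^n], hence of [q]; for [t <= 1/2], where that bound degenerates, the Schur bound
    is at most [2^n], so it is below [2^n q] as well. *)
Lemma fwd_min (Om : set V) (q M : R) t p g : 0 < t < 1 -> Cc p -> Bb g ->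
  measurable Om -> Bb (\1_Om : V -> R) -> (forall x, ~ Om x -> g x = 0) ->
  1 <= q -> vol Om <= (2 * rho) ^+ n * q -> 0 <= M ->
  (1 - t)^-1 ^+ n <= M \/ q <= M ->
  ip (fwd t p g) (fwd t p g) <= M * (far_const p * ip g g).
Proof.
move=> t01 cp bg mOm bOm gOm q1 volq M0 H.
have /andP[t0 t1] := t01.
have t1' : 0 < 1 - t by rewrite subr_gt0.
have ig := ip_ge0 g; have ipp := ip_ge0 p.
have S := fwd_Schur t01 cp bg.
have n2 : 1 <= 2 ^+ n :> R by rewrite exprn_ege1// ler1n.
have n4 : 0 <= 4 ^+ n :> R by rewrite exprn_ge0.
have K0 : L1 p ^+ 2 <= L1 p ^+ 2 + 4 ^+ n * ip p p by rewrite lerDl mulr_ge0.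
have K1 : 4 ^+ n * ip p p <= L1 p ^+ 2 + 4 ^+ n * ip p p by rewrite lerDr sqr_ge0.
have K2 : 0 <= L1 p ^+ 2 + 4 ^+ n * ip p p by apply: le_trans K0; exact: sqr_ge0.
have fromSchur : (1 - t)^-1 ^+ n <= 2 ^+ n * M ->
    ip (fwd t p g) (fwd t p g) <= M * (far_const p * ip g g).
  move=> h; apply: (le_trans S); rewrite /far_const.
  rewrite [leRHS](_ : _ = 2 ^+ n * M * (L1 p ^+ 2 + 4 ^+ n * ip p p) * ip g g); last by ring.
  rewrite ler_wpM2r//.
  by rewrite ler_pM ?sqr_ge0// exprn_ge0// invr_ge0 ltW.
case: H => [h|h].
  by apply: fromSchur; apply: (le_trans h); rewrite ler_peMl.
have [t2|t2] := leP t 2^-1.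
  apply: fromSchur; apply: (@le_trans _ _ (2 ^+ n)); last by rewrite ler_peMr ?exprn_ge0// (le_trans q1).
  rewrite lerXn2r ?nnegrE ?invr_ge0 ?(ltW t1')//.
  by rewrite -[leRHS]invrK lef_pV2 ?posrE//; lra.
have rt0 : 0 < rho * t by rewrite mulr_gt0.
rewrite /fwd /nconv ipZ; last by apply: conv_Bb => //; rewrite gt_eqF ?invr_gt0.
have HS := @conv_L2_HS R n p (rho * t)^-1 (- ((1 - t) / (rho * t))) (- (t / (rho * t)) *: x0) g Om.
have {}HS := HS _ _ (Cc_Bb cp) bg mOm bOm gOm.
apply: (@le_trans _ _ (((rho * t)^-1 ^+ n) ^+ 2 * (`|(rho * t)^-1|^-1 ^+ n * (\int[mu]_z p z ^+ 2) * vol Om * ip g g))).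
  rewrite ler_wpM2l ?sqr_ge0//; apply: HS; first by rewrite gt_eqF ?invr_gt0.
  by rewrite oppr_eq0 mulf_neq0 ?invr_eq0 ?gt_eqF.
have -> : \int[mu]_z p z ^+ 2 = ip p p by apply: eq_Rintegral => z _; rewrite expr2.
rewrite gtr0_norm ?invr_gt0// invrK.
rewrite (_ : _ * _ = (rho * t)^-1 ^+ n * vol Om * (ip p p * ip g g)); last first.
  rewrite expr2 exprVn; field.
  by rewrite expf_neq0// gt_eqF.
apply: (@le_trans _ _ (4 ^+ n * q * (ip p p * ip g g))).
  rewrite ler_wpM2r ?mulr_ge0// (le_trans (ler_wpM2l _ volq)) ?exprn_ge0 ?invr_ge0 ?(ltW rt0)//.
  rewrite mulrA ler_wpM2r ?(le_trans _ q1)// -exprMn.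
  rewrite lerXn2r ?nnegrE ?mulr_ge0 ?invr_ge0 ?(ltW rho0) ?(ltW rt0)//.
  rewrite (_ : _ * _ = 2 / t); last by field; rewrite !gt_eqF.
  by rewrite ler_pdivrMr//; lra.
rewrite /far_const (_ : 4 ^+ n * q * _ = q * (4 ^+ n * ip p p * ip g g)); last by ring.
rewrite ler_pM ?mulr_ge0 ?(le_trans _ q1)// ler_wpM2r//.
by rewrite (le_trans K1)// ler_peMl.
Qed.

End far_bound.

Lemma far_bound (R : realType) (n : nat) : (2 <= n)%N -> exists2 C : R, 0 <= C &
  forall (rho : R) (x0 : 'rV[R]_n) (Om : set 'rV[R]_n) (q : R) (w : R -> R) (p g : 'rV[R]_n -> R),
  0 < rho ->
  time_weight 1 w -> Cc p -> Bb g ->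
  measurable Om -> Bb (\1_Om : 'rV[R]_n -> R) -> (forall x, ~ Om x -> g x = 0) ->
  1 <= q -> vol Om <= (2 * rho) ^+ n * q ->
  (forall t, `|w t| <= \1_(`]0, 1[%classic) t) ->
  ip (timeop rho x0 w p g) (timeop rho x0 w p g) <= (C * log_factor n q) ^+ 2 * (far_const p * ip g g).
Proof.
move=> n2; have [C C0 HC] := far_weight R n2.
exists C => // rho x0 Om q w p g rho0 tw cp bg mOm bOm gOm q1 volq wD.
have [m [mm [m0 [m1 [m00 mb]]] mE mI]] := HC q q1.
have mD : measurable (`]0, 1[%classic : set (measurableTypeR R)) by exact: measurable_itv.
have D01 : `]0, 1[%classic `<=` (`[0, 1]%classic : set R).
  by move=> t /=; rewrite !in_itv/= => /andP[h1 h2]; rewrite !ltW.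
have B0 : 0 <= far_const p * ip g g by rewrite mulr_ge0 ?far_const_ge0// ip_ge0.
have := timeop_Minkowski rho0 tw cp bg mD D01 wD mm m00 mb B0.
move=> /(_ x0) H; apply: le_trans (H _) _.
  move=> t /=; rewrite in_itv/= => t01 _.
  by apply: (@fwd_min R n rho x0 rho0 Om q (m t ^+ 2) t p g) => //; [exact: sqr_ge0|exact: mE].
rewrite ler_wpM2r// lerXn2r ?nnegrE//; last exact: mI.
  apply: Rintegral_ge0 => t _; rewrite mulr_ge0//.
  by have /andP[h _] := mb t; exact: le_trans (ltW m00) h.
by rewrite mulr_ge0// (le_trans _ (log_factor_ge1 n q)).
Qed.



(** * A bump function *)

Section flat_function.
Variable R : realType.
Implicit Types (p : {poly R}) (s r : R).

(* [p(1/s) exp(-1/s)] on [s > 0], extended by [0]: this family is stable under derivation *)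
Definition flat p s : R := if 0 < s then p.[s^-1] * expR (- s^-1) else 0.

(** The free exponent [k] carries the induction on [p]: a factor [X] in the polynomial is absorbed
    by raising [k]. *)
Lemma poly_exp_bound p k : exists2 C, 0 <= C & forall r, 0 <= r -> r ^+ k * `|p.[r]| * expR (- r) <= C.
Proof.
elim/poly_ind: p k => [|p c IH] k.
  by exists 0 => // r r0; rewrite horner0 normr0 mulr0 mul0r.
have [C C0 HC] := IH k.+1.
have cE r : 0 <= r -> r ^+ k * expR (- r) <= k`!%:R + 1.
  move=> r0; rewrite expRN ler_pdivrMr ?expR_gt0//.
  case: k {HC} => [|k]; first by rewrite expr0 fact0; have := expR_ge1Dx r; lra.
  have := expR_ge1Dxn k r0; have f0 : 0 < (k.+1)`!%:R :> R by rewrite ltr0n fact_gt0.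
  have e0 := expR_gt0 r; rewrite -(ler_pM2l f0) mulrDr mulr1 mulrCA mulfV ?gt_eqF// mulr1.
  rewrite mulrDl mul1r; lra.
exists (C + `|c| * (k`!%:R + 1)); first by rewrite addr_ge0// mulr_ge0// addr_ge0.
move=> r r0; rewrite hornerMXaddC.
apply: (@le_trans _ _ (r ^+ k.+1 * `|p.[r]| * expR (- r) + `|c| * (r ^+ k * expR (- r)))).
  rewrite [leRHS](_ : _ = r ^+ k * (`|p.[r]| * r + `|c|) * expR (- r)); last by rewrite exprSr; ring.
  rewrite ler_wpM2r ?expR_ge0// ler_wpM2l ?exprn_ge0// (le_trans (ler_normD _ _))//.
  by rewrite normrM (ger0_norm r0).
by rewrite lerD ?HC// ler_wpM2l// cE.
Qed.

Lemma flat_linear_bound p : exists2 C, 0 <= C & forall s, `|flat p s| <= C * `|s|.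
Proof.
have [C C0 HC] := poly_exp_bound p 1.
exists C => // s; rewrite /flat; case: ifPn => [s0|_]; last by rewrite normr0 mulr_ge0.
rewrite [`|s|]gtr0_norm// -ler_pdivrMr// normrM (ger0_norm (expR_ge0 _)).
rewrite mulrC mulrA -[_^-1]expr1; apply: HC.
by rewrite invr_ge0 ltW.
Qed.

(** For [s > 0] this is the chain rule with [1/s] differentiated to [- s^-2]. At zero the difference
    quotient is [flat (p * 'X)], which is continuous there by the linear bound, so Caratheodory's
    criterion applies. *)
Lemma is_derive_flat p s : is_derive s 1 (flat p) (flat ('X^2 * (p - p^`())) s).
Proof.
have [s0|s0|->] := ltgtP s 0.
- rewrite {2}/flat ltNge (ltW s0)/=.
  apply: (@near_eq_is_derive _ _ _ (cst 0)).
  near=> z; rewrite /flat ltNge ltW//; near: z.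
  exact: lt_nbhsl.
- have H : is_derive s 1 (fun z : R => p.[z^-1] * expR (- z^-1)) (flat ('X^2 * (p - p^`())) s).
    have sn0 : s != 0 by rewrite gt_eqF.
    have iV : is_derive s 1 (fun z : R => z^-1) (- s ^- 2).
      have H := @is_deriveV _ id s 1 1 sn0 (is_derive_id s 1).
      by move: H; rewrite /GRing.scale/= mulr1.
    have iN : is_derive s 1 (fun z : R => - z^-1) (s ^- 2).
      by have := is_deriveN iV; rewrite opprK.
    have i1 := is_derive1_comp (is_derive_poly p s^-1) iV.
    have i2 := @is_derive1_comp _ expR (fun z : R => - z^-1) s _ _ (is_derive_expR (- s^-1)) iN.
    have i3 := is_deriveM i1 i2.
    rewrite (_ : flat _ _ = (horner p \o GRing.inv) s *: (expR (- s^-1) / s ^+ 2) +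
      (expR \o (fun z : R => - z^-1)) s *: (p^`().[s^-1] * - s ^- 2)); first exact: i3.
    by rewrite /flat s0 /GRing.scale/= hornerM hornerXn hornerD hornerN exprVn; ring.
  apply: near_eq_is_derive H.
  near=> z; rewrite /flat (_ : 0 < z = true)//; near: z.
  exact: lt_nbhsr.
rewrite {2}/flat ltxx; apply/is_derive1_caratheodory.
exists (flat (p * 'X)); split.
- move=> z; rewrite subr0 /flat ltxx subr0; case: ifPn => z0; last by rewrite mul0r.
  by rewrite hornerMX; field; rewrite gt_eqF.
- have [C C0 HC] := flat_linear_bound (p * 'X).
  have f0 : flat (p * 'X) 0 = 0 by rewrite /flat ltxx.
  rewrite /prop_for /continuous_at f0; apply/cvgr0Pnorm_lt => e e0.
  near=> z; apply: le_lt_trans (HC z) _.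
  apply: (@le_lt_trans _ _ ((C + 1) * `|z|)); first by rewrite ler_wpM2r//; lra.
  rewrite -ltr_pdivlMl; last by lra.
  near: z; exists ((C + 1)^-1 * e) => /=.
    by rewrite mulr_gt0// invr_gt0; lra.
  by move=> z; rewrite /= sub0r normrN.
by rewrite /flat ltxx.
Unshelve. all: by end_near. Qed.

Lemma flat_continuous p : continuous (flat p).
Proof.
move=> s; apply: differentiable_continuous; apply/derivable1_diffP.
by have := is_derive_flat p s; case.
Qed.

Lemma flat1_ge0 s : 0 <= flat 1 s.
Proof. by rewrite /flat; case: ifP => // _; rewrite hornerC mul1r expR_ge0. Qed.

Lemma flat1_mono r s : 0 < r -> r <= s -> expR (- r^-1) <= flat 1 s.
Proof.
move=> r0 rs; have s0 := lt_le_trans r0 rs.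
by rewrite /flat s0 hornerC mul1r ler_expR lerN2 lef_pV2.
Qed.

End flat_function.

Section bump.
Variables (R : realType) (n : nat).
Local Notation V := 'rV[R]_n.
Local Notation mu := (lebesgue_rV R n).
Local Notation e_ i := (delta_mx ord0 i : V).

Lemma is_derive_along_line (f : V -> R) (x v : V) (a : R) :
  is_derive (0 : R) 1 (fun h : R => f (h *: v + x)) a -> is_derive x v f a.
Proof.
set phi := fun h : R => _; move=> H.
have E : (fun h : R => h^-1 *: ((phi \o shift 0) (h *: (1 : R)) - phi 0)) =
   (fun h : R => h^-1 *: ((f \o shift x) (h *: v) - f x)).
  apply/funext => h /=; congr (_ *: (_ - _)).
    by rewrite /phi addr0 [h *: 1]mulr1.
  by rewrite /phi scale0r add0r.
have [dphi ev] := H; apply: DeriveDef; first by move: dphi; rewrite /derivable E.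
by rewrite -ev /derive E.
Qed.

Lemma smooth_flat_coord (p : {poly R}) (c b : R) (i : 'I_n) :
  smooth (fun x : V => flat p (c + b * x ord0 i)).
Proof.
pose P (f : V -> R) := exists k p, f = fun x : V => k * flat p (c + b * x ord0 i).
apply: (@smooth_coind _ _ P); last first.
  by exists 1, p; apply/funext => x; rewrite mul1r.
move=> _ [k [{}p ->]].
have dF (x : V) j : is_derive x (e_ j) (fun x : V => k * flat p (c + b * x ord0 i))
    (k * (b * (i == j)%:R * flat ('X^2 * (p - p^`())) (c + b * x ord0 i))).
  apply: is_derive_along_line.
  set d : R := (i == j)%:R; have eij : e_ j ord0 i = d by rewrite mxE eqxx.
  have iA : is_derive (0 : R) 1 (fun h : R => c + b * (h * d + x ord0 i)) (b * d).
    by apply: is_derive_eq; rewrite /GRing.scale/=; ring.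
  have H0 : c + b * x ord0 i = c + b * (0 * d + x ord0 i) by rewrite mul0r add0r.
  have iF := is_derive_flat p (c + b * (0 * d + x ord0 i)).
  have iC := is_deriveZ k (@is_derive1_comp _ (flat p) (fun h : R => c + b * (h * d + x ord0 i)) 0 _ _ iF iA).
  rewrite (_ : (fun h : R => _) = (fun h : R => k * (flat p (c + b * (h * d + x ord0 i))))); last first.
    by apply/funext => h; rewrite !mxE.
  rewrite H0 [b * d * _]mulrC; exact: iC.
split.
- move=> x; apply: (@continuousM _ _ (cst k) (fun x : V => flat p (c + b * x ord0 i)) x).
    exact: cst_continuous.
  apply: (@continuous_comp _ _ _ (fun x : V => c + b * x ord0 i) (flat p)); last exact: flat_continuous.
  apply: (@continuousD _ _ _ (cst c) (fun x : V => b * x ord0 i)); first exact: cst_continuous.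
  apply: (@continuousM _ _ (cst b) (fun x : V => x ord0 i) x); first exact: cst_continuous.
  have H := @smooth_continuous _ _ _ (@smooth_coord R n i) x.
  exact: H.
- by move=> j x; have [] := dF x j.
move=> j; exists (k * (b * (i == j)%:R)), ('X^2 * (p - p^`())).
apply/funext => x; rewrite /partial; have := dF x j => H.
by rewrite (@derive_val _ _ _ _ _ _ _ H); ring.
Qed.

(** A product over the coordinates instead of a radial function: its support is a ball of the max
    norm, and smoothness reduces to one variable. *)
Definition bump (a : R) : V -> R :=
  fun x => \prod_(i < n) (flat 1 (a + 1 * x ord0 i) * flat 1 (a + -1 * x ord0 i)).

Lemma smooth_prod (I : Type) (r : seq I) (F : I -> V -> R) :
  (forall i, smooth (F i)) -> smooth (fun x => \prod_(i <- r) F i x).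
Proof.
move=> sF; elim: r => [|i r IH].
  by rewrite (_ : (fun _ => _) = fun=> 1); [exact: smooth_cst|apply/funext => x; rewrite big_nil].
rewrite (_ : (fun _ => _) = F i \* (fun x => \prod_(i <- r) F i x)).
  exact: smoothM (sF i) IH.
by apply/funext => x; rewrite big_cons.
Qed.

Lemma smooth_bump a : smooth (bump a).
Proof.
apply: smooth_prod => i.
exact: (smoothM (smooth_flat_coord 1 a 1 i) (smooth_flat_coord 1 a (-1) i)).
Qed.

Lemma bump_support a x : 0 <= a -> a < `|x| -> bump a x = 0.
Proof.
move=> a0 ax; have [i Hi] : exists i, a < `|x ord0 i|.
  apply: contrapT => H; move: ax; rewrite ltNge => /negP; apply.
  by apply: rV_norm_le => // i; rewrite leNgt; apply/negP => h; apply: H; exists i.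
rewrite /bump (bigD1 i)//=; apply/eqP; rewrite !mulf_eq0; apply/orP; left.
move: Hi; rewrite lter_normr => /orP[h|h].
  apply/orP; right; rewrite /flat ifF ?eqxx//; apply/negbTE; rewrite -leNgt; lra.
apply/orP; left; rewrite /flat ifF ?eqxx//; apply/negbTE; rewrite -leNgt; lra.
Qed.

Lemma Cc_bump a : 0 <= a -> Cc (bump a).
Proof. by move=> a0; split; [exact: smooth_bump|exists a => x; exact: bump_support]. Qed.

Lemma bump_ge0 a x : 0 <= bump a x.
Proof. by apply: prodr_ge0 => i _; rewrite mulr_ge0// flat1_ge0. Qed.

(** On the cube of half the size each of the [2 n] factors is at least [exp (- 2 / a)]. *)
Lemma integral_bump_gt0 a : 0 < a -> 0 < \int[mu]_x bump a x.
Proof.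
move=> a0; have a20 : 0 < a / 2 by rewrite divr_gt0.
pose c : R := (expR (- (a / 2)^-1) * expR (- (a / 2)^-1)) ^+ n.
have c0 : 0 < c by rewrite exprn_gt0// mulr_gt0// expR_gt0.
have ci : mu.-integrable setT (EFin \o (fun x => c * \1_(cube (a / 2)) x)).
  apply: integrableZ_real; apply: integrable_indic_fin; [exact: measurable_cube|exact: cube_finite].
apply: (@lt_le_trans _ _ (\int[mu]_x (c * \1_(cube (a / 2)) x))).
  rewrite RintegralZl//; last first.
    apply: integrable_indic_fin; [exact: measurable_cube|exact: cube_finite].
  rewrite mulr_gt0// /Rintegral integral_indic//; last exact: measurable_cube.
  by rewrite setIT [X in fine X](cube_measure n (ltW a20))/= exprn_gt0// mulr_gt0.
apply: le_Rintegral => //; first exact: Bb_integrable (Cc_Bb (Cc_bump (ltW a0))).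
move=> x _; rewrite indicE; case: (boolP (x \in _)) => [/set_mem xc|_]; last by rewrite mulr0 bump_ge0.
rewrite mulr1 /c /bump -[X in _ ^+ X]card_ord -prodr_const; apply: ler_prod => i _.
rewrite mulr_ge0 ?expR_ge0//=; have := xc i; rewrite /= in_itv/= => /andP[h1 h2].
by rewrite ler_pM ?expR_ge0// flat1_mono//; lra.
Qed.

Lemma bump_exists (a : R) : 0 < a -> exists om : V -> R,
  [/\ Cc om, forall x, a < `|x| -> om x = 0 & \int[mu]_x om x = 1].
Proof.
move=> a0; have i0 := integral_bump_gt0 a0.
have cb := Cc_bump (ltW a0).
exists (fun x => (\int[mu]_x bump a x)^-1 * bump a x); split.
- exact: CcZ.
- by move=> x ax; rewrite bump_support ?mulr0// ltW.
by rewrite RintegralZl//; [rewrite mulVf// gt_eqF|exact: Bb_integrable (Cc_Bb cb)].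
Qed.

End bump.

(** * The Bogovskii operator *)

Section kernel_ftc.
Variables (R : realType) (n : nat).
Local Notation V := 'rV[R]_n.
Local Notation leb := (@lebesgue_measure R).
Local Notation e_ i := (delta_mx ord0 i : V).

Lemma is_derive_scaled_line (om : V -> R) (b v : V) (sg : R) : smooth om ->
  is_derive sg 1 (fun sg : R => sg ^+ n * om (b + sg *: v))
    (n%:R * sg ^+ n.-1 * om (b + sg *: v) +
     sg ^+ n * \sum_i v ord0 i * partial i om (b + sg *: v)).
Proof.
move=> so.
have dd x u : is_derive x u om (\sum_i u ord0 i * partial i om x).
  apply: is_derive_directional => [i y|i]; first exact: smooth_derivable.
  exact: smooth_continuous (smooth_partial i so).
have dv x : derivable om x v by have [] := dd x v.
have H1 := is_derive_line (dv (b + sg *: v)).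
rewrite (@derive_val _ _ _ _ _ _ _ (dd (b + sg *: v) v)) in H1.
have H2 := is_deriveX n (is_derive_id sg 1).
have H3 := is_deriveM H2 H1.
rewrite (_ : _ + _ = (id ^+ n) sg *: (\sum_i v ord0 i * partial i om (b + sg *: v)) +
  om (b + sg *: v) *: ((n%:R * id sg ^+ n.-1) *: 1)).
  rewrite (_ : (fun sg : R => _) = (id : R -> R) ^+ n * (fun s : R => om (b + s *: v))); first exact: H3.
  by apply/funext => s; rewrite /GRing.mul/= fctE.
by rewrite /GRing.scale/= fctE; ring.
Qed.

(* Fundamental theorem of calculus for the kernel [s^n om (b + s v)] with [s = (rho t)^-1] *)
Lemma kernel_ftc (om : V -> R) (b v : V) (rho ep : R) : 0 < rho -> 0 < ep < 1 -> smooth om ->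
  \int[leb]_t (\1_(`]ep, 1[%classic) t * (rho * (rho * t)^-1 ^+ 2 *
    (n%:R * (rho * t)^-1 ^+ n.-1 * om (b + (rho * t)^-1 *: v) +
     (rho * t)^-1 ^+ n * \sum_i v ord0 i * partial i om (b + (rho * t)^-1 *: v)))) =
  (rho * ep)^-1 ^+ n * om (b + (rho * ep)^-1 *: v) - rho^-1 ^+ n * om (b + rho^-1 *: v).
Proof.
move=> rho0 /andP[ep0 ep1] so.
pose H sg := sg ^+ n * om (b + sg *: v).
pose dH sg := n%:R * sg ^+ n.-1 * om (b + sg *: v) +
     sg ^+ n * \sum_i v ord0 i * partial i om (b + sg *: v).
have iH (sg : R) : is_derive sg 1 H (dH sg) by exact: is_derive_scaled_line.
have cdH : continuous dH.
  pose g := fun z : V => \sum_i v ord0 i * partial i om z.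
  have sg : smooth g by apply: smooth_sum => i; exact: smoothZ (smooth_partial i so).
  have lc (h : V -> R) : smooth h -> continuous (fun s : R => h (b + s *: v)).
    move=> sh; apply: line_continuous => y.
    have : is_derive y v h (\sum_i v ord0 i * partial i h y).
      apply: is_derive_directional => [i z|i]; first exact: smooth_derivable.
      exact: smooth_continuous (smooth_partial i sh).
    by case.
  move=> s; apply: (@continuousD _ _ _ (fun s : R => n%:R * s ^+ n.-1 * om (b + s *: v)) (fun s : R => s ^+ n * g (b + s *: v))).
    apply: (@continuousM _ _ (fun s : R => n%:R * s ^+ n.-1)); last exact: lc.
    apply: (@continuousM _ _ (cst n%:R)); first exact: cst_continuous.
    exact: exprn_continuous.
  apply: (@continuousM _ _ (fun s : R => s ^+ n)); last exact: lc.
  exact: exprn_continuous.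
have iS (t : R) : 0 < t -> is_derive t 1 (fun t : R => (rho * t)^-1) (- (rho * (rho * t)^-1 ^+ 2)).
  move=> t0; have rt0 : rho * t != 0 by rewrite mulf_neq0// gt_eqF.
  have := @is_deriveV _ (fun t => rho * t) t _ 1 rt0 (is_deriveZ rho (is_derive_id t 1)).
  rewrite (_ : _ *: (rho *: 1) = - (rho * (rho * t)^-1 ^+ 2))//.
  by rewrite /GRing.scale/= mulr1 exprVn mulNr mulrC.
pose F t := - H ((rho * t)^-1).
pose f t := rho * (rho * t)^-1 ^+ 2 * dH ((rho * t)^-1).
have iF (t : R) : 0 < t -> is_derive t 1 F (f t).
  move=> t0; have := is_deriveN (@is_derive1_comp _ H (fun t : R => (rho * t)^-1) t _ _ (iH _) (iS t t0)).
  rewrite (_ : - (_ * _) = f t)//.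
  by rewrite /f mulrN opprK mulrC.
have cS (t : R) : 0 < t -> {for t, continuous (fun t : R => (rho * t)^-1)}.
  move=> t0; apply: differentiable_continuous; apply/derivable1_diffP.
  by have := iS t t0; case.
have cf (t : R) : 0 < t -> {for t, continuous f}.
  move=> t0; apply: (@continuousM _ _ (fun t : R => rho * (rho * t)^-1 ^+ 2)).
    apply: (@continuousM _ _ (cst rho)); first exact: cst_continuous.
    apply: (@continuous_comp _ _ _ (fun t : R => (rho * t)^-1) (fun s : R => s ^+ 2)).
      exact: cS.
    exact: exprn_continuous.
  apply: (@continuous_comp _ _ _ (fun t : R => (rho * t)^-1) dH); first exact: cS.
  exact: cdH.
have cF (t : R) : 0 < t -> {for t, continuous F}.
  move=> t0; apply: differentiable_continuous; apply/derivable1_diffP.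
  by have := iF t t0; case.
have wf : {within `[ep, 1]%classic, continuous f}.
  apply: continuous_in_subspaceT => t; rewrite inE/= in_itv/= => /andP[t1 _].
  exact/cf/(lt_le_trans ep0).
have H1 : (\int[leb]_(t in `[ep, 1%R]) (f t)%:E)%E = ((F 1)%:E - (F ep)%:E)%E.
  apply: continuous_FTC2 => //.
  - split.
    + by move=> t; rewrite in_itv/= => /andP[t1 _]; have [] := iF t (lt_trans ep0 t1).
    + by apply: cvg_at_right_filter; exact: cF.
    + by apply: cvg_at_left_filter; exact: cF.
  - move=> t; rewrite in_itv/= => /andP[t1 _]; rewrite derive1E.
    exact: (@derive_val _ _ _ _ _ _ _ (iF t (lt_trans ep0 t1))).
have mf : measurable_fun `]ep, 1[%classic f.
  apply: (@measurable_funS _ _ _ _ `[ep, 1]%classic) => //; first exact: subset_itv_oo_cc.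
  by apply: subspace_continuous_measurable_fun => //; exact: measurable_itv.
transitivity (\int[leb]_(t in `]ep, 1[) f t).
  rewrite [RHS]Rintegral_mkcond; apply: eq_Rintegral => t _; rewrite patchE indicE.
  by case: ifP => _; rewrite ?mul1r ?mul0r.
rewrite /Rintegral -(@integral_itv_bndoo _ ep 1 (fun t => (f t)%:E) true false); last exact/measurable_EFinP.
rewrite H1 /= /F /H mulr1; ring.
Qed.

End kernel_ftc.

Section bogovskii.
Variables (R : realType) (n : nat).
Local Notation V := 'rV[R]_n.
Local Notation mu := (lebesgue_rV R n).
Local Notation leb := (@lebesgue_measure R).
Local Notation e_ i := (delta_mx ord0 i : V).
Implicit Types (f g h p : V -> R) (w v : R -> R).
Variables (om : V -> R) (rho : R) (x0 : V).
Hypotheses (com : Cc om) (rho0 : 0 < rho).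

Local Notation fwd := (fwd rho x0).
Local Notation timeop := (timeop rho x0).

Definition coord_mul (c : V) (i : 'I_n) f : V -> R := fun y => (y ord0 i - c ord0 i) * f y.

(* With [z = (x - (1-t) y - t x0) / (rho t)] the factor [(x - y) / t] of the kernel is
   [rho z - (y - x0)]: this is where the two terms come from. *)
Definition bogovskii w f (j : 'I_n) : V -> R :=
  fun x => rho * timeop w (coord_mul 0 j om) f x - timeop w om (coord_mul x0 j f) x.

Lemma smooth_coord_sub (c : V) i : smooth (fun y : V => y ord0 i - c ord0 i).
Proof. have H := smoothB (@smooth_coord R n i) (@smooth_cst R n (c ord0 i)); exact: H. Qed.

Lemma coord_mul_Cc c i f : Cc f -> Cc (coord_mul c i f).
Proof. move=> cf; exact: CcM_smooth (smooth_coord_sub c i) cf. Qed.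

Lemma coord_mul_Bb c i f : Bb f -> Bb (coord_mul c i f).
Proof.
move=> [mf [M HM] /bdd_support_cube[r r0 fr]]; split.
- apply: measurable_funM => //; apply: measurable_funB => //; exact: measurable_coord.
- exists ((r + `|c ord0 i|) * M) => x; rewrite /coord_mul.
  have M0 : 0 <= M by exact: le_trans (HM 0).
  have [xr|xr] := pselect (cube r x); last by rewrite fr// mulr0 normr0 mulr_ge0// addr_ge0.
  rewrite normrM ler_pM//; apply: (le_trans (ler_normB _ _)); rewrite lerD2r.
  by apply: le_trans (coord_le_norm x i) _; apply/(cubeP _ r0).
by exists r => x rx; rewrite /coord_mul fr ?mulr0// => /(cubeP _ r0); rewrite leNgt rx.
Qed.

Lemma bogovskii_Cc w f j : time_weight 1 w -> Bb f -> Cc (bogovskii w f j).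
Proof.
move=> tw bf.
have c1 := timeop_Cc x0 rho0 tw (coord_mul_Cc 0 j com) bf.
have c2 := timeop_Cc x0 rho0 tw com (coord_mul_Bb x0 j bf).
have := CcD (CcZ rho c1) (CcZ (-1) c2); congr Cc; apply/funext => x.
by rewrite /bogovskii/= mulN1r.
Qed.

Lemma bogovskii_partials w f j s : time_weight 1 w -> Bb f ->
  partials s (bogovskii w f j) = (fun x => rho * partials s (timeop w (coord_mul 0 j om) f) x
    - partials s (timeop w om (coord_mul x0 j f)) x).
Proof.
move=> tw bf.
have c1 := timeop_smooth x0 rho0 tw (coord_mul_Cc 0 j com) bf.
have c2 := timeop_smooth x0 rho0 tw com (coord_mul_Bb x0 j bf).
elim: s => [|i s IH] //=; rewrite IH.
have d1 x : derivable (partials s (timeop w (coord_mul 0 j om) f)) x (e_ i).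
  exact: smooth_derivable (smooth_partials s c1).
have d2 x : derivable (partials s (timeop w om (coord_mul x0 j f))) x (e_ i).
  exact: smooth_derivable (smooth_partials s c2).
have dZ x : derivable (fun x => rho * partials s (timeop w (coord_mul 0 j om) f) x) x (e_ i).
  exact: smooth_derivable (smoothZ rho (smooth_partials s c1)).
have H := partialB dZ d2; rewrite (partialZ rho d1) in H; exact: H.
Qed.

Lemma bfin2_iint_sum (I : Type) (r : seq I) (F : I -> R * V -> R) :
  (forall i, bfin2 leb mu (F i)) ->
  \int[leb]_t \int[mu]_y (\sum_(i <- r) F i (t, y)) = \sum_(i <- r) \int[leb]_t \int[mu]_y F i (t, y).
Proof.
move=> bF; elim: r => [|i r IH].
  rewrite big_nil; under eq_Rintegral do under eq_Rintegral do rewrite big_nil.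
  by under eq_Rintegral do rewrite Rintegral_cst// mul0r; rewrite Rintegral_cst// mul0r.
have bS := bfin2_sum r bF.
under eq_Rintegral do under eq_Rintegral do rewrite big_cons.
rewrite big_cons -IH -RintegralD//; [|exact: bfin_integrable (bfin2_integral1 (bF i))|exact: bfin_integrable (bfin2_integral1 bS)].
apply: eq_Rintegral => t _; rewrite RintegralD//.
  exact: bfin_integrable (bfin2_section1 t (bF i)).
exact: bfin_integrable (bfin2_section1 t bS).
Qed.

Lemma bfin2Z (k : R) (F : R * V -> R) : bfin2 leb mu F -> bfin2 leb mu (fun z => k * F z).
Proof.
move=> [mF [M [D [E [mDE D8 E8 M0 HM]]]]]; split; first exact: measurable_funM.
exists (`|k| * M), D, E; split => //; first by rewrite mulr_ge0.
by move=> t y; rewrite normrM -mulrA ler_wpM2l.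
Qed.

Lemma bfin2_iintB (k : R) (F G : R * V -> R) : bfin2 leb mu F -> bfin2 leb mu G ->
  \int[leb]_t \int[mu]_y (k * F (t, y) - G (t, y)) =
  k * \int[leb]_t \int[mu]_y F (t, y) - \int[leb]_t \int[mu]_y G (t, y).
Proof.
move=> bF bG; have i1 := bfin_integrable (bfin2_integral1 bF).
have i2 := bfin_integrable (bfin2_integral1 bG).
rewrite -RintegralZl// -RintegralB//; last exact: integrableZ_real.
apply: eq_Rintegral => t _.
have j1 := bfin_integrable (bfin2_section1 t bF).
have j2 := bfin_integrable (bfin2_section1 t bG).
by rewrite RintegralB//; [rewrite RintegralZl|exact: integrableZ_real].
Qed.

Lemma time_weight_itv (ep : R) : 0 < ep -> time_weight 1 (\1_(`]ep, 1[%classic) : R -> R).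
Proof.
move=> ep0; split; first by apply: measurable_indic; exact: measurable_itv.
  by exists 1 => t; rewrite indicE ger0_norm// lern1 leq_b1.
exists ep => // t; rewrite indicE; case: (boolP (t \in _)) => [/set_mem/=|_]; last by rewrite eqxx.
by rewrite in_itv/= => /andP[h1 h2] _; rewrite mul1r !ltW.
Qed.

(** With [s = (rho t)^-1] and [b = (y - x0) / rho] the argument of [om] is [b + s (x - y)], and the
    differentiated kernels add up to minus the time derivative of [s^n om (b + s (x - y))]. The end
    [t = ep] gives the contraction; at [t = 1] the kernel no longer depends on [y], which leaves the
    integral of [f]. *)
Lemma bogovskii_div (ep : R) f x : 0 < ep < 1 -> Bb f ->
  \sum_j partial j (bogovskii (\1_(`]ep, 1[%classic)) f j) x =
  fwd ep om f x - rho^-1 ^+ n * om (rho^-1 *: (x - x0)) * \int[mu]_y f y.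
Proof.
move=> ep01 bf; have /andP[ep0 ep1] := ep01.
have tw := time_weight_itv ep0; have tw' := time_weight_inv rho0 tw.
set w := (\1_(`]ep, 1[%classic) : R -> R) in tw tw' *.
pose w' t := (rho * t)^-1 * w t.
pose Z t y := (rho * t)^-1 *: x + (- ((1 - t) / (rho * t)) *: y + - (t / (rho * t)) *: x0).
pose K p (z : R * V) := w' z.1 * ((rho * z.1)^-1 ^+ n * (p (Z z.1 z.2) * f z.2)).
pose K' p j (z : R * V) := w' z.1 * ((rho * z.1)^-1 ^+ n * (p (Z z.1 z.2) * coord_mul x0 j f z.2)).
pose G j (z : R * V) := rho * K (partial j (coord_mul 0 j om)) z - K' (partial j om) j z.
have bK j : bfin2 leb mu (K (partial j (coord_mul 0 j om))).
  exact: (timeop_kernel x0 rho0 x tw' (Cc_partial j (coord_mul_Cc 0 j com)) bf).1.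
have bK' j : bfin2 leb mu (K' (partial j om) j).
  exact: (timeop_kernel x0 rho0 x tw' (Cc_partial j com) (coord_mul_Bb x0 j bf)).1.
have bG j : bfin2 leb mu (G j).
  have := bfin2D (bfin2Z rho (bK j)) (bfin2Z (-1) (bK' j)); congr bfin2.
  by apply/funext => z; rewrite /G mulN1r.
transitivity (\int[leb]_t \int[mu]_y (\sum_j G j (t, y))).
  rewrite bfin2_iint_sum//; apply: eq_bigr => j _.
  have := bogovskii_partials j [:: j] tw bf => /= ->.
  rewrite (timeop_partial x0 rho0 j tw (coord_mul_Cc 0 j com) bf).
  rewrite (timeop_partial x0 rho0 j tw com (coord_mul_Bb x0 j bf)).
  rewrite (timeop_kernel x0 rho0 x tw' (Cc_partial j (coord_mul_Cc 0 j com)) bf).2.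
  rewrite (timeop_kernel x0 rho0 x tw' (Cc_partial j com) (coord_mul_Bb x0 j bf)).2.
  by symmetry; exact: (bfin2_iintB rho (bK j) (bK' j)).
(* The fundamental theorem applies in [t] for fixed [y], so the time integral has to become the
   inner one. *)
rewrite (bfin2_Fubini (bfin2_sum _ bG)).
pose s t := (rho * t)^-1.
pose b y := rho^-1 *: (y - x0).
have ZE t y : 0 < t -> Z t y = b y + s t *: (x - y).
  move=> t0; rewrite /Z /b /s; apply/rowP => i; rewrite !mxE.
  by field; rewrite !gt_eqF.
have so := com.1.
have GE t y : \sum_j G j (t, y) = (w t * (rho * s t ^+ 2 *
    (n%:R * s t ^+ n.-1 * om (b y + s t *: (x - y)) +
     s t ^+ n * \sum_i (x - y) ord0 i * partial i om (b y + s t *: (x - y))))) * f y.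
  have [wt|wt] := eqVneq (w t) 0.
    by rewrite wt !mul0r big1// => j _; rewrite /G /K /K' /w' /= wt !(mul0r, mulr0) subrr.
  have t0 : 0 < t.
    have := wt; rewrite /w indicE; case: (boolP (t \in _)) => [/set_mem/=|_]; last by rewrite eqxx.
    by rewrite in_itv/= => /andP[h _] _; exact: lt_trans h.
  rewrite /G /K /K' /w' /= -/(s t) ZE//; set z := b y + _.
  have pE j : partial j (coord_mul 0 j om) z = om z + z ord0 j * partial j om z.
    have H := @partialM _ _ _ _ j (fun x => smooth_derivable (smooth_coord_sub 0 j)) (fun x => smooth_derivable so).
    have {H}-> : partial j (coord_mul 0 j om) z = (z ord0 j - (0 : V) ord0 j) * partial j om z + om z * partial j (fun y : V => y ord0 j - (0 : V) ord0 j) z.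
      by rewrite -[LHS]/(partial j ((fun y : V => y ord0 j - (0 : V) ord0 j) \* om) z) H.
    have -> : partial j (fun y : V => y ord0 j - (0 : V) ord0 j) = fun=> 1.
      rewrite (_ : (fun y : V => _) = (fun y : V => y ord0 j)); first by rewrite partial_coord eqxx.
      by apply/funext => u; rewrite mxE subr0.
    have z00 : (0 : V) ord0 j = 0 by rewrite mxE.
    by rewrite z00 subr0 mulr1 addrC.
  under eq_bigr do rewrite pE.
  (* The summand [y - x0] cancels against the second term of the field; what remains is the factor
     [x - y] of the time derivative. *)
  have zE j : rho * z ord0 j = rho * s t * (x - y) ord0 j + (y ord0 j - x0 ord0 j).
    rewrite /z /b !mxE; generalize (s t) => st.
    by field; rewrite gt_eqF.
  rewrite (eq_bigr (fun j => w t * (rho * s t ^+ 2) * f y * ((s t)^-1 * s t ^+ n * om z + s t ^+ n * ((x - y) ord0 j * partial j om z)))).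
    rewrite -mulr_sumr big_split/= sumr_const card_ord -mulr_sumr.
    have sn : (s t)^-1 * s t ^+ n *+ n = n%:R * s t ^+ n.-1.
      case: {+}n => [|k]; first by rewrite mulr0n mul0r.
      by rewrite exprS mulKf ?mulr_natl// /s invr_neq0// mulf_neq0// gt_eqF.
    rewrite -mulrnAl sn; ring.
  move=> j _; rewrite /coord_mul.
  have s0 : s t != 0 by rewrite /s invr_neq0// mulf_neq0// gt_eqF.
  have -> : rho * (s t * w t * (s t ^+ n * ((om z + z ord0 j * partial j om z) * f y))) =
    s t * w t * s t ^+ n * f y * (rho * om z + (rho * z ord0 j) * partial j om z) by ring.
  rewrite zE; field.
  exact: s0.
have Eint y : \int[leb]_t (\sum_j G j (t, y)) =
    (s ep ^+ n * om (b y + s ep *: (x - y)) - rho^-1 ^+ n * om (rho^-1 *: (x - x0))) * f y.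
  have -> : rho^-1 *: (x - x0) = b y + rho^-1 *: (x - y).
    by apply/rowP => i; rewrite /b !mxE; ring.
  rewrite -(kernel_ftc (b y) (x - y) rho0 ep01 so).
  (* Where [f y] is nonzero, integrability in [t] of the bare kernel is recovered by dividing the
     integrable product by [f y]. *)
  have [fy|fy] := eqVneq (f y) 0.
    rewrite fy mulr0 (_ : (fun t => _) = fun=> 0) ?Rintegral_cst ?mul0r//.
    by apply/funext => t; rewrite GE fy mulr0.
  have i1 := bfin_integrable (bfin2_section2 y (bfin2_sum (index_enum _) bG)).
  rewrite mulrC -RintegralZl//; last first.
    have := integrableZ_real (f y)^-1 i1; congr (_.-integrable _ _); apply/funext => t /=.
    by congr EFin; rewrite GE mulrC mulfK.
  by apply: eq_Rintegral => t _; rewrite GE mulrC.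
under eq_Rintegral do rewrite Eint mulrBl.
have ii : mu.-integrable setT (EFin \o (fun y => om (Z ep y) * f y)).
  apply: (@integrable_param _ _ _ _ _ (fun=> _)) => //.
    exact: measurable_fun_rV_affine.
  exact: Bb_integrable.
have i2 : mu.-integrable setT (EFin \o (fun y => s ep ^+ n * om (b y + s ep *: (x - y)) * f y)).
  rewrite (_ : (fun y => _) = (fun y => s ep ^+ n * (om (Z ep y) * f y))).
    exact: integrableZ_real.
  by apply/funext => y; rewrite ZE// mulrA.
rewrite RintegralB//; last exact: integrableZ_real (Bb_integrable bf).
rewrite RintegralZl//; last exact: Bb_integrable.
congr (_ - _).
rewrite /fwd /nconv /conv -RintegralZl//.
by apply: eq_Rintegral => y _; rewrite -ZE// mulrA.
Qed.

End bogovskii.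

(** * Star-shaped domains *)

Section geometry.
Variables (R : realType) (n : nat).
Local Notation V := 'rV[R]_n.
Local Notation mu := (lebesgue_rV R n).
Local Notation e_ i := (delta_mx ord0 i : V).
Implicit Types (x y z : V) (Om : set V).

Lemma coord_le_enorm x i : `|x ord0 i| <= enorm x.
Proof.
rewrite /enorm -sqrtr_sqr ler_wsqrtr// (bigD1 i)//= lerDl.
by apply: sumr_ge0 => j _; exact: sqr_ge0.
Qed.

Lemma norm_le_enorm x : `|x| <= enorm x.
Proof. by apply: rV_norm_le => [|i]; [exact: sqrtr_ge0|exact: coord_le_enorm]. Qed.

Lemma enorm_le_norm x : enorm x <= n%:R * `|x|.
Proof.
have n0 : 0 <= n%:R * `|x| by rewrite mulr_ge0.
rewrite /enorm -[leRHS]ger0_norm// -sqrtr_sqr ler_wsqrtr//.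
apply: (@le_trans _ _ (\sum_(i < n) `|x| ^+ 2)).
  apply: ler_sum => i _; rewrite -real_normK ?num_real// lerXn2r ?nnegrE//.
  exact: coord_le_norm.
rewrite sumr_const card_ord exprMn -[leLHS]mulr_natl ler_wpM2r ?sqr_ge0//.
by rewrite -natrX ler_nat; case: {+}n => // k; rewrite expnS leq_pmulr.
Qed.

Lemma measurable_eball x (r : R) : 0 < r -> measurable (eball x r).
Proof.
move=> r0; rewrite (_ : eball x r = (fun y : V => \sum_i (y - x) ord0 i ^+ 2) @^-1` `]-oo, r ^+ 2[%classic).
  rewrite -[X in measurable X]setTI; suff : measurable_fun setT (fun y : V => \sum_i (y - x) ord0 i ^+ 2).
    by apply => //; exact: measurable_itv.
  apply: (@measurable_sum _ _ _ _ _ _ (fun i (y : V) => (y - x) ord0 i ^+ 2)) => i.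
  apply: measurable_funX; under eq_fun do rewrite !mxE.
  by apply: measurable_funB => //; exact: measurable_coord.
apply/seteqP; split => y /=; rewrite /eball /= in_itv/= /enorm => h.
  rewrite -[X in X < _]sqr_sqrtr ?sumr_ge0//; last by move=> i _; exact: sqr_ge0.
  by rewrite ltrXn2r// ?nnegrE ?ltW// sqrtr_ge0.
by rewrite -[r]ger0_norm ?(ltW r0)// -sqrtr_sqr ltr_sqrt// exprn_gt0.
Qed.

Lemma measure_cube_shift x (r : R) : 0 <= r ->
  mu [set y | cube r (y - x)] = ((2 * r) ^+ n)%:E.
Proof.
have mc : measurable (cube r : set V) by exact: measurable_cube.
move=> r0; have := @lebesgue_rV_affine R n 1 (- x) (cube r) (oner_neq0 _) mc.
rewrite normr1 invr1 expr1n mul1e cube_measure// => <-.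
by congr (mu _); apply/seteqP; split => y /=; rewrite scale1r.
Qed.

Lemma measurable_cube_shift x (r : R) : measurable [set y : V | cube r (y - x)].
Proof.
rewrite -[X in measurable X]setTI (_ : [set y | _] = (fun y => 1 *: y + (- x)) @^-1` cube r).
  by apply: measurable_fun_rV_affine => //; exact: measurable_cube.
by apply/seteqP; split => y /=; rewrite scale1r.
Qed.

Lemma eball_cube x (r : R) : 0 < r -> eball x r `<=` [set y | cube r (y - x)].
Proof.
move=> r0 y; rewrite /eball /= => h; apply/(cubeP _ (ltW r0)).
exact: le_trans (norm_le_enorm _) (ltW h).
Qed.

Lemma norm_lt_eball x y (r : R) : (0 < n)%N -> 0 < r -> `|y - x| < r / n%:R -> eball x r y.
Proof.
move=> n0 r0 h; rewrite /eball /=; apply: (le_lt_trans (enorm_le_norm _)).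
by rewrite mulrC -ltr_pdivlMr// ltr0n.
Qed.

Lemma vol_eball_le x (r : R) : 0 < r -> vol (eball x r) <= (2 * r) ^+ n.
Proof.
move=> r0; rewrite /vol -lee_fin fineK.
  rewrite -(measure_cube_shift x (ltW r0)); apply: le_measure; rewrite ?inE.
  - exact: measurable_eball.
  - exact: measurable_cube_shift.
  - exact: eball_cube.
rewrite ge0_fin_numE//; apply: (@le_lt_trans _ _ (mu [set y | cube r (y - x)])).
  apply: le_measure; rewrite ?inE; [exact: measurable_eball|exact: measurable_cube_shift|exact: eball_cube].
by rewrite measure_cube_shift ?ltW// ltry.
Qed.

Lemma eball_finite x (r : R) : 0 < r -> (mu (eball x r) < +oo)%E.
Proof.
move=> r0; apply: (@le_lt_trans _ _ (mu [set y | cube r (y - x)])).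
  apply: le_measure; rewrite ?inE; [exact: measurable_eball|exact: measurable_cube_shift|exact: eball_cube].
by rewrite measure_cube_shift ?ltW// ltry.
Qed.

Lemma vol_eball_gt0 x (r : R) : (0 < n)%N -> 0 < r -> 0 < vol (eball x r).
Proof.
move=> n0 r0; have n0' : 0 < n%:R :> R by rewrite ltr0n.
pose s := r / n%:R / 2; have s0 : 0 < s by rewrite /s !divr_gt0.
apply: (@lt_le_trans _ _ ((2 * s) ^+ n)); first by rewrite exprn_gt0// mulr_gt0.
rewrite /vol -lee_fin fineK; last by rewrite ge0_fin_numE// eball_finite.
rewrite -(measure_cube_shift x (ltW s0)); apply: le_measure; rewrite ?inE.
- exact: measurable_cube_shift.
- exact: measurable_eball.
move=> y /(cubeP _ (ltW s0)) h; apply: norm_lt_eball => //; apply: (le_lt_trans h).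
by rewrite /s ltr_pdivrMr// ltr_pMr ?divr_gt0// ltr1n.
Qed.

Section star.
Variables (Om : set V) (diam rho : R) (x0 : V).
Hypotheses (n0 : (0 < n)%N) (dOm : domain Om) (dm : ediameter Om = diam%:E) (rho0 : 0 < rho)
  (star : star_shaped Om (eball x0 rho)).

Lemma eball_sub : eball x0 rho `<=` Om.
Proof.
move=> y By; have [[x Ox] _ _] := dOm.
have := star Ox By (t := 1); rewrite subrr scale0r scale1r add0r; apply.
by rewrite ler01 lexx.
Qed.

Lemma center_in : Om x0.
Proof.
apply: eball_sub; apply: norm_lt_eball => //.
by rewrite subrr normr0 divr_gt0// ltr0n.
Qed.

Lemma enorm_le_diam x y : Om x -> Om y -> enorm (x - y) <= diam.
Proof.
move=> Ox Oy; rewrite -lee_fin -dm; apply: ereal_sup_ubound.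
by exists (x, y).
Qed.

Lemma domain_measurable : measurable Om.
Proof. by have [_ oOm _] := dOm; exact: rV_open_measurable. Qed.

(** A point at distance [rho / 2] from the centre suffices. This lets a factor [rho] be traded for
    the diameter in the final estimate. *)
Lemma half_rho_le_diam : rho / 2 <= diam.
Proof.
pose k := Ordinal n0; pose y := x0 + (rho / 2) *: e_ k.
have dk : 0 < rho / 2 by rewrite divr_gt0.
have ey : enorm (y - x0) = rho / 2.
  rewrite /y [_ + _ - x0]addrAC subrr add0r /enorm (bigD1 k)//= !mxE !eqxx mulr1.
  rewrite big1 ?addr0 ?sqrtr_sqr ?gtr0_norm// => i ik.
  by rewrite !mxE (negbTE ik) andbF mulr0 expr0n.
rewrite -ey; apply: enorm_le_diam; last exact: center_in.
by apply: eball_sub; rewrite /eball /= ey ltr_pdivrMr// ltr_pMr// ltr1n.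
Qed.

Lemma diam_gt0 : 0 < diam.
Proof. by apply: lt_le_trans half_rho_le_diam; rewrite divr_gt0. Qed.

Lemma domain_cube : Om `<=` [set y | cube diam (y - x0)].
Proof.
move=> y Oy; apply/(cubeP _ (ltW diam_gt0)); apply: (le_trans (norm_le_enorm _)).
exact: enorm_le_diam Oy center_in.
Qed.

Lemma domain_finite : (mu Om < +oo)%E.
Proof.
apply: (@le_lt_trans _ _ (mu [set y | cube diam (y - x0)])).
  apply: le_measure; rewrite ?inE; [exact: domain_measurable|exact: measurable_cube_shift|exact: domain_cube].
by rewrite measure_cube_shift ?(ltW diam_gt0)// ltry.
Qed.

Lemma domain_indic_Bb : Bb (\1_Om : V -> R).
Proof.
apply: (@bounded_indic_Bb R n Om (`|x0| + diam)).
- by rewrite addr_ge0// ltW// diam_gt0.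
- exact: domain_measurable.
move=> y /domain_cube /(cubeP _ (ltW diam_gt0)) h.
apply/cubeP; first by rewrite addr_ge0// ltW// diam_gt0.
by rewrite -[y](subrK x0) addrC (le_trans (ler_normD _ _))// lerD2l.
Qed.

Lemma coord_le_diam y i : Om y -> `|y ord0 i - x0 ord0 i| <= diam.
Proof.
move=> Oy; have := coord_le_enorm (y - x0) i; rewrite !mxE => h; apply: (le_trans h).
exact: enorm_le_diam Oy center_in.
Qed.

Lemma vol_ratio_ge1 : 1 <= vol Om / vol (eball x0 rho).
Proof.
rewrite ler_pdivlMr ?vol_eball_gt0// mul1r /vol fine_le//.
- by rewrite ge0_fin_numE// eball_finite.
- by rewrite ge0_fin_numE// domain_finite.
apply: le_measure; rewrite ?inE; [exact: measurable_eball|exact: domain_measurable|exact: eball_sub].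
Qed.

(** The circumscribed cube bounds the volume of the ball by [(2 rho)^n]. In this form the ratio
    enters the Hilbert-Schmidt estimate. *)
Lemma vol_le_ratio : vol Om <= (2 * rho) ^+ n * (vol Om / vol (eball x0 rho)).
Proof.
have v0 := vol_eball_gt0 x0 n0 rho0; have vle := vol_eball_le x0 rho0.
have O0 : 0 <= vol Om by rewrite /vol fine_ge0.
rewrite mulrA ler_pdivlMr// mulrC ler_wpM2r//.
Qed.

(** A point [x] of the closure lies near some [x'] as in the hypothesis, and [x - x'] can be charged
    to the endpoint in the ball, at the price of [1/t <= 1/ep]. With [|x - x'| < ep rho / (4 n)] the
    endpoint is off centre by at most [rho / (2 n) + rho / (4 n)], less than [rho / n] in the max
    norm, so it stays in the Euclidean ball. *)
Lemma star_closure_sub (h : V -> R) (ep : R) : 0 < ep ->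
  (forall x, h x != 0 -> exists t y z, [/\ ep <= t <= 1, Om y, `|z| <= (2 * n%:R)^-1 &
     x = (1 - t) *: y + t *: (x0 + rho *: z)]) ->
  closure [set x | h x != 0] `<=` Om.
Proof.
move=> ep0 H x clx; have n0' : 0 < n%:R :> R by rewrite ltr0n.
have dl0 : 0 < ep * rho / (4 * n%:R) by rewrite divr_gt0 ?mulr_gt0.
have [x' [hx' bx']] := clx _ (nbhsx_ballx x _ dl0).
have [t [y [z [/andP[t1 t2] Oy zn E]]]] := H x' hx'.
have t0 : 0 < t by exact: lt_le_trans t1.
have {}bx' : `|x - x'| < ep * rho / (4 * n%:R) by move: bx'; rewrite -ball_normE.
have -> : x = (1 - t) *: y + t *: (x0 + rho *: z + t^-1 *: (x - x')).
  rewrite scalerDr scalerA mulfV ?gt_eqF// scale1r addrA -E addrC subrK//.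
apply: star Oy _ _ _; last by rewrite (ltW t0).
apply: norm_lt_eball => //; rewrite -[x0 + _ + _]addrA addrAC subrr add0r.
apply: (le_lt_trans (ler_normD _ _)); rewrite !normrZ !gtr0_norm ?invr_gt0//.
have h1 : rho * `|z| <= rho * (2 * n%:R)^-1 by rewrite ler_pM2l.
have h2 : t^-1 * `|x - x'| <= rho / (4 * n%:R).
  rewrite mulrC ler_pdivrMr// (le_trans (ltW bx'))// -mulrA mulrC ler_wpM2l//.
  by rewrite divr_ge0 ?mulr_ge0 ?ltW.
have h3 : rho * (2 * n%:R)^-1 + rho / (4 * n%:R) < rho / n%:R.
  rewrite (_ : _ + _ = rho / n%:R * (3 / 4)); last by field; rewrite gt_eqF.
  by rewrite gtr_pMr ?divr_gt0//; lra.
exact: le_lt_trans (lerD h1 h2) h3.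
Qed.

Section supports.
Variable om : V -> R.
Hypotheses (com : Cc om) (om0 : forall z, (2 * n%:R)^-1 < `|z| -> om z = 0).

Lemma star_kernel_zero (h : V -> R) (ep : R) : 0 < ep ->
  (forall x, (forall t y, ep <= t <= 1 -> Om y ->
     om ((rho * t)^-1 *: x + (- ((1 - t) / (rho * t)) *: y + - (t / (rho * t)) *: x0)) = 0) ->
     h x = 0) ->
  closure [set x | h x != 0] `<=` Om.
Proof.
move=> ep0 H; apply: (star_closure_sub ep0) => x; apply: contra_neqP => N.
apply: H => t y /andP[t1 t2] Oy; have t0 : 0 < t by exact: lt_le_trans t1.
set z := _ *: x + _; apply: om0; rewrite ltNge; apply/negP => zn; apply: N.
exists t, y, z; split => //; first by rewrite t1.
by apply/rowP => i; rewrite /z !mxE; field; rewrite !gt_eqF.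
Qed.

Lemma timeop_zero w p g (ep : R) x : 0 < ep -> (forall t, w t != 0 -> ep <= t <= 1) ->
  (forall y, ~ Om y -> g y = 0) -> (forall z, om z = 0 -> p z = 0) ->
  (forall t y, ep <= t <= 1 -> Om y ->
     om ((rho * t)^-1 *: x + (- ((1 - t) / (rho * t)) *: y + - (t / (rho * t)) *: x0)) = 0) ->
  timeop rho x0 w p g x = 0.
Proof.
move=> ep0 we gO pom H; rewrite /timeop (_ : (fun t => _) = fun=> 0) ?Rintegral_cst ?mul0r//.
apply/funext => t; have [->|wt] := eqVneq (w t) 0; first by rewrite mul0r.
rewrite /fwd /nconv /conv (_ : (fun y => _) = fun=> 0) ?Rintegral_cst ?mul0r ?mulr0//.
apply/funext => y; have [Oy|Oy] := pselect (Om y); last by rewrite gO// mulr0.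
by rewrite pom ?mul0r//; apply: H => //; exact: we.
Qed.

Lemma bogovskii_test f (ep : R) j : 0 < ep -> Bb f -> (forall y, ~ Om y -> f y = 0) ->
  test_function Om (bogovskii om rho x0 (\1_(`]ep, 1[%classic)) f j).
Proof.
move=> ep0 bf fO; have tw := time_weight_itv ep0.
apply: test_functionP; first exact: bogovskii_Cc.
have we t : (\1_(`]ep, 1[%classic) t : R) != 0 -> ep <= t <= 1.
  rewrite indicE; case: (boolP (t \in _)) => [/set_mem/=|_]; last by rewrite eqxx.
  by rewrite in_itv/= => /andP[h1 h2] _; rewrite !ltW.
apply: (star_kernel_zero ep0) => x H; rewrite /bogovskii.
rewrite (timeop_zero ep0 we _ _ H)//; last by move=> z z0; rewrite /coord_mul z0 mulr0.
rewrite (timeop_zero ep0 we _ _ H)//; first by rewrite mulr0 subr0.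
by move=> y Oy; rewrite /coord_mul fO// mulr0.
Qed.

Lemma fwd_test f (ep : R) : 0 < ep <= 1 -> Bb f -> (forall y, ~ Om y -> f y = 0) ->
  test_function Om (fwd rho x0 ep om f).
Proof.
move=> /andP[ep0 ep1] bf fO.
have al0 : (rho * ep)^-1 != 0 by rewrite invr_eq0 mulf_neq0 ?gt_eqF.
apply: test_functionP.
  by have := CcZ ((rho * ep)^-1 ^+ n) (conv_Cc (- ((1 - ep) / (rho * ep))) (- (ep / (rho * ep)) *: x0) al0 com bf).
apply: (star_kernel_zero ep0) => x H.
rewrite /fwd /nconv /conv (_ : (fun y => _) = fun=> 0) ?Rintegral_cst ?mul0r ?mulr0//.
apply/funext => y; have [Oy|Oy] := pselect (Om y); last by rewrite fO// mulr0.
by rewrite H ?mul0r// lexx.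
Qed.

End supports.

End star.

Lemma test_function_partial Om (f : V -> R) i : test_function Om f -> test_function Om (partial i f).
Proof.
move=> tf; have cf := test_function_Cc tf; apply: test_functionP; first exact: Cc_partial.
have [_ _ fO] := tf; apply: subset_trans fO.
have /closure_id -> := @closed_closure _ [set x : V | f x != 0].
apply: closure_subset => x; apply: contra_neqP => nx.
have : open (~` closure [set x | f x != 0]) by rewrite openC; exact: closed_closure.
rewrite openE => /(_ x nx) N; rewrite /partial.
rewrite (@near_eq_derive _ _ _ f (cst 0) x (e_ i)); first exact: derive_cst.
apply: filterS N => y /= ny; apply/eqP; apply: contrapT => /negP fy.
by apply: ny; exact: subset_closure.
Qed.

Lemma test_function_partials Om (f : V -> R) s : test_function Om f -> test_function Om (partials s f).
Proof. by move=> tf; elim: s => //= i s IH; exact: test_function_partial. Qed.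

End geometry.

(** * Estimates of the Bogovskii operator in L2 *)

Section square_integrable.
Variables (R : realType) (n : nat).
Local Notation V := 'rV[R]_n.
Local Notation mu := (lebesgue_rV R n).
Implicit Types (f g h : V -> R).

(** The estimates use functions on the whole space, where test functions, contractions and limits
    live together; the spaces on [Om] are reached by restriction. *)
Definition SQ f := measurable_fun [set: V] f /\ mu.-integrable setT (EFin \o (fun x => f x ^+ 2)).

Lemma Bb_SQ f : Bb f -> SQ f.
Proof.
move=> bf; split; first by have [] := bf.
rewrite (_ : (fun x => _) = f \* f); first exact: Bb_integrable (BbM bf bf).
by apply/funext => x; rewrite expr2.
Qed.

Lemma SQ_integrableM f g : SQ f -> SQ g -> mu.-integrable setT (EFin \o (fun x => f x * g x)).
Proof.
move=> [mf f2] [mg g2]; apply: (integrable_dom _ (integrableD_real f2 g2)); first exact: measurable_funM.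
move=> x; have h := sqr_ge0 (`|f x| - `|g x|).
have h2 := sqr_ge0 (`|f x|); have h3 := sqr_ge0 (`|g x|).
rewrite -[f x ^+ 2]real_normK ?num_real// -[g x ^+ 2]real_normK ?num_real// normrM; nra.
Qed.

Lemma SQD f g : SQ f -> SQ g -> SQ (f \+ g).
Proof.
move=> sf sg; have [mf f2] := sf; have [mg g2] := sg; split; first exact: measurable_funD.
rewrite (_ : (fun x => _) = (fun x => (f x ^+ 2 + g x ^+ 2) + 2 * (f x * g x))).
  apply: integrableD_real; first exact: integrableD_real.
  exact/integrableZ_real/SQ_integrableM.
by apply/funext => x /=; ring.
Qed.

Lemma SQZ (k : R) f : SQ f -> SQ (fun x => k * f x).
Proof.
move=> [mf f2]; split; first exact: measurable_funM.
rewrite (_ : (fun x => _) = (fun x => k ^+ 2 * f x ^+ 2)); first exact: integrableZ_real.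
by apply/funext => x; rewrite exprMn.
Qed.

Lemma SQB f g : SQ f -> SQ g -> SQ (f \- g).
Proof.
move=> sf sg; have := SQD sf (SQZ (-1) sg); congr SQ; apply/funext => x /=.
by rewrite mulN1r.
Qed.

Definition nrm f : R := Num.sqrt (ip f f).

Lemma nrm_ge0 f : 0 <= nrm f. Proof. exact: sqrtr_ge0. Qed.

Lemma nrm_sqr f : nrm f ^+ 2 = ip f f.
Proof. by rewrite sqr_sqrtr// ip_ge0. Qed.

Lemma nrm_le f (K : R) : 0 <= K -> ip f f <= K ^+ 2 -> nrm f <= K.
Proof. by move=> K0 h; rewrite /nrm -[leRHS]ger0_norm// -sqrtr_sqr ler_wsqrtr. Qed.

Lemma ip_le_nrm f g : SQ f -> SQ g -> `|ip f g| <= nrm f * nrm g.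
Proof.
move=> sf sg; rewrite -ler_sqr ?nnegrE ?mulr_ge0 ?nrm_ge0// exprMn !nrm_sqr real_normK ?num_real//.
have [mf f2] := sf; have [mg g2] := sg.
have := Cauchy_Schwarz f2 (SQ_integrableM sf sg) g2.
have E (h : V -> R) : \int[mu]_x (h x ^+ 2) = ip h h by apply: eq_Rintegral => x _; rewrite expr2.
by rewrite !E.
Qed.

Lemma nrmD f g : SQ f -> SQ g -> nrm (f \+ g) <= nrm f + nrm g.
Proof.
move=> sf sg; apply: nrm_le; first by rewrite addr_ge0 ?nrm_ge0.
have -> : ip (f \+ g) (f \+ g) = ip f f + ip g g + 2 * ip f g.
  have iff := SQ_integrableM sf sf; have igg := SQ_integrableM sg sg; have ifg := SQ_integrableM sf sg.
  rewrite /ip -RintegralZl// -!RintegralD//; [|exact: integrableD_real|exact: integrableZ_real].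
  by apply: eq_Rintegral => x _ /=; ring.
have h := le_trans (ler_norm _) (ip_le_nrm sf sg).
rewrite sqrrD !nrm_sqr -[nrm f * nrm g *+ 2]mulr_natl; lra.
Qed.

Lemma nrmZ (k : R) f : SQ f -> nrm (fun x => k * f x) = `|k| * nrm f.
Proof.
move=> sf; rewrite /nrm (_ : ip _ _ = k ^+ 2 * ip f f); first by rewrite sqrtrM ?sqr_ge0// sqrtr_sqr.
rewrite /ip -RintegralZl//; last exact: SQ_integrableM.
by apply: eq_Rintegral => x _; ring.
Qed.

Lemma nrmB f g : SQ f -> SQ g -> nrm (f \- g) <= nrm f + nrm g.
Proof.
move=> sf sg; have := nrmD sf (SQZ (-1) sg); rewrite nrmZ// normrN1 mul1r.
by congr (nrm _ <= _); apply/funext => x /=; rewrite mulN1r.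
Qed.

Lemma nrm0 : nrm (fun=> 0) = 0.
Proof.
by rewrite /nrm /ip; under eq_Rintegral do rewrite mul0r; rewrite Rintegral_cst// mul0r sqrtr0.
Qed.

Lemma SQ0 : SQ (fun=> 0).
Proof. exact: (Bb_SQ (@Bb0 R n)). Qed.

Lemma SQ_sum (I : Type) (r : seq I) (F : I -> V -> R) :
  (forall i, SQ (F i)) -> SQ (fun x => \sum_(i <- r) F i x).
Proof.
move=> sF; elim: r => [|i r IH].
  by under eq_fun do rewrite big_nil; exact: SQ0.
by under eq_fun do rewrite big_cons; exact: SQD.
Qed.

Lemma nrm_sum (I : Type) (r : seq I) (F : I -> V -> R) :
  (forall i, SQ (F i)) -> nrm (fun x => \sum_(i <- r) F i x) <= \sum_(i <- r) nrm (F i).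
Proof.
move=> sF; elim: r => [|i r IH].
  by under eq_fun do rewrite big_nil; rewrite nrm0 big_nil.
under eq_fun do rewrite big_cons; rewrite big_cons.
by apply: (le_trans (nrmD (sF i) (SQ_sum r sF))); rewrite lerD2l.
Qed.

Lemma nrm_le_pointwise f g (K : R) : 0 <= K -> SQ f -> SQ g -> (forall x, `|f x| <= K * `|g x|) ->
  nrm f <= K * nrm g.
Proof.
move=> K0 sf sg h; apply: nrm_le; first by rewrite mulr_ge0// nrm_ge0.
rewrite exprMn nrm_sqr /ip -RintegralZl//; last exact: SQ_integrableM.
apply: le_Rintegral => //; [exact: SQ_integrableM|exact: integrableZ_real (SQ_integrableM sg sg)|].
move=> x _; rewrite -!expr2 -[f x ^+ 2]real_normK ?num_real// -[g x ^+ 2]real_normK ?num_real//.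
by rewrite -exprMn lerXn2r ?nnegrE ?mulr_ge0.
Qed.

End square_integrable.

(** * Derivatives indexed by words *)

Section words.
Variables (R : realType) (n : nat).
Local Notation V := 'rV[R]_n.
Local Notation e_ i := (delta_mx ord0 i : V).
Implicit Types (f g h : V -> R) (s : seq 'I_n).

(** There are finitely many words of a given length, so constants found word by word become
    uniform. *)
Lemma words_bounded (X : seq 'I_n -> R) k : exists2 C, 0 <= C & forall s, size s = k -> X s <= C.
Proof.
exists (\sum_(t : k.-tuple 'I_n) `|X t|); first by apply: sumr_ge0.
move=> s /eqP sk; rewrite (bigD1 (Tuple sk))//=; apply: (le_trans (ler_norm _)).
by rewrite lerDl sumr_ge0.
Qed.

Definition deriv_norm k f : R := \sum_(t : k.-tuple 'I_n) nrm (partials t f).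

Lemma deriv_norm_ge0 k f : 0 <= deriv_norm k f.
Proof. by apply: sumr_ge0 => t _; exact: nrm_ge0. Qed.

Lemma nrm_partials_le s f : nrm (partials s f) <= deriv_norm (size s) f.
Proof.
rewrite /deriv_norm (bigD1 (in_tuple s))//= lerDl.
by apply: sumr_ge0 => t _; exact: nrm_ge0.
Qed.

Lemma deriv_norm0 f : deriv_norm 0 f = nrm f.
Proof.
rewrite /deriv_norm (bigD1 [tuple])//= big1 ?addr0// => t /negP[]; apply/eqP; exact: tuple0.
Qed.

(** Leibniz' rule for the affine factor [y_j - c_j]: its second derivatives vanish, so apart from
    the main term each occurrence of [j] in the word is used up once. *)
Fixpoint deletions (j : 'I_n) s : seq (seq 'I_n) :=
  if s is i :: s' then (if i == j then [:: s'] else [::]) ++ map (cons i) (deletions j s') else [::].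

Lemma size_deletions j s : (size (deletions j s) <= size s)%N.
Proof.
elim: s => //= i s IH; rewrite size_cat size_map.
by case: ifP => _ /=; rewrite ?add1n ?add0n ?ltnS// (leq_trans IH).
Qed.

Lemma size_in_deletions j s t : t \in deletions j s -> size t = (size s).-1.
Proof.
elim: s t => //= i s IH t; rewrite mem_cat => /orP[|/mapP[u us ->]].
  by case: ifP => // _; rewrite inE => /eqP ->.
rewrite /= (IH _ us) prednK//.
by case: s us {IH} => //.
Qed.

Lemma partial_coord_mul (c : V) (i j : 'I_n) f : smooth f ->
  partial i (coord_mul c j f) = (fun x => coord_mul c j (partial i f) x + (if i == j then f x else 0)).
Proof.
move=> sf; have H := @partialM _ _ _ _ i (fun x => smooth_derivable (smooth_coord_sub c j)) (fun x => smooth_derivable sf).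
rewrite -[LHS]/(partial i ((fun y : V => y ord0 j - c ord0 j) \* f)) H; apply/funext => x /=.
have -> : partial i (fun y : V => y ord0 j - c ord0 j) = fun=> (i == j)%:R.
  have d1 y := smooth_derivable (i := i) (x := y) (@smooth_coord R n j).
  have d2 y := smooth_derivable (i := i) (x := y) (@smooth_cst R n (c ord0 j)).
  have H2 := @partialB _ _ _ _ i d1 d2; rewrite partial_coord in H2.
  rewrite -[LHS]/(partial i ((fun y : V => y ord0 j) \- (fun=> c ord0 j))) H2.
  by apply/funext => y /=; rewrite /partial derive_cst subr0 eq_sym.
by case: (i == j); rewrite ?mulr1 ?mulr0.
Qed.

Lemma partials_coord_mul (c : V) (j : 'I_n) s f : smooth f ->
  partials s (coord_mul c j f) =
  (fun x => coord_mul c j (partials s f) x + \sum_(t <- deletions j s) partials t f x).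
Proof.
move=> sf; elim: s => [|i s IH] /=; first by apply/funext => x; rewrite big_nil addr0.
have s1 : smooth (coord_mul c j (partials s f)).
  exact: smoothM (smooth_coord_sub c j) (smooth_partials s sf).
have s2 (r : seq (seq 'I_n)) : smooth (fun x => \sum_(t <- r) partials t f x).
  by apply: smooth_sum => t; exact: smooth_partials.
rewrite IH.
have d1 y := smooth_derivable (i := i) (x := y) s1.
have d2 r y := smooth_derivable (i := i) (x := y) (s2 r).
have H := @partialD _ _ _ _ i d1 (d2 (deletions j s)).
rewrite -[LHS]/(partial i (coord_mul c j (partials s f) \+ (fun x => \sum_(t <- deletions j s) partials t f x))) H.
rewrite partial_coord_mul; last exact: smooth_partials.
have E r : partial i (fun x => \sum_(t <- r) partials t f x) = (fun x => \sum_(t <- r) partial i (partials t f) x).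
  elim: r => [|t r IHr].
    apply/funext => x; rewrite big_nil (_ : (fun x => _) = fun=> 0); first by rewrite /partial derive_cst.
    by apply/funext => y; rewrite big_nil.
  have d3 y := smooth_derivable (i := i) (x := y) (smooth_partials t sf).
  rewrite (_ : (fun x => _) = partials t f \+ (fun x => \sum_(t <- r) partials t f x)).
    by rewrite (@partialD _ _ _ _ i d3 (d2 r)) IHr; apply/funext => x; rewrite big_cons.
  by apply/funext => y; rewrite big_cons.
rewrite E; apply/funext => x /=; rewrite big_cat big_map/= -addrA; congr (_ + (_ + _)).
by case: ifP => _; rewrite ?big_seq1 ?big_nil.
Qed.

End words.

(** * Derivatives of time averages *)

Section timeop_bounds.
Variables (R : realType) (n : nat).
Local Notation V := 'rV[R]_n.
Local Notation mu := (lebesgue_rV R n).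
Local Notation leb := (@lebesgue_measure R).
Implicit Types (f g h p : V -> R) (s : seq 'I_n) (w : R -> R).

Lemma timeopZ (c : R) rho (x0 : V) w p g : 0 < rho -> time_weight 1 w -> Cc p -> Bb g ->
  timeop rho x0 (fun t => c * w t) p g = (fun x => c * timeop rho x0 w p g x).
Proof.
move=> rho0 tw cp bg; apply/funext => x; rewrite /timeop -RintegralZl//; last exact: timeop_integrable.
by apply: eq_Rintegral => t _; rewrite mulrA.
Qed.

Lemma timeopD rho (x0 : V) w1 w2 p g : 0 < rho -> time_weight 1 w1 -> time_weight 1 w2 -> Cc p -> Bb g ->
  timeop rho x0 (fun t => w1 t + w2 t) p g = timeop rho x0 w1 p g \+ timeop rho x0 w2 p g.
Proof.
move=> rho0 tw1 tw2 cp bg; apply/funext => x; rewrite /timeop/= -RintegralD//; try exact: timeop_integrable.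
by apply: eq_Rintegral => t _; rewrite mulrDl.
Qed.

Lemma partialsD s f g : smooth f -> smooth g -> partials s (f \+ g) = partials s f \+ partials s g.
Proof.
move=> sf sg; elim: s => //= i s ->.
have d1 y := smooth_derivable (i := i) (x := y) (smooth_partials s sf).
have d2 y := smooth_derivable (i := i) (x := y) (smooth_partials s sg).
exact: partialD d1 d2.
Qed.

Lemma partialsZ s (c : R) f : smooth f -> partials s (fun x => c * f x) = (fun x => c * partials s f x).
Proof.
move=> sf; elim: s => //= i s ->.
have d1 y := smooth_derivable (i := i) (x := y) (smooth_partials s sf).
exact: partialZ d1.
Qed.

Lemma partialsB s f g : smooth f -> smooth g -> partials s (f \- g) = partials s f \- partials s g.
Proof.
move=> sf sg; elim: s => //= i s ->.
have d1 y := smooth_derivable (i := i) (x := y) (smooth_partials s sf).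
have d2 y := smooth_derivable (i := i) (x := y) (smooth_partials s sg).
exact: partialB d1 d2.
Qed.

Definition near_time (N : nat) : R -> R := \1_(`]2^-1 / 2 ^+ N, 2^-1]%classic).
Definition far_time : R -> R := \1_(`]2^-1, 1[%classic).

Lemma dyadic_gt0 (N : nat) : 0 < 2^-1 / 2 ^+ N :> R.
Proof. by rewrite divr_gt0// exprn_gt0. Qed.

Lemma dyadic_le_half (N : nat) : 2^-1 / 2 ^+ N <= 2^-1 :> R.
Proof. by rewrite ler_pdivrMr ?exprn_gt0// ler_peMr// exprn_ege1// ler1n. Qed.

Lemma near_timeP N t : near_time N t != 0 -> 2^-1 / 2 ^+ N < t <= 2^-1.
Proof.
rewrite /near_time indicE; case: (boolP (t \in _)) => [/set_mem/=|_]; last by rewrite eqxx.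
by rewrite in_itv.
Qed.

Lemma far_timeP t : far_time t != 0 -> 2^-1 < t < 1.
Proof.
rewrite /far_time indicE; case: (boolP (t \in _)) => [/set_mem/=|_]; last by rewrite eqxx.
by rewrite in_itv.
Qed.

Lemma time_weight_near N : time_weight 1 (near_time N).
Proof.
split; first by apply: measurable_indic; exact: measurable_itv.
  by exists 1 => t; rewrite /near_time indicE ger0_norm// lern1 leq_b1.
exists (2^-1 / 2 ^+ N); first exact: dyadic_gt0.
move=> t /near_timeP/andP[h1 h2]; rewrite mul1r (ltW h1)/= (le_trans h2)//.
by rewrite invf_le1// ler1n.
Qed.

Lemma time_weight_far : time_weight 1 far_time.
Proof.
split; first by apply: measurable_indic; exact: measurable_itv.
  by exists 1 => t; rewrite /far_time indicE ger0_norm// lern1 leq_b1.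
by exists 2^-1 => // t /far_timeP/andP[h1 h2]; rewrite mul1r !ltW.
Qed.

Lemma split_time N : \1_(`]2^-1 / 2 ^+ N, 1[%classic) = (fun t => near_time N t + far_time t).
Proof.
apply/funext => t; rewrite /near_time /far_time !indicE -natrD; congr (_%:R).
have h := dyadic_le_half N; rewrite !mem_setE/= !in_itv/=.
case: (leP t 2^-1) => ht; rewrite ?andbT ?andbF.
  by rewrite (_ : t < 1) ?andbT ?addn0//; lra.
by rewrite (le_lt_trans h ht)/= add0n.
Qed.

(** The letters of [s] go to [g] at the price [(1 - t)^-k <= 2^k]. The remaining one stays: it makes
    the kernel a derivative, as almost orthogonality requires, and it brings the singular weight
    [(rho t)^-1]. *)
Lemma near_part p i k : Cc p -> exists2 C, 0 <= C &
  forall rho (x0 : V) N g s, 0 < rho -> size s = k -> Cc g ->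
  nrm (partials (i :: s) (timeop rho x0 (near_time N) p g)) <= C * (rho^-1 * nrm (partials s g)).
Proof.
move=> cp; exists (2 ^+ k * Num.sqrt (64 * cotlar_const p i)).
  by rewrite mulr_ge0 ?exprn_ge0// sqrtr_ge0.
move=> rho x0 N g s rho0 sk cg.
have tw := time_weight_near N.
have w2 t : near_time N t != 0 -> t <= 2^-1 by move=> /near_timeP/andP[].
have bg := Cc_Bb (Cc_partials s cg).
have tws := near_weight (size s) tw w2.
rewrite /= (timeop_partials_near x0 rho0 s tw w2 cp cg) (timeop_partial x0 rho0 i tws cp bg).
pose v t := (2 ^+ k)^-1 * ((1 - t)^-1 ^+ k * (t^-1 * near_time N t)).
have mv : measurable_fun setT v.
  apply: measurable_funM => //; apply: measurable_funM.
    by apply: measurable_funX; apply: (measurableT_comp (@measurable_invr R)); exact: measurable_funB.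
  by apply: measurable_funM; [exact: measurable_invr|have [] := tw].
have vb t : `|v t| <= t^-1 * \1_(`]2^-1 / 2 ^+ N, 2^-1]%classic) t.
  rewrite /v -/(near_time N); have [->|wt] := eqVneq (near_time N t) 0.
    by rewrite !mulr0 normr0.
  have /andP[t1 t2] := near_timeP wt; have t0 := lt_trans (dyadic_gt0 N) t1.
  rewrite mulrA normrM [X in _ * X <= _]ger0_norm; last first.
    by rewrite mulr_ge0 ?invr_ge0 ?(ltW t0)// /near_time indicE.
  rewrite ler_piMl//.
    by rewrite mulr_ge0 ?invr_ge0 ?(ltW t0)// /near_time indicE.
  have t3 : 2^-1 <= 1 - t by lra.
  have t4 : 0 < 1 - t by exact: lt_le_trans t3.
  rewrite ger0_norm ?mulr_ge0 ?invr_ge0 ?exprn_ge0 ?invr_ge0 ?(ltW t4)//.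
  rewrite ler_pdivrMl ?exprn_gt0// mulr1 lerXn2r ?nnegrE ?invr_ge0 ?(ltW t4)//.
  by rewrite -[leRHS]invrK lef_pV2 ?posrE.
have tv : time_weight 1 v.
  split => //.
    exists (2^-1 / 2 ^+ N)^-1 => t; apply: (le_trans (vb t)); rewrite indicE.
    case: (boolP (t \in _)) => [/set_mem/=|_]; last by rewrite mulr0 invr_ge0 ltW// dyadic_gt0.
    rewrite in_itv/= => /andP[h _]; have h0 := dyadic_gt0 N.
    by rewrite mulr1 lef_pV2 ?posrE ?(ltW h)//; exact: lt_trans h.
  have [_ _ [a a0 wa]] := tw; exists a => // t vt; apply: wa.
  by apply: contra_neq vt => E; rewrite /v E !mulr0.
have -> : (fun t => (rho * t)^-1 * ((1 - t)^-1 ^+ size s * near_time N t)) = (fun t => (rho^-1 * 2 ^+ k) * v t).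
  apply/funext => t; rewrite /v sk invfM.
  have e0 : 2 ^+ k != 0 :> R by rewrite expf_neq0.
  by rewrite [RHS]mulrA -[_ * _ / _]mulrA mulfV// mulr1; ring.
rewrite (timeopZ _ x0 rho0 tv (Cc_partial i cp) bg) nrmZ; last exact: Bb_SQ (timeop_Bb x0 rho0 tv (Cc_partial i cp) bg).
have c0 : 0 <= 64 * cotlar_const p i.
  by rewrite mulr_ge0// /cotlar_const addr_ge0// mulr_ge0// mulr_ge0 ?L1_ge0// mulr_ge0 ?L1_ge0// exprn_ge0.
have H : nrm (timeop rho x0 v (partial i p) (partials s g)) <= Num.sqrt (64 * cotlar_const p i) * nrm (partials s g).
  apply: nrm_le; first by rewrite mulr_ge0 ?sqrtr_ge0 ?nrm_ge0.
  by rewrite exprMn sqr_sqrtr// nrm_sqr; exact: (near_bound x0 rho0 i mv cp bg vb).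
rewrite ger0_norm ?mulr_ge0 ?invr_ge0 ?exprn_ge0 ?(ltW rho0)//.
apply: (le_trans (ler_wpM2l _ H)); first by rewrite mulr_ge0 ?invr_ge0 ?exprn_ge0 ?(ltW rho0).
by rewrite le_eqVlt; apply/orP; left; apply/eqP; ring.
Qed.

(** For [t > 1/2] a derivative of the kernel costs at most [2 / rho], so all of them can stay on it
    and [g] enters through its L2 norm alone. *)
Lemma far_part p s : (2 <= n)%N -> Cc p -> exists2 C, 0 <= C &
  forall rho (x0 : V) (Om : set V) q g, 0 < rho -> Bb g ->
  measurable Om -> Bb (\1_Om : V -> R) -> (forall x, ~ Om x -> g x = 0) ->
  1 <= q -> vol Om <= (2 * rho) ^+ n * q ->
  nrm (partials s (timeop rho x0 far_time p g)) <= C * (rho^-1 ^+ size s * log_factor n q * nrm g).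
Proof.
move=> n2 cp; have [C C0 HC] := far_bound R n2.
exists (2 ^+ size s * (C * Num.sqrt (far_const (partials s p)))).
  by rewrite !mulr_ge0 ?exprn_ge0// sqrtr_ge0.
move=> rho x0 Om q g rho0 bg mOm bOm gOm q1 volq.
have tw := time_weight_far; have cps := Cc_partials s cp.
rewrite (timeop_partials x0 rho0 s tw cp bg).
pose v t := (2 ^+ size s)^-1 * (t^-1 ^+ size s * far_time t).
have vb t : `|v t| <= \1_(`]0, 1[%classic) t.
  rewrite /v; have [->|wt] := eqVneq (far_time t) 0; first by rewrite !mulr0 normr0.
  have /andP[t1 t2] := far_timeP wt; have t0 : 0 < t by apply: lt_trans t1.
  rewrite [\1_ _ t]indicE mem_set/=; last by rewrite in_itv/= t0.
  rewrite mulrA normrM; apply: (@le_trans _ _ (1 * 1)); last by rewrite mulr1.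
  rewrite ler_pM// ?ger0_norm ?mulr_ge0 ?invr_ge0 ?exprn_ge0 ?invr_ge0 ?(ltW t0)//; last first.
    by rewrite /far_time indicE lern1 leq_b1.
  rewrite ler_pdivrMl ?exprn_gt0// mulr1 lerXn2r ?nnegrE ?invr_ge0 ?(ltW t0)//.
  by rewrite -[leRHS]invrK lef_pV2 ?posrE ?(ltW t1).
have tv : time_weight 1 v.
  split.
  - apply: measurable_funM => //; apply: measurable_funM; last by have [] := tw.
    by apply: measurable_funX; exact: measurable_invr.
  - by exists 1 => t; apply: (le_trans (vb t)); rewrite indicE lern1 leq_b1.
  have [_ _ [a a0 wa]] := tw; exists a => // t vt; apply: wa.
  by apply: contra_neq vt => E; rewrite /v E !mulr0.
have -> : (fun t => (rho * t)^-1 ^+ size s * far_time t) = (fun t => (rho^-1 ^+ size s * 2 ^+ size s) * v t).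
  apply/funext => t; rewrite /v invfM exprMn.
  have e0 : 2 ^+ size s != 0 :> R by rewrite expf_neq0.
  by rewrite [RHS]mulrA -[_ * _ / _]mulrA mulfV// mulr1 mulrA.
rewrite (timeopZ _ x0 rho0 tv cps bg) nrmZ; last exact: Bb_SQ (timeop_Bb x0 rho0 tv cps bg).
have Q1 := log_factor_ge1 n q.
have H : nrm (timeop rho x0 v (partials s p) g) <= (C * log_factor n q) * (Num.sqrt (far_const (partials s p)) * nrm g).
  apply: nrm_le; first by rewrite !mulr_ge0 ?sqrtr_ge0 ?nrm_ge0// (le_trans _ Q1).
  rewrite exprMn [X in _ * X]exprMn sqr_sqrtr ?far_const_ge0// nrm_sqr.
  exact: HC tv cps bg mOm bOm gOm q1 volq vb.
rewrite ger0_norm ?mulr_ge0 ?exprn_ge0 ?invr_ge0 ?(ltW rho0)//.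
apply: (le_trans (ler_wpM2l _ H)); first by rewrite mulr_ge0 ?exprn_ge0 ?invr_ge0 ?(ltW rho0).
by rewrite le_eqVlt; apply/orP; left; apply/eqP; ring.
Qed.

Lemma timeop_deriv_bound p k : (2 <= n)%N -> Cc p -> exists2 C, 0 <= C &
  forall rho (x0 : V) (Om : set V) q N g i s, 0 < rho -> size s = k -> Cc g ->
  measurable Om -> Bb (\1_Om : V -> R) -> (forall x, ~ Om x -> g x = 0) ->
  1 <= q -> vol Om <= (2 * rho) ^+ n * q ->
  nrm (partials (i :: s) (timeop rho x0 (\1_(`]2^-1 / 2 ^+ N, 1[%classic)) p g)) <=
  C * (rho^-1 * nrm (partials s g) + rho^-1 ^+ k.+1 * log_factor n q * nrm g).
Proof.
move=> n2 cp.
have [A A0 HA] : exists2 A, 0 <= A & forall i rho (x0 : V) N g s, 0 < rho -> size s = k -> Cc g ->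
  nrm (partials (i :: s) (timeop rho x0 (near_time N) p g)) <= A * (rho^-1 * nrm (partials s g)).
  have /choice[a Ha] : forall i, exists C, 0 <= C /\
    forall rho (x0 : V) N g s, 0 < rho -> size s = k -> Cc g ->
    nrm (partials (i :: s) (timeop rho x0 (near_time N) p g)) <= C * (rho^-1 * nrm (partials s g)).
    by move=> i; have [C C0 HC] := near_part i k cp; exists C.
  exists (\sum_i a i); first by apply: sumr_ge0 => i _; have [] := Ha i.
  move=> i rho x0 N g s rho0 sk cg; have [a0 H] := Ha i.
  apply: (le_trans (H _ _ _ _ _ rho0 sk cg)); rewrite ler_wpM2r ?mulr_ge0 ?invr_ge0 ?nrm_ge0 ?(ltW rho0)//.
  by rewrite (bigD1 i)//= lerDl sumr_ge0// => j _; have [] := Ha j.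
have /choice[b Hb] : forall s, exists C, 0 <= C /\
    forall rho (x0 : V) (Om : set V) q g, 0 < rho -> Bb g ->
    measurable Om -> Bb (\1_Om : V -> R) -> (forall x, ~ Om x -> g x = 0) ->
    1 <= q -> vol Om <= (2 * rho) ^+ n * q ->
    nrm (partials s (timeop rho x0 far_time p g)) <= C * (rho^-1 ^+ size s * log_factor n q * nrm g).
  by move=> s; have [C C0 HC] := far_part s n2 cp; exists C.
have [B B0 HB] := words_bounded b k.+1.
exists (A + B); first exact: addr_ge0.
move=> rho x0 Om q N g i s rho0 sk cg mOm bOm gOm q1 volq.
have bg := Cc_Bb cg.
have twn := time_weight_near N; have twf := time_weight_far.
rewrite split_time (timeopD x0 rho0 twn twf cp bg).
have c1 := timeop_Cc x0 rho0 twn cp bg; have c2 := timeop_Cc x0 rho0 twf cp bg.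
rewrite (partialsD _ c1.1 c2.1).
apply: (le_trans (nrmD (Bb_SQ (Cc_Bb (Cc_partials (i :: s) c1))) (Bb_SQ (Cc_Bb (Cc_partials (i :: s) c2))))).
have Q1 := log_factor_ge1 n q.
have r0 : 0 <= rho^-1 by rewrite invr_ge0 ltW.
have t1 : 0 <= rho^-1 * nrm (partials s g) by rewrite mulr_ge0 ?nrm_ge0.
have t2 : 0 <= rho^-1 ^+ k.+1 * log_factor n q * nrm g.
  by rewrite !mulr_ge0 ?nrm_ge0 ?exprn_ge0// (le_trans _ Q1).
have H1 := HA i rho x0 N g s rho0 sk cg.
have [b0 Hb'] := Hb (i :: s).
have H2 := Hb' rho x0 Om q g rho0 bg mOm bOm gOm q1 volq.
rewrite /= sk in H2; have bB := HB (i :: s) (congr1 S sk).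
apply: (le_trans (lerD H1 (le_trans H2 (ler_wpM2r t2 bB)))).
by rewrite [leRHS]mulrDr; apply: lerD; rewrite ler_wpM2r// ?lerDl ?lerDr.
Qed.

End timeop_bounds.

(** * Bounds on the truncated field *)

Section bogovskii_bounds.
Variables (R : realType) (n : nat).
Local Notation V := 'rV[R]_n.
Local Notation mu := (lebesgue_rV R n).
Implicit Types (f g h p : V -> R) (s : seq 'I_n) (w : R -> R).

Definition cutoff (N : nat) : R -> R := \1_(`]2^-1 / 2 ^+ N, 1[%classic).

Definition bogovskii_rhs k (diam rho q : R) f : R :=
  \sum_(1 <= l < k) diam / rho ^+ (k - l) * deriv_norm l f +
  diam / rho ^+ k * log_factor n q * nrm f.

(** The sum has no term with [l = 0], but the last summand dominates it because [log_factor] is at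
    least one. *)
Lemma bogovskii_rhs_term k l diam rho q f : 0 <= diam -> 0 < rho -> (l < k)%N ->
  diam / rho ^+ (k - l) * deriv_norm l f <= bogovskii_rhs k diam rho q f.
Proof.
move=> d0 r0 lk; have r1 m : 0 <= diam / rho ^+ m by rewrite divr_ge0// exprn_ge0// ltW.
have t0 m : 0 <= diam / rho ^+ (k - m) * deriv_norm m f.
  by rewrite mulr_ge0// deriv_norm_ge0.
have Q1 := log_factor_ge1 n q.
have s0 : 0 <= \sum_(1 <= l < k) diam / rho ^+ (k - l) * deriv_norm l f by apply: sumr_ge0.
have u0 : 0 <= diam / rho ^+ k * log_factor n q * nrm f.
  by rewrite mulr_ge0 ?nrm_ge0// mulr_ge0// (le_trans _ Q1).
case: l lk => [|l] lk.
  rewrite subn0 deriv_norm0 /bogovskii_rhs -[leLHS]add0r lerD//.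
  by rewrite ler_wpM2r ?nrm_ge0// ler_peMr.
rewrite /bogovskii_rhs -[leLHS]addr0 lerD//.
rewrite (big_cat_nat (n := l.+1))//=; last exact: ltnW.
rewrite (big_ltn (m := l.+1))// addrCA lerDl addr_ge0//; apply: sumr_ge0 => //.
Qed.

Lemma succ_sub_pred k : (0 < k)%N -> (k.+1 - k.-1 = 2)%N.
Proof. by case: k => // k _ /=; rewrite -add2n addnK. Qed.

Section domain.
Variables (Om : set V) (diam rho : R) (x0 : V).
Hypotheses (n2 : (2 <= n)%N) (dOm : domain Om) (dm : ediameter Om = diam%:E) (rho0 : 0 < rho)
  (star : star_shaped Om (eball x0 rho)).

Lemma n_gt0 : (0 < n)%N. Proof. exact: leq_trans n2. Qed.

Lemma nrm_coord_mul j g : Bb g -> (forall y, ~ Om y -> g y = 0) ->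
  nrm (coord_mul x0 j g) <= diam * nrm g.
Proof.
move=> bg gO; have d0 := diam_gt0 n_gt0 dOm dm rho0 star.
apply: nrm_le_pointwise => //; [exact: ltW|exact: Bb_SQ (coord_mul_Bb _ _ bg)|exact: Bb_SQ|].
move=> x; rewrite /coord_mul; have [Ox|Ox] := pselect (Om x); last by rewrite gO// mulr0 normr0 mulr0.
by rewrite normrM ler_wpM2r// (coord_le_diam n_gt0 dOm dm rho0 star).
Qed.

Lemma nrm_partials_coord_mul j s f : test_function Om f ->
  nrm (partials s (coord_mul x0 j f)) <=
  diam * nrm (partials s f) + (size s)%:R * deriv_norm (size s).-1 f.
Proof.
move=> tf; have cf := test_function_Cc tf; have sf := cf.1.
rewrite partials_coord_mul//.
have S1 t : SQ (partials t f) by exact: Bb_SQ (Cc_Bb (Cc_partials t cf)).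
have S2 : SQ (coord_mul x0 j (partials s f)).
  exact: Bb_SQ (coord_mul_Bb _ _ (Cc_Bb (Cc_partials s cf))).
apply: (le_trans (nrmD S2 (SQ_sum (deletions j s) S1))); apply: lerD.
  apply: nrm_coord_mul; first exact: Cc_Bb (Cc_partials s cf).
  by move=> y; exact: test_function_supp (test_function_partials s tf).
apply: (le_trans (nrm_sum _ S1)).
apply: (@le_trans _ _ (\sum_(t <- deletions j s) deriv_norm (size s).-1 f)).
  rewrite !big_seq; apply: ler_sum => t /size_in_deletions <-; exact: nrm_partials_le.
rewrite big_const_seq count_predT iter_addr_0 -[leLHS]mulr_natl ler_wpM2r ?deriv_norm_ge0//.
by rewrite ler_nat size_deletions.
Qed.

End domain.

Lemma bogovskii_partials_nrm (om : V -> R) rho (x0 : V) w f j s : Cc om -> 0 < rho -> time_weight 1 w -> Bb f ->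
  nrm (partials s (bogovskii om rho x0 w f j)) <=
  rho * nrm (partials s (timeop rho x0 w (coord_mul 0 j om) f)) +
  nrm (partials s (timeop rho x0 w om (coord_mul x0 j f))).
Proof.
move=> com rho0 tw bf; rewrite bogovskii_partials//.
have c1 := timeop_Cc x0 rho0 tw (coord_mul_Cc 0 j com) bf.
have c2 := timeop_Cc x0 rho0 tw com (coord_mul_Bb x0 j bf).
have S1 := Bb_SQ (Cc_Bb (Cc_partials s c1)); have S2 := Bb_SQ (Cc_Bb (Cc_partials s c2)).
apply: (le_trans (nrmB (SQZ rho S1) S2)); rewrite lerD2r nrmZ// ger0_norm//; exact: ltW.
Qed.

(** One term of the field carries [rho] where the claim has the diameter; [rho <= 2 diam] exchanges
    them. The same inequality, with one more power of [rho], serves the derivative of lower order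
    left by Leibniz' rule. *)
Lemma bogovskii_const_le (rho diam Dk Dk1 X c1 c2 k r Q nf : R) : 0 < rho -> 0 <= diam ->
  rho / 2 <= diam -> 0 <= c1 -> 0 <= c2 -> 0 <= k -> 0 <= Dk -> 0 <= Dk1 -> 0 <= r -> 0 <= Q -> 0 <= nf ->
  diam / rho * Dk <= X -> diam / rho ^+ 2 * (k * Dk1) <= k * X -> diam * r * Q * nf <= X ->
  rho * (c1 * (rho^-1 * Dk + r * Q * nf)) +
  c2 * (rho^-1 * (diam * Dk + k * Dk1) + r * Q * (diam * nf)) <=
  (4 * c1 + c2 * (2 + 2 * k)) * X.
Proof.
move=> rho0 d0 rd c10 c20 k0 Dk0 Dk10 r0 Q0 nf0 h1 h2 h3.
have a1 : Dk <= 2 * (diam / rho * Dk).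
  rewrite mulrA ler_peMl// mulrA ler_pdivlMr// mul1r; lra.
have a2 : rho * (r * Q * nf) <= 2 * (diam * r * Q * nf).
  rewrite [leRHS](_ : _ = 2 * diam * (r * Q * nf)); last by ring.
  by rewrite ler_wpM2r ?mulr_ge0//; lra.
have a3 : rho^-1 * (k * Dk1) <= 2 * (diam / rho ^+ 2 * (k * Dk1)).
  rewrite [leRHS]mulrA ler_wpM2r ?mulr_ge0//.
  rewrite expr2 invfM mulrA [leRHS]mulrA ler_peMl ?invr_ge0 ?(ltW rho0)//.
  by rewrite ler_pdivlMr// mul1r; lra.
have b1 : rho * (c1 * (rho^-1 * Dk + r * Q * nf)) = c1 * Dk + c1 * (rho * (r * Q * nf)).
  by field; rewrite gt_eqF.
have b2 : c2 * (rho^-1 * (diam * Dk + k * Dk1) + r * Q * (diam * nf)) =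
  c2 * (diam / rho * Dk) + c2 * (rho^-1 * (k * Dk1)) + c2 * (diam * r * Q * nf).
  by field; rewrite gt_eqF.
rewrite b1 b2.
have d1 : c1 * Dk <= c1 * (2 * X) by rewrite ler_wpM2l//; lra.
have d2 : c1 * (rho * (r * Q * nf)) <= c1 * (2 * X) by rewrite ler_wpM2l//; lra.
have d3 : c2 * (diam / rho * Dk) <= c2 * X by rewrite ler_wpM2l.
have d4 : c2 * (rho^-1 * (k * Dk1)) <= c2 * (2 * (k * X)) by rewrite ler_wpM2l//; lra.
have d5 : c2 * (diam * r * Q * nf) <= c2 * X by rewrite ler_wpM2l.
rewrite [leRHS](_ : _ = c1 * (2 * X) + c1 * (2 * X) + (c2 * X + c2 * (2 * (k * X)) + c2 * X)).
  exact: lerD (lerD d1 d2) (lerD (lerD d3 d4) d5).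
by ring.
Qed.

Lemma bogovskii_bound (om : V -> R) k : (2 <= n)%N -> Cc om -> exists2 C, 0 <= C &
  forall (Om : set V) diam rho x0, domain Om -> ediameter Om = diam%:E -> 0 < rho ->
  star_shaped Om (eball x0 rho) ->
  forall N f j s, test_function Om f -> size s = k.+1 ->
  nrm (partials s (bogovskii om rho x0 (cutoff N) f j)) <=
  C * bogovskii_rhs k.+1 diam rho (vol Om / vol (eball x0 rho)) f.
Proof.
move=> n2 com; have n0 := n_gt0 n2.
have [C2 C20 H2] := timeop_deriv_bound k n2 com.
have /choice[c Hc] : forall j, exists C, 0 <= C /\
  forall rho (x0 : V) (Om : set V) q N g i s, 0 < rho -> size s = k -> Cc g ->
  measurable Om -> Bb (\1_Om : V -> R) -> (forall x, ~ Om x -> g x = 0) ->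
  1 <= q -> vol Om <= (2 * rho) ^+ n * q ->
  nrm (partials (i :: s) (timeop rho x0 (\1_(`]2^-1 / 2 ^+ N, 1[%classic)) (coord_mul 0 j om) g)) <=
  C * (rho^-1 * nrm (partials s g) + rho^-1 ^+ k.+1 * log_factor n q * nrm g).
  by move=> j; have [C C0 HC] := timeop_deriv_bound k n2 (coord_mul_Cc 0 j com); exists C.
pose C1 := \sum_j c j.
have C10 : 0 <= C1 by apply: sumr_ge0 => j _; have [] := Hc j.
have cC1 j : c j <= C1.
  by rewrite /C1 (bigD1 j)//= lerDl sumr_ge0// => i _; have [] := Hc i.
exists (4 * C1 + C2 * (2 + 2 * k%:R)); first by rewrite addr_ge0// mulr_ge0// addr_ge0// mulr_ge0.
move=> Om diam rho x0 dOm dm rho0 star N f j [//|i s] tf [sk].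
have cf := test_function_Cc tf; have bf := Cc_Bb cf.
have fO y : ~ Om y -> f y = 0 by exact: test_function_supp tf.
set q := _ / _; have q1 : 1 <= q := vol_ratio_ge1 n0 dOm dm rho0 star.
have volq : vol Om <= (2 * rho) ^+ n * q := vol_le_ratio Om x0 n0 rho0.
have mOm := domain_measurable dOm; have bOm := domain_indic_Bb n0 dOm dm rho0 star.
have d0 := diam_gt0 n0 dOm dm rho0 star; have rd := half_rho_le_diam n0 dOm dm rho0 star.
have tw : time_weight 1 (cutoff N) by apply: time_weight_itv; exact: dyadic_gt0.
apply: (le_trans (bogovskii_partials_nrm x0 j (i :: s) com rho0 tw bf)).
have [cj0 H1] := Hc j.
have K1 := H1 rho x0 Om q N f i s rho0 sk cf mOm bOm fO q1 volq.
have ccf := coord_mul_Cc x0 j cf.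
have cfO y : ~ Om y -> coord_mul x0 j f y = 0 by move=> Oy; rewrite /coord_mul fO// mulr0.
have K2 := H2 rho x0 Om q N (coord_mul x0 j f) i s rho0 sk ccf mOm bOm cfO q1 volq.
have L1 := nrm_partials_le s f; rewrite sk in L1.
have L2 := nrm_partials_coord_mul n2 dOm dm rho0 star j s tf; rewrite sk in L2.
have L3 := nrm_coord_mul n2 dOm dm rho0 star j bf fO.
have Q1 := log_factor_ge1 n q; have Q0 : 0 <= log_factor n q by exact: le_trans Q1.
have r0 : 0 <= rho^-1 by rewrite invr_ge0 ltW.
have rk0 : 0 <= rho^-1 ^+ k.+1 by rewrite exprn_ge0.
set X := bogovskii_rhs _ _ _ _ _.
have X0 : 0 <= X.
  apply: le_trans (bogovskii_rhs_term q f (ltW d0) rho0 (ltn0Sn k)).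
  by rewrite mulr_ge0 ?deriv_norm_ge0// divr_ge0 ?exprn_ge0 ?ltW.
have T1 : diam / rho * deriv_norm k f <= X.
  by have := bogovskii_rhs_term q f (ltW d0) rho0 (ltnSn k); rewrite subSnn expr1.
(* For [k = 0] the predecessor is no lower order, but then the factor [k] removes the term. *)
have T2 : diam / rho ^+ 2 * (k%:R * deriv_norm k.-1 f) <= k%:R * X.
  rewrite mulrCA; have [k0|k0] := posnP k.
    by rewrite (_ : k%:R = 0 :> R) ?k0// !mul0r.
  rewrite ler_wpM2l//; have lt : (k.-1 < k.+1)%N by rewrite ltnS leq_pred.
  have := bogovskii_rhs_term q f (ltW d0) rho0 lt.
  by rewrite succ_sub_pred.
have T3 : diam * rho^-1 ^+ k.+1 * log_factor n q * nrm f <= X.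
  by rewrite /X /bogovskii_rhs exprVn lerDr; apply: sumr_ge0 => l _; rewrite mulr_ge0 ?deriv_norm_ge0// divr_ge0 ?exprn_ge0 ?ltW.
apply: le_trans (bogovskii_const_le rho0 (ltW d0) rd C10 C20 _ (deriv_norm_ge0 k f) (deriv_norm_ge0 k.-1 f) rk0 Q0 (nrm_ge0 f) T1 T2 T3) => //.
apply: lerD.
  rewrite ler_wpM2l ?(ltW rho0)//; apply: (le_trans K1).
  apply: ler_pM => //; first by rewrite addr_ge0 ?mulr_ge0 ?nrm_ge0.
  by rewrite lerD2r ler_wpM2l.
apply: (le_trans K2); rewrite ler_wpM2l//; apply: lerD; first by rewrite ler_wpM2l// (le_trans L2)// lerD2r ler_wpM2l// ltW.
by rewrite ler_wpM2l// mulr_ge0.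
Qed.

Section fixed_domain.
Variables (om : V -> R) (Om : set V) (diam rho : R) (x0 : V).
Hypotheses (com : Cc om) (n2 : (2 <= n)%N) (dOm : domain Om) (dm : ediameter Om = diam%:E)
  (rho0 : 0 < rho) (star : star_shaped Om (eball x0 rho)).

(** A crude bound, whose constant may depend on the domain, for words of every length including the
    empty one. It serves the convergence of the approximations; the sharp constant comes from
    [bogovskii_bound]. *)
Lemma bogovskii_bounded s : exists2 K, 0 <= K & forall N f j, test_function Om f ->
  nrm (partials s (bogovskii om rho x0 (cutoff N) f j)) <=
  K * (\sum_(l < size s) deriv_norm l f + nrm f).
Proof.
have n0 := n_gt0 n2; have d0 := diam_gt0 n0 dOm dm rho0 star.
set q := vol Om / vol (eball x0 rho); have q1 : 1 <= q := vol_ratio_ge1 n0 dOm dm rho0 star.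
have volq : vol Om <= (2 * rho) ^+ n * q := vol_le_ratio Om x0 n0 rho0.
have mOm := domain_measurable dOm; have bOm := domain_indic_Bb n0 dOm dm rho0 star.
have Q1 := log_factor_ge1 n q; have Q0 : 0 <= log_factor n q by exact: le_trans Q1.
case: s => [|i s].
  have [C C0 HC] := far_bound R n2.
  have /choice[c Hc] : forall p, exists c, 0 <= c /\ (Cc p -> forall N g, Bb g -> (forall y, ~ Om y -> g y = 0) ->
    nrm (timeop rho x0 (cutoff N) p g) <= c * nrm g).
    move=> p; exists ((C * log_factor n q) * Num.sqrt (far_const p)).
    have c0 : 0 <= (C * log_factor n q) * Num.sqrt (far_const p) by rewrite !mulr_ge0// sqrtr_ge0.
    split=> // cp N g bg gO; apply: nrm_le; first by rewrite mulr_ge0// nrm_ge0.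
    rewrite 2!exprMn sqr_sqrtr ?far_const_ge0// nrm_sqr -mulrA.
    apply: (HC rho x0 Om q (cutoff N) p g rho0 _ cp bg mOm bOm gO q1 volq).
      by apply: time_weight_itv; exact: dyadic_gt0.
    move=> t; rewrite /cutoff !indicE ger0_norm// ler_nat.
    case: (boolP (t \in _)) => // /set_mem/=; rewrite in_itv/= => /andP[t1 t2].
    by rewrite mem_set//= in_itv/= (lt_trans (dyadic_gt0 R N) t1).
  exists (\sum_j rho * c (coord_mul 0 j om) + c om * diam).
    by rewrite addr_ge0 ?mulr_ge0 ?(ltW d0)//; [apply: sumr_ge0 => j _; rewrite mulr_ge0 ?(ltW rho0)//; have [] := Hc (coord_mul 0 j om)|have [] := Hc om].
  move=> N f j tf; have bf := Cc_Bb (test_function_Cc tf).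
  have fO y : ~ Om y -> f y = 0 by exact: test_function_supp tf.
  have tw : time_weight 1 (cutoff N) by apply: time_weight_itv; exact: dyadic_gt0.
  apply: (le_trans (bogovskii_partials_nrm x0 j [::] com rho0 tw bf)).
  rewrite big_ord0 add0r mulrDl; apply: lerD.
    have [_ H] := Hc (coord_mul 0 j om).
    apply: (@le_trans _ _ (rho * c (coord_mul 0 j om) * nrm f)).
      by rewrite -mulrA ler_wpM2l ?(ltW rho0)//; apply: H => //; exact: coord_mul_Cc.
    rewrite ler_wpM2r ?nrm_ge0// (bigD1 j)//= lerDl; apply: sumr_ge0 => i _.
    by rewrite mulr_ge0 ?(ltW rho0)//; have [] := Hc (coord_mul 0 i om).
  have [co H] := Hc om; apply: (le_trans (H com N _ (coord_mul_Bb _ _ bf) _)).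
    by move=> y Oy; rewrite /coord_mul fO// mulr0.
  by rewrite -mulrA ler_wpM2l// (nrm_coord_mul n2 dOm dm rho0 star j bf fO).
have [C C0 HC] := bogovskii_bound (size s) n2 com.
pose M := \sum_(l < (size s).+2) diam / rho ^+ l * log_factor n q.
have r1 m : 0 <= diam / rho ^+ m by rewrite divr_ge0 ?exprn_ge0 ?ltW.
have MM m : (m < (size s).+2)%N -> diam / rho ^+ m * log_factor n q <= M.
  by move=> ms; rewrite /M (bigD1 (Ordinal ms))//= lerDl; apply: sumr_ge0 => l _; rewrite mulr_ge0.
have M0 : 0 <= M by apply: sumr_ge0 => l _; rewrite mulr_ge0.
exists (C * M); first exact: mulr_ge0.
move=> N f j tf; apply: (le_trans (HC Om diam rho x0 dOm dm rho0 star N f j (i :: s) tf erefl)).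
rewrite -mulrA ler_wpM2l// /bogovskii_rhs [leRHS]mulrDr; apply: lerD; last first.
  by rewrite ler_wpM2r ?nrm_ge0// MM.
rewrite -(big_mkord xpredT (fun l => deriv_norm l f)) [in leRHS]big_ltn// [leRHS]mulrDr.
apply: (@le_trans _ _ (M * \sum_(1 <= l < (size s).+1) deriv_norm l f)).
  rewrite mulr_sumr !big_nat; apply: ler_sum => l /andP[l1 l2].
  rewrite ler_wpM2r ?deriv_norm_ge0//; apply: le_trans (MM ((size s).+1 - l)%N _); last by rewrite ltnS leq_subr.
  by rewrite ler_peMr.
by rewrite lerDr mulr_ge0// deriv_norm_ge0.
Qed.

(** Two truncations differ by a time average over a short interval. Here all derivatives go to [f],
    so [K] involves one order more than the Sobolev norm of [f] controls: the truncation has to be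
    chosen after [f]. *)
Lemma bogovskii_short f s j : Cc f -> exists2 K, 0 <= K & forall N N', (N <= N')%N ->
  nrm (partials s (bogovskii om rho x0 (cutoff N') f j \- bogovskii om rho x0 (cutoff N) f j)) <=
  K * (2^-1 / 2 ^+ N).
Proof.
move=> cf.
have short p g : Cc p -> Cc g -> exists2 K, 0 <= K & forall N N', (N <= N')%N ->
    nrm (partials s (timeop rho x0 (cutoff N') p g \- timeop rho x0 (cutoff N) p g)) <= K * (2^-1 / 2 ^+ N).
  move=> cp cg; pose B := 2 ^+ n * L1 p ^+ 2 * ip (partials s g) (partials s g).
  have B0 : 0 <= B by rewrite mulr_ge0 ?ip_ge0// mulr_ge0 ?sqr_ge0// exprn_ge0.
  exists (2 ^+ size s * Num.sqrt B); first by rewrite mulr_ge0 ?exprn_ge0 ?sqrtr_ge0.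
  move=> N N' NN.
  have e0 := dyadic_gt0 R N; have e0' := dyadic_gt0 R N'; have e2 := dyadic_le_half R N.
  have ee : 2^-1 / 2 ^+ N' <= 2^-1 / 2 ^+ N :> R.
    by rewrite ler_pM2l ?invr_gt0// lef_pV2 ?posrE ?exprn_gt0// ler_weXn2l// ler1n.
  set e := 2^-1 / 2 ^+ N in e0 e2 ee *; set e' := 2^-1 / 2 ^+ N' in e0' ee *.
  pose v : R -> R := \1_(`]e', e]%classic).
  have vP t : v t != 0 -> e' < t <= e.
    rewrite /v indicE; case: (boolP (t \in _)) => [/set_mem/=|_]; last by rewrite eqxx.
    by rewrite in_itv.
  have v01 t : 0 <= v t <= 1 by rewrite /v indicE ler0n lern1 leq_b1.
  have tv : time_weight 1 v.
    split; first by apply: measurable_indic; exact: measurable_itv.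
      by exists 1 => t; have /andP[h1 h2] := v01 t; rewrite ger0_norm.
    exists e' => // t /vP/andP[h1 h2]; rewrite mul1r (ltW h1)/= (le_trans h2)// (le_trans e2)//.
    by rewrite invf_le1// ler1n.
  have v2 t : v t != 0 -> t <= 2^-1 by move=> /vP/andP[_ h]; exact: le_trans e2.
  have tw M : time_weight 1 (cutoff M) by apply: time_weight_itv; exact: dyadic_gt0.
  have bg := Cc_Bb cg.
  have -> : timeop rho x0 (cutoff N') p g \- timeop rho x0 (cutoff N) p g = timeop rho x0 v p g.
    have -> : cutoff N' = (fun t => cutoff N t + v t).
      apply/funext => t; rewrite /cutoff /v !indicE -natrD; congr (_%:R).
      rewrite !mem_setE/= !in_itv/= -/e -/e'.
      case: (leP t e) => te; rewrite ?andbT ?andbF/=.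
        by rewrite add0n (_ : t < 1 = true) ?andbT//; apply/idP; lra.
      by rewrite addn0 (le_lt_trans ee te).
    rewrite (timeopD x0 rho0 (tw N) tv cp bg); apply/funext => x /=.
    by rewrite addrAC subrr add0r.
  rewrite (timeop_partials_near x0 rho0 s tv v2 cp cg).
  have bgs := Cc_Bb (Cc_partials s cg).
  pose u t := (2 ^+ size s)^-1 * ((1 - t)^-1 ^+ size s * v t).
  have p2 : 0 < 2 ^+ size s :> R by rewrite exprn_gt0.
  have ub t : `|u t| <= \1_(`[0, e]%classic) t.
    rewrite /u; have [->|vt] := eqVneq (v t) 0; first by rewrite !mulr0 normr0.
    have /andP[t1 t2] := vP t vt; rewrite [\1_ _ t]indicE mem_set/=; last first.
      by rewrite in_itv/= t2 ltW// (lt_trans e0').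
    have /andP[h1 h2] := v01 t; have t3 : 2^-1 <= 1 - t by lra.
    have t4 : 0 < 1 - t by exact: lt_le_trans t3.
    have i0 : 0 <= (1 - t)^-1 by rewrite invr_ge0 ltW.
    rewrite ger0_norm; last by rewrite !mulr_ge0// ?invr_ge0 ?exprn_ge0// ltW.
    rewrite ler_pdivrMl// mulr1 -[leRHS]mulr1 ler_pM ?exprn_ge0//.
    rewrite lerXn2r ?nnegrE//.
    by rewrite -[leRHS]invrK lef_pV2 ?posrE.
  have tu : time_weight 1 u.
    have [mv _ [a a0 wa]] := tv; split.
    - apply: measurable_funM => //; apply: measurable_funM => //.
      by apply: measurable_funX; apply: (measurableT_comp (@measurable_invr R)); exact: measurable_funB.
    - by exists 1 => t; apply: (le_trans (ub t)); rewrite indicE lern1 leq_b1.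
    exists a => // t ut; apply: wa; by apply: contra_neq ut => E; rewrite /u E !mulr0.
  rewrite (_ : (fun t => _) = (fun t => 2 ^+ size s * u t)); last first.
    by apply/funext => t; rewrite /u mulrA mulfV ?mul1r// gt_eqF.
  rewrite (timeopZ _ x0 rho0 tu cp bgs) nrmZ; last exact: Bb_SQ (timeop_Bb x0 rho0 tu cp bgs).
  rewrite (ger0_norm (ltW p2)) -[leRHS]mulrA ler_wpM2l ?(ltW p2)//.
  apply: nrm_le; first by rewrite mulr_ge0 ?sqrtr_ge0 ?ltW.
  rewrite exprMn sqr_sqrtr// mulrC; apply: timeop_short => //.
  by rewrite e2 ltW.
have [K1 K10 H1] := short _ _ (coord_mul_Cc 0 j com) cf.
have [K2 K20 H2] := short _ _ com (coord_mul_Cc x0 j cf).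
exists (rho * K1 + K2); first by rewrite addr_ge0// mulr_ge0// ltW.
move=> N N' NN.
have tw M : time_weight 1 (cutoff M) by apply: time_weight_itv; exact: dyadic_gt0.
have c1 M := timeop_Cc x0 rho0 (tw M) (coord_mul_Cc 0 j com) (Cc_Bb cf).
have c2 M := timeop_Cc x0 rho0 (tw M) com (Cc_Bb (coord_mul_Cc x0 j cf)).
have CcB f1 f2 : Cc f1 -> Cc f2 -> Cc (f1 \- f2).
  move=> cf1 cf2; have := CcD cf1 (CcZ (-1) cf2); congr Cc; apply/funext => x /=.
  by rewrite mulN1r.
have -> : bogovskii om rho x0 (cutoff N') f j \- bogovskii om rho x0 (cutoff N) f j =
  (fun x => rho * (timeop rho x0 (cutoff N') (coord_mul 0 j om) f \- timeop rho x0 (cutoff N) (coord_mul 0 j om) f) x) \-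
  (timeop rho x0 (cutoff N') om (coord_mul x0 j f) \- timeop rho x0 (cutoff N) om (coord_mul x0 j f)).
  have E4 (r a b c d : R) : r * a - b - (r * c - d) = r * (a - c) - (b - d) by ring.
  by apply/funext => x; exact: E4.
have d1 := CcB _ _ (c1 N') (c1 N); have d2 := CcB _ _ (c2 N') (c2 N).
rewrite (partialsB _ (smoothZ rho d1.1) d2.1) (partialsZ _ _ d1.1).
have S1 := Bb_SQ (Cc_Bb (Cc_partials s d1)); have S2 := Bb_SQ (Cc_Bb (Cc_partials s d2)).
apply: (le_trans (nrmB (SQZ rho S1) S2)); rewrite nrmZ// ger0_norm ?(ltW rho0)//.
rewrite mulrDl; apply: lerD; last exact: H2.
by rewrite -mulrA ler_wpM2l ?(ltW rho0)//; exact: H1.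
Qed.

End fixed_domain.

End bogovskii_bounds.

(** * Convergence of the contractions in L2 *)

Section dominated.
Variables (R : realType) (n : nat).
Local Notation V := 'rV[R]_n.
Local Notation mu := (lebesgue_rV R n).
Implicit Types (f g h : V -> R).

Lemma nrm_dominated (hs : nat -> V -> R) h G : (forall k, measurable_fun setT (hs k)) ->
  measurable_fun setT h -> SQ G -> (forall k x, `|hs k x| <= G x) -> (forall x, `|h x| <= G x) ->
  (forall x, hs k x @[k --> \oo] --> h x) ->
  nrm (hs k \- h) @[k --> \oo] --> (0 : R).
Proof.
move=> mhs mh [mG G2] hsG hG cv.
have E k : \int[mu]_x ((hs k x - h x) ^+ 2) = ip (hs k \- h) (hs k \- h).
  by apply: eq_Rintegral => x _; rewrite expr2.
have H : (\int[mu]_x ((hs k x - h x) ^+ 2)%:E)%E @[k --> \oo] --> (\int[mu]_x 0%:E)%E.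
  apply: (@dominated_cvg _ _ _ mu setT measurableT (fun k x => ((hs k x - h x) ^+ 2)%:E) (fun=> 0%:E)
    (fun x => (4 * G x ^+ 2)%:E)) => //.
  - move=> k; apply/measurable_EFinP; apply: measurable_funX; exact: measurable_funB.
  - move=> x _; apply: cvg_EFin; first by near=> k.
    have H0 : (hs k x - h x) @[k --> \oo] --> h x - h x by apply: cvgB => //; exact: cvg_cst.
    have H1 := cvg_comp _ _ H0 (@exprn_continuous R 2 (h x - h x)).
    by move: H1; rewrite subrr expr0n.
  - exact: integrableZ_real.
  move=> k x _; rewrite lee_fin ger0_norm ?sqr_ge0//.
  have h1 := hsG k x; have h2 := hG x; have h3 := ler_normB (hs k x) (h x).
  have G0 : 0 <= G x by exact: le_trans h2.
  rewrite -real_normK ?num_real// (_ : 4 * G x ^+ 2 = (2 * G x) ^+ 2); last by ring.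
  rewrite lerXn2r ?nnegrE ?mulr_ge0//; lra.
have {}H : ip (hs k \- h) (hs k \- h) @[k --> \oo] --> (0 : R).
  rewrite integral0 in H; have H2 := fine_cvg H.
  have -> : (fun k => ip (hs k \- h) (hs k \- h)) = fine \o (fun k => \int[mu]_x ((hs k x - h x) ^+ 2)%:E)%E.
    by apply/funext => k /=; rewrite -E.
  exact: H2.
rewrite /nrm -(sqrtr0 R).
exact: (@cvg_comp _ _ _ (fun k => ip (hs k \- h) (hs k \- h)) (@Num.sqrt R) _ (nbhs 0) _ H (@sqrt_continuous R 0)).
Unshelve. all: by end_near. Qed.

End dominated.

Import HBNNSimple.

(** * A monotone class argument *)

Section density.
Variables (R : realType) (n : nat).
Local Notation V := 'rV[R]_n.
Local Notation mu := (lebesgue_rV R n).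
Implicit Types (f g h : V -> R).

Definition lipschitz_fun f := exists2 L, 0 <= L & forall x y, `|f y - f x| <= L * `|y - x|.

Definition tent (r : R) : V -> R := fun x => Num.max 0 (Num.min 1 (r + 1 - `|x|)).

Lemma clamp_lipschitz (a b : R) :
  `|Num.max 0 (Num.min 1 a) - Num.max 0 (Num.min 1 b)| <= `|a - b|.
Proof.
wlog ab : a b / a <= b.
  by move=> H; have [/H//|/ltW/H] := leP a b; rewrite distrC [X in _ <= X -> _]distrC.
have m1 : Num.max 0 (Num.min 1 a) <= Num.max 0 (Num.min 1 b).
  rewrite ge_max !le_max lexx/=; apply/orP; right; rewrite le_min !ge_min lexx/=.
  by rewrite ab !orbT.
rewrite distrC (ger0_norm (_ : 0 <= _ - _)) ?subr_ge0// distrC ger0_norm ?subr_ge0//.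
rewrite lerBlDr ge_max; apply/andP; split.
  by rewrite addr_ge0 ?subr_ge0// le_max lexx.
have [h|h] := leP a 0.
  apply: (@le_trans _ _ b); first by rewrite ge_min lexx orbT.
  by apply: (@le_trans _ _ (b - a)); [lra|rewrite lerDl le_max lexx].
have [h1|h1] := leP 1 a.
  by rewrite max_r//; apply: (@le_trans _ _ 1); [rewrite ge_min lexx|lra].
by rewrite max_r ?(ltW h)// subrK ge_min lexx orbT.
Qed.

Lemma tent_lipschitz r : lipschitz_fun (tent r).
Proof.
exists 1 => // x y; apply: (le_trans (clamp_lipschitz _ _)).
rewrite mul1r (_ : r + 1 - `|y| - (r + 1 - `|x|) = `|x| - `|y|); last by ring.
by rewrite distrC -[`|y - x|]distrC (le_trans (ler_dist_dist _ _))// distrC.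
Qed.

Lemma tent01 r x : 0 <= tent r x <= 1.
Proof. by rewrite /tent le_max lexx/= ge_max ler01/= ge_min lexx. Qed.

Lemma tent_support r x : 0 <= r -> r + 1 < `|x| -> tent r x = 0.
Proof. by move=> r0 h; rewrite /tent max_l// ge_min; apply/orP; right; lra. Qed.

Lemma tent_in r x : `|x| <= r -> tent r x = 1.
Proof. by move=> h; rewrite /tent min_l ?max_r//; lra. Qed.

Lemma lipschitz_continuous_fun f : lipschitz_fun f -> continuous f.
Proof.
move=> [L L0 HL]; apply: (@lipschitz_continuous_rV _ _ f (L + 1)); first by lra.
by move=> x y; apply: (le_trans (HL x y)); rewrite ler_wpM2r//; lra.
Qed.

Lemma lipschitz_measurable f : lipschitz_fun f -> measurable_fun setT f.
Proof. by move=> lf; apply: rV_continuous_measurable; exact: lipschitz_continuous_fun. Qed.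

Lemma lipschitzM f g : lipschitz_fun f -> lipschitz_fun g -> (forall x, `|f x| <= 1) ->
  (forall x, `|g x| <= 1) -> lipschitz_fun (f \* g).
Proof.
move=> [L L0 HL] [M M0 HM] f1 g1; exists (L + M); first exact: addr_ge0.
move=> x y /=; rewrite (_ : _ - _ = (f y - f x) * g y + f x * (g y - g x)); last by ring.
apply: (le_trans (ler_normD _ _)); rewrite !normrM mulrDl lerD//.
  by rewrite (le_trans (ler_wpM2l _ (g1 y)))// mulr1.
by rewrite (le_trans (ler_wpM2r _ (f1 x)))// mul1r.
Qed.

Lemma tent_Bb r : 0 <= r -> Bb (tent r).
Proof.
move=> r0; split; first exact: lipschitz_measurable (tent_lipschitz r).
- by exists 1 => x; have /andP[h1 h2] := tent01 r x; rewrite ger0_norm.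
- by exists (r + 1) => x; exact: tent_support.
Qed.

(* a pi-system generating the Borel sets *)
Definition corner (b : 'I_n -> bool) (c : 'I_n -> R) : set V := [set x | forall i, b i -> c i <= x ord0 i].

Definition corners : set (set V) := [set A | exists b c, A = corner b c].

Lemma corners_setI : setI_closed corners.
Proof.
move=> _ _ [b1 [c1 ->]] [b2 [c2 ->]].
exists (fun i => b1 i || b2 i), (fun i => if b1 i then (if b2 i then Num.max (c1 i) (c2 i) else c1 i) else c2 i).
apply/seteqP; split => x /=.
  move=> [h1 h2] i; have := h1 i; have := h2 i.
  by case: (b1 i); case: (b2 i) => //= H2 H1 _; rewrite ?ge_max ?H1 ?H2.
move=> H; split => i bi; have := H i; rewrite bi ?orbT /= => /(_ isT).
  by case: (b2 i) => //; rewrite ge_max => /andP[].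
by case: (b1 i) => //; rewrite ge_max => /andP[].
Qed.

Lemma measurable_corners : @measurable _ V `<=` <<s corners >>.
Proof.
apply: smallest_sub; first exact: smallest_sigma_algebra.
rewrite -bigcup_seq => A [i _ [B mB <-]]; rewrite setTI.
pose S := [set B : set R | <<s corners >> ((fun x : V => x ord0 i) @^-1` B)].
have : <<s RGenCInfty.G (R := R) >> `<=` S.
  apply: smallest_sub; last first.
    move=> _ [c ->]; apply: sub_sigma_algebra; exists (fun j => j == i), (fun=> c).
    apply/seteqP; split => x /=; first by rewrite in_itv/= andbT => h j /eqP ->.
    by move=> /(_ i (eqxx _)); rewrite in_itv/= andbT.
  have [s0 sC sU] := @smallest_sigma_algebra _ setT corners.
  split; first by rewrite /S /= preimage_set0.
    by move=> D SD; rewrite /S /= setTD preimage_setC -setTD; exact: sC.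
  by move=> F SF; rewrite /S /= preimage_bigcup; exact: sU.
apply; move: mB; rewrite /measurable/= => mB.
by have := RGenCInfty.measurableE R; rewrite /measurable/= => <-.
Qed.

Section induction.
Variable P : (V -> R) -> Prop.
Hypothesis P1 : forall h, lipschitz_fun h -> Bb h -> P h.
Hypothesis P2 : forall (k : R) f g, Bb f -> Bb g -> P f -> P g -> P (fun x => f x + k * g x).
Hypothesis P3 : forall (hs : nat -> V -> R) h (M r : R), 0 <= M -> 0 <= r ->
  (forall k, Bb (hs k)) -> Bb h -> (forall k, P (hs k)) ->
  (forall k x, `|hs k x| <= M * tent r x) -> (forall x, `|h x| <= M * tent r x) ->
  (forall x, hs k x @[k --> \oo] --> h x) -> P h.

Lemma Bb_tent_indic r (A : set V) : 0 <= r -> measurable A -> Bb (fun x => tent r x * \1_A x).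
Proof.
move=> r0 mA; rewrite (_ : (fun x => _) = (\1_A : V -> R) \* tent r).
  apply: BbM_bounded; [exact: measurable_indic| |exact: tent_Bb].
  by exists 1 => x; rewrite indicE ger0_norm// lern1 leq_b1.
by apply/funext => x /=; rewrite mulrC.
Qed.

Lemma tent_indic_le r (A : set V) x : `|tent r x * \1_A x| <= 1 * tent r x.
Proof.
have /andP[h1 h2] := tent01 r x; rewrite mul1r ger0_norm ?mulr_ge0//.
by rewrite ler_piMr// indicE lern1 leq_b1.
Qed.

Lemma cvg_eventually_eq (u : nat -> R) (l : R) K : (forall k, (K <= k)%N -> u k = l) ->
  u k @[k --> \oo] --> l.
Proof.
move=> H; apply: cvg_near_cst; near=> k; apply: H; near: k; exact: nbhs_infty_ge.
Unshelve. all: by end_near. Qed.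

(** A corner is the zero set of the Lipschitz function [|pp|], so its indicator is the limit of the
    Lipschitz functions [g k], equal to one on the corner and to zero as soon as [|pp|] reaches
    [1/k]. *)
Lemma P_corner r A : 0 <= r -> corners A -> P (fun x => tent r x * \1_A x).
Proof.
move=> r0 [b [c ->]].
pose pp (x : V) : V := \row_i (if b i then Num.max 0 (c i - x ord0 i) else 0).
have ppL x y : `|pp y - pp x| <= `|y - x|.
  apply: rV_norm_le => // i; rewrite !mxE; case: (b i); last by rewrite subrr normr0.
  have h : `|(y - x) ord0 i| <= `|y - x| by exact: coord_le_norm.
  apply: le_trans h; rewrite !mxE.
  have H (u v : R) : `|Num.max 0 u - Num.max 0 v| <= `|u - v|.
    have [hu|hu] := leP u 0; have [hv|hv] := leP v 0.
    - by rewrite subrr normr0.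
    - by rewrite sub0r normrN gtr0_norm// distrC ger0_norm; lra.
    - by rewrite subr0 gtr0_norm// ger0_norm; lra.
    - by [].
  apply: (le_trans (H _ _)); rewrite (_ : _ - _ - _ = - (y ord0 i - x ord0 i)) ?normrN//; ring.
have ppA x : corner b c x <-> `|pp x| = 0.
  split=> [H|/normr0_eq0 H i bi].
    suff -> : pp x = 0 by rewrite normr0.
    apply/rowP => i; rewrite !mxE; case: ifP => // bi; apply: max_l.
    by rewrite subr_le0; exact: H.
  have := congr1 (fun z : V => z ord0 i) H; rewrite !mxE bi => /eqP.
  by rewrite eq_maxl subr_le0.
pose g k x := Num.max 0 (Num.min 1 (1 - k%:R * `|pp x|)) : R.
have g01 k x : 0 <= g k x <= 1 by rewrite /g le_max lexx/= ge_max ler01/= ge_min lexx.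
have gL k : lipschitz_fun (g k).
  exists k%:R => // x y; apply: (le_trans (clamp_lipschitz _ _)).
  rewrite (_ : 1 - _ - _ = k%:R * (`|pp x| - `|pp y|)); last by ring.
  rewrite normrM ger0_norm// ler_wpM2l// (le_trans (ler_dist_dist _ _))//.
  by rewrite distrC.
have mA : measurable (corner b c).
  rewrite (_ : corner b c = (fun x => `|pp x|) @^-1` [set 0]).
    rewrite -[X in measurable X]setTI; suff : measurable_fun setT (fun x => `|pp x|).
      by apply => //; exact: measurable_set1.
    apply: lipschitz_measurable; exists 1 => // x y; rewrite mul1r.
    exact: le_trans (ler_dist_dist _ _) (ppL x y).
  by apply/seteqP; split => x /ppA.
have t1 x : `|tent r x| <= 1 by have /andP[h1 h2] := tent01 r x; rewrite ger0_norm.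
have g1 k x : `|g k x| <= 1 by have /andP[h1 h2] := g01 k x; rewrite ger0_norm.
have bg k : Bb (tent r \* g k).
  rewrite (_ : _ \* _ = g k \* tent r); last by apply/funext => x /=; rewrite mulrC.
  by apply: BbM_bounded; [exact: lipschitz_measurable|exists 1; exact: g1|exact: tent_Bb].
apply: (P3 (hs := fun k => tent r \* g k) ler01 r0) => //.
- exact: Bb_tent_indic.
- by move=> k; apply: P1 => //; apply: lipschitzM => //; exact: tent_lipschitz.
- move=> k x /=; rewrite mul1r normrM (le_trans (ler_wpM2l _ (g1 k x)))// mulr1.
  by have /andP[h1 h2] := tent01 r x; rewrite ger0_norm.
- by move=> x; exact: tent_indic_le.
move=> x; rewrite indicE; have [Ax|Ax] := pselect (corner b c x).
  rewrite mem_set// mulr1; apply: (@cvg_eventually_eq _ _ 0) => k _ /=.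
  by rewrite /g ((ppA x).1 Ax) mulr0 subr0 minxx max_r// mulr1.
rewrite memNset// mulr0.
have p0 : 0 < `|pp x| by rewrite normr_gt0; apply/eqP => h; apply: Ax; apply/ppA; rewrite h normr0.
have [K HK] : exists K : nat, `|pp x|^-1 <= K%:R.
  by exists (Num.bound `|pp x|^-1); rewrite ltW// archi_boundP// invr_ge0.
apply: (@cvg_eventually_eq _ _ K) => k Kk /=.
rewrite /g max_l ?mulr0// ge_min; apply/orP; right; rewrite subr_le0.
by rewrite -ler_pdivrMr// div1r (le_trans HK)// ler_nat.
Qed.

(** The sets with this property form a lambda-system: [P2] gives proper differences and [P3]
    increasing unions. *)
Lemma P_measurable r A : 0 <= r -> measurable A -> P (fun x => tent r x * \1_A x).
Proof.
move=> r0 mA.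
pose H := [set B : set V | measurable B /\ P (fun x => tent r x * \1_B x)].
suff : <<s corners >> `<=` H by move=> sub; have [] := sub _ (measurable_corners mA).
have mcor B : corners B -> measurable B.
  move=> [b [c ->]].
  rewrite (_ : corner b c = [set x : V | forall i, (if b i then `[c i, +oo[%classic else setT : set (measurableTypeR R)) (x ord0 i)]).
    by apply: (@measurable_rV_box R n (fun i => if b i then `[c i, +oo[%classic else setT)) => i; case: (b i) => //; exact: measurable_itv.
  by apply/seteqP; split => x /= h i; have := h i; case: (b i) => //=; rewrite in_itv/= andbT //; apply.
apply: (lambda_system_subset corners_setI) => //.
- split => //.
  + split => //; rewrite (_ : (fun x => _) = tent r).
      by apply: P1; [exact: tent_lipschitz|exact: tent_Bb].
    by apply/funext => x; rewrite indicT mulr1.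
  + move=> B D DB [mB PB] [mD PD]; split; first exact: measurableD.
    have := P2 (-1) (Bb_tent_indic r0 mB) (Bb_tent_indic r0 mD) PB PD.
    congr P; apply/funext => x; rewrite !indicE in_setD.
    have [xD|xD] := boolP (x \in D).
      by rewrite (mem_set (DB _ (set_mem xD))) /= mulr1 mulr0; ring.
    by rewrite andbT mulr0 mulr0 addr0.
  + move=> F Fh FH; have mF k : measurable (F k) by have [] := FH k.
    have mU : measurable (\bigcup_k F k) by exact: bigcupT_measurable.
    split => //; apply: (P3 (hs := fun k x => tent r x * \1_(F k) x) ler01 r0) => //.
    - by move=> k; exact: Bb_tent_indic.
    - exact: Bb_tent_indic.
    - by move=> k; have [] := FH k.
    - by move=> k x; exact: tent_indic_le.
    - by move=> x; exact: tent_indic_le.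
    move=> x; have [[K _ FK]|Fx] := pselect ((\bigcup_k F k) x).
      apply: (@cvg_eventually_eq _ _ K) => k Kk; rewrite !indicE !mem_set//.
        by exists K.
      by move: x FK; exact/subsetPset/Fh.
    apply: (@cvg_eventually_eq _ _ 0) => k _; rewrite !indicE !memNset//.
    by move=> Fk; apply: Fx; exists k.
- by move=> B cB; split; [exact: mcor|exact: P_corner].
Qed.

Lemma P_sum (I : eqType) (s : seq I) (c : I -> R) (F : I -> V -> R) : P (fun=> 0) ->
  (forall i, Bb (F i)) -> (forall i, P (F i)) -> P (fun x => \sum_(i <- s) c i * F i x).
Proof.
move=> P0 bF PF; elim: s => [|i s IH].
  by rewrite (_ : (fun x => _) = fun=> 0)//; apply/funext => x; rewrite big_nil.
rewrite (_ : (fun x => _) = (fun x => \sum_(i <- s) c i * F i x + c i * F i x)).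
  by apply: P2 => //; apply: Bb_sum => j; exact: BbZ.
by apply/funext => x; rewrite big_cons addrC.
Qed.

(** A functional monotone class theorem: linear combinations and dominated limits lead from
    Lipschitz functions to all of [Bb]. A nonnegative function is a limit of simple ones, which the
    factor [tent r] keeps in a bounded set. *)
Lemma Bb_induction h : Bb h -> P h.
Proof.
have P0 : P (fun=> 0) by apply: P1; [by exists 0 => // x y; rewrite subrr normr0 mul0r|exact: (@Bb0 R n)].
suff pos g : Bb g -> (forall x, 0 <= g x) -> P g.
  move=> [mh [M HM] [r hr]].
  have bp : Bb h^\+.
    split; first exact: measurable_funrpos.
      exists M => x; rewrite /funrpos; have := HM x; have := normr_ge0 (h x).
      by have [h0|h0] := leP (h x) 0; rewrite ?normr0; [move=> a b; exact: le_trans b|].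
    by exists r => x /hr h0; rewrite /funrpos h0 maxxx.
  have bn : Bb h^\-.
    split; first exact: measurable_funrneg.
      exists M => x; rewrite /funrneg; have := HM x; rewrite -normrN; have := normr_ge0 (- h x).
      by have [h0|h0] := leP (- h x) 0; rewrite ?normr0; [move=> a b; exact: le_trans b|].
    by exists r => x /hr h0; rewrite /funrneg h0 oppr0 maxxx.
  have := P2 (-1) bp bn (pos _ bp (funrpos_ge0 h)) (pos _ bn (funrneg_ge0 h)).
  congr P; apply/funext => x; rewrite mulN1r -[in RHS](funrposBneg h).
  by [].
move=> bg g0; have [mg [M HM] /bdd_support_cube[r r0 gr]] := bg.
have mgE : measurable_fun setT (EFin \o g) by exact/measurable_EFinP.
pose s k := nnsfun_approx measurableT mgE k.
have gE0 x : setT x -> (0 <= (EFin \o g) x)%E by move=> _; rewrite lee_fin.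
have sg x : s k x @[k --> \oo] --> g x.
  have := cvg_nnsfun_approx measurableT mgE gE0 (I : setT x).
  by move/fine_cvg; apply: cvg_trans.
have sle k x : s k x <= g x.
  have nd : {homo (fun k => s k x) : a b / (a <= b)%N >-> a <= b}.
    move=> a b ab; have := nd_nnsfun_approx measurableT mgE ab.
    by move=> /lefP; apply.
  have := nondecreasing_cvgn_le nd (cvgP _ (sg x)) k.
  by rewrite (cvg_lim _ (sg x)).
have M0 : 0 <= M by exact: le_trans (HM 0).
have ct x : g x = tent r x * g x.
  have [xr|xr] := pselect (cube r x); last by rewrite gr// mulr0.
  by rewrite tent_in ?mul1r//; apply/(cubeP _ r0).
have bs k : Bb (fun x => tent r x * s k x).
  rewrite (_ : (fun x => _) = (fun x => s k x) \* tent r); last by apply/funext => x /=; rewrite mulrC.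
  apply: BbM_bounded => //; last exact: tent_Bb.
  by exists M => x; rewrite ger0_norm// (le_trans (sle k x))// (le_trans _ (HM x))// ler_norm.
apply: (P3 (hs := fun k x => tent r x * s k x) M0 r0) => //.
- move=> k; pose A y := s k @^-1` [set y].
  have mA y : measurable (A y) by rewrite /A -[X in measurable X]setTI; exact: measurable_funP.
  have fr : finite_set (range (s k)) by exact: fimfunP.
  rewrite (_ : (fun x => _) = (fun x => \sum_(y <- finmap.enum_fset (fset_set (range (s k)))) y * (tent r x * \1_(A y) x))).
    by apply: P_sum => // y; [exact: Bb_tent_indic|exact: P_measurable].
  apply/funext => x; rewrite {1}[s k x]fimfunE fsbig_finite// mulr_sumr.
  by apply: eq_bigr => y _; rewrite mulrCA.
- move=> k x; have /andP[h1 h2] := tent01 r x; rewrite ger0_norm ?mulr_ge0// mulrC ler_wpM2r//.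
  by rewrite (le_trans (sle k x))// (le_trans _ (HM x))// ler_norm.
- move=> x; rewrite ct; have /andP[h1 h2] := tent01 r x; rewrite normrM (ger0_norm h1) mulrC ler_wpM2r//.
move=> x; rewrite [in X in _ --> X]ct; apply: cvgM; first exact: cvg_cst.
exact: sg.
Qed.

End induction.

End density.

(** * Contractions as approximations of the identity *)

Section mollification.
Variables (R : realType) (n : nat).
Local Notation V := 'rV[R]_n.
Local Notation mu := (lebesgue_rV R n).
Implicit Types (f g h : V -> R).
Variables (om : V -> R) (rho : R) (x0 : V).
Hypotheses (com : Cc om) (rho0 : 0 < rho) (om1 : \int[mu]_x om x = 1).

Definition dyadic (N : nat) : R := 2^-1 / 2 ^+ N.

Lemma dyadic_cvg0 : dyadic N @[N --> \oo] --> (0 : R).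
Proof.
rewrite (_ : dyadic = fun N => 2^-1 * (2^-1) ^+ N); last by apply/funext => N; rewrite /dyadic exprVn.
rewrite -[X in _ --> X](mulr0 2^-1); apply: cvgM; first exact: cvg_cst.
apply: cvg_expr; rewrite ger0_norm ?invr_ge0// invf_lt1// ltr1n; by [].
Qed.

Lemma fwd_bounded : exists2 K, 0 <= K & forall N g, Bb g -> nrm (fwd rho x0 (dyadic N) om g) <= K * nrm g.
Proof.
exists (Num.sqrt (2 ^+ n * L1 om ^+ 2)); first exact: sqrtr_ge0.
move=> N g bg; apply: nrm_le; first by rewrite mulr_ge0 ?sqrtr_ge0 ?nrm_ge0.
have k0 : 0 <= 2 ^+ n * L1 om ^+ 2 by rewrite mulr_ge0 ?sqr_ge0 ?exprn_ge0.
have t0 := dyadic_gt0 R N; have t1 := dyadic_le_half R N; rewrite -/(dyadic N) in t0 t1.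
rewrite exprMn sqr_sqrtr// nrm_sqr; apply: (le_trans (fwd_Schur x0 rho0 _ com bg)).
  by rewrite t0/=; lra.
rewrite ler_wpM2r ?ip_ge0// ler_wpM2r ?sqr_ge0//.
have t2 : 2^-1 <= 1 - dyadic N by lra.
have t3 : 0 < 1 - dyadic N by exact: lt_le_trans t2.
rewrite lerXn2r ?nnegrE ?invr_ge0 ?(ltW t3)//.
by rewrite -[leRHS]invrK lef_pV2 ?posrE.
Qed.

Lemma fwd_lin t (k : R) f g : Bb f -> Bb g ->
  fwd rho x0 t om (fun x => f x + k * g x) = (fun x => fwd rho x0 t om f x + k * fwd rho x0 t om g x).
Proof.
move=> bf bg; apply/funext => x; rewrite /fwd /nconv.
have := convD (rho * t)^-1 (- ((1 - t) / (rho * t))) (- (t / (rho * t)) *: x0) com bf (BbZ k bg).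
rewrite -[f + _]/(fun x => f x + k * g x) => ->.
rewrite -[X in _ * X]/(_ x + _ x) convZ//; ring.
Qed.

(** The change of variables leaves [om] fixed and puts the dependence on [t] into [h], which for
    small [t] is evaluated near [x]. *)
Lemma fwd_recentred t h x : 0 < t < 1 -> Bb h ->
  fwd rho x0 t om h x =
  (1 - t)^-1 ^+ n * \int[mu]_z (om z * h ((1 - t)^-1 *: (x - t *: x0 - (rho * t) *: z))).
Proof.
move=> /andP[t0 t1] bh; have l0 : 0 < 1 - t by rewrite subr_gt0.
have rt0 : 0 < rho * t by rewrite mulr_gt0.
set G := fun z => om z * _.
have bG : Bb G.
  have [mh [M HM] _] := bh.
  rewrite (_ : G = (fun z => h ((1 - t)^-1 *: (x - t *: x0 - (rho * t) *: z))) \* om); last first.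
    by apply/funext => z /=; rewrite mulrC.
  apply: BbM_bounded; [|by exists M|exact: Cc_Bb].
  apply: (measurableT_comp mh).
  rewrite (_ : (fun z => _) = (fun z => (- ((1 - t)^-1 * (rho * t))) *: z + (1 - t)^-1 *: (x - t *: x0))).
    exact: measurable_fun_rV_affine.
  by apply/funext => z; rewrite scalerBr scaleNr scalerA addrC.
rewrite /fwd /nconv /conv.
have be0 : - ((1 - t) / (rho * t)) != 0 by rewrite oppr_eq0 mulf_neq0 ?invr_eq0 ?gt_eqF.
have H := Rintegral_rV_affine ((rho * t)^-1 *: x + - (t / (rho * t)) *: x0) be0 (Bb_integrable bG).
transitivity ((rho * t)^-1 ^+ n * \int[mu]_y G (- ((1 - t) / (rho * t)) *: y + ((rho * t)^-1 *: x + - (t / (rho * t)) *: x0))).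
  congr (_ * _); apply: eq_Rintegral => y _; rewrite /G addrCA; congr (_ * h _).
  by apply/rowP => i; rewrite !mxE; field; rewrite !gt_eqF.
rewrite H mulrA normrN gtr0_norm ?divr_gt0// -exprMn; congr (_ ^+ n * _).
by field; rewrite !gt_eqF.
Qed.

(** At each point the contraction differs from [(1 - t)^-n h x] by [O(t)], since [h] is Lipschitz
    and [om] has integral one. Uniform bounds on size and support then allow dominated
    convergence. *)
Lemma fwd_lipschitz_cvg h : lipschitz_fun h -> Bb h ->
  nrm (fwd rho x0 (dyadic N) om h \- h) @[N --> \oo] --> (0 : R).
Proof.
move=> [L L0 HL] bh; have [mh [M HM] /bdd_support_cube[r2 r20 hr]] := bh.
have [so /bdd_support_cube[a a0 oma']] := com.
have oma z : a < `|z| -> om z = 0 by move=> az; apply: oma' => /(cubeP _ a0); rewrite leNgt az.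
have M0 : 0 <= M by exact: le_trans (HM 0).
have t0 N : 0 < dyadic N := dyadic_gt0 R N; have t1 N : dyadic N <= 2^-1 := dyadic_le_half R N.
have t01 N : 0 < dyadic N < 1 by apply/andP; split; [exact: t0|have := t1 N; rewrite /dyadic; lra].
have l2 N : 2^-1 <= 1 - dyadic N by have := t1 N; rewrite /dyadic; lra.
have l0 N : 0 < 1 - dyadic N by exact: lt_le_trans (l2 N).
have li N : (1 - dyadic N)^-1 <= 2 by rewrite -[leRHS]invrK lef_pV2 ?posrE.
have lin N : (1 - dyadic N)^-1 ^+ n <= 2 ^+ n by rewrite lerXn2r ?nnegrE ?invr_ge0 ?(ltW (l0 N)).
have io : mu.-integrable setT (EFin \o om) by exact: Bb_integrable (Cc_Bb com).
have iao := integrable_norm_real io.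
pose r3 := a * rho + r2 + `|x0| *+ 3.
have r30 : 0 <= r3 by rewrite !addr_ge0 ?mulr_ge0 ?mulrn_wge0// ltW.
have supp N x : r3 < `|x| -> fwd rho x0 (dyadic N) om h x = 0.
  move=> xr; rewrite /fwd /nconv /conv (_ : (fun y => _) = fun=> 0) ?Rintegral_cst ?mul0r ?mulr0//.
  apply/funext => y; have [yr|yr] := pselect (cube r2 y); last by rewrite hr// mulr0.
  rewrite (@kernel_support_bound _ _ _ _ rho0 (dyadic N) (dyadic N) a r2 om x y)// ?mul0r//.
  - by have /andP[_ h1] := t01 N; exact: ltW.
  - exact/cubeP.
have iy N x : mu.-integrable setT (EFin \o (fun z => om z * h ((1 - dyadic N)^-1 *: (x - dyadic N *: x0 - (rho * dyadic N) *: z)))).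
  apply: (integrable_dom _ (integrableZ_real M iao)).
    apply: measurable_funM; first exact: smooth_measurable.
    apply: (measurableT_comp mh).
    rewrite (_ : (fun z => _) = (fun z => (- ((1 - dyadic N)^-1 * (rho * dyadic N))) *: z + (1 - dyadic N)^-1 *: (x - dyadic N *: x0))).
      exact: measurable_fun_rV_affine.
    by apply/funext => z; rewrite scalerBr scaleNr scalerA addrC.
  by move=> z; rewrite normrM mulrC ler_wpM2r.
have bound N x : `|fwd rho x0 (dyadic N) om h x| <= 2 ^+ n * (M * L1 om).
  rewrite fwd_recentred// normrM ger0_norm ?exprn_ge0 ?invr_ge0 ?(ltW (l0 N))//.
  rewrite ler_pM ?exprn_ge0 ?invr_ge0 ?(ltW (l0 N))//.
  apply: (le_trans (le_normr_Rintegral measurableT (iy N x))).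
  rewrite /L1 -RintegralZl//; apply: le_Rintegral => //.
  - exact: integrable_norm_real.
  - exact: integrableZ_real.
  by move=> z _; rewrite normrM mulrC ler_wpM2r.
pose B := 2 ^+ n * (M * L1 om) + M.
have B1 : 0 <= 2 ^+ n * (M * L1 om) by rewrite !mulr_ge0 ?exprn_ge0 ?L1_ge0.
have B0 : 0 <= B by rewrite addr_ge0.
pose r := r3 + r2.
have r0 : 0 <= r by rewrite addr_ge0.
apply: (@nrm_dominated _ _ _ _ (fun x => B * tent r x)) => //.
- move=> N; have [mf _ _] := @fwd_Bb R n rho x0 rho0 (dyadic N) om h (t0 N) com bh; exact: mf.
- exact: (@SQZ R n B (@tent R n r) (Bb_SQ (@tent_Bb R n r r0))).
- move=> N x; have [xr|xr] := leP `|x| r3.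
    by rewrite tent_in ?mulr1 ?(le_trans (bound N x)) ?lerDl// (le_trans xr)// lerDl.
  by rewrite supp// normr0 mulr_ge0//; have /andP[] := tent01 r x.
- move=> x; have [xr|xr] := pselect (cube r2 x).
    rewrite tent_in ?mulr1 ?(le_trans (HM x)) ?lerDr//.
    by move/(cubeP _ r20): xr => xr; rewrite (le_trans xr)// lerDr.
  by rewrite hr// normr0 mulr_ge0//; have /andP[] := tent01 r x.
move=> x; pose K := 2 ^+ n * (L * (2 * (`|x| + `|x0| + rho * a)) * L1 om).
have est N : `|fwd rho x0 (dyadic N) om h x - (1 - dyadic N)^-1 ^+ n * h x| <= K * dyadic N.
  rewrite fwd_recentred// -mulrBr.
  have -> : h x = \int[mu]_z (om z * h x).
    by under eq_Rintegral do rewrite mulrC; rewrite RintegralZl// om1 mulr1.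
  have ihx : mu.-integrable setT (EFin \o (fun z => om z * h x)).
    by under [X in _ \o X]eq_fun do rewrite mulrC; exact: integrableZ_real.
  rewrite -RintegralB// normrM ger0_norm ?exprn_ge0 ?invr_ge0 ?(ltW (l0 N))//.
  rewrite /K -mulrA ler_pM ?exprn_ge0 ?invr_ge0 ?(ltW (l0 N))//.
  apply: (le_trans (le_normr_Rintegral measurableT (integrableB_real (iy N x) ihx))).
  rewrite /L1 mulrAC -RintegralZl//; apply: le_Rintegral => //.
  - exact: integrable_norm_real (integrableB_real (iy N x) ihx).
  - exact: integrableZ_real.
  move=> z _; rewrite -mulrBr normrM mulrC.
  have [za|za] := leP `|z| a; last by rewrite oma// normr0 !mulr0.
  rewrite ler_wpM2r//; apply: (le_trans (HL _ _)); rewrite -mulrA ler_wpM2l//.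
  have E : (1 - dyadic N)^-1 *: (x - dyadic N *: x0 - (rho * dyadic N) *: z) - x =
     (1 - dyadic N)^-1 *: (dyadic N *: (x - x0 - rho *: z)).
    by apply/rowP => i; rewrite !mxE; field; rewrite gt_eqF.
  have li0 : 0 <= (1 - dyadic N)^-1 by rewrite invr_ge0 (ltW (l0 N)).
  rewrite E 2!normrZ (ger0_norm li0) (gtr0_norm (t0 N)).
  rewrite [leRHS](_ : _ = 2 * (dyadic N * (`|x| + `|x0| + rho * a))); last by ring.
  rewrite ler_pM ?invr_ge0 ?(ltW (l0 N)) ?mulr_ge0 ?(ltW (t0 N))// ler_wpM2l ?(ltW (t0 N))//.
  apply: (le_trans (ler_normB _ _)); rewrite lerD ?ler_normB//.
  by rewrite normrZ gtr0_norm// ler_pM2l.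
have c1 : (1 - dyadic N)^-1 ^+ n * h x @[N --> \oo] --> h x.
  rewrite -[X in _ --> X]mul1r; apply: cvgM; last exact: cvg_cst.
  have c0 : (1 - dyadic N)^-1 @[N --> \oo] --> (1 - 0 : R)^-1.
    apply: cvgV; first by rewrite subr0 oner_neq0.
    by apply: cvgB; [exact: cvg_cst|exact: dyadic_cvg0].
  have := cvg_comp _ _ c0 (@exprn_continuous R n _); rewrite subr0 invr1 expr1n.
  exact.
have c2 : (fwd rho x0 (dyadic N) om h x - (1 - dyadic N)^-1 ^+ n * h x) @[N --> \oo] --> (0 : R).
  apply/cvgr0Pnorm_le => e e0.
  have cK : K * dyadic N @[N --> \oo] --> (0 : R).
    by rewrite -[X in _ --> X](mulr0 K); apply: cvgM; [exact: cvg_cst|exact: dyadic_cvg0].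
  move/cvgr0Pnorm_le : cK => /(_ e e0); apply: filterS => N H.
  by rewrite (le_trans (est N))// (le_trans (ler_norm _)).
have H := cvgD c2 c1; rewrite add0r in H.
rewrite (_ : (fun N => _) = ((fun N => fwd rho x0 (dyadic N) om h x - (1 - dyadic N)^-1 ^+ n * h x) \+
  (fun N => (1 - dyadic N)^-1 ^+ n * h x))); first exact: H.
by apply/funext => N /=; rewrite subrK.
Qed.

(** The contractions are bounded on L2 uniformly in [N], so the claim passes to dominated limits and
    [Bb_induction] reduces it to Lipschitz functions. *)
Lemma fwd_cvg h : Bb h -> nrm (fwd rho x0 (dyadic N) om h \- h) @[N --> \oo] --> (0 : R).
Proof.
move: h; apply: Bb_induction => [h lh bh|k f g bf bg cf cg|hs h M r M0 r0 bhs bh chs hsM hM cv].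
- exact: fwd_lipschitz_cvg.
- have sf N f' : Bb f' -> SQ (fwd rho x0 (dyadic N) om f' \- f').
    move=> bf'; exact: SQB (Bb_SQ (@fwd_Bb R n rho x0 rho0 (dyadic N) om f' (dyadic_gt0 R N) com bf')) (Bb_SQ bf').
  have lim : nrm (fwd rho x0 (dyadic N) om f \- f) + `|k| * nrm (fwd rho x0 (dyadic N) om g \- g) @[N --> \oo] --> (0 : R).
    rewrite -[X in _ --> X](_ : 0 + `|k| * 0 = 0); last by rewrite mulr0 addr0.
    by apply: cvgD => //; apply: cvgM => //; exact: cvg_cst.
  apply: (squeeze_cvgr _ (cvg_cst 0) lim); near=> N; rewrite nrm_ge0/=.
  rewrite -nrmZ; last exact: sf.
  rewrite fwd_lin// (_ : _ \- _ = (fwd rho x0 (dyadic N) om f \- f) \+ (fun x => k * (fwd rho x0 (dyadic N) om g \- g) x)).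
    apply: nrmD; [exact: sf|exact: SQZ (sf _ _ bg)].
  by apply/funext => x /=; ring.
have [K K0 HK] := fwd_bounded.
have SG : SQ (fun x : V => M * tent r x) by exact: (@SQZ R n M (@tent R n r) (Bb_SQ (@tent_Bb R n r r0))).
have mB (f : V -> R) : Bb f -> measurable_fun setT f by case.
have cn := nrm_dominated (fun k => mB _ (bhs k)) (mB _ bh) SG hsM hM cv.
apply/cvgr0Pnorm_le => e e0.
have e1 : 0 < e / 2 / (K + 1) by rewrite !divr_gt0//; lra.
move/cvgr0Pnorm_le : (cn) => /(_ _ e1) [k _ Hk].
have {Hk} Hk := Hk k (leqnn k); rewrite /= ger0_norm ?nrm_ge0// in Hk.
have e2 : 0 < e / 2 by rewrite divr_gt0.
move/cvgr0Pnorm_le : (chs k) => /(_ _ e2); apply: filterS => N /=.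
rewrite !(ger0_norm (nrm_ge0 _)) => HN.
have bd : Bb (fun x => h x + -1 * hs k x).
  by have := BbD bh (BbZ (-1) (bhs k)).
have fb f' : Bb f' -> SQ (fwd rho x0 (dyadic N) om f').
  by move=> bf'; exact: Bb_SQ (@fwd_Bb R n rho x0 rho0 (dyadic N) om f' (dyadic_gt0 R N) com bf').
have -> : fwd rho x0 (dyadic N) om h \- h =
    (fwd rho x0 (dyadic N) om (fun x => h x + -1 * hs k x) \+ (fwd rho x0 (dyadic N) om (hs k) \- hs k)) \+ (hs k \- h).
  by rewrite fwd_lin//; apply/funext => x /=; ring.
have s1 := fb _ bd; have s2 := SQB (fb _ (bhs k)) (Bb_SQ (bhs k)); have s3 := SQB (Bb_SQ (bhs k)) (Bb_SQ bh).
apply: (le_trans (nrmD (SQD s1 s2) s3)).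
apply: (@le_trans _ _ (K * nrm (hs k \- h) + e / 2 + nrm (hs k \- h))).
  rewrite lerD2r (le_trans (nrmD s1 s2))// lerD//.
  apply: (le_trans (HK N _ bd)); rewrite ler_wpM2l//.
  rewrite (_ : (fun x => _) = (fun x => -1 * (hs k \- h) x)); last by apply/funext => x /=; ring.
  by rewrite nrmZ// normrN1 mul1r.
have : (K + 1) * nrm (hs k \- h) <= e / 2 by rewrite mulrC -ler_pdivlMr//; lra.
lra.
Unshelve. all: by end_near. Qed.

End mollification.

(** The sequence lies between [v + 2 s / 2^k], which is nonincreasing, and [v - 2 s / 2^k], which is
    nondecreasing; this yields the limit and the rate together. *)
Lemma geometric_limit (R : realType) (v : nat -> R) (s : R) : 0 <= s ->
  (forall k, `|v k.+1 - v k| <= s / 2 ^+ k) ->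
  exists2 l, v @ \oo --> l & forall k, `|v k - l| <= 2 * s / 2 ^+ k.
Proof.
move=> s0 Hv.
have p0 k : 0 < 2 ^+ k :> R by rewrite exprn_gt0.
have c0 : 2 * s / 2 ^+ N @[N --> \oo] --> (0 : R).
  rewrite (_ : (fun N => _) = (fun N => 4 * s * dyadic R N)).
    by rewrite -(mulr0 (4 * s)); apply: cvgM; [exact: cvg_cst|exact: dyadic_cvg0].
  by apply/funext => N; rewrite /dyadic /=; field; rewrite gt_eqF.
have step k : 2 * s / 2 ^+ k - 2 * s / 2 ^+ k.+1 = s / 2 ^+ k.
  by rewrite exprS; field; rewrite gt_eqF.
have Hk k := Hv k; have Hn k : v k.+1 - v k <= s / 2 ^+ k /\ - (s / 2 ^+ k) <= v k.+1 - v k.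
  by have := Hk k; rewrite ler_norml => /andP[].
pose a k := v k + 2 * s / 2 ^+ k; pose b k := v k - 2 * s / 2 ^+ k.
have na : {homo a : n m / (n <= m)%N >-> m <= n}.
  apply: (@homo_leq _ _ (fun x y => y <= x)) => //; first by move=> x y z h1 h2; exact: le_trans h1.
  move=> k; have [h1 _] := Hn k; have := step k; rewrite /a; move: (2 * s / 2 ^+ k.+1) => y.
  by move: (2 * s / _) (s / _) h1 => c d; lra.
have nb : {homo b : n m / (n <= m)%N >-> n <= m}.
  apply: (@homo_leq _ _ (fun x y => x <= y)) => //; first by move=> x y z; exact: le_trans.
  move=> k; have [_ h1] := Hn k; have := step k; rewrite /b; move: (2 * s / 2 ^+ k.+1) => y.
  by move: (2 * s / _) (s / _) h1 => c d; lra.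
have ba k : b k <= a k.
  have : 0 <= 2 * s / 2 ^+ k by rewrite divr_ge0 ?mulr_ge0 ?(ltW (p0 k)).
  by rewrite /a /b; move: (2 * s / _) => c; lra.
have ca : cvgn a.
  apply: nonincreasing_is_cvgn => //; exists (b 0%N) => _ [k _ <-].
  by apply: le_trans (ba k); exact: nb.
have va : v @ \oo --> limn a.
  have H := cvgB ca c0; rewrite subr0 in H.
  rewrite (_ : v = a \- (fun N => 2 * s / 2 ^+ N)); first exact: H.
  by apply/funext => k; rewrite /a /= addrK.
have vb : b @ \oo --> limn a.
  by have := cvgB va c0; rewrite subr0; apply.
exists (limn a) => // k; rewrite ler_distlC.
have h1 := nonincreasing_cvgn_ge na ca k.
have h2 : b k <= limn a.
  by have /(_ k) := nondecreasing_cvgn_le nb (cvgP _ vb); rewrite (cvg_lim _ vb).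
by apply/andP; split; move: h1 h2; rewrite /a /b; move: (2 * s / _) => c; lra.
Unshelve. all: by end_near. Qed.

(** * Completeness of L2 *)

Section Riesz_Fischer.
Variables (R : realType) (n : nat).
Local Notation V := 'rV[R]_n.
Local Notation mu := (lebesgue_rV R n).
Implicit Types (f g h : V -> R).

Lemma nrm_ae f g : measurable_fun setT f -> measurable_fun setT g ->
  {ae mu, forall x, f x = g x} -> nrm f = nrm g.
Proof.
move=> mf mg fg; congr Num.sqrt; rewrite /ip /Rintegral; congr fine.
apply: ae_eq_integral => //; [by apply/measurable_EFinP; exact: measurable_funM..|].
by apply: filterS fg => x fgx _; rewrite fgx.
Qed.

(** The squared norms are at most [C^2 / 16^k], so the series of [4^k D_k^2] has integral at most
    [2 C^2]. Each term is below the sum, which gives pointwise geometric decay with a single square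
    integrable factor. *)
Lemma weighted_square_sum (D : nat -> V -> R) (C : R) : (forall k, SQ (D k)) ->
  (forall k, nrm (D k) <= C / (2 ^+ k) ^+ 2) ->
  exists G : V -> R, exists2 A : set V, measurable A & [/\ mu.-integrable setT (EFin \o G), forall x, 0 <= G x,
    {ae mu, forall x, A x} & forall k x, A x -> `|D k x| <= Num.sqrt (G x) / 2 ^+ k].
Proof.
move=> sD HD.
have p0 k : 0 < 2 ^+ k :> R by rewrite exprn_gt0.
pose F (k : nat) (x : V) := (((2 ^+ k) ^+ 2 * D k x ^+ 2)%:E)%E.
have F0 k x : (0 <= F k x)%E by rewrite lee_fin mulr_ge0 ?sqr_ge0.
have mF k : measurable_fun setT (F k).
  apply/measurable_EFinP; apply: measurable_funM => //; apply: measurable_funX.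
  by have [] := sD k.
pose S x := (\sum_(0 <= k <oo) F k x)%E.
have mS : measurable_fun setT S by exact: ge0_emeasurable_sum.
have S0 x : (0 <= S x)%E by exact: nneseries_ge0.
have IF k : (\int[mu]_x F k x <= (C ^+ 2 / (2 ^+ k) ^+ 2)%:E)%E.
  have [mD D2] := sD k.
  have iF : mu.-integrable setT (EFin \o (fun x => (2 ^+ k) ^+ 2 * D k x ^+ 2)) by exact: integrableZ_real.
  rewrite -(fineK (integrable_fin_num measurableT iF)) lee_fin.
  rewrite -[fine _]/(\int[mu]_x ((2 ^+ k) ^+ 2 * D k x ^+ 2)) RintegralZl//.
  have -> : \int[mu]_x (D k x ^+ 2) = nrm (D k) ^+ 2.
    by rewrite nrm_sqr; apply: eq_Rintegral => x _; rewrite expr2.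
  have C0 : 0 <= C / (2 ^+ k) ^+ 2 by exact: le_trans (nrm_ge0 _) (HD k).
  have H : nrm (D k) ^+ 2 <= (C / (2 ^+ k) ^+ 2) ^+ 2.
    by rewrite ler_sqr ?nnegrE ?nrm_ge0.
  rewrite (_ : C ^+ 2 / _ = (2 ^+ k) ^+ 2 * (C / (2 ^+ k) ^+ 2) ^+ 2).
    by rewrite ler_wpM2l ?sqr_ge0.
  by field; rewrite gt_eqF.
have IS : (\int[mu]_x S x <= (2 * C ^+ 2)%:E)%E.
  rewrite /S integral_nneseries//.
  apply: (@lime_le _ _ _ _) => [|]; first by apply: is_cvg_nneseries => k _ _; exact: integral_ge0.
  near=> N; apply: (@le_trans _ _ (\sum_(0 <= k < N) (C ^+ 2 / (2 ^+ k) ^+ 2)%:E)%E).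
    by apply: lee_sum => k _.
  rewrite sumEFin lee_fin.
  (* Strengthened for the induction by a multiple of the next term, in the role of the tail. *)
  suff: forall M, \sum_(0 <= k < M) (C ^+ 2 / (2 ^+ k) ^+ 2) + 2 * (C ^+ 2 / (2 ^+ M) ^+ 2) <= 2 * C ^+ 2.
    move=> /(_ N); apply: le_trans; rewrite lerDl mulr_ge0 ?divr_ge0 ?sqr_ge0//.
  elim=> [|M IH]; first by rewrite big_nil add0r expr0 expr1n divr1.
  apply: le_trans IH; rewrite big_nat_recr//= -addrA lerD2l.
  have -> : C ^+ 2 / (2 ^+ M.+1) ^+ 2 = 4^-1 * (C ^+ 2 / (2 ^+ M) ^+ 2).
    by rewrite [2 ^+ M.+1]exprS; field; rewrite gt_eqF.
  have : 0 <= C ^+ 2 / (2 ^+ M) ^+ 2 by rewrite divr_ge0 ?sqr_ge0.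
  by move: (_ / _) => y; lra.
have iS : mu.-integrable setT S.
  apply/integrableP; split => //.
  under eq_integral do rewrite gee0_abs//.
  exact: le_lt_trans IS (ltry _).
pose A := S @^-1` [set y | y \is a fin_num].
have mA : measurable A.
  by rewrite -[A]setTI; exact: (emeasurable_fin_num measurableT mS).
exists (fine \o S), A => //; split.
- apply: (le_integrable measurableT _ _ iS); first by apply/measurable_EFinP; exact: measurableT_comp.
  move=> x _; rewrite /= ger0_norm ?fine_ge0// gee0_abs//.
  by have := S0 x; case: (S x) => [r| |] //= _; rewrite leey.
- by move=> x; rewrite fine_ge0.
- by have := integrable_ae measurableT iS; apply: filterS => x; apply.
move=> k x Ax; rewrite ler_pdivlMr//.
have FS : (F k x <= S x)%E.
  apply: (@le_trans _ _ (\sum_(0 <= i < k.+1) F i x)%E); last exact: nneseries_lim_ge.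
  by rewrite big_nat_recr//= leeDr// sume_ge0.
have : (2 ^+ k) ^+ 2 * D k x ^+ 2 <= fine (S x) by rewrite -lee_fin fineK.
rewrite -exprMn => H; have := ler_wsqrtr H; rewrite sqrtr_sqr normrM gtr0_norm//.
by rewrite mulrC.
Unshelve. all: by end_near. Qed.

(** Off the set [A] of full measure the functions are replaced by zero, so a pointwise limit exists
    everywhere. The rate of [geometric_limit] has a square integrable factor, so it is a rate in L2
    as well. *)
Lemma Riesz_Fischer (w : nat -> V -> R) (C : R) : (forall k, SQ (w k)) ->
  (forall k, nrm (w k.+1 \- w k) <= C / (2 ^+ k) ^+ 2) ->
  exists2 g, SQ g & nrm (w k \- g) @[k --> \oo] --> (0 : R).
Proof.
move=> sw Hw.
have [G [A mA [iG G0 aeA HA]]] := weighted_square_sum (fun k => SQB (sw k.+1) (sw k)) Hw.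
pose v k x := w k x * \1_A x.
have H x : exists2 l, v ^~ x @ \oo --> l & forall k, `|v k x - l| <= 2 * Num.sqrt (G x) / 2 ^+ k.
  apply: geometric_limit; first exact: sqrtr_ge0.
  move=> k; rewrite /v indicE -mulrBl; have [Ax|Ax] := boolP (x \in A).
    by rewrite mulr1; apply: HA; rewrite -inE.
  by rewrite mulr0 normr0 divr_ge0 ?sqrtr_ge0 ?exprn_ge0.
have {H} /choice[g Hg] : forall x, exists l, v ^~ x @ \oo --> l /\ forall k, `|v k x - l| <= 2 * Num.sqrt (G x) / 2 ^+ k.
  by move=> x; have [l h1 h2] := H x; exists l.
have mw k : measurable_fun setT (w k) by have [] := sw k.
have mv k : measurable_fun setT (v k) by apply: measurable_funM => //; exact: measurable_indic.
have mg : measurable_fun setT g by apply: (measurable_fun_cvg mv) => x _; have [] := Hg x.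
have mG : measurable_fun setT G by apply/measurable_EFinP; exact: measurable_int iG.
have sqG : SQ (fun x => 2 * Num.sqrt (G x)).
  split; first by apply: measurable_funM => //; exact: (measurableT_comp (continuous_measurable_fun (@sqrt_continuous R)) mG).
  rewrite (_ : (fun x => _) = (fun x => 4 * G x)); first exact: integrableZ_real.
  by apply/funext => x; rewrite exprMn sqr_sqrtr// expr2; ring.
have dom k x : `|v k x - g x| <= (2 * Num.sqrt (G x)) * (2 ^+ k)^-1 by have [_] := Hg x; apply.
have sq_dom (f h : V -> R) : measurable_fun setT f -> SQ h -> (forall x, `|f x| <= h x) -> SQ f.
  move=> mf [mh h2] fh; split => //; apply: (integrable_dom _ h2); first exact: measurable_funX.
  by move=> x; rewrite normrX lerXn2r ?nnegrE// (le_trans _ (fh x)).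
have sv k : SQ (v k \- g).
  apply: (sq_dom _ (fun x => (2 ^+ k)^-1 * (2 * Num.sqrt (G x)))); [exact: measurable_funB|exact: SQZ|].
  by move=> x; rewrite mulrC; exact: dom.
have wv k : {ae mu, forall x, w k x = v k x}.
  by apply: filterS aeA => x Ax; rewrite /v indicE mem_set// mulr1.
have sg : SQ g.
  have s0 : SQ (v 0%N).
    apply: (sq_dom _ (fun x => `|w 0%N x|)) => //.
      split; first exact: measurableT_comp.
      by have [_] := sw 0%N; congr (_.-integrable _ _); apply/funext => x /=; rewrite real_normK ?num_real.
    by move=> x; rewrite /v normrM ler_piMr// indicE; case: (_ \in _); rewrite ?normr1 ?normr0.
  by have := SQB s0 (sv 0%N); congr SQ; apply/funext => x /=; ring.
exists g => //.
have bd k : nrm (w k \- g) <= nrm (fun x => 2 * Num.sqrt (G x)) * 2 * dyadic R k.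
  rewrite (@nrm_ae _ (v k \- g)); [|exact: measurable_funB|exact: measurable_funB|].
    have -> : nrm (fun x => 2 * Num.sqrt (G x)) * 2 * dyadic R k = nrm (fun x => (2 ^+ k)^-1 * (2 * Num.sqrt (G x))).
      rewrite (nrmZ (2 ^+ k)^-1 sqG) ger0_norm ?invr_ge0 ?exprn_ge0// /dyadic.
      by move: (nrm _) => c; field; rewrite gt_eqF// exprn_gt0.
    rewrite -[leRHS]mul1r; apply: nrm_le_pointwise => //; first exact: SQZ.
    move=> x; rewrite mul1r mulrC; apply: le_trans (ler_norm _); exact: dom.
  by apply: filterS (wv k) => x /= ->.
have lim : nrm (fun x => 2 * Num.sqrt (G x)) * 2 * dyadic R k @[k --> \oo] --> (0 : R).
  set c := _ * 2; rewrite -(mulr0 c); apply: cvgM; [exact: cvg_cst|exact: dyadic_cvg0].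
apply: (squeeze_cvgr _ (cvg_cst 0) lim); near=> k.
by rewrite nrm_ge0 bd.
Unshelve. all: by end_near. Qed.

End Riesz_Fischer.

(** * Sobolev spaces *)

Section restriction.
Variables (R : realType) (n : nat).
Local Notation V := 'rV[R]_n.
Local Notation mu := (lebesgue_rV R n).
Implicit Types (f g h u : V -> R) (a : 'I_n -> nat).

Lemma restrict_real (A : set V) f : f \_ A = (fun x => f x * \1_A x).
Proof. by apply/funext => x; rewrite patchE indicE; case: ifP => _; rewrite ?mulr1 ?mulr0. Qed.

Lemma restrictB (A : set V) f g : (f \- g) \_ A = (f \_ A) \- (g \_ A).
Proof. by rewrite !restrict_real; apply/funext => x /=; rewrite mulrBl. Qed.

Lemma SQ_restrict (A : set V) f : measurable A -> SQ f -> SQ (f \_ A).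
Proof.
move=> mA [mf f2]; rewrite restrict_real; split; first by apply: measurable_funM => //; exact: measurable_indic.
apply: (integrable_dom _ f2).
  by apply: measurable_funX; apply: measurable_funM => //; exact: measurable_indic.
by move=> x; rewrite indicE normrX; case: (_ \in _); rewrite ?mulr1 ?mulr0 ?normr0 ?expr0n/= ?sqr_ge0// real_normK ?num_real.
Qed.

Lemma nrm_restrict_le (A : set V) f : measurable A -> SQ f -> nrm (f \_ A) <= nrm f.
Proof.
move=> mA sf; rewrite -[leRHS]mul1r; apply: nrm_le_pointwise => //; first exact: SQ_restrict.
by move=> x; rewrite restrict_real mul1r indicE normrM; case: (_ \in _); rewrite ?normr1 ?normr0 ?mulr1 ?mulr0.
Qed.

Lemma restrict_supp (A : set V) f : (forall x, ~ A x -> f x = 0) -> f \_ A = f.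
Proof.
move=> fA; rewrite restrict_real; apply/funext => x; rewrite indicE.
by have [|/negP Ax] := boolP (x \in A); rewrite ?mulr1// fA ?mul0r// => Ax'; apply: Ax; rewrite inE.
Qed.

Lemma restrict_out (A : set V) f x : ~ A x -> (f \_ A) x = 0.
Proof. by move=> Ax; rewrite restrict_real indicE memNset// mulr0. Qed.

Lemma Lfun2P f : f \in Lfun mu 2%:E <-> SQ f.
Proof.
split=> [Lf|[mf f2]].
  split; last exact: Lfun2_integrable_sqr.
  by move: Lf; rewrite inE => /andP[] /[!inE].
rewrite inE; apply/andP; split; rewrite inE//= /finite_norm unlock /Lnorm poweR_lty//.
have -> : (\int[mu]_x (`|(EFin \o f) x| `^ 2) = \int[mu]_x (EFin \o (fun x => f x ^+ 2)%R) x)%E.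
  by apply: eq_integral => x _; rewrite /= -[2%R]/(2%:R) powR_mulrn ?normr_ge0// real_normK ?num_real.
have /integrableP[_] := f2; apply: le_lt_trans; apply: ge0_le_integral => //.
- by move=> x _; rewrite lee_fin sqr_ge0.
- by apply/measurable_EFinP; exact: measurable_funX.
- by apply: measurableT_comp => //; apply/measurable_EFinP; exact: measurable_funX.
- by move=> x _; exact: lee_abs.
Qed.

Lemma fine_Lnorm2 f : SQ f -> fine ('N[mu]_2%:E [EFin \o f])%E = nrm f.
Proof.
move=> sf; have [mf f2] := sf.
rewrite unlock /Lnorm.
have -> : (\int[mu]_x (`|(EFin \o f) x| `^ 2) = \int[mu]_x (EFin \o (fun x => f x ^+ 2)%R) x)%E.
  by apply: eq_integral => x _; rewrite /= -[2%R]/(2%:R) powR_mulrn ?normr_ge0// real_normK ?num_real.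
rewrite -(fineK (integrable_fin_num measurableT f2)) poweR_EFin /=.
have E : fine (\int[mu]_x ((f x ^+ 2)%:E))%E = ip f f.
  by rewrite -[LHS]/(\int[mu]_x (f x ^+ 2)); apply: eq_Rintegral => x _; rewrite expr2.
by rewrite E powR12_sqrt ?ip_ge0.
Qed.

Variables (Om : set V).
Hypothesis mOm : measurable Om.

Lemma L2P u : L2 Om u <-> SQ (u \_ Om).
Proof. exact: Lfun2P. Qed.

Lemma L2normE u : L2 Om u -> L2norm Om u = nrm (u \_ Om).
Proof. by move/L2P; exact: fine_Lnorm2. Qed.

Lemma SQ_L2 u : SQ u -> L2 Om u.
Proof. by move=> su; apply/L2P; exact: SQ_restrict. Qed.

Lemma Rintegral_restrict_ip u g : \int[mu]_(x in Om) (u x * g x) = ip (u \_ Om) g.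
Proof.
rewrite Rintegral_mkcond; apply: eq_Rintegral => x _.
by rewrite !restrict_real mulrAC.
Qed.

Lemma nrm_eq0_ae f : SQ f -> nrm f = 0 -> {ae mu, forall x, f x = 0}.
Proof.
move=> [mf f2] /eqP; rewrite sqrtr_eq0 => f0.
have : (\int[mu]_x `|(EFin \o (fun x => (f x ^+ 2)%R)) x| = 0)%E.
  rewrite (eq_integral (EFin \o (fun x => f x ^+ 2))); last first.
    by move=> x _; rewrite /= ger0_norm ?sqr_ge0.
  rewrite -(fineK (integrable_fin_num measurableT f2)).
  have -> : fine (\int[mu]_x (EFin \o (fun x => (f x ^+ 2)%R)) x)%E = ip f f.
    by rewrite -[LHS]/(\int[mu]_x (f x ^+ 2)); apply: eq_Rintegral => x _; rewrite expr2.
  by congr EFin; apply/eqP; rewrite eq_le f0 ip_ge0.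
have mf2 : measurable_fun setT (EFin \o (fun x => f x ^+ 2)).
  by apply/measurable_EFinP; exact: measurable_funX.
move/(ae_eq_integral_abs mu measurableT mf2); apply: filterS => x /(_ I) /= [] /eqP.
by rewrite sqrf_eq0 => /eqP.
Qed.

Lemma ip_partial f g i : Cc f -> Cc g -> ip (partial i f) g = - ip f (partial i g).
Proof. by move=> cf [sg _]; exact: integration_by_parts_rV. Qed.

Lemma ip_partials f g s : Cc f -> Cc g -> ip (partials s f) g = (-1) ^+ size s * ip f (partials s g).
Proof.
move=> cf cg; elim: s g cg => [|i s IH] g cg; first by rewrite /= expr0 mul1r.
rewrite [partials _ f]/= ip_partial//; last exact: Cc_partials.
rewrite IH; last exact: Cc_partial.
rewrite /= exprS mulN1r mulNr; congr (- (_ * ip f _)).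
have -> : partials s (partial i g) = partials (s ++ [:: i]) g by rewrite partials_cat.
rewrite -[RHS]/(partials (i :: s) g); apply: partials_perm; first by have [] := cg.
by rewrite cats1 perm_rcons.
Qed.

End restriction.

(** * Density of test functions in L2 *)

Section density.
Variables (R : realType) (n : nat).
Local Notation V := 'rV[R]_n.
Local Notation mu := (lebesgue_rV R n).
Implicit Types (f g h u : V -> R) (a : 'I_n -> nat).
Variables (om : V -> R) (Om : set V) (diam rho : R) (x0 : V).
Hypotheses (n0 : (0 < n)%N) (com : Cc om) (om0 : forall z, (2 * n%:R)^-1 < `|z| -> om z = 0)
  (om1 : \int[mu]_x om x = 1)
  (dOm : domain Om) (dm : ediameter Om = diam%:E) (rho0 : 0 < rho) (star : star_shaped Om (eball x0 rho)).

(** Cutting [h] to zero where it is large makes it bounded; a contraction towards the ball then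
    smooths it and, as [Om] is star-shaped, gives it compact support in [Om]. *)
Lemma test_dense h (e : R) : SQ h -> (forall x, ~ Om x -> h x = 0) -> 0 < e ->
  exists2 phi, test_function Om phi & nrm (phi \- h) < e.
Proof.
move=> sh hO e0; have [mh h2] := sh.
have bOm := domain_indic_Bb n0 dOm dm rho0 star.
pose A (k : nat) := [set x | `|h x| <= k%:R].
have mA k : measurable (A k).
  have mnh : measurable_fun setT (fun x => `|h x|) by exact: measurableT_comp.
  rewrite (_ : A k = setT `&` (fun x => `|h x|) @^-1` `]-oo, k%:R]%classic).
    exact: mnh measurableT _ (measurable_itv _).
  by apply/seteqP; split => x /=; rewrite in_itv/= => // -[].
pose hk k x := h x * \1_(A k) x.
have bhk k : Bb (hk k).
  have [_ _ [r hr]] := bOm; split.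
  - by apply: measurable_funM => //; exact: measurable_indic.
  - exists k%:R => x; rewrite /hk indicE normrM; case: (boolP (x \in A k)) => [/set_mem|_] //=.
      by rewrite normr1 mulr1.
    by rewrite normr0 mulr0.
  - exists r => x /hr H; rewrite /hk hO ?mul0r// => Ox.
    by move: H; rewrite indicE mem_set// => /eqP; rewrite oner_eq0.
have cv : nrm (hk k \- h) @[k --> \oo] --> (0 : R).
  apply: (@nrm_dominated _ _ _ _ (fun x => `|h x|)) => //.
  - by move=> k; have [] := bhk k.
  - split; first exact: measurableT_comp.
    by move: h2; congr (_.-integrable _ _); apply/funext => x /=; rewrite real_normK ?num_real.
  - by move=> k x; rewrite /hk normrM indicE; case: (_ \in _); rewrite ?normr1 ?normr0 ?mulr1 ?mulr0.
  move=> x; apply: cvg_near_cst; near=> k; rewrite /hk indicE mem_set ?mulr1//=.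
  near: k; exact: nbhs_infty_ger.
have e2 : 0 < e / 2 by rewrite divr_gt0.
move/cvgr0Pnorm_lt : cv => /(_ _ e2) [k _ /(_ k (leqnn k)) /=]; rewrite ger0_norm ?nrm_ge0// => hk1.
move/cvgr0Pnorm_lt : (fwd_cvg x0 com rho0 om1 (bhk k)) => /(_ _ e2) [N _ /(_ N (leqnn N)) /=].
rewrite ger0_norm ?nrm_ge0// => hk2.
have hkO y : ~ Om y -> hk k y = 0 by move=> Oy; rewrite /hk hO// mul0r.
have t01 : 0 < dyadic R N <= 1.
  by rewrite (dyadic_gt0 R N) (le_trans (dyadic_le_half R N))//; lra.
have tf := fwd_test n0 rho0 star com om0 t01 (bhk k) hkO.
exists (fwd rho x0 (dyadic R N) om (hk k)) => //.
have s1 := Bb_SQ (Cc_Bb (test_function_Cc tf)); have s2 := Bb_SQ (bhk k).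
rewrite (_ : _ \- h = (fwd rho x0 (dyadic R N) om (hk k) \- hk k) \+ (hk k \- h)).
  apply: le_lt_trans (nrmD (SQB s1 s2) (SQB s2 sh)) _; lra.
by apply/funext => x /=; ring.
Unshelve. all: by end_near. Qed.

(** A test function closer to [h] than the norm of [h] would make that norm squared, which equals
    the product of [h - phi] with [h], smaller than itself. *)
Lemma test_orthogonal h : SQ h -> (forall x, ~ Om x -> h x = 0) ->
  (forall phi, test_function Om phi -> ip h phi = 0) -> nrm h = 0.
Proof.
move=> sh hO orth; apply/eqP; rewrite eq_le nrm_ge0 andbT leNgt; apply/negP => h0.
have [phi tp hp] := test_dense sh hO h0.
have sp := Bb_SQ (Cc_Bb (test_function_Cc tp)).
have H := ip_le_nrm (SQB sp sh) sh.
have E : ip (phi \- h) h = - nrm h ^+ 2.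
  rewrite nrm_sqr -[RHS]add0r -(orth phi tp) /ip -RintegralB//.
  - by apply: eq_Rintegral => x _ /=; ring.
  - exact: SQ_integrableM.
  - exact: SQ_integrableM.
move: H; rewrite E normrN ger0_norm ?sqr_ge0// leNgt expr2 => /negP[].
by rewrite ltr_pM2r.
Qed.

End density.

Lemma sqrt_sum_sqr_le (R : realType) (I : Type) (r : seq I) (P : pred I) (F : I -> R) :
  (forall i, 0 <= F i) -> Num.sqrt (\sum_(i <- r | P i) F i ^+ 2) <= \sum_(i <- r | P i) F i.
Proof.
move=> F0; have S0 : 0 <= \sum_(i <- r | P i) F i by apply: sumr_ge0.
rewrite -[leRHS]ger0_norm// -sqrtr_sqr ler_wsqrtr//.
elim: r {S0} => [|i r IH]; first by rewrite !big_nil expr0n.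
rewrite !big_cons; case: (P i) => //; have S0 : 0 <= \sum_(i <- r | P i) F i by apply: sumr_ge0.
by move: S0 IH (F0 i); move: (bigop _ _ _) (bigop _ _ _) (F i) => a b c; nra.
Qed.

Lemma le_sqrt_sum_sqr (R : realType) (I : finType) (P : pred I) (F : I -> R) i : P i -> 0 <= F i ->
  F i <= Num.sqrt (\sum_(j | P j) F j ^+ 2).
Proof.
move=> Pi F0; rewrite -[leLHS]ger0_norm// -sqrtr_sqr ler_wsqrtr// (bigD1 i)//= lerDl.
by apply: sumr_ge0 => j _; exact: sqr_ge0.
Qed.

Lemma sum_cvg0 (R : realType) (I : Type) (r : seq I) (P : pred I) (F : I -> nat -> R) :
  (forall i, P i -> F i @ \oo --> (0 : R)) -> (fun k => \sum_(i <- r | P i) F i k) @ \oo --> (0 : R).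
Proof.
move=> F0; elim: r => [|i r IH].
  by under eq_fun do rewrite big_nil; exact: cvg_cst.
under eq_fun do rewrite big_cons.
case: (boolP (P i)) => // /F0 H.
by have := cvgD H IH; rewrite addr0; apply.
Qed.

(** * Weak derivatives *)

Section weak_derivatives.
Variables (R : realType) (n : nat) (Om : set 'rV[R]_n).
Local Notation V := 'rV[R]_n.
Local Notation mu := (lebesgue_rV R n).
Implicit Types (f g h u v : V -> R) (a : 'I_n -> nat).
Hypothesis mOm : measurable Om.

(** The sorted word along which [mpartial] differentiates; [multiplicity] is the passage back, up to
    the order of the letters. *)
Definition multi_word a : seq 'I_n := flatten [seq nseq (a i) i | i <- enum 'I_n].

Definition multiplicity (s : seq 'I_n) : 'I_n -> nat := fun i => count_mem i s.

Lemma size_multi_word a : size (multi_word a) = (\sum_i a i)%N.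
Proof.
rewrite /multi_word size_flatten /shape -map_comp sumnE big_map big_enum /=.
by apply: eq_bigr => i _; rewrite size_nseq.
Qed.

Lemma sum_multiplicity s : (\sum_i multiplicity s i)%N = size s.
Proof.
elim: s => [|j s IH]; first by rewrite big1.
rewrite /= -IH /multiplicity /= big_split/= -[RHS]add1n; congr (_ + _)%N.
by rewrite (bigD1 j)//= eqxx big1// => i /negbTE ij; rewrite eq_sym ij.
Qed.

Lemma multi_word0 : multi_word (fun=> 0%N) = [::].
Proof. by apply: size0nil; rewrite size_multi_word big1. Qed.

Lemma ip_restrictl u g : (forall x, ~ Om x -> g x = 0) -> ip (u \_ Om) g = ip u g.
Proof.
move=> gO; apply: eq_Rintegral => x _; rewrite restrict_real indicE.
by have [|/negP Ax] := boolP (x \in Om); rewrite ?mulr1// gO ?mulr0// => Ax'; apply: Ax; rewrite inE.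
Qed.

Lemma ipBl f g h : SQ f -> SQ g -> SQ h -> ip (f \- g) h = ip f h - ip g h.
Proof.
move=> sf sg sh; rewrite /ip -RintegralB//; [|exact: SQ_integrableM..].
by apply: eq_Rintegral => x _ /=; ring.
Qed.

Lemma test_SQ phi : test_function Om phi -> SQ phi.
Proof. by move=> /test_function_Cc/Cc_Bb/Bb_SQ. Qed.

Lemma weak_derivativeP a u g : weak_derivative Om a u g <->
  forall phi, test_function Om phi ->
    ip (u \_ Om) (partials (multi_word a) phi) = (-1) ^+ (\sum_i a i)%N * ip (g \_ Om) phi.
Proof.
by split=> H phi tp; have := H phi tp; rewrite !Rintegral_restrict_ip.
Qed.

Lemma weak_derivativeB a u v g h : L2 Om u -> L2 Om v -> L2 Om g -> L2 Om h ->
  weak_derivative Om a u g -> weak_derivative Om a v h -> weak_derivative Om a (u \- v) (g \- h).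
Proof.
move=> /L2P su /L2P sv /L2P sg /L2P sh /weak_derivativeP wu /weak_derivativeP wv.
apply/weak_derivativeP => phi tp; rewrite !restrictB !ipBl//; first by rewrite wu// wv// mulrBr.
  exact: test_SQ.
by apply: test_SQ; exact: test_function_partials.
Qed.

Lemma weak_derivative0 u : weak_derivative Om (fun=> 0%N) u u.
Proof. by apply/weak_derivativeP => phi tp; rewrite multi_word0 big1// expr0 mul1r. Qed.

Lemma weak_derivative_Cc a f : Cc f -> weak_derivative Om a f (partials (multi_word a) f).
Proof.
move=> cf; apply/weak_derivativeP => phi tp; have cp := test_function_Cc tp.
rewrite !ip_restrictl; last 2 first.
- by move=> x Ox; exact: test_function_supp tp Ox.
- by move=> x Ox; exact: test_function_supp (test_function_partials _ tp) Ox.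
by rewrite ip_partials// size_multi_word mulrA -expr2 sqrr_sign mul1r.
Qed.

Lemma wderivP a u : (exists2 g, L2 Om g & weak_derivative Om a u g) ->
  L2 Om (wderiv Om a u) /\ weak_derivative Om a u (wderiv Om a u).
Proof.
move=> [g Lg wg].
exact: (@xgetPex _ (cst 0) [set g | L2 Om g /\ weak_derivative Om a u g] (ex_intro _ g (conj Lg wg))).
Qed.

Lemma ip_cvg (w : nat -> V -> R) u h : (forall k, SQ (w k)) -> SQ u -> SQ h ->
  nrm (w k \- u) @[k --> \oo] --> (0 : R) -> ip (w k) h @[k --> \oo] --> ip u h.
Proof.
move=> sw su sh cv; apply/cvgrPdist_le => e e0.
have e1 : 0 < e / (nrm h + 1) by rewrite divr_gt0// ltr_wpDl// nrm_ge0.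
move/cvgr0Pnorm_le : cv => /(_ _ e1); apply: filterS => k; rewrite ger0_norm ?nrm_ge0// => H.
rewrite distrC -ipBl//; apply: (le_trans (ip_le_nrm (SQB (sw k) su) sh)).
move: H; rewrite ler_pdivlMr ?ltr_wpDl ?nrm_ge0// => H.
have := nrm_ge0 (w k \- u); lra.
Qed.

Lemma weak_derivative_lim a (w : nat -> V -> R) u g : (forall k, Cc (w k)) -> SQ u -> SQ g ->
  nrm (w k \- u) @[k --> \oo] --> (0 : R) ->
  nrm (partials (multi_word a) (w k) \- g) @[k --> \oo] --> (0 : R) -> weak_derivative Om a u g.
Proof.
move=> cw su sg wu wg; apply/weak_derivativeP => phi tp; have cp := test_function_Cc tp.
have sp := test_SQ tp; have spp := test_SQ (test_function_partials (multi_word a) tp).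
rewrite !ip_restrictl; last 2 first.
- by move=> x Ox; exact: test_function_supp tp Ox.
- by move=> x Ox; exact: test_function_supp (test_function_partials _ tp) Ox.
have h1 := ip_cvg (fun k => Bb_SQ (Cc_Bb (cw k))) su spp wu.
have h2 := ip_cvg (fun k => Bb_SQ (Cc_Bb (Cc_partials (multi_word a) (cw k)))) sg sp wg.
have E : (fun k => ip (w k) (partials (multi_word a) phi)) =
    (fun k => (-1) ^+ (\sum_i a i)%N * ip (partials (multi_word a) (w k)) phi).
  by apply/funext => k; rewrite ip_partials// size_multi_word mulrA -expr2 sqrr_sign mul1r.
have h3 : (-1) ^+ (\sum_i a i)%N * ip (partials (multi_word a) (w k)) phi @[k --> \oo] -->
    (-1) ^+ (\sum_i a i)%N * ip g phi by apply: cvgM => //; exact: cvg_cst.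
rewrite -E in h3.
exact: (cvg_unique _ h1 h3).
Qed.

Lemma nrm_eq_of_dist0 f g : SQ f -> SQ g -> nrm (f \- g) = 0 -> nrm f = nrm g.
Proof.
move=> sf sg fg.
have D (p q : V -> R) : SQ p -> SQ q -> nrm (p \- q) = 0 -> nrm p <= nrm q.
  move=> sp sq pq; rewrite -[leRHS]add0r -pq.
  have := nrmD (SQB sp sq) sq; congr (nrm _ <= _); apply/funext => x /=; ring.
apply/eqP; rewrite eq_le !D//.
rewrite (_ : _ \- _ = (fun x => -1 * (f \- g) x)); last by apply/funext => x /=; ring.
by rewrite nrmZ ?fg ?mulr0//; exact: SQB.
Qed.

Hypothesis orth : forall h, SQ h -> (forall x, ~ Om x -> h x = 0) ->
  (forall phi, test_function Om phi -> ip h phi = 0) -> nrm h = 0.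

Lemma weak_derivative_unique a u g h : L2 Om g -> L2 Om h ->
  weak_derivative Om a u g -> weak_derivative Om a u h -> nrm ((g \_ Om) \- (h \_ Om)) = 0.
Proof.
move=> /L2P sg /L2P sh /weak_derivativeP wg /weak_derivativeP wh; apply: orth; first exact: SQB.
  by move=> x Ox /=; rewrite !restrict_out// subr0.
move=> phi tp; have sp := test_SQ tp; rewrite ipBl//; apply/eqP; rewrite subr_eq0; apply/eqP.
have := wg phi tp; rewrite wh// => /(congr1 (fun y => (-1) ^+ (\sum_i a i)%N * y)).
by rewrite !mulrA -!expr2 sqrr_sign !mul1r.
Qed.

(** [wderiv] is an arbitrary choice; by uniqueness its norm can be computed from any known weak
    derivative. *)
Lemma L2norm_wderiv a u g : L2 Om g -> weak_derivative Om a u g ->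
  L2norm Om (wderiv Om a u) = nrm (g \_ Om).
Proof.
move=> Lg wg; have [Lw ww] := wderivP (ex_intro2 _ _ g Lg wg).
rewrite L2normE//; apply: nrm_eq_of_dist0; [exact/L2P|exact/L2P|].
exact: weak_derivative_unique ww wg.
Qed.

Lemma L2norm_ge0 u : 0 <= L2norm Om u.
Proof. by rewrite /L2norm fine_ge0// Lnorm_ge0. Qed.

Lemma L2norm_wderiv_le a u : L2norm Om (wderiv Om a u) <= Hs_seminorm Om (\sum_i a i)%N u.
Proof.
set s := (\sum_i a i)%N.
(* The seminorm sums over functions into ['I_s.+1]; each [a i] is at most the sum [s], so [inord]
   does not alter it. *)
pose b : {ffun 'I_n -> 'I_s.+1} := [ffun i => inord (a i)].
have bE : (fun i => b i : nat) = a.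
  apply/funext => i; rewrite ffunE inordK// ltnS /s (bigD1 i)//= leq_addr//.
rewrite -bE; apply: (@le_sqrt_sum_sqr _ _ _ (fun b : {ffun 'I_n -> 'I_s.+1} => L2norm Om (wderiv Om (fun i => b i) u))).
  by apply/eqP; rewrite /s; apply: eq_bigr => i _; rewrite -[in RHS]bE.
exact: L2norm_ge0.
Qed.

Lemma Hs_seminorm_le_sum s u : Hs_seminorm Om s u <=
  \sum_(a : {ffun 'I_n -> 'I_s.+1} | (\sum_i a i == s)%N) L2norm Om (wderiv Om (fun i => a i) u).
Proof. by apply: sqrt_sum_sqr_le => a; exact: L2norm_ge0. Qed.

Lemma Hs_seminorm_le_norm l s u : (l <= s)%N -> Hs_seminorm Om l u <= Hs_norm Om s u.
Proof.
move=> ls; rewrite -ltnS in ls.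
apply: (@le_sqrt_sum_sqr _ _ predT (fun l : 'I_s.+1 => Hs_seminorm Om l u) (Ordinal ls)) => //.
exact: sqrtr_ge0.
Qed.

(** Integration by parts against a test function passes to the limit, so the limits of the
    derivatives are weak derivatives of the limit. The family [g] is indexed by words, of which the
    norms see the sorted ones. *)
Lemma Hs0_limit d (w : nat -> V -> R) (g : seq 'I_n -> V -> R) : (forall k, test_function Om (w k)) ->
  (forall s, (size s <= d)%N -> SQ (g s) /\ nrm (partials s (w k) \- g s) @[k --> \oo] --> (0 : R)) ->
  Hs0 Om d (g [::]) /\ forall a, (\sum_i a i <= d)%N -> weak_derivative Om a (g [::]) (g (multi_word a)).
Proof.
move=> tw wg; have [s0 c0] := wg [::] isT.
have cw k := test_function_Cc (tw k).
have W a : (\sum_i a i <= d)%N -> SQ (g (multi_word a)) /\ weak_derivative Om a (g [::]) (g (multi_word a)).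
  move=> ad; have [|s1 c1] := wg (multi_word a); first by rewrite size_multi_word.
  by split => //; exact: weak_derivative_lim cw s0 s1 c0 c1.
split; last by move=> a /W [].
have H : Hs Om d (g [::]).
  split; first exact: SQ_L2.
  by move=> a /W [sa wa]; exists (g (multi_word a)) => //; exact: SQ_L2.
case: d wg W H => [|d] wg W H; first exact: SQ_L2.
split => // e e0.
pose F (l : nat) (a : {ffun 'I_n -> 'I_l.+1}) k := nrm (partials (multi_word (fun i => a i)) (w k) \- g (multi_word (fun i => a i))).
have cF : (fun k => \sum_(l < d.+2) \sum_(a : {ffun 'I_n -> 'I_l.+1} | (\sum_i a i == l)%N) F l a k) @ \oo --> (0 : R).
  apply: sum_cvg0 => l _; apply: sum_cvg0 => a /eqP al.
  have sl : (size (multi_word (fun i => a i)) <= d.+1)%N by rewrite size_multi_word al -ltnS.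
  by have [_] := wg _ sl.
move/cvgr0Pnorm_lt : cF => /(_ _ e0) [k _ /(_ k (leqnn k)) Hk].
exists (w k) => //; apply: le_lt_trans Hk; apply: le_trans (ler_norm _).
apply: (le_trans (sqrt_sum_sqr_le _ _ _)) => [l|]; first exact: sqrtr_ge0.
apply: ler_sum => l _; apply: (le_trans (Hs_seminorm_le_sum _ _)); apply: ler_sum => a /eqP al.
have [|sa wa] := W (fun i => a i); first by rewrite al -ltnS.
have sp : SQ (partials (multi_word (fun i => a i)) (w k)) by exact: Bb_SQ (Cc_Bb (Cc_partials _ (cw k))).
rewrite (@L2norm_wderiv _ _ (g (multi_word (fun i => a i)) \- partials (multi_word (fun i => a i)) (w k))).
- apply: (le_trans (nrm_restrict_le mOm (SQB sa sp))); rewrite /F.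
  rewrite (_ : _ \- _ = (fun x => -1 * (partials (multi_word (fun i => a i)) (w k) \- g (multi_word (fun i => a i))) x)).
    by rewrite nrmZ ?normrN1 ?mul1r//; exact: SQB.
  by apply/funext => x /=; ring.
- by apply: SQ_L2 => //; exact: SQB.
- apply: weak_derivativeB => //; [exact: SQ_L2|apply: SQ_L2 => //; exact: test_SQ|exact: SQ_L2|exact: SQ_L2|].
  exact: weak_derivative_Cc.
Qed.

(** For [m > 0] the closure in the definition provides the test function; for [m = 0] the space is
    all of L2 and density takes over. *)
Lemma Hs0_approx m f (e : R) : (forall h (e : R), SQ h -> (forall x, ~ Om x -> h x = 0) -> 0 < e ->
    exists2 phi, test_function Om phi & nrm (phi \- h) < e) ->
  Hs0 Om m f -> 0 < e -> exists2 phi, test_function Om phi &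
  forall s, (size s <= m)%N -> nrm (partials s phi \- (wderiv Om (multiplicity s) f) \_ Om) <= e.
Proof.
move=> dense Hf e0.
have W0 : L2 Om f -> nrm ((wderiv Om (fun=> 0%N) f) \_ Om \- f \_ Om) = 0.
  move=> Lf; have [Lw ww] := wderivP (ex_intro2 _ _ f Lf (weak_derivative0 f)).
  exact: weak_derivative_unique ww (weak_derivative0 f).
case: m Hf => [Lf|m [[Lf Hf] af]].
  have /L2P sf := Lf; have [phi tp H] := dense _ _ sf (fun x => @restrict_out _ _ Om f x) e0.
  exists phi => // s; rewrite leqn0 size_eq0 => /eqP ->.
  have [Lw ww] := wderivP (ex_intro2 _ _ f Lf (weak_derivative0 f)).
  have sw : SQ ((wderiv Om (fun=> 0%N) f) \_ Om) by exact/L2P.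
  rewrite -[multiplicity _]/(fun=> 0%N) /=.
  rewrite (_ : _ \- _ = (phi \- f \_ Om) \- ((wderiv Om (fun=> 0%N) f) \_ Om \- f \_ Om)); last first.
    by apply/funext => x /=; ring.
  apply: (le_trans (nrmB (SQB (test_SQ tp) sf) (SQB sw sf))); rewrite W0// addr0; exact: ltW.
have [phi tp H] := af e e0; exists phi => // s sm.
set a := multiplicity s; have as_ : (\sum_i a i)%N = size s := sum_multiplicity s.
have [|g Lg wg] := Hf a; first by rewrite as_.
have [Lw ww] := wderivP (ex_intro2 _ _ g Lg wg).
have cp := test_function_Cc tp.
have Ep : partials s phi = partials (multi_word a) phi by apply: mpartial_count; have [] := cp.
have tpp := test_function_partials (multi_word a) tp; have spp := test_SQ tpp.
have Lphi : L2 Om phi by apply: SQ_L2 => //; exact: test_SQ.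
have Lpp : L2 Om (partials (multi_word a) phi) by exact: SQ_L2.
have wB := weak_derivativeB Lf Lphi Lw Lpp ww (weak_derivative_Cc a cp).
have LB : L2 Om (wderiv Om a f \- partials (multi_word a) phi).
  by apply/L2P; rewrite restrictB; apply: SQB; exact/L2P.
have := L2norm_wderiv LB wB; rewrite restrictB [partials _ _ \_ _]restrict_supp; last first.
  by move=> x; exact: test_function_supp tpp.
have {LB wB} h1 := L2norm_wderiv_le a (f \- phi).
have h2 : Hs_seminorm Om (\sum_i a i)%N (f \- phi) <= Hs_norm Om m.+1 (f \- phi).
  by apply: Hs_seminorm_le_norm; rewrite as_.
move=> E; rewrite E in h1; apply: le_trans (ltW H); apply: le_trans h2; apply: le_trans h1.
rewrite Ep (_ : _ \- _ = (fun x => -1 * ((wderiv Om a f) \_ Om \- partials (multi_word a) phi) x)); last first.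
  by apply/funext => x /=; ring.
rewrite nrmZ ?normrN1 ?mul1r//; apply: SQB => //; exact/L2P.
Qed.

End weak_derivatives.

Lemma subf_split (R : realType) (T : Type) (f g h : T -> R) : f \- h = (f \- g) \+ (g \- h).
Proof. by apply/funext => x /=; ring. Qed.

Lemma inv_sqr_cvg0 (R : realType) : 1 / (2 ^+ k) ^+ 2 @[k --> \oo] --> (0 : R).
Proof.
have H : 2 * dyadic R k @[k --> \oo] --> (0 : R).
  by rewrite -(mulr0 2); apply: cvgM; [exact: cvg_cst|exact: dyadic_cvg0].
rewrite (_ : (fun k => _) = (fun k => (2 * dyadic R k) * (2 * dyadic R k))).
  by rewrite -(mulr0 (0 : R)); exact: cvgM.
by apply/funext => k; rewrite /dyadic; field; rewrite gt_eqF// exprn_gt0.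
Qed.

Lemma le_add_cvg0 (R : realType) (a b : R) (u : nat -> R) : (forall k, a <= b + u k) ->
  u @ \oo --> (0 : R) -> a <= b.
Proof.
move=> H u0; apply/ler_addgt0Pr => e e0.
move/cvgr0Pnorm_le : u0 => /(_ _ e0) [k _ /(_ k (leqnn k)) /= Hk].
by apply: (le_trans (H k)); rewrite lerD2l (le_trans (ler_norm _)).
Qed.

(** * Solutions of the divergence equation *)

Section bogovskii_linear.
Variables (R : realType) (n : nat).
Local Notation V := 'rV[R]_n.
Local Notation mu := (lebesgue_rV R n).
Implicit Types (f g h : V -> R).

Lemma test_functionB (Om : set V) f g : test_function Om f -> test_function Om g -> test_function Om (f \- g).
Proof.
move=> tf tg; have [_ _ fO] := tf; have [_ _ gO] := tg.
have cf := test_function_Cc tf; have cg := test_function_Cc tg.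
apply: test_functionP.
  by have := CcD cf (CcZ (-1) cg); congr Cc; apply/funext => x /=; rewrite mulN1r.
apply: (@subset_trans _ (closure ([set x | f x != 0] `|` [set x | g x != 0]))).
  apply: closure_subset => x /=; have [fx|] := eqVneq (f x) 0; last by left.
  by have [gx|] := eqVneq (g x) 0; [rewrite fx gx subrr eqxx|right].
by rewrite closureU => x [/fO|/gO].
Qed.

Variables (om : V -> R) (rho : R) (x0 : V).
Hypotheses (com : Cc om) (rho0 : 0 < rho).

Lemma timeop_lin w p (k : R) f g : time_weight 1 w -> Cc p -> Bb f -> Bb g ->
  timeop rho x0 w p (fun x => f x + k * g x) = (fun x => timeop rho x0 w p f x + k * timeop rho x0 w p g x).
Proof.
move=> tw cp bf bg; apply/funext => x; rewrite /timeop.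
have i1 := timeop_integrable x0 rho0 x tw cp bf; have i2 := timeop_integrable x0 rho0 x tw cp bg.
rewrite -RintegralZl// -RintegralD//; last exact: integrableZ_real.
apply: eq_Rintegral => t _; rewrite (fwd_lin rho x0 cp t k bf bg) mulrDr; congr (_ + _); exact: mulrCA.
Qed.

Lemma bogovskiiB w f g j : time_weight 1 w -> Bb f -> Bb g ->
  bogovskii om rho x0 w (f \- g) j = bogovskii om rho x0 w f j \- bogovskii om rho x0 w g j.
Proof.
move=> tw bf bg; apply/funext => x; rewrite /bogovskii /=.
have -> : coord_mul x0 j (f \- g) = (fun y => coord_mul x0 j f y + -1 * coord_mul x0 j g y).
  by apply/funext => y; rewrite /coord_mul /=; ring.
have -> : f \- g = (fun y => f y + -1 * g y) by apply/funext => y /=; rewrite mulN1r.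
rewrite !timeop_lin//; [|exact: coord_mul_Bb|exact: coord_mul_Bb|exact: coord_mul_Cc].
move: (timeop _ _ _ _ _ _) (timeop _ _ _ _ _ _) (timeop _ _ _ _ _ _) (timeop _ _ _ _ _ _) => a b c d.
ring.
Qed.

End bogovskii_linear.

Section bogovskii_limits.
Variables (R : realType) (n : nat).
Local Notation V := 'rV[R]_n.
Local Notation mu := (lebesgue_rV R n).
Variables (om : V -> R) (Om : set V) (diam rho : R) (x0 : V).
Hypotheses (n2 : (2 <= n)%N) (com : Cc om) (om1 : \int[mu]_x om x = 1) (dOm : domain Om)
  (dm : ediameter Om = diam%:E) (rho0 : 0 < rho) (star : star_shaped Om (eball x0 rho)).
Variables (m : nat) (phi : nat -> V -> R) (F : seq 'I_n -> V -> R).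
Hypotheses (tphi : forall k, test_function Om (phi k))
  (sF : forall s, (size s <= m)%N -> SQ (F s))
  (phiF : forall k s, (size s <= m)%N -> nrm (partials s (phi k) \- F s) <= 1 / (2 ^+ k) ^+ 2)
  (F_mean : ip (F [::]) \1_Om = 0).

Let cphi k := test_function_Cc (tphi k).
Let bphi k := Cc_Bb (cphi k).

Let B N g j := bogovskii om rho x0 (cutoff N) g j.

Let cB N g j : Bb g -> Cc (B N g j).
Proof. by move=> bg; apply: bogovskii_Cc => //; apply: time_weight_itv; exact: dyadic_gt0. Qed.

Let eta0 k : 0 < 1 / (2 ^+ k) ^+ 2 :> R.
Proof. by rewrite divr_gt0 ?exprn_gt0. Qed.

Lemma truncation_level k : exists T, forall N, (T <= N)%N ->
  nrm (fwd rho x0 (dyadic R N) om (phi k) \- phi k) <= 1 / (2 ^+ k) ^+ 2 /\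
  forall N' s j, (N <= N')%N -> (size s <= m.+1)%N ->
    nrm (partials s (B N' (phi k) j \- B N (phi k) j)) <= 1 / (2 ^+ k) ^+ 2.
Proof.
have /choice[K HK] : forall p : seq 'I_n * 'I_n, exists K, 0 <= K /\ forall N N', (N <= N')%N ->
    nrm (partials p.1 (B N' (phi k) p.2 \- B N (phi k) p.2)) <= K * dyadic R N.
  by move=> [s j]; have [K K0 HK] := bogovskii_short x0 com rho0 s j (cphi k); exists K.
have /choice[C HC] : forall l, exists C, 0 <= C /\ forall s, size s = l -> \sum_j K (s, j) <= C.
  by move=> l; have [C C0 HC] := words_bounded (fun s => \sum_j K (s, j)) l; exists C.
pose K0 := \sum_(l < m.+2) C l.
have K0p : 0 <= K0 by apply: sumr_ge0 => l _; have [] := HC l.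
have KK s j : (size s <= m.+1)%N -> K (s, j) <= K0.
  move=> sm; have [_ /(_ s erefl) H] := HC (size s).
  apply: (@le_trans _ _ (\sum_j K (s, j))).
    by rewrite (bigD1 j)//= lerDl; apply: sumr_ge0 => i _; have [] := HK (s, i).
  apply: (le_trans H); rewrite -ltnS in sm.
  rewrite /K0 (bigD1 (Ordinal sm))//= lerDl.
  by apply: sumr_ge0 => i _; have [] := HC i.
have c1 : K0 * dyadic R N @[N --> \oo] --> (0 : R).
  by rewrite -(mulr0 K0); apply: cvgM; [exact: cvg_cst|exact: dyadic_cvg0].
move/cvgr0Pnorm_le : c1 => /(_ _ (eta0 k)) [T1 _ H1].
move/cvgr0Pnorm_le : (fwd_cvg x0 com rho0 om1 (bphi k)) => /(_ _ (eta0 k)) [T2 _ H2].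
exists (maxn T1 T2) => N; rewrite geq_max => /andP[TN1 TN2]; split.
  by have := H2 N TN2; rewrite /= ger0_norm ?nrm_ge0.
move=> N' s j NN sm; have [_ /(_ _ _ NN) /= h1] := HK (s, j).
apply: (le_trans h1); apply: (le_trans _ (H1 N TN1)); apply: (le_trans _ (ler_norm _)).
by rewrite ler_wpM2r ?KK// ltW// dyadic_gt0.
Qed.

Lemma truncation_levels : exists N : nat -> nat, (forall k, (N k <= N k.+1)%N) /\ forall k,
  nrm (fwd rho x0 (dyadic R (N k)) om (phi k) \- phi k) <= 1 / (2 ^+ k) ^+ 2 /\
  forall s j, (size s <= m.+1)%N ->
    nrm (partials s (B (N k.+1) (phi k) j \- B (N k) (phi k) j)) <= 1 / (2 ^+ k) ^+ 2.
Proof.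
have /choice[T HT] := truncation_level.
(* Partial sums make the levels nondecreasing and keep them above [T k]. *)
exists (fun k => \sum_(i < k.+1) T i)%N.
have mono k : (\sum_(i < k.+1) T i <= \sum_(i < k.+2) T i)%N by rewrite [leqRHS]big_ord_recr leq_addr.
split => // k; have Tk : (T k <= \sum_(i < k.+1) T i)%N by rewrite big_ord_recr leq_addl.
have [h1 h2] := HT k _ Tk; split => // s j sm.
exact: h2.
Qed.

Lemma phi_increment k s : (size s <= m)%N ->
  nrm (partials s (phi k.+1 \- phi k)) <= 2 / (2 ^+ k) ^+ 2.
Proof.
move=> sm; have sp i : SQ (partials s (phi i)) by exact: Bb_SQ (Cc_Bb (Cc_partials s (cphi i))).
rewrite partialsB; [|by have [] := cphi k.+1|by have [] := cphi k].
rewrite (_ : _ \- _ = (partials s (phi k.+1) \- F s) \- (partials s (phi k) \- F s)); last first.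
  by apply/funext => x /=; ring.
apply: (le_trans (nrmB (SQB (sp _) (sF sm)) (SQB (sp _) (sF sm)))).
have h : 1 / (2 ^+ k.+1) ^+ 2 <= 1 / (2 ^+ k) ^+ 2 :> R.
  rewrite !div1r lef_pV2 ?posrE ?exprn_gt0// lerXn2r ?nnegrE ?exprn_ge0// [leRHS]exprS.
  by rewrite ler_peMl ?exprn_ge0// ler1n.
have h1 := phiF k.+1 sm; have h2 := phiF k sm; move: h h1 h2; rewrite [2 / _]mulrC.
by rewrite !div1r; lra.
Qed.

(** Level and function change together. Inserting the field of [phi k] at the new level leaves the
    field of [phi k.+1 \- phi k], bounded uniformly in the level, and a mere change of truncation
    for [phi k]. *)
Lemma bogovskii_increment N s j : (forall k, (N k <= N k.+1)%N) -> (size s <= m.+1)%N ->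
  (forall k, nrm (partials s (B (N k.+1) (phi k) j \- B (N k) (phi k) j)) <= 1 / (2 ^+ k) ^+ 2) ->
  exists C, forall k, nrm (partials s (B (N k.+1) (phi k.+1) j) \- partials s (B (N k) (phi k) j)) <= C / (2 ^+ k) ^+ 2.
Proof.
move=> mono sm H; have [K K0 HK] := bogovskii_bounded com n2 dOm dm rho0 star s.
exists (K * (\sum_(l < size s) #|{: l.-tuple 'I_n}|%:R * 2 + 2) + 1) => k.
have td := test_functionB (tphi k.+1) (tphi k).
have h1 := HK (N k.+1) _ j td.
have tw : time_weight 1 (cutoff (N k.+1) : R -> R) by apply: time_weight_itv; exact: dyadic_gt0.
rewrite (bogovskiiB x0 com rho0 j tw (bphi _) (bphi _)) -/(B _ _ _) -/(B _ _ _) in h1.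
have c1 := cB (N k.+1) j (bphi k.+1); have c2 := cB (N k.+1) j (bphi k); have c3 := cB (N k) j (bphi k).
have [s1 _] := c1; have [s2 _] := c2; have [s3 _] := c3.
have q1 := Bb_SQ (Cc_Bb (Cc_partials s c1)); have q2 := Bb_SQ (Cc_Bb (Cc_partials s c2)).
have q3 := Bb_SQ (Cc_Bb (Cc_partials s c3)).
have h2 := H k; rewrite partialsB// in h1; rewrite partialsB// in h2.
rewrite (subf_split _ (partials s (B (N k.+1) (phi k) j))).
apply: (le_trans (nrmD (SQB q1 q2) (SQB q2 q3))).
rewrite [leRHS]mulrDl; apply: lerD => //; apply: (le_trans h1); rewrite -mulrA ler_wpM2l//.
rewrite mulrDl; apply: lerD; last exact: (@phi_increment k [::]).
rewrite mulr_suml; apply: ler_sum => l _; rewrite -mulrA mulr_natl -sumr_const.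
apply: ler_sum => t _; apply: phi_increment; rewrite size_tuple.
by rewrite -ltnS (leq_trans (ltn_ord l)).
Qed.

(** [Riesz_Fischer] gives the limits word by word. In the divergence, the contraction of [phi k]
    tends to [F [::]], and the bump term disappears because the integrals of [phi k] tend to
    zero. *)
Lemma bogovskii_limits : exists (N : nat -> nat) (g : 'I_n -> seq 'I_n -> V -> R),
  (forall j s, (size s <= m.+1)%N -> SQ (g j s) /\
     nrm (partials s (B (N k) (phi k) j) \- g j s) @[k --> \oo] --> (0 : R)) /\
  nrm ((fun x => \sum_j g j [:: j] x) \- F [::]) = 0.
Proof.
have [N [mono HN]] := truncation_levels; exists N.
have qB k s j : SQ (partials s (B (N k) (phi k) j)).
  exact: Bb_SQ (Cc_Bb (Cc_partials s (cB (N k) j (bphi k)))).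
have /choice[g Hg] : forall p : 'I_n * seq 'I_n, exists g, (size p.2 <= m.+1)%N -> SQ g /\
     nrm (partials p.2 (B (N k) (phi k) p.1) \- g) @[k --> \oo] --> (0 : R).
  move=> [j s]; have [sm|sm] := boolP (size s <= m.+1)%N; last by exists (fun=> 0).
  have [C HC] := bogovskii_increment mono sm (fun k => (HN k).2 s j sm).
  have [g sg cg] := Riesz_Fischer (fun k => qB k s j) HC.
  by exists g.
exists (fun j s => g (j, s)); split=> [j s sm|]; first exact: Hg (j, s) sm.
pose h x := rho^-1 ^+ n * om (rho^-1 *: (x - x0)).
have sh : SQ h.
  have ch : Cc (fun x => om (rho^-1 *: x + - (rho^-1 *: x0))).
    by apply: Cc_affine => //; rewrite invr_eq0 gt_eqF.
  have := SQZ (rho^-1 ^+ n) (Bb_SQ (Cc_Bb ch)); congr SQ; apply/funext => x.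
  by rewrite /h scalerBr.
have bO := domain_indic_Bb (ltnW n2) dOm dm rho0 star.
have s1 : SQ (F [::]) by exact: sF.
have sphi k := Bb_SQ (bphi k).
have dphi k : nrm (phi k \- F [::]) <= 1 / (2 ^+ k) ^+ 2 by exact: (@phiF k [::]).
(* The [phi k] themselves need not have mean zero; Cauchy-Schwarz on [Om] controls their integrals
   by the distance to [F [::]]. *)
have mean k : `|\int[mu]_x phi k x| <= 1 / (2 ^+ k) ^+ 2 * nrm (\1_Om : V -> R).
  have -> : \int[mu]_x phi k x = ip (phi k \- F [::]) \1_Om.
    rewrite ipBl//; [|exact: Bb_SQ]; rewrite F_mean subr0; apply: eq_Rintegral => x _.
    rewrite indicE; have [|/negP xO] := boolP (x \in Om); rewrite ?mulr1//.
    by rewrite (test_function_supp (tphi k)) ?mul0r// => xO'; apply: xO; rewrite inE.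
  apply: (le_trans (ip_le_nrm (SQB (sphi k) s1) (Bb_SQ bO))).
  by rewrite ler_wpM2r ?nrm_ge0.
have st : SQ (fun x => \sum_j g (j, [:: j]) x) by apply: SQ_sum => j; have [] := Hg (j, [:: j]) isT.
have fwdSQ k : SQ (fwd rho x0 (dyadic R (N k)) om (phi k)).
  exact: Bb_SQ (@fwd_Bb R n rho x0 rho0 _ _ _ (dyadic_gt0 R (N k)) com (bphi k)).
have bd k : nrm ((fun x => \sum_j g (j, [:: j]) x) \- F [::]) <=
    \sum_j nrm (partials [:: j] (B (N k) (phi k) j) \- g (j, [:: j])) +
    (2 + nrm (\1_Om : V -> R) * nrm h) * (1 / (2 ^+ k) ^+ 2).
  have e01 : 0 < dyadic R (N k) < 1.
    by rewrite (dyadic_gt0 R (N k)) (le_lt_trans (dyadic_le_half R (N k)))//; lra.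
  pose c := \int[mu]_x phi k x.
  have dv x : \sum_j partial j (B (N k) (phi k) j) x = fwd rho x0 (dyadic R (N k)) om (phi k) x - c * h x.
    by rewrite [c * _]mulrC; exact: (bogovskii_div x0 com rho0 x e01 (bphi k)).
  have sd j : SQ (fun x => -1 * (partials [:: j] (B (N k) (phi k) j) \- g (j, [:: j])) x).
    by apply: SQZ; apply: SQB; [exact: qB|have [] := Hg (j, [:: j]) isT].
  rewrite (_ : _ \- _ = (fun x => \sum_j (-1 * (partials [:: j] (B (N k) (phi k) j) \- g (j, [:: j])) x)) \+
    ((fwd rho x0 (dyadic R (N k)) om (phi k) \- phi k) \+ ((phi k \- F [::]) \+ (fun x => - c * h x)))).
    have q1 := SQB (fwdSQ k) (sphi k); have q2 := SQB (sphi k) s1; have q3 := SQZ (- c) sh.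
    apply: (le_trans (nrmD (SQ_sum _ sd) (SQD q1 (SQD q2 q3)))); apply: lerD.
      apply: (le_trans (nrm_sum _ sd)); apply: ler_sum => j _.
      rewrite nrmZ ?normrN1 ?mul1r//; apply: SQB; [exact: qB|by have [] := Hg (j, [:: j]) isT].
    apply: (le_trans (nrmD q1 (SQD q2 q3))).
    have [h1 _] := HN k; have h2 := nrmD q2 q3; rewrite nrmZ// normrN in h2.
    have h3 : `|c| * nrm h <= nrm (\1_Om : V -> R) * nrm h * (1 / (2 ^+ k) ^+ 2).
      by rewrite [leRHS]mulrAC ler_wpM2r ?nrm_ge0// [leRHS]mulrC; exact: mean.
    have h4 := dphi k; move: h1 h2 h3 h4; move: (1 / _) => y; lra.
  apply/funext => x /=; have := dv x; rewrite -mulr_sumr sumrB => ->; ring.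
have lim : \sum_j nrm (partials [:: j] (B (N k) (phi k) j) \- g (j, [:: j])) +
    (2 + nrm (\1_Om : V -> R) * nrm h) * (1 / (2 ^+ k) ^+ 2) @[k --> \oo] --> (0 : R).
  rewrite -[X in _ --> X](addr0 (0 : R)); apply: cvgD.
    apply: sum_cvg0 => j _.
    by have [] := Hg (j, [:: j]) isT.
  set A := 2 + _; rewrite -(mulr0 A); apply: cvgM; first exact: cvg_cst.
  exact: inv_sqr_cvg0.
apply/eqP; rewrite eq_le nrm_ge0 andbT.
by apply: (le_add_cvg0 _ lim) => k; rewrite add0r; exact: bd.
Qed.

End bogovskii_limits.

Section sobolev_complements.
Variables (R : realType) (n : nat) (Om : set 'rV[R]_n).
Local Notation V := 'rV[R]_n.
Local Notation mu := (lebesgue_rV R n).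
Implicit Types (f g h u v : V -> R) (a : 'I_n -> nat).

Lemma multi_word1 (i : 'I_n) : multi_word (fun j => j == i : nat) = [:: i].
Proof.
rewrite /multi_word -(filter_pred1_uniq (enum_uniq 'I_n) (mem_enum _ i)).
by elim: (enum 'I_n) => //= j s ->; case: (j == i).
Qed.

Lemma Hs0_deriv m f a : Hs0 Om m f -> (\sum_i a i <= m)%N ->
  exists2 g, L2 Om g & weak_derivative Om a f g.
Proof.
case: m => [Lf|m [[_ Hf] _]]; last exact: Hf.
rewrite leqn0 sum_nat_eq0 => /forallP a0.
have -> : a = fun=> 0%N by apply/funext => i; exact/eqP/(implyP (a0 i)).
by exists f => //; exact: weak_derivative0.
Qed.

End sobolev_complements.

Section norm_bounds.
Variables (R : realType) (n : nat).
Local Notation V := 'rV[R]_n.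

Lemma bogovskii_rhs_le k (diam rho q : R) (phi : V -> R) (A e L : R) (S : nat -> R) :
  0 <= diam -> 0 < rho ->
  (forall l, (l < k)%N -> deriv_norm l phi <= A * (S l + e)) -> nrm phi <= A * (L + e) ->
  bogovskii_rhs k diam rho q phi <=
  A * (\sum_(1 <= l < k) diam / rho ^+ (k - l) * S l + diam / rho ^+ k * log_factor n q * L) +
  A * (\sum_(1 <= l < k) diam / rho ^+ (k - l) + diam / rho ^+ k * log_factor n q) * e.
Proof.
move=> d0 r0 HS HL; have c0 i : 0 <= diam / rho ^+ i by rewrite divr_ge0// exprn_ge0// ltW.
have l0 : 0 <= log_factor n q by exact: le_trans (log_factor_ge1 n q).
have -> : A * (\sum_(1 <= l < k) diam / rho ^+ (k - l) * S l + diam / rho ^+ k * log_factor n q * L) +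
  A * (\sum_(1 <= l < k) diam / rho ^+ (k - l) + diam / rho ^+ k * log_factor n q) * e =
  \sum_(1 <= l < k) diam / rho ^+ (k - l) * (A * (S l + e)) + diam / rho ^+ k * log_factor n q * (A * (L + e)).
  have -> : \sum_(1 <= l < k) diam / rho ^+ (k - l) * (A * (S l + e)) =
     A * \sum_(1 <= l < k) diam / rho ^+ (k - l) * S l + A * (\sum_(1 <= l < k) diam / rho ^+ (k - l)) * e.
    rewrite [A * _ * e]mulrAC [A * \sum_(1 <= l < k) _]mulr_sumr [A * e * _]mulr_sumr -big_split/=.
    by apply: eq_bigr => l _; ring.
  by move: (bigop _ _ _) (bigop _ _ _) (_ * log_factor _ _) => x y z; ring.
apply: lerD; last by rewrite ler_wpM2l// mulr_ge0.
by rewrite !big_nat; apply: ler_sum => l /andP[_ lk]; rewrite ler_wpM2l// HS.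
Qed.

End norm_bounds.

Section bogovskii_solution.
Variables (R : realType) (n : nat).
Local Notation V := 'rV[R]_n.
Local Notation mu := (lebesgue_rV R n).
Variables (om : V -> R) (Om : set V) (diam rho : R) (x0 : V).
Hypotheses (n2 : (2 <= n)%N) (com : Cc om) (om0 : forall z, (2 * n%:R)^-1 < `|z| -> om z = 0)
  (om1 : \int[mu]_x om x = 1) (dOm : domain Om)
  (dm : ediameter Om = diam%:E) (rho0 : 0 < rho) (star : star_shaped Om (eball x0 rho)).
Variables (m : nat) (f : V -> R) (C : R).
Hypotheses (Hf : Hs0 Om m f) (f0 : L20 Om f) (C0 : 0 <= C)
  (HC : forall N g j s, test_function Om g -> size s = m.+1 ->
    nrm (partials s (bogovskii om rho x0 (cutoff N) g j)) <=
    C * bogovskii_rhs m.+1 diam rho (vol Om / vol (eball x0 rho)) g).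

Let n0 : (0 < n)%N := ltnW n2.
Let mOm : measurable Om := domain_measurable dOm.
Let dense h (e : R) := @test_dense R n om Om diam rho x0 n0 com om0 om1 dOm dm rho0 star h e.
Let orth h := @test_orthogonal R n om Om diam rho x0 n0 com om0 om1 dOm dm rho0 star h.
Let q := vol Om / vol (eball x0 rho).
Let X := \sum_(1 <= l < m.+1) diam / rho ^+ (m.+1 - l) * Hs_seminorm Om l f +
  diam / rho ^+ m.+1 * log_factor n q * L2norm Om f.

(** The targets of the approximation. Even [F [::]] is a chosen weak derivative, of order zero, and
    agrees with [f] on [Om] almost everywhere only. *)
Let F s := wderiv Om (multiplicity s) f \_ Om.

Let Lf : L2 Om f. Proof. by have [] := f0. Qed.

Let sF s : (size s <= m)%N -> SQ (F s).
Proof.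
move=> sm; apply/L2P; have [] // := @wderivP R n Om (multiplicity s) f _.
by apply: (Hs0_deriv Hf); rewrite sum_multiplicity.
Qed.

Let F_f : nrm (F [::] \- f \_ Om) = 0.
Proof.
have [Lw ww] := wderivP (ex_intro2 _ _ f Lf (weak_derivative0 f)).
exact: (weak_derivative_unique orth Lw Lf ww (weak_derivative0 f)).
Qed.

Let F_mean : ip (F [::]) \1_Om = 0.
Proof.
have s1 : SQ (F [::]) by exact: sF.
have s2 : SQ (f \_ Om) by exact/L2P.
have s3 : SQ (\1_Om : V -> R) := Bb_SQ (domain_indic_Bb n0 dOm dm rho0 star).
have := ip_le_nrm (SQB s1 s2) s3; rewrite F_f mul0r normr_le0 ipBl// subr_eq0 => /eqP ->.
have [_ <-] := f0; rewrite Rintegral_mkcond; apply: eq_Rintegral => x _.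
by rewrite restrict_real indicE; case: (_ \in _); rewrite ?mulr1 ?mulr0.
Qed.

Let diam0 : 0 <= diam := ltW (diam_gt0 n0 dOm dm rho0 star).

Let F_le s : nrm (F s) <= Hs_seminorm Om (size s) f \/ (m < size s)%N.
Proof.
have [sm|] := leqP (size s) m; last by right.
left; rewrite -[in leRHS](sum_multiplicity s); apply: le_trans (L2norm_wderiv_le _ _ _).
have [] := @wderivP R n Om (multiplicity s) f _; last by move=> Lw _; rewrite L2normE.
by apply: (Hs0_deriv Hf); rewrite sum_multiplicity.
Qed.

(** Each of the [n^l] words of length [l] is bounded by the whole seminorm, whence the factor
    [n^m]. *)
Let approx_rhs phi (e : R) : test_function Om phi ->
  (forall s, (size s <= m)%N -> nrm (partials s phi \- F s) <= e) ->
  bogovskii_rhs m.+1 diam rho q phi <= n%:R ^+ m * X +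
   n%:R ^+ m * (\sum_(1 <= l < m.+1) diam / rho ^+ (m.+1 - l) + diam / rho ^+ m.+1 * log_factor n q) * e.
Proof.
move=> tp H; have cp := test_function_Cc tp.
have e0 : 0 <= e by exact: le_trans (nrm_ge0 _) (H [::] isT).
have n1 : 1 <= n%:R :> R by rewrite ler1n.
have sp s : SQ (partials s phi) := Bb_SQ (Cc_Bb (Cc_partials s cp)).
have est s : (size s <= m)%N -> nrm (partials s phi) <= nrm (F s) + e.
  move=> sm; rewrite (_ : partials s phi = F s \+ (partials s phi \- F s)).
    by apply: (le_trans (nrmD (sF sm) (SQB (sp s) (sF sm)))); rewrite lerD2l H.
  by apply/funext => x /=; rewrite addrC subrK.
apply: bogovskii_rhs_le => // [l lm|].
  rewrite ltnS in lm; apply: (@le_trans _ _ (\sum_(t : l.-tuple 'I_n) (Hs_seminorm Om l f + e))).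
    apply: ler_sum => t _; have st := size_tuple t; have tm : (size t <= m)%N by rewrite st.
    apply: (le_trans (est t tm)); rewrite lerD2r; have [|] := F_le t; first by rewrite st.
    by rewrite ltnNge tm.
  rewrite sumr_const card_tuple card_ord -[leLHS]mulr_natl natrX ler_wpM2r//.
    by rewrite addr_ge0// sqrtr_ge0.
  exact: ler_weXn2l.
apply: (le_trans (est [::] isT)).
have -> : nrm (F [::]) = L2norm Om f.
  rewrite L2normE//; apply: nrm_eq_of_dist0 F_f; [exact: sF|exact/L2P].
by rewrite ler_peMl ?exprn_ege1// addr_ge0 ?L2norm_ge0.
Qed.

(** The limit inherits the bound of the truncated fields, which is uniform in the level. The factors
    in front count the components and, from above, the multi-indices of order [m.+1]. *)
Lemma bogovskii_solution : exists u : 'I_n -> V -> R,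
  [/\ forall i, Hs0 Om m.+1 (u i),
      {ae mu, forall x, Om x -> wdiv Om u x = f x}
    & Hs_seminorm_vec Om m.+1 u <= n%:R * #|{ffun 'I_n -> 'I_m.+2}|%:R * (C * n%:R ^+ m * X)].
Proof.
have e0 k : 0 < 1 / (2 ^+ k) ^+ 2 :> R by rewrite divr_gt0 ?exprn_gt0.
have /choice[phi Hphi] : forall k : nat, exists phi, test_function Om phi /\
    forall s, (size s <= m)%N -> nrm (partials s phi \- F s) <= 1 / (2 ^+ k) ^+ 2.
  move=> k; have [phi tp Hp] := Hs0_approx mOm orth dense Hf (e0 k).
  by exists phi.
have tphi k := (Hphi k).1; have phiF k := (Hphi k).2.
have [N [g [Hg Hdiv]]] := bogovskii_limits n2 com om1 dOm dm rho0 star tphi sF phiF F_mean.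
pose w j k := bogovskii om rho x0 (cutoff (N k)) (phi k) j.
have tw j k : test_function Om (w j k).
  apply: (bogovskii_test n0 rho0 star com om0 j (dyadic_gt0 R (N k))).
    exact: Cc_Bb (test_function_Cc (tphi k)).
  by move=> y; exact: test_function_supp (tphi k).
have sw s j k : SQ (partials s (w j k)) := Bb_SQ (Cc_Bb (Cc_partials s (test_function_Cc (tw j k)))).
have Hu j := Hs0_limit mOm orth (tw j) (Hg j).
have X0 : 0 <= X.
  rewrite /X addr_ge0 ?sumr_ge0// => [l _|].
    by rewrite mulr_ge0 ?sqrtr_ge0// divr_ge0 ?exprn_ge0 ?(ltW rho0).
  by rewrite !mulr_ge0 ?L2norm_ge0 ?invr_ge0 ?exprn_ge0 ?(ltW rho0)// (le_trans _ (log_factor_ge1 n q)).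
have gb j s : size s = m.+1 -> nrm (g j s) <= C * n%:R ^+ m * X.
  move=> sm; have [sg cg] : SQ (g j s) /\ nrm (partials s (w j k) \- g j s) @[k --> \oo] --> (0 : R).
    by apply: Hg; rewrite sm.
  (* The approximation error enters with this constant; it depends on the domain, but the error
     itself vanishes in the limit. *)
  pose Y := C * (n%:R ^+ m * (\sum_(1 <= l < m.+1) diam / rho ^+ (m.+1 - l) + diam / rho ^+ m.+1 * log_factor n q)).
  have lim : Y * (1 / (2 ^+ k) ^+ 2) + nrm (partials s (w j k) \- g j s) @[k --> \oo] --> (0 : R).
    rewrite -[X in _ --> X](addr0 (0 : R)); apply: cvgD => //.
    rewrite -(mulr0 Y); apply: cvgM; first exact: cvg_cst.
    exact: inv_sqr_cvg0.
  apply: (le_add_cvg0 _ lim) => k.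
  have s1 := SQB (sw s j k) sg; have := nrmB (sw s j k) s1.
  rewrite (_ : _ \- (_ \- _) = g j s); last by apply/funext => x /=; exact: subKr.
  move=> tri; apply: (le_trans tri); rewrite addrA lerD2r.
  apply: (le_trans (HC (N k) j (tphi k) sm)).
  apply: (le_trans (ler_wpM2l C0 (approx_rhs (tphi k) (phiF k)))).
  by rewrite /Y mulrDr !mulrA.
exists (fun j => g j [::]); split.
- by move=> j; have [] := Hu j.
- have sg j : SQ (g j [:: j]) by have [] := Hg j [:: j] isT.
  have ad (j : 'I_n) : (\sum_(i < n) (i == j : nat) = 1)%N by rewrite -size_multi_word multi_word1.
  have Wj j : weak_derivative Om (fun i => i == j : nat) (g j [::]) (g j [:: j]).
    by have [_] := Hu j; move=> /(_ (fun i => i == j : nat)); rewrite ad multi_word1; apply.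
  have Lg j : L2 Om (g j [:: j]) by exact: SQ_L2.
  have LW j := wderivP (ex_intro2 _ _ _ (Lg j) (Wj j)).
  have sW j : SQ (wderiv Om (fun i => i == j : nat) (g j [::]) \_ Om) by have [/L2P] := LW j.
  have D0 j : nrm (wderiv Om (fun i => i == j : nat) (g j [::]) \_ Om \- g j [:: j] \_ Om) = 0.
    have [Lw ww] := LW j; exact: (weak_derivative_unique orth Lw (Lg j) ww (Wj j)).
  have sgO j : SQ (g j [:: j] \_ Om) by exact/L2P.
  have sS : SQ (fun x => \sum_j g j [:: j] x) by exact: SQ_sum.
  have s1 : SQ (F [::]) by exact: sF.
  have s2 : SQ (f \_ Om) by exact/L2P.
  (* Three differences, each of norm zero: the chosen weak derivatives against the limits [g j
     [:: j]], the divergence of the limit against [F [::]], and [F [::]] against [f]. *)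
  have E : wdiv Om (fun j => g j [::]) \_ Om \- f \_ Om =
     (fun x => \sum_j (wderiv Om (fun i => i == j : nat) (g j [::]) \_ Om \- g j [:: j] \_ Om) x) \+
     (((fun x => \sum_j g j [:: j] x) \- F [::]) \_ Om \+ (F [::] \- f \_ Om)).
    rewrite restrictB /F [(_ \_ Om) \_ Om]restrict_supp; last by move=> x; exact: restrict_out.
    apply/funext => x; rewrite /= sumrB !restrict_real /wdiv.
    rewrite [X in _ = X - _ + _](_ : _ = (\sum_i wderiv Om (fun j => j == i : nat) (g i [::]) x) * \1_Om x); last first.
      by rewrite mulr_suml; apply: eq_bigr => j _; rewrite restrict_real.
    rewrite [X in _ = _ - X + _](_ : _ = (\sum_i g i [:: i] x) * \1_Om x); last first.
      by rewrite mulr_suml; apply: eq_bigr => j _; rewrite restrict_real.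
    by ring.
  have sE : SQ (wdiv Om (fun j => g j [::]) \_ Om \- f \_ Om).
    rewrite E; apply: SQD; first by apply: SQ_sum => j; exact: SQB.
    by apply: SQD; [apply: SQ_restrict => //; exact: SQB|exact: SQB].
  have E0 : nrm (wdiv Om (fun j => g j [::]) \_ Om \- f \_ Om) = 0.
    apply/eqP; rewrite eq_le nrm_ge0 andbT E.
    have q1 : SQ (fun x => \sum_j (wderiv Om (fun i => i == j : nat) (g j [::]) \_ Om \- g j [:: j] \_ Om) x).
      by apply: SQ_sum => j; exact: SQB.
    have q2 : SQ (((fun x => \sum_j g j [:: j] x) \- F [::]) \_ Om).
      by apply: SQ_restrict => //; exact: SQB.
    have q3 := SQB s1 s2.
    apply: (le_trans (nrmD q1 (SQD q2 q3))); rewrite -[leRHS]addr0; apply: lerD.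
      by apply: (le_trans (nrm_sum _ (fun j => SQB (sW j) (sgO j)))); rewrite big1.
    apply: (le_trans (nrmD q2 q3)); rewrite F_f addr0 -[leRHS]Hdiv.
    by apply: nrm_restrict_le => //; exact: SQB.
  apply: filterS (nrm_eq0_ae sE E0) => x /= /eqP; rewrite subr_eq0 => /eqP H Ox.
  by move: H; rewrite !restrict_real indicE mem_set// !mulr1.
apply: (le_trans (sqrt_sum_sqr_le _ _ _)) => [j|]; first exact: sqrtr_ge0.
have K0 : 0 <= C * n%:R ^+ m * X by rewrite !mulr_ge0 ?exprn_ge0.
rewrite -mulrA [leRHS]mulr_natl -[n in _ *+ n]card_ord -sumr_const; apply: ler_sum => j _.
apply: (le_trans (Hs_seminorm_le_sum _ _ _)).
apply: (@le_trans _ _ (\sum_(a : {ffun 'I_n -> 'I_m.+2} | (\sum_i a i == m.+1)%N) (C * n%:R ^+ m * X))).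
  apply: ler_sum => a /eqP am; have [_ W] := Hu j.
  have sm : size (multi_word (fun i => a i)) = m.+1 by rewrite size_multi_word.
  have sg : SQ (g j (multi_word (fun i => a i))) by have [] := Hg j (multi_word (fun i => a i)); rewrite ?sm.
  rewrite (L2norm_wderiv orth (SQ_L2 mOm sg)); last by apply: W; rewrite am.
  exact: le_trans (nrm_restrict_le mOm sg) (gb j _ sm).
rewrite sumr_const -[leLHS]mulr_natl ler_wpM2r// ler_nat; exact: max_card.
Qed.

End bogovskii_solution.

Theorem theoremA1 (R : realType) (n d : nat) (hn : (2 <= n)%N)
    (hd : (1 <= d)%N) :
  exists2 c : R, 0 < c &
  forall (Om : set 'rV[R]_n) (diam rho : R) (x0 : 'rV[R]_n)
         (f : 'rV[R]_n -> R),
    domain Om -> ediameter Om = diam%:E ->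
    0 < rho -> star_shaped Om (eball x0 rho) ->
    Hs0 Om d.-1 f -> L20 Om f ->
  exists u : 'I_n -> 'rV[R]_n -> R,
    [/\ forall i, Hs0 Om d (u i),
        {ae lebesgue_rV R n, forall x, Om x -> wdiv Om u x = f x}
      & let q := vol Om / vol (eball x0 rho) in
        Hs_seminorm_vec Om d u <=
        c * (\sum_(1 <= l < d) diam / rho ^+ (d - l) * Hs_seminorm Om l f
             + diam / rho ^+ d
               * (1 + q `^ ((n%:R - 2) / (2 * (n%:R - 1)))
                      * ln q `^ (n%:R / (2 * (n%:R - 1))))
               * L2norm Om f)].
Proof.
case: d hd => // m _; have n0 : (0 < n)%N := ltnW hn.
(* Max-norm radius [1 / (2 n)] means Euclidean radius at most [1/2], which leaves room in the ball
   for [star_closure_sub]. *)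
have a0 : 0 < (2 * n%:R)^-1 :> R by rewrite invr_gt0 mulr_gt0// ltr0n.
have [om [com om0 om1]] := @bump_exists R n _ a0.
have [C C0 HC] := @bogovskii_bound R n om m hn com.
pose K : R := n%:R * #|{ffun 'I_n -> 'I_m.+2}|%:R * (C * n%:R ^+ m).
have K0 : 0 <= K by rewrite !mulr_ge0 ?exprn_ge0.
(* [K] is only known to be nonnegative, and the constant has to be positive. *)
exists (K + 1) => [|Om diam rho x0 f dOm dm rho0 star Hf f0]; first by rewrite ltr_wpDl.
have {}Hf : Hs0 Om m f by exact: Hf.
have [u [Hu du bu]] := bogovskii_solution hn com om0 om1 dOm dm rho0 star Hf f0 C0 (HC Om diam rho x0 dOm dm rho0 star).
exists u; split => //=.
have d0 := ltW (diam_gt0 n0 dOm dm rho0 star).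
set X := (Y in _ <= _ * Y).
have X0 : 0 <= X.
  rewrite /X addr_ge0 ?sumr_ge0// => [l _|].
    by rewrite mulr_ge0 ?sqrtr_ge0// divr_ge0 ?exprn_ge0 ?(ltW rho0).
  rewrite mulr_ge0 ?L2norm_ge0// mulr_ge0 ?divr_ge0 ?exprn_ge0 ?(ltW rho0)//.
  exact: le_trans (log_factor_ge1 n _).
apply: (@le_trans _ _ (K * X)); last by rewrite ler_wpM2r// lerDl.
by rewrite /K -[leRHS]mulrA.
Qed.
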